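(* Assume the Riemann Hypothesis for the family $\{L(s,\chi^{4n-3})\}_{n\ge1}$, i.e. for every $n\ge 1$ all zeros of $L(s,\chi^{4n-3})$ in the strip $0<\Re s<1$ lie on the line $\Re s=1/2$. Then for every $\epsilon>0$ and all sufficiently large $N$ (depending on $\epsilon$), $L(1/2,\chi^{4n-3})\neq 0$ for at least $(1/4-\epsilon)N$ values of $n$ with $1\le n\le N$.
   Context: Let $\eta=\frac{1+\sqrt{-7}}{2}$ with $\sqrt{-7}=i\sqrt 7$; the ring of integers of $\mathbb{Q}(\sqrt{-7})$ is $\{a+b\eta: a,b\in\mathbb{Z}\}$, and $N(a+b\eta)=a^2+ab+2b^2$. For integers $a,b$ set $\epsilon_{a,b}=\left(\frac{a^3-2a^2b-ab^2+b^3}{7}\right)$ (Legendre symbol, equal to $0$ when $7$ divides the numerator). The Hecke Grössencharacter $\chi$ is defined on ideals by $\chi((a+b\eta))=\epsilon_{a,b}(a+b\eta)$ (so it is $0$ if $a+b\eta$ is not coprime to $\sqrt{-7}$). For each integer $n\ge 1$, $L(s,\chi^{4n-3})$ is the $L$-function (normalized so that its central point is $s=1/2$) defined for $\Re s>1$ by the absolutely convergent series $$L(s,\chi^{4n-3})=\frac12\sum_{(a,b)\in\mathbb{Z}^2\setminus\{(0,0)\}}\frac{\epsilon_{a,b}\,(a+b\eta)^{4n-3}}{(a^2+ab+2b^2)^{s+2n-3/2}},$$ and elsewhere by analytic continuation; it is entire, and $\left(\frac{7}{2\pi}\right)^s\Gamma(s+2n-3/2)L(s,\chi^{4n-3})$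 is invariant under $s\mapsto 1-s$. *)

(* Defs.v *)
From HB Require Import structures.
From mathcomp Require Import all_boot all_order all_algebra.
From mathcomp Require Import complex.
From mathcomp Require Import all_classical all_reals all_analysis.
From mathcomp Require summability.

Set Implicit Arguments.
Unset Strict Implicit.
Unset Printing Implicit Defensive.

Import Order.TTheory GRing.Theory Num.Theory.
Import numFieldNormedType.Exports.

Local Open Scope ring_scope.
Local Open Scope complex_scope.

(* Legendre symbol; meant for odd primes p only. *)
Definition legendre (p : nat) (m : int) : int :=
  if (p%:Z %| m)%Z then 0
  else if [exists x : 'F_p, x ^+ 2 == m%:~R] then 1 else -1.

Definition hecke_eps (a b : int) : int :=
  legendre 7 (a ^+ 3 - 2 * a ^+ 2 * b - a * b ^+ 2 + b ^+ 3).

(* The norm of a + b * eta. *)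
Definition eta_norm (a b : int) : int := a ^+ 2 + a * b + 2 * b ^+ 2.

Section HeckeL.
Variable R : realType.
Local Notation C := (R[i]).

Definition eta : C := (1 + (Num.sqrt 7) *i) / 2.

(* x ^ s = exp (s * ln x), for real x > 0 and complex s. *)
Definition cpow (x : R) (s : C) : C :=
  (x `^ complex.Re s)%:C *
  (cos (complex.Im s * ln x) +i* sin (complex.Im s * ln x)).

Definition hecke_term (n : nat) (s : C) (a b : int) : C :=
  (hecke_eps a b)%:~R * (a%:~R + b%:~R * eta) ^+ (4 * n - 3)
  / cpow (eta_norm a b)%:~R (s + (2 * n)%:R - 3 / 2).

(* [summability.sum] is the unconditional sum, the limit of the partial sums
   along the finite subsets of the index type directed by inclusion. *)
Definition hecke_series (n : nat) (s : C) : C :=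
  2^-1 * summability.sum (fun v : {v : int * int | v != (0, 0)} =>
    hecke_term n s (val v).1 (val v).2 : C^o).

Definition entire (f : C -> C) : Prop :=
  forall s : C, derivable (f : C^o -> C^o) s 1.

(* By the identity theorem, at most one function f satisfies this predicate
   for a given n. *)
Definition is_hecke_L (n : nat) (f : C -> C) : Prop :=
  entire f /\ forall s : C, 1 < complex.Re s -> f s = hecke_series n s.

Definition zeros_on_critical_line (f : C -> C) : Prop :=
  forall s : C, 0 < complex.Re s < 1 -> f s = 0 -> complex.Re s = 1 / 2.

End HeckeL.

(* Main.v *)
(* Put r = n - 1, let O be the ring of integers and M = sqrt (-7) O. Formally,
   L(1/2, chi^(4r+1)) = W^(2r)(0) / (2 (2r)!) for
   W(t) = sum_(x in O) eps(x) / T_t(x), T_t(x) = conj x - t x, and W = 2 w with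
   w = Z(1) + Z(2) + Z(4), where Z is the zeta function of the lattice T_t(M) made
   periodic by an R-linear correction. The Frobenius-Stickelberger relation
   (zeta x + zeta y - zeta (x + y))^2 = wp x + wp y + wp (x + y) at the 7-torsion
   points, and Liouville's theorem for the derivatives in t, give a closed
   differential system: for suitable functions V, eta, beta of t and a derivation
   D proportional to w^-2 d/dt,
     D w = beta w, D V = -3 (V - 1) eta, D eta = 3 (V - 1) (27 V - 14),
     D beta = - beta^2 + 18 (V - 1) (3 V - 2).
   So the derivatives of w are w^(2m+1) times integral polynomials in V, eta, beta,
   and modulo a D-stable ideal those of even order 2r > 0 are 4 + 2 V. At t = 0 one has w <> 0,
   eta = beta = 0 and V = 0 or 28/27, so the ideal takes values in 8 Z[1/3] and
   4 + 2 V does not: no even derivative of w vanishes at 0, and every central value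
   is nonzero.

   The series is reached at s = 1/2 by grouping the terms along third differences
   in each class modulo M: the grouped series converges locally uniformly for
   Re s >= 0 and agrees with L by the identity theorem. *)

Require Import Defs.
From HB Require Import structures.
From mathcomp Require Import all_boot all_order all_algebra.
From mathcomp Require Import complex ring lra zify.
From mathcomp Require Import all_classical all_reals all_analysis.
From mathcomp Require summability.

Set Implicit Arguments.
Unset Strict Implicit.
Unset Printing Implicit Defensive.

Import Order.TTheory GRing.Theory Num.Theory.
Import numFieldNormedType.Exports.

Local Open Scope ring_scope.
Local Open Scope complex_scope.

(** * Complex differentiation and the maximum principle *)

(** The parameter t enters because the a-th t-derivative of 1 / (conj x - t x) is a! x^a / (conj x -
    t x)^(a+1); at t = 0 and a = 2r this is (2r)! x^(4r+1) / |x|^(2(2r+1)), the central term. The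
    system closes because [JJ] trades the t-derivative of Z for values of wp and wp', and the
    Frobenius-Stickelberger relation makes these polynomials in the torsion values Z(1), Z(2), Z(4),
    which doubling permutes cyclically modulo 7. The values at t = 0 come from two symmetries.
    Multiplication by sqrt (-7) relates T_t to T_(-t) and gives e(t) + e(-t) = - (2/7) w^2 for e =
    [ee]: evenness in t makes beta vanish at 0, the value at 0 makes eta equal to beta there, and
    eta^2 = V (28 - 27 V) leaves two values of V. Complex conjugation makes the torsion values real
    at t = 0, so that w = 0 would force all three to vanish. The final obstruction is 2-adic: 4 + 2
    V is 4 or 164 / 27. Grouping along third differences is what s = 1/2 demands: the terms are
    bounded for Re s >= 0, a third difference gains |v|^-3, and this is summable over Z^2. *)

Section Modulus.
Variable R : realType.
Local Notation C := R[i].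
Local Notation Re := (@complex.Re R).
Local Notation Im := (@complex.Im R).
Implicit Types z w : C.

(** A real-valued modulus: the norm of [R[i]] takes its values in [R[i]], which is only partially
    ordered. *)
Definition mg z : R := Num.sqrt (Re z ^+ 2 + Im z ^+ 2).

Lemma mgE z : (mg z)%:C = `|z|. Proof. by rewrite normc_def. Qed.
Lemma mg_ge0 z : 0 <= mg z. Proof. exact: sqrtr_ge0. Qed.
Lemma mg0 : mg 0 = 0. Proof. by apply: complexI; rewrite mgE normr0. Qed.
Lemma mg1 : mg 1 = 1. Proof. by apply: complexI; rewrite mgE normr1. Qed.
Lemma mgN z : mg (- z) = mg z. Proof. by apply: complexI; rewrite !mgE normrN. Qed.
Lemma mgM z w : mg (z * w) = mg z * mg w.
Proof. by apply: complexI; rewrite rmorphM /= !mgE normrM. Qed.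
Lemma mgV z : mg z^-1 = (mg z)^-1.
Proof. by apply: complexI; rewrite fmorphV /= !mgE normfV. Qed.
Lemma mgX z n : mg (z ^+ n) = mg z ^+ n.
Proof. by apply: complexI; rewrite rmorphXn /= !mgE normrX. Qed.
Lemma mgD z w : mg (z + w) <= mg z + mg w.
Proof. by rewrite -lecR rmorphD /= !mgE ler_normD. Qed.
Lemma mgB z w : mg (z - w) <= mg z + mg w.
Proof. by rewrite -(mgN w) mgD. Qed.
Lemma mgBC z w : mg (z - w) = mg (w - z). Proof. by rewrite -mgN opprB. Qed.
Lemma mg_eq0 z : (mg z == 0) = (z == 0).
Proof. by rewrite -(inj_eq (@complexI R)) mgE normr_eq0. Qed.
Lemma mg_gt0 z : (0 < mg z) = (z != 0).
Proof. by rewrite lt_def mg_eq0 mg_ge0 andbT. Qed.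
Lemma mgR (x : R) : mg x%:C = `|x|.
Proof. by rewrite /mg /= expr0n addr0 sqrtr_sqr. Qed.
Lemma mgn n : mg n%:R = n%:R.
Proof. by apply: complexI; rewrite mgE normr_nat rmorph_nat. Qed.
Lemma mgBl z w : mg z - mg w <= mg (z + w).
Proof. by rewrite lerBlDr -{1}(addrK w z); apply: mgB. Qed.
Lemma mgBr z w : mg z - mg w <= mg (z - w).
Proof. by rewrite -(mgN w) mgBl. Qed.
Lemma Re_mg z : `|Re z| <= mg z.
Proof. by rewrite -lecR mgE normc_ge_Re. Qed.
Lemma mg_conj z : mg (conjc z) = mg z.
Proof. by case: z => a b; rewrite /mg /= sqrrN. Qed.
Lemma mg_i : mg 'i = 1.
Proof. by rewrite /mg /= expr0n add0r expr1n sqrtr1. Qed.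
Lemma Im_mg z : `|Im z| <= mg z.
Proof.
have := Re_mg (z * 'i); rewrite ReiNIm normrN mgM.
by rewrite mg_i mulr1.
Qed.
Lemma mg_ReIm z : mg z <= `|Re z| + `|Im z|.
Proof. by rewrite {1}(complexE z); apply: (le_trans (mgD _ _)); rewrite mgM mg_i mul1r !mgR. Qed.
Lemma mg_sum (I : Type) (r : seq I) (P : pred I) (F : I -> C) :
  mg (\sum_(i <- r | P i) F i) <= \sum_(i <- r | P i) mg (F i).
Proof.
elim/big_rec2: _ => [|i y x _ h]; first by rewrite mg0.
by apply: (le_trans (mgD _ _)); rewrite lerD2l.
Qed.

End Modulus.

Section Bisect.
Variable R : realType.

(** A square on which [P] fails has a quarter on which it fails, and the nested squares so obtained
    shrink to a point, near which [P] holds. This drives the mean value inequality, Goursat's lemma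
    and the passage from local to global bounds. *)
Lemma bisect_square (P : R -> R -> R -> Prop) (x0 y0 s0 : R) : 0 < s0 ->
  (forall x y s, 0 < s -> P x y (s / 2) -> P (x + s / 2) y (s / 2) ->
     P x (y + s / 2) (s / 2) -> P (x + s / 2) (y + s / 2) (s / 2) -> P x y s) ->
  (forall x y, x0 <= x <= x0 + s0 -> y0 <= y <= y0 + s0 ->
     exists2 d, 0 < d & forall x' y' s, 0 < s < d ->
       x' <= x <= x' + s -> y' <= y <= y' + s ->
       x0 <= x' -> x' + s <= x0 + s0 -> y0 <= y' -> y' + s <= y0 + s0 ->
       P x' y' s) ->
  P x0 y0 s0.
Proof.
move=> s0_gt0 Pquart Ploc; apply: contrapT => nP.
pose B (q : R * R * R) := P q.1.1 q.1.2 q.2.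
pose c (i j : bool) (q : R * R * R) :=
  (q.1.1 + i%:R * (q.2 / 2), q.1.2 + j%:R * (q.2 / 2), q.2 / 2).
(* The first quarter on which [P] fails; if the first three satisfy [P], the last one cannot. *)
pose nx q := if asbool (~ B (c false false q)) then c false false q
  else if asbool (~ B (c true false q)) then c true false q
  else if asbool (~ B (c false true q)) then c false true q
  else c true true q.
pose Q n := iter n nx (x0, y0, s0).
have nxE q : exists i j, nx q = c i j q.
  by rewrite /nx; do 3 (case: ifP => _; first by [exists false, false|exists true, false|exists false, true]); exists true, true.
have Qs n : (Q n).2 = s0 / 2 ^+ n.
  elim: n => [|n IH]; first by rewrite /= expr0 divr1.
  have [i [j E]] := nxE (Q n); rewrite /Q iterS -/(Q n) E /= IH exprS invfM.
  by ring.
have Qs_gt0 n : 0 < (Q n).2 by rewrite Qs divr_gt0// exprn_gt0.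
have nB n : ~ B (Q n).
  elim: n => // n IH; rewrite /Q iterS -/(Q n) /nx.
  case: ifPn => [/asboolP //|/asboolP/contrapT b1].
  case: ifPn => [/asboolP //|/asboolP/contrapT b2].
  case: ifPn => [/asboolP //|/asboolP/contrapT b3].
  move=> b4; apply: IH; apply: Pquart => //;
    by move: b1 b2 b3 b4; rewrite /B /c /= ?mul0r ?mul1r ?addr0.
have mono n : [/\ (Q n).1.1 <= (Q n.+1).1.1,
    (Q n.+1).1.1 + (Q n.+1).2 <= (Q n).1.1 + (Q n).2,
    (Q n).1.2 <= (Q n.+1).1.2 &
    (Q n.+1).1.2 + (Q n.+1).2 <= (Q n).1.2 + (Q n).2].
  have [i [j E]] := nxE (Q n); rewrite /Q iterS -/(Q n) E /=.
  have := Qs_gt0 n; case: i {E}; case: j; rewrite ?mul1r ?mul0r => s_gt0; split; lra.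
have monoD n k : [/\ (Q n).1.1 <= (Q (k + n)%N).1.1,
    (Q (k + n)%N).1.1 + (Q (k + n)%N).2 <= (Q n).1.1 + (Q n).2,
    (Q n).1.2 <= (Q (k + n)%N).1.2 &
    (Q (k + n)%N).1.2 + (Q (k + n)%N).2 <= (Q n).1.2 + (Q n).2].
  elim: k => [|k [h1 h2 h3 h4]]; first by rewrite add0n.
  have [g1 g2 g3 g4] := mono (k + n)%N; rewrite addSn; split.
  - exact: le_trans h1 g1.
  - exact: le_trans g2 h2.
  - exact: le_trans h3 g3.
  - exact: le_trans g4 h4.
(* Nested intervals in one coordinate; the common point is the supremum of the left ends. *)
have key (p : R * R * R -> R) :
    (forall n k, p (Q n) <= p (Q (k + n)%N) /\ p (Q (k + n)%N) + (Q (k + n)%N).2 <= p (Q n) + (Q n).2) ->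
    exists x, forall n, p (Q n) <= x <= p (Q n) + (Q n).2.
  move=> pm.
  have pu n m : p (Q m) <= p (Q n) + (Q n).2.
    have [/subnK E|/ltnW/subnK E] := leqP n m.
      have [_] := pm n (m - n)%N; rewrite E; have := Qs_gt0 m; lra.
    have [+ _] := pm m (n - m)%N; rewrite E; have := Qs_gt0 n; lra.
  pose S := [set p (Q n) | n in [set: nat]]%classic.
  have hS : has_sup S.
    split; first by exists (p (Q 0%N)); exists 0%N.
    by exists (p (Q 0%N) + (Q 0%N).2) => _ [n _ <-]; exact: pu.
  exists (sup S) => n; apply/andP; split.
    by apply: ub_le_sup; [case: hS|exists n].
  by apply: ge_sup; [case: hS|move=> _ [m _ <-]; exact: pu].
have [x xP] : exists x, forall n, (Q n).1.1 <= x <= (Q n).1.1 + (Q n).2.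
  by apply: (key (fun q => q.1.1)) => n k; have [] := monoD n k.
have [y yP] : exists y, forall n, (Q n).1.2 <= y <= (Q n).1.2 + (Q n).2.
  by apply: (key (fun q => q.1.2)) => n k; have [] := monoD n k.
have [d d_gt0 dP] := Ploc x y (xP 0%N) (yP 0%N).
have [n nP'] : exists n, (Q n).2 < d.
  exists (Num.truncn (s0 / d)).+1; rewrite Qs ltr_pdivrMr ?exprn_gt0//.
  have h1 : s0 / d < (Num.truncn (s0 / d)).+1%:R by exact: truncnS_gt.
  have h2 : (Num.truncn (s0 / d)).+1%:R <= 2 ^+ (Num.truncn (s0 / d)).+1 :> R.
    by rewrite -natrX ler_nat ltnW// ltn_expl.
  by rewrite mulrC -ltr_pdivrMr//; apply: lt_le_trans h2.
apply: (nB n); apply: dP => //; rewrite ?Qs_gt0 ?nP'//;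
  by have := monoD 0%N n; rewrite addn0 => -[].
Qed.
End Bisect.

Section Deriv.
Variable R : realType.
Local Notation C := R[i].
Implicit Types (D : C -> Prop) (F G : C -> C) (z d h : C).

(* [D] is the set of allowed increments: all of them ([allD]) or the real ones
   ([reD]). *)
Definition near0 D (P : C -> Prop) :=
  exists2 r : R, 0 < r & forall h, D h -> mg h < r -> P h.

Lemma near0W D (P Q : C -> Prop) :
  (forall h, D h -> P h -> Q h) -> near0 D P -> near0 D Q.
Proof. by move=> PQ [r r0 rP]; exists r => // h Dh hr; apply: PQ => //; exact: rP. Qed.

Lemma near0_and D (P Q : C -> Prop) :
  near0 D P -> near0 D Q -> near0 D (fun h => P h /\ Q h).
Proof.
move=> [r r0 rP] [s s0 sQ]; exists (Num.min r s); first by rewrite lt_min r0.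
by move=> h Dh; rewrite lt_min => /andP[hr hs]; split; [exact: rP|exact: sQ].
Qed.

Lemma near0_lt D (r : R) : 0 < r -> near0 D (fun h => mg h < r).
Proof. by move=> r0; exists r. Qed.

(** An error bound instead of a difference quotient: nothing is divided by [h], so the chain rule
    needs no case distinction. *)
Definition dv D F z d := forall e : R, 0 < e ->
  near0 D (fun h => mg (F (z + h) - F z - h * d) <= e * mg h).

Definition allD : C -> Prop := fun _ => True.
Definition reD : C -> Prop := fun h => complex.Im h = 0.

Lemma dv_cst D c z : dv D (fun=> c) z 0.
Proof. by move=> e e0; exists 1 => // h _ _ /=; rewrite subrr mulr0 subrr mg0 mulr_ge0 ?mg_ge0 ?ltW. Qed.

Lemma dv_id D z : dv D id z 1.
Proof.
move=> e e0; exists 1 => // h _ _ /=.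
rewrite (_ : _ - _ = 0); last by ring.
by rewrite mg0 mulr_ge0 ?mg_ge0 ?ltW.
Qed.

Lemma dv_eq D F z d d' : dv D F z d -> d = d' -> dv D F z d'.
Proof. by move=> H <-. Qed.

Lemma dv_ext D F G z d : F =1 G -> dv D F z d -> dv D G z d.
Proof. by move=> /funext ->. Qed.

Lemma dv_near D F G z d : F z = G z -> near0 D (fun h => F (z + h) = G (z + h)) ->
  dv D F z d -> dv D G z d.
Proof.
move=> Ez En H e /H h1; have := near0_and En h1.
by apply: near0W => h _ [<-]; rewrite Ez.
Qed.

Lemma dvD D F G z d d' : dv D F z d -> dv D G z d' ->
  dv D (fun x => F x + G x) z (d + d').
Proof.
move=> HF HG e e0; have e20 : 0 < e / 2 by lra.
have := near0_and (HF _ e20) (HG _ e20); apply: near0W => h _ [h1 h2].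
have -> : F (z + h) + G (z + h) - (F z + G z) - h * (d + d') =
  (F (z + h) - F z - h * d) + (G (z + h) - G z - h * d') by ring.
by apply: (le_trans (mgD _ _)); lra.
Qed.

Lemma dv_bnd D F z d : dv D F z d ->
  near0 D (fun h => mg (F (z + h) - F z) <= (mg d + 1) * mg h).
Proof.
move=> /(_ 1 ltr01); apply: near0W => h _; rewrite mul1r => H.
have -> : F (z + h) - F z = (F (z + h) - F z - h * d) + h * d by ring.
apply: (le_trans (mgD _ _)); rewrite mgM; lra.
Qed.

Lemma dv_cont D F z d : dv D F z d -> forall e, 0 < e ->
  near0 D (fun h => mg (F (z + h) - F z) < e).
Proof.
move=> /dv_bnd H e e0; have m0 : 0 < mg d + 1 by have := mg_ge0 d; lra.
have := near0_and H (near0_lt D (divr_gt0 e0 m0)); apply: near0W => h _ [h1 h2].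
by apply: (le_lt_trans h1); rewrite mulrC -ltr_pdivlMr.
Qed.

Lemma dvM D F G z d d' : dv D F z d -> dv D G z d' ->
  dv D (fun x => F x * G x) z (d * G z + F z * d').
Proof.
move=> HF HG e e0.
set A := mg (F z); set B := mg (G z); set a := mg d; set b := mg d'.
have [A0 B0 a0 b0] : [/\ 0 <= A, 0 <= B, 0 <= a & 0 <= b] by split; exact: mg_ge0.
have s0 : 0 < 3 * (A + B + b + 1) by lra.
have e10 := divr_gt0 e0 s0; set e1 := e / _ in e10.
have p0 : 0 < 3 * ((a + 1) * (b + 1)) by rewrite mulr_gt0// mulr_gt0//; lra.
have e20 := divr_gt0 e0 p0; set e2 := e / _ in e20.
have := near0_and (near0_and (HF _ e10) (HG _ e10))
  (near0_and (dv_bnd HG) (near0_and (near0_lt D e20) (near0_lt D (@ltr01 R)))).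
apply: near0W => h _ [[h1 h2] [h3 [h4 h5]]].
have -> : F (z + h) * G (z + h) - F z * G z - h * (d * G z + F z * d') =
  (F (z + h) - F z - h * d) * G (z + h) + F z * (G (z + h) - G z - h * d')
  + h * d * (G (z + h) - G z) by ring.
have hp := mg_ge0 h.
have h6 : mg (G (z + h)) <= B + b + 1.
  have -> : G (z + h) = G z + (G (z + h) - G z) by ring.
  apply: (le_trans (mgD _ _)); rewrite -/B -addrA lerD2l.
  by apply: (le_trans h3); rewrite -[leRHS]mulr1 ler_wpM2l; [|rewrite -/b; lra|exact: ltW].
apply: (le_trans (mgD _ _)); apply: (le_trans (lerD (mgD _ _) (lexx _))).
rewrite !mgM -/A -/a.
have t1 : mg (F (z + h) - F z - h * d) * mg (G (z + h)) <= e1 * mg h * (B + b + 1).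
  by apply: ler_pM => //; exact: mg_ge0.
have t2 : A * mg (G (z + h) - G z - h * d') <= A * (e1 * mg h) by rewrite ler_wpM2l.
have t3 : mg h * a * mg (G (z + h) - G z) <= e / 3 * mg h.
  apply: (@le_trans _ _ (mg h * a * ((b + 1) * mg h))).
    by rewrite ler_wpM2l// mulr_ge0.
  rewrite [leLHS](_ : _ = (a * (b + 1) * mg h) * mg h); last by ring.
  rewrite ler_wpM2r//.
  have : mg h * (3 * ((a + 1) * (b + 1))) <= e by rewrite -ler_pdivlMr// ltW.
  have : 0 <= mg h * (b + 1) by rewrite mulr_ge0//; lra.
  lra.
have E : e1 * (3 * (A + B + b + 1)) = e by rewrite /e1 divfK// gt_eqF.
have E' : e1 * (A + B + b + 1) = e / 3 by lra.
have : e1 * mg h * (B + b + 1) + A * (e1 * mg h) = e / 3 * mg h.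
  by rewrite -E'; ring.
have : 0 <= e * mg h by rewrite mulr_ge0// ltW.
lra.
Qed.

Lemma dvZ D c F z d : dv D F z d -> dv D (fun x => c * F x) z (c * d).
Proof.
move=> H; have := dvM (dv_cst D c z) H.
by rewrite mul0r add0r.
Qed.

Lemma dvN D F z d : dv D F z d -> dv D (fun x => - F x) z (- d).
Proof. by move=> /(dvZ (-1)); under eq_fun do rewrite mulN1r; rewrite mulN1r. Qed.

Lemma dvB D F G z d d' : dv D F z d -> dv D G z d' ->
  dv D (fun x => F x - G x) z (d - d').
Proof. by move=> h1 /dvN h2; exact: dvD. Qed.

Lemma dv_lin D a c z : dv D (fun x => a + c * x) z c.
Proof.
apply: (dv_eq (dvD (dv_cst D a z) (dvZ c (dv_id D z)))).
by rewrite add0r mulr1.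
Qed.

Lemma dvX D F z d n : dv D F z d -> dv D (fun x => F x ^+ n.+1) z (n.+1%:R * F z ^+ n * d).
Proof.
move=> H; elim: n => [|n IH].
  by under eq_fun do rewrite expr1; rewrite expr0 mulr1 mul1r.
under eq_fun do rewrite exprS.
apply: (dv_eq (dvM H IH)); rewrite !exprS (_ : n.+2%:R = 1 + n.+1%:R); last by rewrite -natr1 addrC.
ring.
Qed.

Lemma dvV D F z d : dv D F z d -> F z != 0 ->
  dv D (fun x => (F x)^-1) z (- d / F z ^+ 2).
Proof.
move=> H nz e e0.
set A := mg (F z); have A0 : 0 < A by rewrite /A mg_gt0.
set a := mg d; have a0 : 0 <= a by exact: mg_ge0.
have A20 : 0 < A / 2 by lra.
have e10 : 0 < e * A ^+ 2 / 4 by rewrite !mulr_gt0// exprn_gt0.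
have A3 : 0 < A ^+ 3 by rewrite exprn_gt0.
have q0 : 0 < 4 * ((a + 1) * (a + 1)) by rewrite mulr_gt0// mulr_gt0//; lra.
have e20 : 0 < e * A ^+ 3 / (4 * ((a + 1) * (a + 1))) by rewrite divr_gt0// mulr_gt0.
have := near0_and (near0_and (H _ e10) (dv_bnd H))
  (near0_and (dv_cont H A20) (near0_lt D e20)).
apply: near0W => h _ [[h1 h2] [h3 h4]].
have hp := mg_ge0 h.
have h5 : A / 2 <= mg (F (z + h)).
  have := mgBl (F z) (F (z + h) - F z).
  rewrite [F z + _]addrC subrK -/A; lra.
have nzh : F (z + h) != 0 by rewrite -mg_gt0; lra.
have -> : (F (z + h))^-1 - (F z)^-1 - h * (- d / F z ^+ 2) =
  (- (F z * (F (z + h) - F z - h * d)) + h * d * (F (z + h) - F z)) /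
  (F z ^+ 2 * F (z + h)).
  by field; rewrite nz nzh.
rewrite mgM mgV mgM mgX -/A ler_pdivrMr; last by rewrite mulr_gt0 ?exprn_gt0//; lra.
apply: (le_trans (mgD _ _)); rewrite mgN !mgM -/A -/a.
apply: (@le_trans _ _ (e * mg h * (A ^+ 2 * (A / 2)))); last first.
  by rewrite ler_wpM2l ?mulr_ge0 ?(ltW e0)// ler_wpM2l// exprn_ge0// ltW.
have t1 : A * mg (F (z + h) - F z - h * d) <= A * (e * A ^+ 2 / 4 * mg h).
  by rewrite ler_wpM2l// ltW.
have t2 : mg h * a * mg (F (z + h) - F z) <= mg h * (e * A ^+ 3 / 4).
  rewrite -mulrA ler_wpM2l//.
  apply: (@le_trans _ _ ((a + 1) * ((a + 1) * mg h))).
    by apply: ler_pM => //; [exact: mg_ge0|lra].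
  have : mg h * (4 * ((a + 1) * (a + 1))) <= e * A ^+ 3 by rewrite -ler_pdivlMr// ltW.
  lra.
apply: (le_trans (lerD t1 t2)).
by rewrite (_ : A * _ + _ = e * mg h * (A ^+ 2 * (A / 2))) //; field.
Qed.

Lemma dv_compD D D' F G z d d' : (forall h, D h -> D' (F (z + h) - F z)) ->
  dv D F z d -> dv D' G (F z) d' ->
  dv D (fun x => G (F x)) z (d' * d).
Proof.
move=> HD HF HG e e0.
set a := mg d; set b := mg d'.
have [a0 b0] : 0 <= a /\ 0 <= b by split; exact: mg_ge0.
have p0 : 0 < 2 * (a + 1) by lra. have p1 : 0 < 2 * (b + 1) by lra.
have e10 := divr_gt0 e0 p0; have e20 := divr_gt0 e0 p1.
have [r r0 rP] := HG _ e10.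
have := near0_and (near0_and (HF _ e20) (dv_bnd HF)) (dv_cont HF r0).
apply: near0W => h Dh [[h1 h2] h3].
have hp := mg_ge0 h.
have := rP _ (HD _ Dh) h3; rewrite addrCA subrr addr0 => h4.
have -> : G (F (z + h)) - G (F z) - h * (d' * d) =
  (G (F (z + h)) - G (F z) - (F (z + h) - F z) * d') +
  d' * (F (z + h) - F z - h * d) by ring.
apply: (le_trans (mgD _ _)); rewrite mgM -/b.
have t1 : e / (2 * (a + 1)) * mg (F (z + h) - F z) <= e / 2 * mg h.
  apply: (@le_trans _ _ (e / (2 * (a + 1)) * ((a + 1) * mg h))).
    by rewrite ler_wpM2l// ltW.
  by rewrite le_eqVlt (_ : _ * _ = e / 2 * mg h) ?eqxx//; field; lra.
have t2 : b * mg (F (z + h) - F z - h * d) <= e / 2 * mg h.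
  apply: (@le_trans _ _ ((b + 1) * (e / (2 * (b + 1)) * mg h))).
    apply: ler_pM => //; [exact: mg_ge0|lra].
  by rewrite le_eqVlt (_ : _ * _ = e / 2 * mg h) ?eqxx//; field; lra.
lra.
Qed.

Lemma dv_comp D F G z d d' : dv D F z d -> dv allD G (F z) d' ->
  dv D (fun x => G (F x)) z (d' * d).
Proof. exact: dv_compD. Qed.

Lemma dv_sum D (I : Type) (s : seq I) (F : I -> C -> C) z (d : I -> C) :
  (forall i, dv D (F i) z (d i)) ->
  dv D (fun x => \sum_(i <- s) F i x) z (\sum_(i <- s) d i).
Proof.
move=> H; elim: s => [|i s IH].
  by rewrite big_nil; apply: dv_ext (dv_cst D 0 z) => x; rewrite big_nil.
rewrite big_cons; apply: dv_ext (dvD (H i) IH) => x; by rewrite big_cons.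
Qed.

Definition thick D := forall r : R, 0 < r -> exists h, [/\ D h, mg h < r & h != 0].

Lemma thick_all : thick allD.
Proof.
move=> r r0; exists (r / 2)%:C; split => //; first by rewrite mgR gtr0_norm; lra.
by rewrite -mg_gt0 mgR gtr0_norm; lra.
Qed.

Lemma dv_uniq D F z d d' : thick D -> dv D F z d -> dv D F z d' -> d = d'.
Proof.
move=> tD H H'; apply/eqP; rewrite -subr_eq0 -mg_eq0; apply/negPn/negP => nz.
have p : 0 < mg (d - d') by rewrite lt_def nz mg_ge0.
have e0 : 0 < mg (d - d') / 4 by lra.
have [r r0 rP] := near0_and (H _ e0) (H' _ e0).
have [h [Dh hr hnz]] := tD _ r0; have [h1 h2] := rP _ Dh hr.
have hp : 0 < mg h by rewrite mg_gt0.
have : mg (h * (d - d')) <= mg (d - d') / 2 * mg h.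
  have -> : h * (d - d') = (F (z + h) - F z - h * d') - (F (z + h) - F z - h * d) by ring.
  by apply: (le_trans (mgB _ _)); lra.
rewrite mgM mulrC ler_pM2r//; lra.
Qed.

(** For complex values there is no intermediate point. Bisection reduces the inequality to short
    intervals, on which differentiability at one of their points costs a slack [e]. *)
Lemma dv_mvt D F (d : C -> C) z h (K : R) :
  (forall t : R, D (t%:C * h)) ->
  (forall t : R, 0 <= t <= 1 -> dv D F (z + t%:C * h) (d (z + t%:C * h)) /\
     mg (d (z + t%:C * h)) <= K) ->
  mg (F (z + h) - F z) <= K * mg h.
Proof.
move=> Dh H.
have [->|hnz] := eqVneq h 0; first by rewrite addr0 subrr mg0 mulr0.
have hp : 0 < mg h by rewrite mg_gt0.
apply/ler_addgt0Pr => e e0.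
pose f (t : R) := F (z + t%:C * h).
suff : mg (f (0 + 1) - f 0) <= (K * mg h + e) * 1.
  by rewrite /f add0r mulr1 !rmorph0 !rmorph1 mul1r mul0r addr0.
(* The second coordinate of the squares is a dummy. *)
apply: (@bisect_square R (fun x _ s => mg (f (x + s) - f x) <= (K * mg h + e) * s) 0 0 1) => //.
- move=> x y s s0 h1 h2 _ _.
  have -> : f (x + s) - f x = (f (x + s / 2 + s / 2) - f (x + s / 2)) + (f (x + s / 2) - f x).
    by rewrite -[x + s / 2 + s / 2]addrA -splitr; ring.
  by apply: (le_trans (mgD _ _)); lra.
- move=> x y; rewrite add0r => x01 y01.
  have [Hd Hk] := H x x01.
  have e1 : 0 < e / mg h by rewrite divr_gt0.
  have [r r0 rP] := Hd _ e1.
  exists (r / mg h); first by rewrite divr_gt0.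
  move=> x' y' s /andP[s0 sr] /andP[xx' xs] _ _ _ _ _.
  have step u : `|u| <= s -> mg (f (x + u) - f x - u%:C * (h * d (z + x%:C * h))) <= e * `|u|.
    move=> us; have := rP (u%:C * h) (Dh u).
    rewrite mgM mgR -ltr_pdivlMr// => /(_ (le_lt_trans us sr)).
    rewrite /f rmorphD /= mulrDl addrA -[u%:C * h * _]mulrA.
    by rewrite (_ : e / mg h * _ = e * `|u|)//; field; rewrite gt_eqF.
  have A1 := step (x' + s - x); have A2 := step (x' - x).
  have E : f (x' + s) - f x' = (f (x + (x' + s - x)) - f x - (x' + s - x)%:C * (h * d (z + x%:C * h)))
    - (f (x + (x' - x)) - f x - (x' - x)%:C * (h * d (z + x%:C * h))) + s%:C * (h * d (z + x%:C * h)).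
    rewrite [x + (x' + s - x)]addrC subrK [x + (x' - x)]addrC subrK !rmorphB !rmorphD /=; ring.
  have B1 : `|x' + s - x| = x' + s - x by rewrite ger0_norm; lra.
  have B2 : `|x' - x| = x - x' by rewrite ler0_norm; lra.
  rewrite B1 in A1; rewrite B2 in A2.
  have {}A1 := A1 ltac:(lra); have {}A2 := A2 ltac:(lra).
  rewrite E; apply: (le_trans (mgD _ _)); apply: (le_trans (lerD (mgB _ _) (lexx _))).
  rewrite !mgM mgR (gtr0_norm s0).
  have : s * (mg h * mg (d (z + x%:C * h))) <= s * (mg h * K).
    by apply: ler_wpM2l; [exact: ltW|apply: ler_wpM2l => //; exact: ltW].
  have : e * (x' + s - x) + e * (x - x') = e * s by ring.
  lra.
Qed.

(** The mean value inequality for F x - F1 z * x, whose derivative F1 x - F1 z is bounded by the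
    same inequality. *)
Lemma dv_taylor D F (F1 F2 : C -> C) z h (K : R) :
  (forall t : R, D (t%:C * h)) ->
  (forall t : R, 0 <= t <= 1 -> [/\ dv D F (z + t%:C * h) (F1 (z + t%:C * h)),
     dv D F1 (z + t%:C * h) (F2 (z + t%:C * h)) &
     mg (F2 (z + t%:C * h)) <= K]) ->
  mg (F (z + h) - F z - h * F1 z) <= K * mg h ^+ 2.
Proof.
move=> Dh H.
have K0 : 0 <= K.
  by have [_ _ +] := H 0 ltac:(lra); apply: le_trans; exact: mg_ge0.
have H1 (t : R) : 0 <= t <= 1 -> mg (F1 (z + t%:C * h) - F1 z) <= K * mg h.
  move=> t01; apply: (@le_trans _ _ (K * mg (t%:C * h))).
    apply: (@dv_mvt D F1 F2) => [u|u u01].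
      by rewrite mulrA -rmorphM; exact: Dh.
    rewrite mulrA -rmorphM /=.
    have u2 : 0 <= u * t <= 1.
      have /andP[u0 u1] := u01; have /andP[t0 t1] := t01.
      by rewrite mulr_ge0// mulr_ile1.
    by have [_ ? ?] := H _ u2.
  rewrite ler_wpM2l// mgM mgR ger0_norm; last by case/andP: t01.
  rewrite ler_piMl ?mg_ge0//; by case/andP: t01.
have -> : F (z + h) - F z - h * F1 z =
  (F (z + h) - F1 z * (z + h)) - (F z - F1 z * z) by ring.
rewrite expr2 mulrA.
apply: (@dv_mvt D (fun x => F x - F1 z * x) (fun x => F1 x - F1 z)) => // t t01.
split; last exact: H1.
have [h1 _ _] := H _ t01.
apply: dvB => //; apply: (dv_eq (dvZ _ (dv_id D _))); by rewrite mulr1.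
Qed.

Lemma derivable_dv (f : C -> C) (s : C) : derivable (f : C^o -> C^o) s 1 ->
  exists d, dv allD f s d.
Proof.
move=> /cvg_ex [d /cvgrPdist_le dP]; exists d => e e0.
have := dP e%:C; rewrite ltcR => /(_ e0).
rewrite near_withinE near_nbhs.
move=> /nbhs_ballP[r /= r0 rP].
have [rI rR] : complex.Im r = 0 /\ 0 < complex.Re r.
  by move: r0; rewrite ltcE => /andP[/eqP -> ?].
have rE : r = (complex.Re r)%:C by apply/eqP; rewrite eq_complex /= rI !eqxx.
exists (complex.Re r) => // h _ hr.
have [->|hnz] := eqVneq h 0.
  by rewrite addr0 subrr mul0r subrr mg0 mulr0.
have := rP h; rewrite -ball_normE /= sub0r normrN -mgE {1}rE ltcR => /(_ hr hnz).
rewrite -[X in X <= _ -> _]mgE lecR => H.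
have -> : f (s + h) - f s - h * d = - (h * (d - h^-1 *: (f (h *: 1 + s) - f s))).
  by rewrite /GRing.scale /= mulr1 (addrC h); field.
by rewrite mgN mgM mulrC ler_wpM2r// mg_ge0.
Qed.
End Deriv.

(** * Contour integrals along rectangles and Goursat's lemma *)

Section SegInt.
Variable R : realType.
Local Notation C := R[i].
Local Notation mu := (@lebesgue_measure R).
Local Notation Re := (@complex.Re R).
Local Notation Im := (@complex.Im R).

Definition ri (f : R -> R) (a b : R) : R := (\int[mu]_(x in `[a, b]) f x)%R.
Definition ctn (f : R -> R) (a b : R) :=
  forall x, a <= x <= b -> {for x, continuous f}.

Lemma ctnS f a b a' b' : a <= a' -> b' <= b -> ctn f a b -> ctn f a' b'.
Proof.
move=> aa bb H x /andP[x1 x2]; apply: H.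
by rewrite (le_trans aa x1) (le_trans x2 bb).
Qed.

Lemma ri_integrable f a b : ctn f a b -> mu.-integrable `[a, b]%classic (EFin \o f).
Proof.
move=> H; apply: continuous_compact_integrable; first exact: segment_compact.
apply: continuous_in_subspaceT => x; rewrite inE /= in_itv /=; exact: H.
Qed.

Lemma ri_split f a b c : a <= c <= b -> ctn f a b -> ri f a b = ri f a c + ri f c b.
Proof.
move=> /andP[ac cb] H; have I := ri_integrable H.
have := @Rintegral_itvB R f (BLeft a) (BRight b) c I; rewrite !bnd_simp => /(_ ac cb).
rewrite /ri => E; rewrite -[\int[mu]_(x in `[c, b]) _](@Rintegral_itv_obnd_cbnd R c (BRight b)).
  by rewrite -E addrC subrK.
by apply: integrableS I => //; apply: subset_itv; rewrite bnd_simp.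
Qed.

Lemma riD f g a b : ctn f a b -> ctn g a b -> ri (fun x => f x + g x) a b = ri f a b + ri g a b.
Proof. by move=> /ri_integrable hf /ri_integrable hg; rewrite /ri RintegralD. Qed.

Lemma riZ f k a b : ctn f a b -> ri (fun x => k * f x) a b = k * ri f a b.
Proof. by move=> /ri_integrable hf; rewrite /ri RintegralZl. Qed.

Lemma ri_cst k a b : a <= b -> ri (fun=> k) a b = k * (b - a).
Proof.
move=> ab; rewrite /ri Rintegral_cst//= lebesgue_measure_itv /= lte_fin.
case: ltP => [|ba]; first by rewrite -EFinB.
by rewrite (_ : b = a) ?subrr //; apply/eqP; rewrite eq_le ab ba.
Qed.

Lemma ctn_cst k a b : ctn (fun=> k) a b.
Proof. by move=> x _; exact: cvg_cst. Qed.

Lemma eq_ri f g a b : (forall x, a <= x <= b -> f x = g x) -> ri f a b = ri g a b.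
Proof. by move=> H; apply: eq_Rintegral => x; rewrite inE /= in_itv /=; exact: H. Qed.

Lemma ri_le f g a b : ctn f a b -> ctn g a b ->
  (forall x, a <= x <= b -> f x <= g x) -> ri f a b <= ri g a b.
Proof. by move=> /ri_integrable hf /ri_integrable hg H; apply: le_Rintegral. Qed.

Lemma ri_bound f K a b : a <= b -> ctn f a b -> (forall x, a <= x <= b -> `|f x| <= K) ->
  `|ri f a b| <= K * (b - a).
Proof.
move=> ab hf H; rewrite ler_norml -mulNr -!ri_cst//; apply/andP; split;
  apply: ri_le => //; try exact: ctn_cst; move=> x xab; have := H x xab;
  by rewrite ler_norml => /andP[].
Qed.

Definition ci (g : R -> C) (a b : R) : C :=
  (ri (fun x => Re (g x)) a b) +i* (ri (fun x => Im (g x)) a b).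
Definition cct (g : R -> C) (a b : R) :=
  ctn (fun x => Re (g x)) a b /\ ctn (fun x => Im (g x)) a b.

Lemma cctS g a b a' b' : a <= a' -> b' <= b -> cct g a b -> cct g a' b'.
Proof. by move=> h1 h2 [g1 g2]; split; [apply: ctnS g1|apply: ctnS g2]. Qed.

Lemma ci_split g a b c : a <= c <= b -> cct g a b -> ci g a b = ci g a c + ci g c b.
Proof. by move=> h [g1 g2]; rewrite /ci (ri_split h g1) (ri_split h g2). Qed.

Lemma eq_ci f g a b : (forall x, a <= x <= b -> f x = g x) -> ci f a b = ci g a b.
Proof. by move=> H; rewrite /ci; congr (_ +i* _); apply: eq_ri => x /H ->. Qed.

Lemma ctnD f g a b : ctn f a b -> ctn g a b -> ctn (fun x => f x + g x) a b.
Proof. by move=> hf hg x h; apply: continuousD; [exact: hf|exact: hg]. Qed.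

Lemma ctnN f a b : ctn f a b -> ctn (fun x => - f x) a b.
Proof. by move=> hf x h; apply: continuousN; exact: hf. Qed.

Lemma cctB f g a b : cct f a b -> cct g a b -> cct (fun x => f x - g x) a b.
Proof.
move=> [f1 f2] [g1 g2]; split.
  under eq_fun do rewrite raddfB /=; by apply: ctnD => //; exact: ctnN.
under eq_fun do rewrite raddfB /=; by apply: ctnD => //; exact: ctnN.
Qed.

Lemma ciB f g a b : cct f a b -> cct g a b -> ci (fun x => f x - g x) a b = ci f a b - ci g a b.
Proof.
move=> [f1 f2] [g1 g2]; rewrite /ci.
have rB u v : ctn u a b -> ctn v a b -> ri (fun x => u x - v x) a b = ri u a b - ri v a b.
  move=> hu hv; rewrite riD//; last exact: ctnN.
  congr (_ + _); rewrite -mulN1r -riZ//; apply: eq_ri => x _; by rewrite mulN1r.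
rewrite -[RHS]/(_ +i* _) -!rB//; congr (_ +i* _); apply: eq_ri => x _; by rewrite raddfB.
Qed.

Lemma ci_cst (k : C) a b : a <= b -> ci (fun=> k) a b = k * (b - a)%:C.
Proof.
move=> ab; rewrite /ci !ri_cst//; case: k => k1 k2 /=.
by apply/eqP; rewrite eq_complex /=; apply/andP; split; apply/eqP; ring.
Qed.

Lemma ci_bound g K a b : a <= b -> cct g a b -> (forall x, a <= x <= b -> mg (g x) <= K) ->
  mg (ci g a b) <= 2 * K * (b - a).
Proof.
move=> ab [g1 g2] H; apply: (le_trans (mg_ReIm _)); rewrite /ci /=.
have h1 := @ri_bound _ K _ _ ab g1 (fun x h => le_trans (Re_mg _) (H x h)).
have h2 := @ri_bound _ K _ _ ab g2 (fun x h => le_trans (Im_mg _) (H x h)).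
lra.
Qed.

Lemma cct_dv (g : R -> C) a b :
  (forall x, a <= x <= b -> forall e : R, 0 < e -> exists2 r, 0 < r & forall u, `|u| < r -> mg (g (x + u) - g x) < e) ->
  cct g a b.
Proof.
move=> H.
have K (p : C -> R) : (forall u v, p (u - v) = p u - p v) -> (forall z, `|p z| <= mg z) ->
    ctn (fun x => p (g x)) a b.
  move=> pB pm x xab; apply/cvgrPdist_lt => e e0; have [r r0 rP] := H x xab e e0.
  near=> y.
  have yr : `|y - x| < r.
    by rewrite distrC; near: y; exists r.
  have := rP _ yr; rewrite [x + _]addrC subrK; apply: le_lt_trans.
  by rewrite distrC -pB pm.
by split; apply: K; [exact: raddfB|exact: Re_mg|exact: raddfB|exact: Im_mg].
Unshelve. all: by end_near. Qed.

(** The counterclockwise contour integral. *)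
Definition crect (F : C -> C) (x1 x2 y1 y2 : R) : C :=
  ci (fun u => F (u +i* y1)) x1 x2 - ci (fun u => F (u +i* y2)) x1 x2
  + 'i * (ci (fun v => F (x2 +i* v)) y1 y2 - ci (fun v => F (x1 +i* v)) y1 y2).

Definition hct (F : C -> C) (x1 x2 y1 y2 : R) :=
  forall x y, x1 <= x <= x2 -> y1 <= y <= y2 -> exists d, dv (@allD R) F (x +i* y) d.

Lemma hct_hor F x1 x2 y1 y2 y : hct F x1 x2 y1 y2 -> y1 <= y <= y2 -> cct (fun u => F (u +i* y)) x1 x2.
Proof.
move=> H yy; apply: cct_dv => x xx e e0; have [d /dv_cont dP] := H x y xx yy.
have [r r0 rP] := dP _ e0; exists r => // u ur.
by have := rP u%:C I; rewrite mgR => /(_ ur); rewrite /= -[(x +i* y) + _]/(_ +i* _) addr0.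
Qed.

Lemma hct_ver F x1 x2 y1 y2 x : hct F x1 x2 y1 y2 -> x1 <= x <= x2 -> cct (fun v => F (x +i* v)) y1 y2.
Proof.
move=> H xx; apply: cct_dv => y yy e e0; have [d /dv_cont dP] := H x y xx yy.
have [r r0 rP] := dP _ e0; exists r => // u ur.
have := rP ('i * u%:C) I; rewrite mgM mg_i mul1r mgR => /(_ ur).
by rewrite (_ : (x +i* y) + 'i * u%:C = x +i* (y + u)) //; apply/eqP; rewrite eq_complex /=; apply/andP; split; apply/eqP; ring.
Qed.

Lemma hctS F x1 x2 y1 y2 x1' x2' y1' y2' : x1 <= x1' -> x2' <= x2 -> y1 <= y1' -> y2' <= y2 ->
  hct F x1 x2 y1 y2 -> hct F x1' x2' y1' y2'.
Proof.
move=> a b c d H x y /andP[hx1 hx2] /andP[hy1 hy2]; apply: H.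
  by rewrite (le_trans a hx1) (le_trans hx2 b).
by rewrite (le_trans c hy1) (le_trans hy2 d).
Qed.

Lemma crect_splitx F x1 x2 y1 y2 c : x1 <= c <= x2 -> y1 <= y2 -> hct F x1 x2 y1 y2 ->
  crect F x1 x2 y1 y2 = crect F x1 c y1 y2 + crect F c x2 y1 y2.
Proof.
move=> hc yy H; rewrite /crect.
rewrite (ci_split hc (hct_hor H _)) ?lexx// (ci_split hc (hct_hor H _)) ?lexx ?yy//.
ring.
Qed.

Lemma crect_splity F x1 x2 y1 y2 c : x1 <= x2 -> y1 <= c <= y2 -> hct F x1 x2 y1 y2 ->
  crect F x1 x2 y1 y2 = crect F x1 x2 y1 c + crect F x1 x2 c y2.
Proof.
move=> xx hc H; rewrite /crect.
rewrite (ci_split hc (hct_ver H _)) ?lexx ?xx// (ci_split hc (hct_ver H _)) ?lexx ?xx//.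
ring.
Qed.

Lemma crect_lin (a c : C) x1 x2 y1 y2 : x1 <= x2 -> y1 <= y2 ->
  crect (fun z => a + c * z) x1 x2 y1 y2 = 0.
Proof.
move=> xx yy; have H : hct (fun z => a + c * z) x1 x2 y1 y2.
  by move=> x y _ _; exists c; exact: dv_lin.
rewrite /crect -!ciB; try (by apply: (hct_hor H); rewrite lexx ?yy);
  try (by apply: (hct_ver H); rewrite lexx ?xx).
rewrite (eq_ci (g := fun=> c * ('i * (y1 - y2)%:C))); last first.
  by move=> x _; apply/eqP; case: c a {H} => c1 c2 [a1 a2]; rewrite eq_complex /=; apply/andP; split; apply/eqP; ring.
rewrite [ci _ y1 y2](eq_ci (g := fun=> c * (x2 - x1)%:C)); last first.
  by move=> x _; apply/eqP; case: c a {H} => c1 c2 [a1 a2]; rewrite eq_complex /=; apply/andP; split; apply/eqP; ring.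
rewrite !ci_cst// !rmorphB /=; ring.
Qed.

Definition onb (x1 x2 y1 y2 x y : R) :=
  (x1 <= x <= x2 /\ (y = y1 \/ y = y2)) \/ (y1 <= y <= y2 /\ (x = x1 \/ x = x2)).

Definition hbd (F : C -> C) (x1 x2 y1 y2 : R) :=
  forall x y, onb x1 x2 y1 y2 x y -> exists d, dv (@allD R) F (x +i* y) d.

Lemma hct_hbd F x1 x2 y1 y2 : x1 <= x2 -> y1 <= y2 -> hct F x1 x2 y1 y2 -> hbd F x1 x2 y1 y2.
Proof.
move=> xx yy H x y [[h [->|->]]|[h [->|->]]]; apply: H => //; by rewrite ?lexx ?xx ?yy.
Qed.

Lemma hbd_edges F x1 x2 y1 y2 : hbd F x1 x2 y1 y2 ->
  [/\ cct (fun u => F (u +i* y1)) x1 x2, cct (fun u => F (u +i* y2)) x1 x2,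
      cct (fun v => F (x1 +i* v)) y1 y2 & cct (fun v => F (x2 +i* v)) y1 y2].
Proof.
move=> H; split.
- apply: (@hct_hor F x1 x2 y1 y1); last by rewrite lexx.
  by move=> x y h h'; apply: H; left; split => //; left; apply/eqP; rewrite eq_le andbC.
- apply: (@hct_hor F x1 x2 y2 y2); last by rewrite lexx.
  by move=> x y h h'; apply: H; left; split => //; right; apply/eqP; rewrite eq_le andbC.
- apply: (@hct_ver F x1 x1 y1 y2); last by rewrite lexx.
  by move=> x y h' h; apply: H; right; split => //; left; apply/eqP; rewrite eq_le andbC.
- apply: (@hct_ver F x2 x2 y1 y2); last by rewrite lexx.
  by move=> x y h' h; apply: H; right; split => //; right; apply/eqP; rewrite eq_le andbC.
Qed.

Lemma crect_bound F G K x1 x2 y1 y2 : x1 <= x2 -> y1 <= y2 ->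
  hbd F x1 x2 y1 y2 -> hbd G x1 x2 y1 y2 ->
  (forall x y, onb x1 x2 y1 y2 x y -> mg (F (x +i* y) - G (x +i* y)) <= K) ->
  mg (crect F x1 x2 y1 y2 - crect G x1 x2 y1 y2) <= 4 * K * (x2 - x1 + (y2 - y1)).
Proof.
move=> xx yy /hbd_edges[F1 F2 F3 F4] /hbd_edges[G1 G2 G3 G4] H.
have -> : crect F x1 x2 y1 y2 - crect G x1 x2 y1 y2 =
  (ci (fun u => F (u +i* y1)) x1 x2 - ci (fun u => G (u +i* y1)) x1 x2)
  - (ci (fun u => F (u +i* y2)) x1 x2 - ci (fun u => G (u +i* y2)) x1 x2)
  + 'i * ((ci (fun v => F (x2 +i* v)) y1 y2 - ci (fun v => G (x2 +i* v)) y1 y2)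
     - (ci (fun v => F (x1 +i* v)) y1 y2 - ci (fun v => G (x1 +i* v)) y1 y2)).
  rewrite /crect; ring.
have a1 := ci_bound xx (cctB F1 G1) (fun x h => H x y1 (or_introl (conj h (or_introl erefl)))); rewrite ciB// in a1.
have a2 := ci_bound xx (cctB F2 G2) (fun x h => H x y2 (or_introl (conj h (or_intror erefl)))); rewrite ciB// in a2.
have a3 := ci_bound yy (cctB F3 G3) (fun y h => H x1 y (or_intror (conj h (or_introl erefl)))); rewrite ciB// in a3.
have a4 := ci_bound yy (cctB F4 G4) (fun y h => H x2 y (or_intror (conj h (or_intror erefl)))); rewrite ciB// in a4.
apply: (le_trans (mgD _ _)); rewrite mgM mg_i mul1r.
apply: (le_trans (lerD (mgB _ _) (mgB _ _))).
apply: (le_trans (lerD (lerD a1 a2) (lerD a4 a3))).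
by rewrite le_eqVlt; apply/orP; left; apply/eqP; ring.
Qed.

(** In coordinates rescaled to the unit square, the integral over a subrectangle of scale [s] is
    shown to be at most e * s^2. On small subrectangles F is replaced by its affine approximation,
    whose integral vanishes by [crect_lin]. *)
Lemma goursat F x1 x2 y1 y2 : x1 < x2 -> y1 < y2 -> hct F x1 x2 y1 y2 ->
  crect F x1 x2 y1 y2 = 0.
Proof.
move=> xx yy H.
set w := x2 - x1; set h := y2 - y1.
have w0 : 0 < w by rewrite /w; lra. have h0 : 0 < h by rewrite /h; lra.
pose X x := x1 + x * w; pose Y y := y1 + y * h.
suff key e : 0 < e -> mg (crect F (X 0) (X (0 + 1)) (Y 0) (Y (0 + 1))) <= e * 1 ^+ 2.
  apply/eqP; rewrite -mg_eq0 eq_le mg_ge0 andbT; apply/ler_addgt0Pr => e /key.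
  by rewrite add0r /X /Y !mul0r !mul1r !addr0 expr1n mulr1 add0r /w /h ![_ + (_ - _)]addrC !subrK.
move=> e0.
have Xle x x' : x <= x' -> X x <= X x' by move=> ?; rewrite lerD2l ler_pM2r.
have Yle x x' : x <= x' -> Y x <= Y x' by move=> ?; rewrite lerD2l ler_pM2r.
have X01 : X 0 = x1 /\ X 1 = x2 by rewrite /X /w; split; ring.
have Y01 : Y 0 = y1 /\ Y 1 = y2 by rewrite /Y /h; split; ring.
have Hs x y s : 0 <= x -> x + s <= 1 -> 0 <= y -> y + s <= 1 -> hct F (X x) (X (x + s)) (Y y) (Y (y + s)).
  case: X01 Y01 => Xa Xb [Ya Yb] a b c d; apply: hctS H.
  - by rewrite -Xa Xle. - by rewrite -Xb Xle.
  - by rewrite -Ya Yle. - by rewrite -Yb Yle.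
pose P x y s := 0 <= x -> x + s <= 1 -> 0 <= y -> y + s <= 1 ->
  mg (crect F (X x) (X (x + s)) (Y y) (Y (y + s))) <= e * s ^+ 2.
suff : P 0 0 1 by apply; rewrite ?add0r ?lexx.
apply: bisect_square; rewrite /P //.
  move=> x y s s0 p1 p2 p3 p4 x0 xs y0 ys.
  have E (u : R) : u + s / 2 + s / 2 = u + s by lra.
  move: p1 p2 p3 p4; rewrite !E.
  have [b1 b2 b3 b4] : [/\ x + s / 2 <= 1, 0 <= x + s / 2, y + s / 2 <= 1 & 0 <= y + s / 2] by split; lra.
  have [b5 b6 b7 b8] : [/\ x <= x + s / 2, x + s / 2 <= x + s, y <= y + s / 2 & y + s / 2 <= y + s] by split; lra.
  move=> /(_ x0 b1 y0 b3) p1 /(_ b2 xs y0 b3) p2 /(_ x0 b1 b4 ys) p3 /(_ b2 xs b4 ys) p4.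
  have hH := Hs x y s x0 xs y0 ys.
  have cx : X x <= X (x + s / 2) <= X (x + s) by rewrite !Xle.
  have cy : Y y <= Y (y + s / 2) <= Y (y + s) by rewrite !Yle.
  have cx' : X x <= X (x + s) by apply: Xle; exact: le_trans b6.
  have cy' : Y y <= Y (y + s) by apply: Yle; exact: le_trans b8.
  rewrite (crect_splitx cx cy' hH).
  have hH1 : hct F (X x) (X (x + s / 2)) (Y y) (Y (y + s)) by apply: hctS hH => //; exact: Xle.
  have hH2 : hct F (X (x + s / 2)) (X (x + s)) (Y y) (Y (y + s)) by apply: hctS hH => //; exact: Xle.
  rewrite (crect_splity (Xle _ _ b5) cy hH1) (crect_splity (Xle _ _ b6) cy hH2).
  apply: (le_trans (mgD _ _)); apply: (le_trans (lerD (mgD _ _) (mgD _ _))).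
  have -> : e * s ^+ 2 = e * (s / 2) ^+ 2 * 4 by field.
  lra.
move=> x y; rewrite add0r => hx hy.
have /andP[x0 x1'] := hx; have /andP[y0 y1'] := hy.
have hz : [/\ x1 <= X x <= x2 & y1 <= Y y <= y2].
  case: X01 Y01 => Xa Xb [Ya Yb]; split; first by rewrite -Xa -Xb !Xle.
  by rewrite -Ya -Yb !Yle.
have [d dP] := H _ _ hz.1 hz.2.
set z := (X x +i* Y y) in dP.
(* This factor makes [crect_bound] return exactly e * s^2. *)
have k0 : 0 < 4 * (w + h) * (w + h) by rewrite !mulr_gt0//; lra.
have e1 := divr_gt0 e0 k0.
have [r r0 rP] := dP _ e1.
exists (r / (w + h)); first by rewrite divr_gt0//; lra.
move=> x' y' s /andP[s0 sr] /andP[xa xb] /andP[ya yb] _ _ _ _ xa0 xb1 ya0 yb1.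
have sr' : s * (w + h) < r by rewrite -ltr_pdivlMr//; lra.
have cx' : X x' <= X (x' + s) by apply: Xle; lra.
have cy' : Y y' <= Y (y' + s) by apply: Yle; lra.
rewrite -[crect F _ _ _ _]subr0 -(@crect_lin (F z - d * z) d _ _ _ _ cx' cy').
apply: (le_trans (@crect_bound _ _ (e / (4 * (w + h) * (w + h)) * (s * (w + h))) _ _ _ _ cx' cy' _ _ _)).
- by apply: hct_hbd => //; exact: Hs.
- by move=> u v _; exists d; exact: dv_lin.
- move=> u v uv.
  have [/andP[u1 u2] /andP[v1 v2]] : X x' <= u <= X (x' + s) /\ Y y' <= v <= Y (y' + s).
    by case: uv => [[hh [->|->]]|[hh [->|->]]]; rewrite ?lexx ?hh ?cx' ?cy'.
  have E : F (u +i* v) - (F z - d * z + d * (u +i* v)) =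
     F (z + ((u +i* v) - z)) - F z - ((u +i* v) - z) * d.
    by rewrite [z + _]addrC subrK; ring.
  have B : mg ((u +i* v) - z) <= s * (w + h).
    apply: (le_trans (mg_ReIm _)); rewrite /z /= mulrDr; apply: lerD; rewrite ler_norml.
      rewrite /X in u1 u2 *.
      have : (x - x') * w <= s * w by rewrite ler_pM2r//; lra.
      have : (x' + s - x) * w <= s * w by rewrite ler_pM2r//; lra.
      lra.
    rewrite /Y in v1 v2 *.
    have : (y - y') * h <= s * h by rewrite ler_pM2r//; lra.
    have : (y' + s - y) * h <= s * h by rewrite ler_pM2r//; lra.
    lra.
  rewrite E; apply: (le_trans (rP _ I (le_lt_trans B sr'))).
  by rewrite ler_pM2l.
rewrite /X /Y le_eqVlt; apply/orP; left; apply/eqP; field; lra.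
Qed.

(** The region between the squares is cut into four rectangles: the left and right strips of full
    height, and the bottom and top pieces between them. *)
Lemma crect_annulus F x y a b : 0 < a < b ->
  (forall u v, x - b <= u <= x + b -> y - b <= v <= y + b ->
     (u <= x - a \/ x + a <= u) \/ (v <= y - a \/ y + a <= v) -> exists d, dv (@allD R) F (u +i* v) d) ->
  crect F (x - b) (x + b) (y - b) (y + b) = crect F (x - a) (x + a) (y - a) (y + a).
Proof.
move=> /andP[a0 ab] H.
have h1 : hct F (x - b) (x - a) (y - b) (y + b).
  by move=> u v /andP[u1 u2] hv; apply: H => //; [lra|lra].
have h2 : hct F (x + a) (x + b) (y - b) (y + b).
  by move=> u v /andP[u1 u2] hv; apply: H => //; [lra|lra].
have h3 : hct F (x - b) (x + b) (y - b) (y - a).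
  by move=> u v hu /andP[v1 v2]; apply: H => //; [lra|lra].
have h4 : hct F (x - b) (x + b) (y + a) (y + b).
  by move=> u v hu /andP[v1 v2]; apply: H => //; [lra|lra].
have [q1 q2 q3 q4] : [/\ x - b < x - a, x + a < x + b, y - b < y - a & y + a < y + b] by split; lra.
have [q5 q6 q7] : [/\ x - a < x + a, y - b < y + b & y - a < y + a] by split; lra.
have g1 := goursat q1 q6 h1.
have g2 := goursat q2 q6 h2.
have l1 : x - b <= x - a by lra. have l2 : x + a <= x + b by lra.
have g3 := @goursat F (x - a) (x + a) (y - b) (y - a) q5 q3 (hctS l1 l2 (lexx _) (lexx _) h3).
have g4 := @goursat F (x - a) (x + a) (y + a) (y + b) q5 q4 (hctS l1 l2 (lexx _) (lexx _) h4).
have m1 : y - b <= y - a by lra.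
have [r1 r2 r3] : [/\ y - b <= y - b <= y - a, y + a <= y + b <= y + b & x - b <= x - a <= x - a] by split; lra.
have [r4 r5 r6] : [/\ x + a <= x + a <= x + b, x - b <= x - a <= x + b & x - a <= x + a <= x + b] by split; lra.
have [r7 r8] : y - b <= y - a <= y + b /\ y - a <= y + a <= y + b by split; lra.
have cb := hct_hor h3 r1.
have ct := hct_hor h4 r2.
have cl := hct_ver h1 r3.
have cr := hct_ver h2 r4.
move: g1 g2 g3 g4; rewrite /crect.
rewrite (@ci_split _ (x - b) (x + b) (x - a) r5 cb).
rewrite (@ci_split _ (x - a) (x + b) (x + a) r6 (cctS l1 (lexx _) cb)).
rewrite (@ci_split _ (x - b) (x + b) (x - a) r5 ct).
rewrite (@ci_split _ (x - a) (x + b) (x + a) r6 (cctS l1 (lexx _) ct)).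
rewrite (@ci_split _ (y - b) (y + b) (y - a) r7 cl).
rewrite (@ci_split _ (y - a) (y + b) (y + a) r8 (cctS m1 (lexx _) cl)).
rewrite (@ci_split _ (y - b) (y + b) (y - a) r7 cr).
rewrite (@ci_split _ (y - a) (y + b) (y + a) r8 (cctS m1 (lexx _) cr)).
move=> g1 g2 g3 g4.
apply/eqP; rewrite -subr_eq0; apply/eqP.
have lem (L A1 A2 A3 A4 : C) : A1 = 0 -> A2 = 0 -> A3 = 0 -> A4 = 0 -> L = A1 + A2 + A3 + A4 -> L = 0.
  by move=> -> -> -> -> ->; rewrite !addr0.
by apply: (lem _ _ _ _ _ g1 g2 g3 g4); ring.
Qed.
End SegInt.

(** * The maximum principle, removable singularities and Liouville's theorem *)

Section MaxMod.
Variable R : realType.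
Local Notation C := R[i].
Local Notation Re := (@complex.Re R).
Local Notation Im := (@complex.Im R).
Implicit Types (F : C -> C) (S : C -> Prop).

Lemma ctnZ (f : R -> R) k a b : ctn f a b -> ctn (fun x => k * f x) a b.
Proof. by move=> hf x h; apply: continuousM; [exact: cvg_cst|exact: hf]. Qed.

Lemma ciZ (g : R -> C) k a b : cct g a b -> ci (fun x => k * g x) a b = k * ci g a b.
Proof.
move=> [g1 g2]; case: k => k1 k2; rewrite /ci.
rewrite (@eq_ri _ _ (fun x => k1 * Re (g x) + (- k2) * Im (g x))); last first.
  by move=> x _; case: (g x) => a1 b1 /=; ring.
rewrite [X in _ +i* X](@eq_ri _ _ (fun x => k1 * Im (g x) + k2 * Re (g x))); last first.
  by move=> x _; case: (g x) => a1 b1 /=; ring.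
rewrite !riD ?riZ//; try exact: ctnZ.
by apply/eqP; rewrite eq_complex /=; apply/andP; split; apply/eqP; ring.
Qed.

Lemma crectZ (F : C -> C) k x1 x2 y1 y2 : hbd F x1 x2 y1 y2 ->
  crect (fun z => k * F z) x1 x2 y1 y2 = k * crect F x1 x2 y1 y2.
Proof. by move=> /hbd_edges[F1 F2 F3 F4]; rewrite /crect !ciZ//; ring. Qed.

Lemma dv_invB (c z : C) : z != c -> dv (@allD R) (fun x => (x - c)^-1) z (- 1 / (z - c) ^+ 2).
Proof.
move=> zc; apply: dvV; last by rewrite subr_eq0.
apply: (dv_eq (dvB (dv_id _ _) (dv_cst _ c z))); by rewrite subr0.
Qed.

Lemma onb_far (cx cy a x y : R) : 0 < a -> onb (cx - a) (cx + a) (cy - a) (cy + a) x y ->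
  a <= mg ((x +i* y) - (cx +i* cy)).
Proof.
move=> a0 [[_ h]|[_ h]].
  apply: le_trans (Im_mg _); rewrite /=.
  by case: h => ->; rewrite ler_normr; apply/orP; [right|left]; lra.
apply: le_trans (Re_mg _); rewrite /=.
by case: h => ->; rewrite ler_normr; apply/orP; [right|left]; lra.
Qed.

(** A lower bound in place of the value 2 pi i: on each side, of length 2 a, the imaginary part of
    dz / (z - c) has density at least 1 / (2 a), so each side contributes at least 1. *)
Lemma crect_pole (cx cy a : R) : 0 < a ->
  4 <= mg (crect (fun z => (z - (cx +i* cy))^-1) (cx - a) (cx + a) (cy - a) (cy + a)).
Proof.
move=> a0.
have H : hbd (fun z => (z - (cx +i* cy))^-1) (cx - a) (cx + a) (cy - a) (cy + a).
  move=> x y h; eexists; apply: dv_invB; rewrite -subr_eq0 -mg_gt0.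
  by apply: lt_le_trans (onb_far a0 h).
have [[c1 d1] [c2 d2] [c3 d3] [c4 d4]] := hbd_edges H.
apply: (le_trans _ (Im_mg _)); apply: (le_trans _ (ler_norm _)).
rewrite /crect /ci /= mul0r add0r mul1r.
have key (f : R -> R) m : ctn f (m - a) (m + a) ->
    (forall x, m - a <= x <= m + a -> (2 * a)^-1 <= f x) -> 1 <= ri f (m - a) (m + a).
  move=> cf hf; have := ri_le (@ctn_cst _ _ _ _) cf hf.
  rewrite ri_cst; last by lra.
  by rewrite (_ : _ * _ = 1)//; field; lra.
have key2 (p : R) m : m - a <= p <= m + a -> (2 * a)^-1 <= a / (a ^+ 2 + (p - m) ^+ 2).
  move=> /andP[p1 p2]; rewrite -[(2 * a)^-1]mul1r ler_pdivrMr; last by lra.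
  have q0 : 0 <= (p - m) ^+ 2 by exact: sqr_ge0.
  have q1 : (p - m) ^+ 2 <= a ^+ 2.
    rewrite -subr_ge0 (_ : _ - _ = (a - (p - m)) * (a + (p - m))); last by ring.
    by apply: mulr_ge0; lra.
  have a2 : 0 < a ^+ 2 by rewrite exprn_gt0.
  rewrite mulrAC ler_pdivlMr; last by lra.
  have -> : a * (2 * a) = 2 * a ^+ 2 by ring.
  lra.
have keyN (f : R -> R) m : ctn f (m - a) (m + a) ->
    (forall x, m - a <= x <= m + a -> (2 * a)^-1 <= - f x) -> ri f (m - a) (m + a) <= -1.
  move=> cf hf; have := key _ _ (ctnN cf) hf.
  rewrite (@eq_ri _ _ (fun x => (-1) * f x)) ?riZ//; first by lra.
  by move=> x _; rewrite mulN1r.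
have t1 := key _ _ d1; have t2 := keyN _ _ d2.
have t3 := keyN _ _ c3; have t4 := key _ _ c4.
apply: (@le_trans _ _ (1 - (-1) + (1 - (-1)))); first by lra.
apply: lerD; apply: lerB.
- apply: t1 => x hx; rewrite /= -mulNr opprB (_ : cy - (cy - a) = a); last by ring.
  by rewrite addrC (_ : (cy - a - cy) ^+ 2 = a ^+ 2) ?key2//; ring.
- apply: t2 => x hx; rewrite /= opprK (_ : cy + a - cy = a); last by ring.
  by rewrite addrC key2.
- by apply: t4 => y hy; rewrite /= (_ : cx + a - cx = a) ?key2//; ring.
- apply: t3 => y hy; rewrite /= -mulNr opprB (_ : cx - (cx - a) = a); last by ring.
  by rewrite (_ : (cx - a - cx) ^+ 2 = a ^+ 2) ?key2//; ring.
Qed.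

Definition insq (c : C) (r : R) (z : C) := `|Re (z - c)| <= r /\ `|Im (z - c)| <= r.
(** Besides the sides this contains the corner regions outside the disc; the distance to the centre
    is the only feature of the boundary used in the estimates. *)
Definition bdsq (c : C) (r : R) (z : C) := insq c r z /\ r <= mg (z - c).

Lemma insq_mg c r z : mg (z - c) <= r -> insq c r z.
Proof. by move=> h; split; [exact: le_trans (Re_mg _) h|exact: le_trans (Im_mg _) h]. Qed.

Lemma insq_mg2 c r z : insq c r z -> mg (z - c) <= 2 * r.
Proof. by move=> [h1 h2]; apply: (le_trans (mg_ReIm _)); lra. Qed.

Lemma onb_bdsq (cx cy a x y : R) : 0 < a -> onb (cx - a) (cx + a) (cy - a) (cy + a) x y ->
  bdsq (cx +i* cy) a (x +i* y).
Proof.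
move=> a0 h; split; last exact: onb_far.
split; rewrite /= ler_norml; by case: h => [[/andP[h1 h2] [E|E]]|[/andP[h1 h2] [E|E]]]; apply/andP; split; lra.
Qed.

(** Cauchy's estimate for F z / (z - c): the contour is shrunk to a small square on which F is
    nearly F c. The outer square gives at most 16 K and the pole at least 4 |F c|, whence the
    constant 4. *)
Lemma max_modulus_weak F (c : C) r K : 0 < r ->
  (forall z, insq c r z -> exists d, dv (@allD R) F z d) ->
  (forall z, bdsq c r z -> mg (F z) <= K) -> mg (F c) <= 4 * K.
Proof.
case: c => cx cy r0 hF hK; set c := cx +i* cy.
have K0 : 0 <= K.
  apply: le_trans (mg_ge0 (F ((cx + r) +i* cy))) (hK _ _); apply: onb_bdsq => //.
  by right; split; [apply/andP; split; lra|right].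
apply/ler_addgt0Pr => e e0; have e4 : 0 < e / 4 by lra.
have cin : insq c r c by apply: insq_mg; rewrite subrr mg0; exact: ltW.
have [d0 /dv_cont dP] := hF c cin.
have [s s0 sP] := dP _ e4.
pose a := Num.min (r / 2) (s / 3).
have a0 : 0 < a by rewrite /a lt_min; apply/andP; split; lra.
have ar : a < r by rewrite /a; apply: le_lt_trans (_ : _ <= r / 2) _; [rewrite ge_min lexx|lra].
have as' : 2 * a < s.
  have : a <= s / 3 by rewrite /a ge_min lexx orbT.
  lra.
pose G z := F z * (z - c)^-1.
have dG z : insq c r z -> z != c -> exists d, dv (@allD R) G z d.
  by move=> /hF[d dF] zc; eexists; apply: dvM dF (dv_invB zc).
have sub b x y : 0 < b <= r -> onb (cx - b) (cx + b) (cy - b) (cy + b) x y -> insq c r (x +i* y) /\ (x +i* y) != c.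
  move=> /andP[b0 br] h; have [[h1 h2] h3] := onb_bdsq b0 h; split.
    by split; [exact: le_trans br|exact: le_trans br].
  by rewrite -subr_eq0 -mg_gt0; exact: lt_le_trans h3.
have hG b : 0 < b <= r -> hbd G (cx - b) (cx + b) (cy - b) (cy + b).
  by move=> hb x y h; have [h1 h2] := sub b x y hb h; exact: dG.
have hI b : 0 < b <= r -> hbd (fun z => (z - c)^-1) (cx - b) (cx + b) (cy - b) (cy + b).
  by move=> hb x y h; have [h1 h2] := sub b x y hb h; eexists; exact: dv_invB.
have h0 b : hbd (fun=> 0 : C) (cx - b) (cx + b) (cy - b) (cy + b).
  by move=> x y h; exists 0; exact: dv_cst.
have E : crect G (cx - r) (cx + r) (cy - r) (cy + r) = crect G (cx - a) (cx + a) (cy - a) (cy + a).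
  apply: crect_annulus; first by rewrite a0.
  move=> u v hu hv huv; apply: dG.
    by split; rewrite /= ler_norml; lra.
  rewrite eq_complex /= negb_and.
  case: huv => [[h|h]|[h|h]]; apply/orP.
  - by left; rewrite lt_eqF //; lra.
  - by left; rewrite gt_eqF //; lra.
  - by right; rewrite lt_eqF //; lra.
  - by right; rewrite gt_eqF //; lra.
have rr : 0 < r <= r by rewrite r0 lexx.
have aa : 0 < a <= r by rewrite a0 ltW.
have le1 (b m : R) : 0 < b -> m - b <= m + b by lra.
have B1 : mg (crect G (cx - r) (cx + r) (cy - r) (cy + r)) <= 16 * K.
  have := @crect_bound _ G (fun=> 0) (K / r) _ _ _ _ (le1 _ cx r0) (le1 _ cy r0) (hG _ rr) (h0 _).
  rewrite (_ : crect (fun=> 0) _ _ _ _ = 0); last first.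
    by rewrite /crect !ci_cst ?le1// !mul0r subrr mulr0 addr0.
  rewrite subr0 => /(_ _)/le_trans -> //.
    move=> x y h; rewrite subr0 /G mgM mgV ler_pM ?invr_ge0 ?mg_ge0//.
      exact/hK/onb_bdsq.
    have f := onb_far r0 h; by rewrite lef_pV2 ?posrE ?f ?r0 ?(lt_le_trans r0 f).
  by rewrite le_eqVlt; apply/orP; left; apply/eqP; field; lra.
have B2 : mg (crect G (cx - a) (cx + a) (cy - a) (cy + a) - crect (fun z => F c * (z - c)^-1) (cx - a) (cx + a) (cy - a) (cy + a)) <= 4 * e.
  have hFc : hbd (fun z => F c * (z - c)^-1) (cx - a) (cx + a) (cy - a) (cy + a).
    by move=> x y /(hI _ aa)[d dd]; exists (F c * d); exact: dvZ.
  apply: le_trans (@crect_bound _ G _ (e / 4 / a) _ _ _ _ (le1 _ cx a0) (le1 _ cy a0) (hG _ aa) hFc _) _.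
    move=> x y h; rewrite /G -mulrBl mgM mgV ler_pM ?invr_ge0 ?mg_ge0//.
      have [h1 _] := onb_bdsq a0 h.
      have := sP ((x +i* y) - c) I (le_lt_trans (insq_mg2 h1) as').
      by rewrite [c + _]addrC subrK => /ltW.
    have f := onb_far a0 h; by rewrite lef_pV2 ?posrE ?f ?a0 ?(lt_le_trans a0 f).
  by rewrite le_eqVlt; apply/orP; left; apply/eqP; field; lra.
rewrite crectZ in B2; last exact: hI.
have B3 := crect_pole cx cy a0.
have B4 : 4 * mg (F c) <= mg (F c * crect (fun z => (z - c)^-1) (cx - a) (cx + a) (cy - a) (cy + a)).
  by rewrite mgM mulrC ler_wpM2l// mg_ge0.
rewrite -E in B2; rewrite mgBC in B2.
have := mgBr (F c * crect (fun z => (z - c)^-1) (cx - a) (cx + a) (cy - a) (cy + a)) (crect G (cx - r) (cx + r) (cy - r) (cy + r)).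
lra.
Qed.

(** By Bernoulli's inequality (a / b)^n would otherwise be unbounded. *)
Lemma pow_bound (a b M : R) : 0 <= a -> 0 <= b -> (forall n, a ^+ n <= M * b ^+ n) -> a <= b.
Proof.
move=> a0 b0 H; rewrite leNgt; apply/negP => ba.
have [b00|bp] := eqVneq b 0.
  by have := H 1%N; rewrite b00 !expr1 mulr0 leNgt -{1}b00 ba.
have bp' : 0 < b by rewrite lt_def bp.
pose x := a / b - 1.
have x0 : 0 < x by rewrite /x subr_gt0 ltr_pdivlMr// mul1r.
have Hx n : 1 + n%:R * x <= M.
  have h : 1 + n%:R * x <= (1 + x) ^+ n.
    elim: n => [|n IH]; first by rewrite mul0r addr0 expr0.
    rewrite exprS; apply: le_trans (_ : _ <= (1 + x) * (1 + n%:R * x)) _; last first.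
      by rewrite ler_wpM2l//; lra.
    have -> : (1 + x) * (1 + n%:R * x) = 1 + n.+1%:R * x + n%:R * x ^+ 2 by rewrite -natr1; ring.
    by rewrite lerDl mulr_ge0// sqr_ge0.
  apply: (le_trans h); rewrite /x addrC subrK expr_div_n ler_pdivrMr ?exprn_gt0//.
have := Hx (Num.truncn (M / x)).+1.
have := truncnS_gt (M / x); rewrite ltr_pdivrMr// => h1 h2; lra.
Qed.

(** The weak form for all powers of F; [pow_bound] then removes the constant 4. *)
Theorem max_modulus F (c : C) r K : 0 < r ->
  (forall z, insq c r z -> exists d, dv (@allD R) F z d) ->
  (forall z, bdsq c r z -> mg (F z) <= K) -> mg (F c) <= K.
Proof.
move=> r0 hF hK.
have K0 : 0 <= K.
  apply: le_trans (mg_ge0 (F (c + r%:C))) (hK _ _); split.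
    by apply: insq_mg; rewrite [c + _]addrC addrK mgR gtr0_norm.
  by rewrite [c + _]addrC addrK mgR ler_norm.
apply: (@pow_bound _ _ 4) => //; first exact: mg_ge0.
move=> [|n]; first by rewrite !expr0; lra.
rewrite -mgX; apply: (max_modulus_weak (F := fun z => F z ^+ n.+1) r0).
  by move=> z /hF[d dd]; eexists; exact: dvX dd.
by move=> z /hK h; rewrite mgX lerXn2r ?nnegrE ?mg_ge0.
Qed.

Lemma locbounded_sq F (c : C) r : 0 < r ->
  (forall z, insq c r z -> exists K s, 0 < s /\ forall h, mg h < s -> mg (F (z + h)) <= K) ->
  exists K, forall z, insq c r z -> mg (F z) <= K.
Proof.
case: c => cx cy r0 H.
pose P (x y s : R) := exists K, forall u v, x <= u <= x + s -> y <= v <= y + s -> mg (F (u +i* v)) <= K.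
suff : P (cx - r) (cy - r) (2 * r).
  move=> [K KP]; exists K => -[u v] [/= ]; rewrite !ler_norml => /andP[h1 h2] /andP[h3 h4].
  by apply: KP; apply/andP; split; lra.
apply: bisect_square; first by lra.
  move=> x y s s0 [K1 h1] [K2 h2] [K3 h3] [K4 h4].
  exists (Num.max (Num.max K1 K2) (Num.max K3 K4)) => u v /andP[u1 u2] /andP[v1 v2].
  rewrite !le_max.
  have [uu|uu] := leP u (x + s / 2); have [vv|vv] := leP v (y + s / 2).
  - by rewrite h1 //; apply/andP; split; lra.
  - by rewrite h3 ?orbT //; apply/andP; split; lra.
  - by rewrite h2 ?orbT //; apply/andP; split; lra.
  - by rewrite h4 ?orbT //; apply/andP; split; lra.
move=> x y /andP[x1 x2] /andP[y1 y2].
have hz : insq (cx +i* cy) r (x +i* y) by split; rewrite /= ler_norml; apply/andP; split; lra.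
have [K [s [s0 sP]]] := H _ hz.
exists (s / 2); first by lra.
move=> x' y' t /andP[t0 ts] /andP[a1 a2] /andP[b1 b2] _ _ _ _.
exists K => u v /andP[u1 u2] /andP[v1 v2].
have := sP ((u +i* v) - (x +i* y)); rewrite [_ + (_ - _)]addrC subrK; apply.
apply: (le_lt_trans (mg_ReIm _)); rewrite /=.
have : `|u - x| <= t by rewrite ler_norml; apply/andP; split; lra.
have : `|v - y| <= t by rewrite ler_norml; apply/andP; split; lra.
lra.
Qed.

Lemma dv_locbounded F z d : dv (@allD R) F z d ->
  exists K s, 0 < s /\ forall h, mg h < s -> mg (F (z + h)) <= K.
Proof.
move=> /dv_cont /(_ 1 ltr01)[s s0 sP]; exists (mg (F z) + 1), s; split => // h hs.
rewrite -[F (z + h)](subrK (F z)); apply: (le_trans (mgD _ _)).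
have := sP h I hs; lra.
Qed.

Lemma dv_bounded_sq F (c : C) r : 0 < r ->
  (forall z, insq c r z -> exists d, dv (@allD R) F z d) ->
  exists K, forall z, insq c r z -> mg (F z) <= K.
Proof. by move=> r0 H; apply: locbounded_sq => // z /H[d]; exact: dv_locbounded. Qed.

Definition locfin (S : C -> Prop) := forall r : R, exists l : seq C, forall z, S z -> mg z <= r -> z \in l.

Lemma finite_sep (l : seq C) z : exists2 r : R, 0 < r & forall p, p \in l -> p != z -> r <= mg (p - z).
Proof.
elim: l => [|q l [r r0 rP]]; first by exists 1.
have [->|qz] := eqVneq q z.
  exists r => // p; rewrite inE => /orP[/eqP ->|]; [by rewrite eqxx|exact: rP].
have q0 : 0 < mg (q - z) by rewrite mg_gt0 subr_eq0.
exists (Num.min r (mg (q - z))); first by rewrite lt_min r0.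
move=> p; rewrite inE ge_min => /orP[/eqP -> _|pl pz]; first by rewrite lexx orbT.
by rewrite rP.
Qed.

Lemma locfin_near S z : locfin S -> ~ S z -> near0 (@allD R) (fun h => ~ S (z + h)).
Proof.
move=> lS Sz; have [l lP] := lS (mg z + 1); have [r r0 rP] := finite_sep l z.
exists (Num.min r 1); first by rewrite lt_min r0 ltr01.
move=> h _; rewrite lt_min => /andP[hr h1] Szh.
have hl : z + h \in l by apply: lP => //; apply: le_trans (mgD _ _) _; lra.
have nz : z + h != z by apply/eqP => E; apply: Sz; rewrite -E.
by have := rP _ hl nz; rewrite addrC addKr; lra.
Qed.

(** Removable singularities without power series: a double zero makes any function bounded around p
    differentiable at p, whatever its value there. *)
Lemma dv_sqmul (k : C -> C) p (M : R) : near0 (@allD R) (fun h => h != 0 -> mg (k (p + h)) <= M) ->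
  dv (@allD R) (fun z => (z - p) ^+ 2 * k z) p 0.
Proof.
move=> H e e0.
have M0 : 0 < `|M| + 1 by have := normr_ge0 M; lra.
have := near0_and H (near0_lt _ (divr_gt0 e0 M0)); apply: near0W => h _ [h1 h2].
rewrite subrr expr0n mul0r mulr0 !subr0 [p + h]addrC addrK mgM mgX expr2 -mulrA mulrC.
have [->|nz] := eqVneq h 0; first by rewrite mg0 !mulr0.
rewrite ler_wpM2r ?mg_ge0//.
have hk := h1 nz; rewrite addrC in hk.
have k1 : mg (k (h + p)) <= `|M| + 1 by have := ler_norm M; lra.
apply: le_trans (_ : _ <= mg h * (`|M| + 1)) _; first by rewrite ler_wpM2l// mg_ge0.
by rewrite -ler_pdivlMr// ltW.
Qed.

(** The difference quotient k at z1 is O(1 / |z - z1|), with singularities on S and at z1 only. The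
    product P has double zeros at those inside a large square, so P * k^n is differentiable there;
    as n grows, [max_modulus] and [pow_bound] eliminate P. *)
Lemma liouville_bounded S F (B : R) z1 z2 : locfin S ->
  (forall z, ~ S z -> exists d, dv (@allD R) F z d) ->
  (forall z, ~ S z -> mg (F z) <= B) -> ~ S z1 -> ~ S z2 -> F z1 = F z2.
Proof.
move=> lS dF bF Sz1 Sz2.
have [->//|z12] := eqVneq z1 z2.
pose F0 z := if asbool (S z) then 0 else F z.
have F0E z : ~ S z -> F0 z = F z by rewrite /F0; case: asboolP.
have B0 : 0 <= B by exact: le_trans (mg_ge0 _) (bF _ Sz1).
have bF0 z : mg (F0 z) <= B by rewrite /F0; case: asboolP => [|/bF//]; rewrite mg0.
have dF0 z : ~ S z -> exists d, dv (@allD R) F0 z d.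
  move=> Sz; have [d dd] := dF z Sz; exists d; apply: dv_near dd; first by rewrite F0E.
  by have := locfin_near lS Sz; apply: near0W => h _ /F0E.
pose k z := (F0 z - F0 z1) / (z - z1).
have dk z : ~ S z -> z != z1 -> exists d, dv (@allD R) k z d.
  move=> /dF0[d dd] zz; eexists; apply: dvM (dv_invB zz).
  by apply: dvB dd (dv_cst _ _ _).
have bk z : z != z1 -> mg (k z) <= 2 * B / mg (z - z1).
  move=> zz; rewrite /k mgM mgV ler_wpM2r ?invr_ge0 ?mg_ge0//.
  by apply: (le_trans (mgB _ _)); have := bF0 z; have := bF0 z1; lra.
have kloc p : exists M, near0 (@allD R) (fun h => h != 0 -> mg (k (p + h)) <= M).
  have [->|pz] := eqVneq p z1.
    have [d dd] := dF0 _ Sz1; exists (mg d + 1).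
    have := dv_bnd dd; apply: near0W => h _ hh nz.
    rewrite /k mgM mgV [z1 + h - z1]addrAC subrr add0r ler_pdivrMr ?mg_gt0//.
  have q0 : 0 < mg (p - z1) by rewrite mg_gt0 subr_eq0.
  exists (2 * B / (mg (p - z1) / 2)).
  have q2 : 0 < mg (p - z1) / 2 by lra.
  have := near0_lt (@allD R) q2; apply: near0W.
  move=> h _ hh _.
  have h1 : mg (p - z1) / 2 <= mg (p + h - z1).
    by have := mgBl (p - z1) h; rewrite addrAC; lra.
  apply: le_trans (bk _ _) _; first by rewrite -subr_eq0 -mg_gt0; lra.
  by rewrite ler_wpM2l ?lef_pV2 ?posrE//; lra.
pose d12 := mg (z1 - z2); have d0 : 0 < d12 by rewrite mg_gt0 subr_eq0.
(* The bound on the square of radius rho around z2 tends to 0 as rho grows. *)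
have main (rho : R) : d12 < rho -> mg (k z2) <= 2 * B / (rho - d12).
  move=> dr; have rho0 : 0 < rho by lra.
  have [l0 l0P] := lS (mg z2 + 2 * rho).
  pose l := z1 :: [seq p <- l0 | asbool (S p)].
  have lz2 : z2 \notin l.
    by rewrite inE negb_or eq_sym z12 mem_filter negb_and; apply/orP; left; apply/asboolP.
  have lP z : insq z2 rho z -> z \notin l -> ~ S z /\ z != z1.
    move=> /insq_mg2 zr; rewrite inE negb_or => /andP[-> zl]; split => // Sz; move/negP: zl; apply.
    rewrite mem_filter; apply/andP; split; first exact/asboolP.
    by apply: l0P => //; have := mgD (z - z2) z2; rewrite subrK; lra.
  pose P z := \prod_(p <- l) (z - p) ^+ 2.
  have dprod (s : seq C) z : exists d, dv (@allD R) (fun z => \prod_(p <- s) (z - p) ^+ 2) z d.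
    elim: s => [|p s [d dd]].
      by exists 0; apply: dv_ext (dv_cst _ 1 z) => x; rewrite big_nil.
    eexists; apply: dv_ext; last first.
      exact: dvM (dvX 1 (dvB (dv_id _ _) (dv_cst _ p _))) dd.
    by move=> x; rewrite big_cons.
  have [CP CPP] : exists K, forall z, insq z2 rho z -> mg (P z) <= K.
    by apply: dv_bounded_sq => // z _; exact: dprod.
  have P2 : 0 < mg (P z2).
    rewrite mg_gt0 /P prodf_seq_neq0; apply/allP => p pl /=.
    rewrite expf_eq0 /= subr_eq0; apply: contraNneq lz2 => E; by rewrite E.
  (* The contribution of P is a constant independent of n. *)
  apply: (@pow_bound _ _ (CP / mg (P z2))); [exact: mg_ge0|by rewrite divr_ge0//; lra|].
  move=> n; rewrite mulrAC ler_pdivlMr// mulrC -mgX -mgM.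
  apply: (max_modulus (F := fun z => P z * k z ^+ n) rho0).
    move=> z zr; have [zl|zl] := boolP (z \in l).
      exists 0; apply: (dv_ext (F := fun x => (x - z) ^+ 2 * (\prod_(p <- rem z l) (x - p) ^+ 2 * k x ^+ n))).
        by move=> x; rewrite /P (perm_big _ (perm_to_rem zl)) big_cons mulrA.
      have [M MP] := kloc z; have [d /dv_locbounded[K [s [s0 sP]]]] := dprod (rem z l) z.
      apply: (@dv_sqmul _ _ (K * `|M| ^+ n)).
      have := near0_and MP (near0_lt _ s0); apply: near0W => h _ [h1 h2] nz.
      rewrite mgM mgX ler_pM ?exprn_ge0 ?mg_ge0 ?sP//.
      by rewrite lerXn2r ?nnegrE ?mg_ge0// (le_trans (h1 nz))// ler_norm.
    have [Sz zz] := lP z zr zl; have [d dd] := dk _ Sz zz; have [d' dd'] := dprod l z.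
    case: n => [|n].
      by exists d'; apply: dv_ext dd' => x; rewrite expr0 mulr1.
    by eexists; apply: dvM dd' (dvX n dd).
  move=> z [zr zb]; rewrite mgM mgX.
  have zz1 : rho - d12 <= mg (z - z1).
    have := mgBr (z - z2) (z1 - z2); rewrite (_ : z - z2 - (z1 - z2) = z - z1); last by ring.
    by rewrite -/d12; lra.
  have zz : z != z1 by rewrite -subr_eq0 -mg_gt0; lra.
  rewrite ler_pM ?exprn_ge0 ?mg_ge0 ?CPP// lerXn2r ?nnegrE ?mg_ge0//.
    by rewrite divr_ge0//; lra.
  apply: (le_trans (bk _ zz)); rewrite ler_wpM2l ?lef_pV2 ?posrE//; lra.
have k0 : mg (k z2) <= 0.
  apply/ler_addgt0Pr => e e0; rewrite add0r.
  have h : d12 < d12 + 2 * B / e + 1 by have := divr_ge0 (mulr_ge0 (ler0n R 2) B0) (ltW e0); lra.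
  apply: le_trans (main _ h) _.
  have p : 0 < 2 * B / e + 1 by have := divr_ge0 (mulr_ge0 (ler0n R 2) B0) (ltW e0); lra.
  rewrite (_ : _ - d12 = 2 * B / e + 1); last by ring.
  rewrite ler_pdivrMr// mulrDr mulr1 mulrCA divff ?gt_eqF// mulr1; lra.
have : k z2 == 0 by rewrite -mg_eq0 eq_le k0 mg_ge0.
rewrite /k mulf_eq0 invr_eq0 [X in _ || X]subr_eq0 eq_sym (eq_sym z2) (negbTE z12) orbF eq_sym subr_eq0 !F0E//.
by move/eqP.
Qed.

(** The difference quotient at z1 is bounded off S and z1, hence constant. *)
Lemma liouville_linear S F (A B : R) z1 : locfin S ->
  (forall z, ~ S z -> exists d, dv (@allD R) F z d) ->
  (forall z, ~ S z -> mg (F z) <= A + B * mg z) -> ~ S z1 ->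
  exists a, forall z, ~ S z -> F z = F z1 + a * (z - z1).
Proof.
move=> lS dF bF Sz1.
pose k z := (F z - F z1) / (z - z1).
pose S' z := S z \/ z = z1.
have lS' : locfin S'.
  move=> r; have [l lP] := lS r; exists (z1 :: l) => z [Sz|->] zr; last by rewrite mem_head.
  by rewrite inE lP ?orbT.
have S'P z : ~ S' z -> ~ S z /\ z != z1.
  by move=> h; split; [move=> ?; apply: h; left|apply/eqP => ?; apply: h; right].
have dk z : ~ S' z -> exists d, dv (@allD R) k z d.
  move=> /S'P[/dF[d dd] zz]; eexists; apply: dvM (dv_invB zz).
  by apply: dvB dd (dv_cst _ _ _).
have [d /dv_bnd [s s0 sP]] := dF _ Sz1.
pose M := `|A| + `|B| * mg z1 + mg (F z1).
have M0 : 0 <= M by rewrite /M !addr_ge0 ?mulr_ge0 ?mg_ge0.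
have bk z : ~ S' z -> mg (k z) <= (mg d + 1) + (M / s + `|B|).
  move=> /S'P[Sz zz]; have q : 0 < mg (z - z1) by rewrite mg_gt0 subr_eq0.
  have d0 := mg_ge0 d.
  rewrite /k mgM mgV ler_pdivrMr//.
  have [zs|zs] := ltP (mg (z - z1)) s.
    have := sP _ I zs; rewrite [z1 + _]addrC subrK => /le_trans; apply.
    by rewrite ler_wpM2r ?mg_ge0// lerDl addr_ge0// divr_ge0// ltW.
  apply: le_trans (_ : _ <= M + `|B| * mg (z - z1)) _.
    apply: (le_trans (mgB _ _)); rewrite /M.
    have h1 := bF z Sz; have h2 := ler_norm A.
    have h3 : B * mg z <= `|B| * mg z by rewrite ler_wpM2r ?mg_ge0// ler_norm.
    have h4 : `|B| * mg z <= `|B| * (mg (z - z1) + mg z1).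
      by rewrite ler_wpM2l//; have := mgD (z - z1) z1; rewrite subrK.
    lra.
  apply: (@le_trans _ _ ((M / s + `|B|) * mg (z - z1))); last first.
    by rewrite ler_wpM2r ?mg_ge0//; lra.
  by rewrite mulrDl lerD2r -{1}(mulr1 M) -mulrA ler_wpM2l// mulrC ler_pdivlMr// mul1r.
have [Hex|Hno] := pselect (exists z2, ~ S' z2).
  have [z2 S2] := Hex; exists (k z2) => z Sz.
  have [->|zz] := eqVneq z z1; first by rewrite subrr mulr0 addr0.
  have Sz' : ~ S' z by move=> [//|] /eqP; rewrite (negbTE zz).
  rewrite (liouville_bounded lS' dk bk S2 Sz') /k divfK ?subr_eq0//.
  by rewrite addrC subrK.
(* Here z1 is the only point off S, so any slope works. *)
exists 0 => z Sz; rewrite mul0r addr0.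
have [->//|zz] := eqVneq z z1.
exfalso; apply: Hno; exists z => -[//|] /eqP; by rewrite (negbTE zz).
Qed.
End MaxMod.

(** * Lattice sums *)

Section LatticeSum.
Variable R : realType.
Local Notation C := R[i].
Local Notation pt := (int * int)%type.

Definition mx (v : pt) : nat := maxn `|v.1| `|v.2|.
Definition irange (N : nat) : seq int := [seq k%:Z - N%:Z | k <- iota 0 (2 * N).+1].
Definition box (N : nat) : seq pt := [seq (i, j) | i <- irange N, j <- irange N].

Lemma mem_irange N z : (z \in irange N) = (`|z| <= N)%N.
Proof.
apply/mapP/idP => [[k]|h]; first by rewrite mem_iota => hk ->; lia.
exists (absz (z + N%:Z)); last by move: z h => z h; lia.
by rewrite mem_iota; lia.
Qed.

Lemma mem_box N v : (v \in box N) = (mx v <= N)%N.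
Proof.
rewrite geq_max; case: v => i j /=; rewrite -!mem_irange.
apply/allpairsP/andP => [[[a b] /= [ha hb [-> ->]]]|[hi hj]]; first by [].
by exists (i, j).
Qed.

Lemma irange_uniq N : uniq (irange N).
Proof. by rewrite map_inj_uniq ?iota_uniq// => x y; lia. Qed.

Lemma box_uniq N : uniq (box N).
Proof. by apply: allpairs_uniq; rewrite ?irange_uniq// => -[a b] [c d]. Qed.

Lemma size_box N : size (box N) = ((2 * N).+1 * (2 * N).+1)%N.
Proof. by rewrite size_allpairs !size_map !size_iota. Qed.

Lemma big_box (V : nmodType) N (F : pt -> V) :
  \sum_(v <- box N) F v = \sum_(i <- irange N) \sum_(j <- irange N) F (i, j).
Proof. by rewrite /box big_allpairs. Qed.

(** With n = N + 1 the shell has 8 n points and each term is at most K / (n + 1)^3; n / (n + 1)^3 is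
    at most 1 / n - 1 / (n + 1), which telescopes over successive shells. *)
Lemma shell_bound (G : pt -> R) K N : 0 <= K ->
  (forall v, G v <= K / (mx v).+1%:R ^+ 3) ->
  \sum_(v <- box N.+1 | v \notin box N) G v <= 8 * K * ((N.+1%:R)^-1 - (N.+2%:R)^-1).
Proof.
move=> K0 HG.
have cnt : count (fun v => v \notin box N) (box N.+1) = (8 * N.+1)%N.
  have : (count (mem (box N)) (box N.+1) = size (box N))%N.
    rewrite -size_filter; apply/perm_size/uniq_perm; rewrite ?filter_uniq ?box_uniq// => v.
    by rewrite mem_filter /= !mem_box; lia.
  have := count_predC (mem (box N)) (box N.+1).
  rewrite !size_box => h1 h2; move: h1; rewrite h2.
  rewrite (eq_count (a2 := fun v => v \notin box N)) //; lia.
apply: (@le_trans _ _ (\sum_(v <- box N.+1 | v \notin box N) K / N.+2%:R ^+ 3)).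
  rewrite big_seq_cond [leRHS]big_seq_cond; apply: ler_sum => v /andP[_].
  rewrite mem_box -ltnNge => hN; apply: (le_trans (HG v)).
  rewrite ler_wpM2l// lef_pV2 ?posrE ?exprn_gt0 ?ltr0n//.
  by rewrite lerXn2r ?nnegrE ?ler0n// ler_nat.
rewrite big_const_seq iter_addr_0 cnt -[_ *+ _]mulr_natl natrM.
have p1 : 0 < N.+1%:R :> R by rewrite ltr0n.
have -> : N.+2%:R = N.+1%:R + 1 :> R by rewrite natr1.
set n := N.+1%:R in p1 *.
have -> : n^-1 - (n + 1)^-1 = (n * (n + 1))^-1 by field; lra.
rewrite [leRHS](_ : _ = 8 * n * (K * (n ^+ 2 * (n + 1))^-1)); last by field; lra.
rewrite ler_wpM2l ?mulr_ge0 ?(ltW p1)// ler_wpM2l// lef_pV2 ?posrE ?mulr_gt0 ?exprn_gt0//; try lra.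
rewrite [leRHS]exprSr ler_wpM2r//; first by lra.
by rewrite lerXn2r ?nnegrE; lra.
Qed.

Lemma annulus_bound (G : pt -> R) K N M : 0 <= K -> (N <= M)%N ->
  (forall v, G v <= K / (mx v).+1%:R ^+ 3) ->
  \sum_(v <- box M | v \notin box N) G v <= 8 * K * ((N.+1%:R)^-1 - (M.+1%:R)^-1).
Proof.
move=> K0 + HG; elim: M => [|M IH] NM.
  have -> : N = 0%N by lia.
  rewrite subrr mulr0 big_seq_cond big1 // => v /andP[h1 h2]; by rewrite h1 in h2.
have [E|ltNM] := eqVneq N M.+1.
  rewrite -E subrr mulr0 big_seq_cond big1 // => v /andP[h1 h2]; by rewrite h1 in h2.
have NM' : (N <= M)%N by lia.
rewrite (bigID (mem (box M))) /=.
apply: (@le_trans _ _ (8 * K * ((N.+1%:R)^-1 - (M.+1%:R)^-1) + 8 * K * ((M.+1%:R)^-1 - (M.+2%:R)^-1))); last first.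
  by rewrite -mulrDr addrA subrK.
apply: lerD.
  rewrite (eq_bigl (fun v => (v \in box M) && (v \notin box N))); last by move=> v; rewrite andbC.
  rewrite -big_filter_cond (perm_big (box M)); first exact: IH.
  apply: uniq_perm; rewrite ?filter_uniq ?box_uniq// => v.
  by rewrite mem_filter /= !mem_box; lia.
rewrite (eq_bigl (fun v => (v \notin box M))); first exact: shell_bound.
by move=> v; rewrite !mem_box; lia.
Qed.

Definition dec (n : nat) (F : pt -> C) (K : R) := forall v, mg (F v) <= K / (mx v).+1%:R ^+ n.

Lemma dec_ge0 n F K : dec n F K -> 0 <= K.
Proof.
move=> /(_ (0, 0)); rewrite /mx /= maxnn expr1n divr1; exact: le_trans (mg_ge0 _).
Qed.

(** The set [s] is arbitrary between two boxes: neither the finite sets of an unconditional sum nor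
    the unions of residue classes used later are boxes. *)
Lemma box_exhaust (F : pt -> C) K N M (s : seq pt) : dec 3 F K -> uniq s ->
  {subset box N <= s} -> {subset s <= box M} ->
  mg (\sum_(v <- box M) F v - \sum_(v <- s) F v) <= 8 * K / N.+1%:R.
Proof.
move=> dF us Ns sM; have K0 := dec_ge0 dF.
have NM : (N <= M)%N.
  by have := sM _ (Ns (N%:Z, 0) _); rewrite !mem_box /mx /= maxn0; apply.
rewrite (bigID (mem s)) /= -big_filter (perm_big s); last first.
  apply: uniq_perm; rewrite ?filter_uniq ?box_uniq// => v; rewrite mem_filter /=.
  by apply: andb_idr => /sM.
rewrite addrAC subrr add0r; apply: (le_trans (mg_sum _ _ _)).
apply: (@le_trans _ _ (\sum_(v <- box M | v \notin box N) mg (F v))).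
  rewrite [leRHS](bigID (fun v => v \notin s)) /=.
  rewrite -[leLHS]addr0; apply: lerD; last by apply: sumr_ge0 => v _; exact: mg_ge0.
  rewrite le_eqVlt; apply/orP; left; apply/eqP; apply: eq_bigl => v.
  by apply/idP/andP => [h|[]//]; split => //; apply: contra h; exact: Ns.
apply: (le_trans (annulus_bound K0 NM dF)).
rewrite ler_wpM2l ?mulr_ge0// gerBl invr_ge0 ler0n //.
Qed.

Lemma cauchy_rate_R (x : nat -> R) (K : R) :
  (forall N M, (N <= M)%N -> `|x M - x N| <= K / N.+1%:R) ->
  exists l : R, forall N, `|x N - l| <= K / N.+1%:R.
Proof.
move=> H.
have K0 : 0 <= K by have := H 0%N 0%N (leqnn _); rewrite divr1; exact: le_trans.
have up N M : x N - K / N.+1%:R <= x M + K / M.+1%:R.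
  have pN n : 0 <= K / n.+1%:R by rewrite divr_ge0.
  have p1 := pN N; have p2 := pN M.
  have [NM|/ltnW MN] := leqP N M.
    have := H _ _ NM; rewrite ler_norml => /andP[h1 h2].
    by move: p1 p2 h1 h2; move: (K / N.+1%:R) (K / M.+1%:R) => a b *; lra.
  have := H _ _ MN; rewrite ler_norml => /andP[h1 h2].
  by move: p1 p2 h1 h2; move: (K / N.+1%:R) (K / M.+1%:R) => a b *; lra.
pose S := [set x N - K / N.+1%:R | N in [set: nat]]%classic.
have hS : has_sup S.
  split; first by exists (x 0%N - K / 1%:R); exists 0%N.
  by exists (x 0%N + K / 1%:R) => _ [n _ <-]; exact: up.
exists (sup S) => N.
have h1 : sup S <= x N + K / N.+1%:R.
  by apply: ge_sup; [case: hS|move=> _ [n _ <-]; exact: up].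
have h2 : x N - K / N.+1%:R <= sup S by apply: ub_le_sup; [case: hS|exists N].
by move: h1 h2; move: (K / _) => a *; rewrite ler_norml; apply/andP; split; lra.
Qed.

Lemma cauchy_rate (x : nat -> C) (K : R) :
  (forall N M, (N <= M)%N -> mg (x M - x N) <= K / N.+1%:R) ->
  exists l : C, forall N, mg (x N - l) <= 2 * K / N.+1%:R.
Proof.
move=> H.
have [a aP] : exists l : R, forall N, `|complex.Re (x N) - l| <= K / N.+1%:R.
  apply: cauchy_rate_R => N M h; rewrite -raddfB; exact: le_trans (Re_mg _) (H _ _ h).
have [b bP] : exists l : R, forall N, `|complex.Im (x N) - l| <= K / N.+1%:R.
  apply: cauchy_rate_R => N M h; rewrite -raddfB; exact: le_trans (Im_mg _) (H _ _ h).
exists (a +i* b) => N; apply: (le_trans (mg_ReIm _)).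
have E : x N - (a +i* b) = (complex.Re (x N) - a) +i* (complex.Im (x N) - b) by case: (x N).
rewrite E /= -mulrA mulr_natl mulr2n; exact: lerD.
Qed.

(* Sums over Z^2 by square boxes, with a prescribed rate so that no limit has
   to be taken; terms of order |v|^-3 are summable in this sense. *)
Definition haslsum (F : pt -> C) (l : C) := exists K : R, forall N,
  mg (\sum_(v <- box N) F v - l) <= K / N.+1%:R.

Definition lsum (F : pt -> C) : C := xget 0 [set l | haslsum F l]%classic.

Lemma rate_eq0 (a K : R) : 0 <= a -> (forall N, a <= K / N.+1%:R) -> a = 0.
Proof.
move=> a0 H; apply/eqP; rewrite eq_le a0 andbT leNgt; apply/negP => ap.
have K0 : 0 <= K by have := H 0%N; rewrite divr1; lra.
have := H (Num.truncn (K / a)); rewrite ler_pdivlMr ?ltr0n// mulrC -ler_pdivlMr//.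
by rewrite leNgt truncnS_gt.
Qed.

Lemma haslsum_uniq F l l' : haslsum F l -> haslsum F l' -> l = l'.
Proof.
move=> [K HK] [K' HK']; apply/eqP; rewrite -subr_eq0 -mg_eq0; apply/eqP.
apply: (@rate_eq0 _ (K + K')); first exact: mg_ge0.
move=> N; rewrite mulrDl.
have -> : l - l' = (\sum_(v <- box N) F v - l') - (\sum_(v <- box N) F v - l) by ring.
by apply: (le_trans (mgB _ _)); rewrite [leRHS]addrC; apply: lerD.
Qed.

Lemma lsumE F l : haslsum F l -> lsum F = l.
Proof. by move=> H; apply: (haslsum_uniq _ H); rewrite /lsum; case: xgetP => [y _ //|nx]; case: (nx l). Qed.

Lemma haslsum_eq F G l : F =1 G -> haslsum F l -> haslsum G l.
Proof. by move=> /funext ->. Qed.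

Lemma haslsumD F G l l' : haslsum F l -> haslsum G l' ->
  haslsum (fun v => F v + G v) (l + l').
Proof.
move=> [K HK] [K' HK']; exists (K + K') => N; rewrite mulrDl big_split /=.
rewrite (_ : _ - _ = (\sum_(v <- box N) F v - l) + (\sum_(v <- box N) G v - l')); last by ring.
by apply: (le_trans (mgD _ _)); apply: lerD.
Qed.

Lemma haslsumZ c F l : haslsum F l -> haslsum (fun v => c * F v) (c * l).
Proof.
move=> [K HK]; exists (mg c * K) => N.
by rewrite -mulr_sumr -mulrBr mgM -mulrA ler_wpM2l ?mg_ge0.
Qed.

Lemma haslsumN F l : haslsum F l -> haslsum (fun v => - F v) (- l).
Proof. by move=> /(haslsumZ (-1)); rewrite mulN1r; under eq_fun do rewrite mulN1r. Qed.

Lemma haslsumB F G l l' : haslsum F l -> haslsum G l' ->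
  haslsum (fun v => F v - G v) (l - l').
Proof. by move=> h1 /haslsumN h2; exact: haslsumD. Qed.

Lemma haslsum_perm (h : pt -> pt) F l : involutive h -> (forall v, mx (h v) = mx v) ->
  haslsum F l -> haslsum (fun v => F (h v)) l.
Proof.
move=> hK hm [K HK]; exists K => N; have := HK N.
rewrite (_ : \sum_(v <- box N) F (h v) = \sum_(v <- box N) F v)//.
rewrite -(big_map h xpredT F); apply: perm_big; apply: uniq_perm; rewrite ?box_uniq//.
  by rewrite map_inj_uniq ?box_uniq//; exact: inv_inj.
move=> v; apply/mapP/idP => [[w hw ->]|hv]; first by rewrite mem_box hm -mem_box.
by exists (h v); rewrite ?hK// mem_box hm -mem_box.
Qed.

Lemma dec_haslsum F K : dec 3 F K -> haslsum F (lsum F).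
Proof.
move=> dF.
suff [l Hl] : exists l, haslsum F l by rewrite (lsumE Hl).
have [l lP] : exists l : C, forall N, mg (\sum_(v <- box N) F v - l) <= 2 * (8 * K) / N.+1%:R.
  apply: cauchy_rate => N M NM; apply: box_exhaust => //; first exact: box_uniq.
  by move=> v; rewrite !mem_box; lia.
by exists l, (2 * (8 * K)).
Qed.

Lemma lsum_exhaust F K N s : dec 3 F K -> uniq s -> {subset box N <= s} ->
  mg (\sum_(v <- s) F v - lsum F) <= 8 * K / N.+1%:R.
Proof.
move=> dF us Ns; have [K' HK'] := dec_haslsum dF.
pose m := \max_(v <- s) mx v.
have sm M : (m <= M)%N -> {subset s <= box M}.
  by move=> mM v vs; rewrite mem_box (leq_trans _ mM)// leq_bigmax_seq.
apply/ler_addgt0Pr => e e0.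
pose M := maxn m (Num.truncn (K' / e)).
have h1 := box_exhaust dF us Ns (sm M (leq_maxl _ _)).
have h2 := HK' M.
have h3 : K' / M.+1%:R <= e.
  rewrite ler_pdivrMr ?ltr0n// mulrC -ler_pdivrMr//.
  apply: ltW; apply: (lt_le_trans (truncnS_gt _)).
  by rewrite ler_nat ltnS leq_maxr.
rewrite mgBC in h1.
rewrite -[_ - lsum F](subrK (\sum_(v <- box M) F v)).
have -> : \sum_(v <- s) F v - lsum F - \sum_(v <- box M) F v + \sum_(v <- box M) F v =
  (\sum_(v <- s) F v - \sum_(v <- box M) F v) + (\sum_(v <- box M) F v - lsum F) by ring.
apply: (le_trans (mgD _ _)); apply: lerD => //; exact: le_trans h3.
Qed.

Lemma lsum_box F K N : dec 3 F K -> mg (\sum_(v <- box N) F v - lsum F) <= 8 * K / N.+1%:R.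
Proof. by move=> dF; apply: lsum_exhaust => //; exact: box_uniq. Qed.

Lemma lsum_bound F K : dec 3 F K -> mg (lsum F) <= 9 * K.
Proof.
move=> dF; have := lsum_box 0 dF; rewrite divr1.
have -> : \sum_(v <- box 0) F v = F (0, 0).
  have -> : box 0 = [:: (0, 0)] by [].
  by rewrite big_seq1.
have := dF (0, 0); rewrite /mx /= maxnn expr1n divr1 => h1 h2.
have := mgBr (lsum F) (F (0, 0)); rewrite mgBC; lra.
Qed.

Lemma tele_iota (g : nat -> C) m : \sum_(k <- iota 0 m) (g k - g k.+1) = g 0%N - g m.
Proof.
elim: m => [|m IH]; first by rewrite big_nil subrr.
by rewrite -addn1 iotaD big_cat /= IH big_seq1 add0n addn1; ring.
Qed.

Lemma tele_irange (g : int -> C) N :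
  \sum_(i <- irange N) (g (i - 1) - g i) = g (- N%:Z - 1) - g N%:Z.
Proof.
rewrite big_map; pose f k := g (k%:Z - N%:Z - 1).
rewrite (eq_bigr (fun k => f k - f k.+1)); last first.
  by move=> k _; rewrite /f; congr (_ - g _); lia.
by rewrite tele_iota /f; congr (g _ - g _); lia.
Qed.

Lemma edge_bound (G1 G2 : int -> C) K N :
  (forall j, mg (G1 j) <= K / N.+1%:R ^+ 2) -> (forall j, mg (G2 j) <= K / N.+1%:R ^+ 2) ->
  mg (\sum_(j <- irange N) (G1 j - G2 j)) <= 4 * K / N.+1%:R.
Proof.
move=> h1 h2; apply: (le_trans (mg_sum _ _ _)).
apply: (@le_trans _ _ (\sum_(j <- irange N) 2 * (K / N.+1%:R ^+ 2))).
  apply: ler_sum => j _; by apply: (le_trans (mgB _ _)); rewrite mulr_natl mulr2n; apply: lerD.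
have K0 : 0 <= K / N.+1%:R ^+ 2 by exact: le_trans (mg_ge0 _) (h1 0).
rewrite big_const_seq iter_addr_0 count_predT size_map size_iota -[_ *+ _]mulr_natl.
have p : 0 < N.+1%:R :> R by rewrite ltr0n.
have -> : 4 * K / N.+1%:R = (2 * N.+1%:R) * (2 * (K / N.+1%:R ^+ 2)) by field; lra.
by apply: ler_wpM2r; [exact: mulr_ge0|rewrite -!natr1 natrM; lra].
Qed.

(** The box sums telescope to two edges of 2 N + 1 terms of order N^-2. Order 2 is too weak to sum G
    itself, but such terms occur as corrections when a lattice sum is translated. *)
Lemma haslsum_step1 G K : dec 2 G K -> haslsum (fun v => G (v.1 - 1, v.2) - G v) 0.
Proof.
move=> dG; have K0 := dec_ge0 dG.
exists (4 * K) => N; rewrite subr0 big_box exchange_big /=.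
rewrite (eq_bigr (fun j => G (- N%:Z - 1, j) - G (N%:Z, j))); last first.
  by move=> j _; rewrite (tele_irange (fun i => G (i, j))).
have le (v : pt) : (N <= mx v)%N -> mg (G v) <= K / N.+1%:R ^+ 2.
  move=> h; apply: (le_trans (dG v)); rewrite ler_wpM2l// lef_pV2 ?posrE ?exprn_gt0 ?ltr0n//.
  by rewrite lerXn2r ?nnegrE ?ler0n// ler_nat.
by apply: edge_bound => j; apply: le; rewrite /mx /=; lia.
Qed.

Lemma haslsum_step2 G K : dec 2 G K -> haslsum (fun v => G (v.1, v.2 - 1) - G v) 0.
Proof.
move=> dG.
have dG' : dec 2 (fun v => G (v.2, v.1)) K.
  by move=> v; have := dG (v.2, v.1); rewrite /mx /= maxnC.
have := haslsum_step1 dG' => /(@haslsum_perm (fun v => (v.2, v.1)) _ _ _) h.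
apply: haslsum_eq (h _ _) => /=; first by case.
- by case.
- by move=> v; rewrite /mx /= maxnC.
Qed.
End LatticeSum.

(** * Symbol estimates with a lattice weight *)

Section SymbolClass.
Variable R : realType.
Local Notation C := R[i].
Variables (I : Type) (rho : I -> R) (U : I -> C -> Prop) (D : C -> Prop) (drop : int).
Hypothesis rho1 : forall i, 1 <= rho i.
Hypothesis drop0 : 0 <= drop.
Implicit Types F G : I -> C -> C.

(* [sym k d F]: the derivatives of [F i] up to order [k] are O(rho i ^ (d - j * drop)),
   as for a symbol of degree [d]; the weight [rho] is the size of a lattice index. *)
Definition sym0 (d : int) F := exists K : R, forall i y, U i y -> mg (F i y) <= K * rho i ^ d.

Fixpoint sym (k : nat) (d : int) F : Prop :=
  sym0 d F /\ if k is k'.+1 then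
    exists F', (forall i y, U i y -> dv D (F i) y (F' i y)) /\ sym k' (d - drop) F'
  else True.

Let rho_gt0 i : 0 < rho i. Proof. exact: lt_le_trans (rho1 i). Qed.
Let rho_neq0 i : rho i != 0. Proof. by rewrite gt_eqF. Qed.
Let rhoX_gt0 i d : 0 < rho i ^ d. Proof. exact: exprz_gt0. Qed.

Lemma sym0P d F : sym0 d F -> exists K, 0 <= K /\ forall i y, U i y -> mg (F i y) <= K * rho i ^ d.
Proof.
move=> [K HK]; exists `|K|; split => // i y /HK /le_trans; apply.
by rewrite ler_pM2r// ler_norm.
Qed.

Lemma sym_sym0 k d F : sym k d F -> sym0 d F. Proof. by case: k => [|k] []. Qed.

Lemma rho_le (d e : int) i : d <= e -> rho i ^ d <= rho i ^ e.
Proof.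
move=> de; rewrite -(subrK d e) expfzDr// ler_peMl ?(ltW (rhoX_gt0 _ _))//.
have : 0 <= e - d by rewrite subr_ge0.
by case: (e - d) => // n _; rewrite exprn_ege1.
Qed.

Lemma sym0_weak d e F : d <= e -> sym0 d F -> sym0 e F.
Proof.
move=> de /sym0P[K [K0 HK]]; exists K => i y /HK /le_trans; apply.
by rewrite ler_wpM2l// rho_le.
Qed.

Lemma sym_weak k d e F : d <= e -> sym k d F -> sym k e F.
Proof.
elim: k d e F => [|k IH] d e F de [h0 h1]; split => //; try exact: sym0_weak h0.
by have [F' [dF sF]] := h1; exists F'; split => //; apply: IH sF; rewrite lerD2r.
Qed.

Lemma symW k d F : sym k.+1 d F -> sym k d F.
Proof.
elim: k d F => [|k IH] d F [h0 [F' [dF sF]]]; split => //.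
by exists F'; split => //; exact: IH.
Qed.

Lemma sym_ext k d F G : (forall i, F i =1 G i) -> sym k d F -> sym k d G.
Proof. by move=> E; have -> : G = F by apply/funext => i; apply/funext => y; rewrite E. Qed.

Lemma sym0D d F G : sym0 d F -> sym0 d G -> sym0 d (fun i y => F i y + G i y).
Proof.
move=> [K HK] [L HL]; exists (K + L) => i y Uy; rewrite mulrDl.
by apply: (le_trans (mgD _ _)); apply: lerD; [exact: HK|exact: HL].
Qed.

Lemma symD k d F G : sym k d F -> sym k d G -> sym k d (fun i y => F i y + G i y).
Proof.
elim: k d F G => [|k IH] d F G [f0 f1] [g0 g1]; split => //; try exact: sym0D.
have [F' [dF sF]] := f1; have [G' [dG sG]] := g1.
exists (fun i y => F' i y + G' i y); split; last exact: IH.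
by move=> i y Uy; apply: dvD; [exact: dF|exact: dG].
Qed.

Lemma sym0M d e F G : sym0 d F -> sym0 e G -> sym0 (d + e) (fun i y => F i y * G i y).
Proof.
move=> [K HK] [L HL]; exists (K * L) => i y Uy.
rewrite mgM expfzDr// mulrACA.
by apply: ler_pM; rewrite ?mg_ge0//; [exact: HK|exact: HL].
Qed.

Lemma symM k d e F G : sym k d F -> sym k e G -> sym k (d + e) (fun i y => F i y * G i y).
Proof.
elim: k d e F G => [|k IH] d e F G sF sG.
  by split => //; apply: sym0M; [case: sF|case: sG].
have sF' := symW sF; have sG' := symW sG.
move: sF sG => [f0 [F' [dF hF]]] [g0 [G' [dG hG]]].
split; first exact: sym0M.
exists (fun i y => F' i y * G i y + F i y * G' i y); split.
  by move=> i y Uy; apply: dvM; [exact: dF|exact: dG].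
apply: symD.
  by have := IH _ _ _ _ hF sG'; rewrite addrAC.
by have := IH _ _ _ _ sF' hG; rewrite addrA.
Qed.

Lemma sym_zero k d : sym k d (fun _ _ => 0).
Proof.
elim: k d => [|k IH] d; split => //; try by exists 0 => i y _; rewrite mg0 mul0r.
exists (fun _ _ => 0); split => //; by move=> i y _; exact: dv_cst.
Qed.

Lemma sym_cst k d (c : I -> C) K : (forall i, mg (c i) <= K * rho i ^ d) -> sym k d (fun i _ => c i).
Proof.
move=> H; case: k => [|k]; split => //; try by exists K => i y _.
exists (fun _ _ => 0); split; last exact: sym_zero.
by move=> i y _; exact: dv_cst.
Qed.

Lemma sym_scal k d (c : C) F : sym k d F -> sym k d (fun i y => c * F i y).
Proof.
move=> sF; rewrite -[d]add0r; apply: symM sF; apply: (@sym_cst _ _ _ (mg c)) => i.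
by rewrite expr0z mulr1.
Qed.

Lemma symN k d F : sym k d F -> sym k d (fun i y => - F i y).
Proof. by move=> /(sym_scal (-1)); apply: sym_ext => i y; rewrite mulN1r. Qed.

Lemma symB k d F G : sym k d F -> sym k d G -> sym k d (fun i y => F i y - G i y).
Proof. by move=> sF /symN sG; exact: symD. Qed.

Lemma symX k d F n : sym k d F -> sym k (d * n%:Z) (fun i y => F i y ^+ n).
Proof.
move=> sF; elim: n => [|n IH].
  rewrite mulr0; apply: (@sym_cst _ _ (fun=> 1) 1) => i; by rewrite mg1 expr0z mulr1.
have -> : d * n.+1%:Z = d + d * n%:Z by rewrite -{2}[d]mulr1 -mulrDr -intS.
by apply: sym_ext (symM sF IH) => i y; rewrite exprS.
Qed.

(** The basic symbol. With [drop = 0] the variable is z or t and derivatives keep their order; with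
    [drop = 1] it runs along a segment of the lattice and each derivative gains a power of the
    weight. *)
Lemma sym_lin k d (a b : I -> C) K B : (forall i, mg (a i) <= K * rho i ^ d) ->
  (forall i, mg (b i) <= K * rho i ^ (d - drop)) -> (forall i y, U i y -> mg y <= B) ->
  sym k d (fun i y => a i + b i * y).
Proof.
move=> ha hb hB; case: k => [|k]; split => //;
  try (exists (K + K * `|B|) => i y Uy; apply: (le_trans (mgD _ _)); rewrite mgM mulrDl;
    apply: lerD => //; rewrite mulrAC; apply: ler_pM; rewrite ?mg_ge0//;
    [apply: (le_trans (hb i)); apply: ler_wpM2l; [|apply: rho_le; rewrite gerBl//] |
     exact: le_trans (hB _ _ Uy) (ler_norm _)];
    by have := le_trans (mg_ge0 _) (ha i); rewrite pmulr_lge0).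
exists (fun i _ => b i); split; last exact: (@sym_cst _ _ _ K).
move=> i y _; exact: dv_lin.
Qed.

(* The alternative [A i = 0] accommodates the junk value [0^-1 = 0]. *)
Lemma sym_inv k d F (c : R) : 0 < c ->
  (forall i, (forall y, F i y = 0) \/ (forall y, U i y -> c * rho i ^ d <= mg (F i y))) ->
  sym k d F -> sym k (- d) (fun i y => (F i y)^-1).
Proof.
move=> c0 Hlow.
have h0 : sym0 (- d) (fun i y => (F i y)^-1).
  exists c^-1 => i y Uy; have [->|H] := Hlow i.
    by rewrite invr0 mg0 mulr_ge0 ?invr_ge0 ?(ltW c0)// ltW.
  have h := H y Uy; have p : 0 < c * rho i ^ d by rewrite mulr_gt0.
  by rewrite mgV -invr_expz -invfM lef_pV2 ?posrE// (lt_le_trans p).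
elim: k d F Hlow h0 => [|k IH] d F Hlow h0 sF; split => //.
have sF' := symW sF; have [_ [F' [dF hF]]] := sF.
have sV := IH d F Hlow h0 sF'.
exists (fun i y => - F' i y * ((F i y)^-1 * (F i y)^-1)); split; last first.
  apply: sym_weak (symM (symN hF) (symM sV sV)).
  by rewrite le_eqVlt; apply/orP; left; apply/eqP; ring.
move=> i y Uy; have [E|H] := Hlow i.
  rewrite E invr0 mulr0 mulr0; apply: dv_ext (dv_cst _ 0 y) => x; by rewrite E invr0.
rewrite -invfM -expr2; apply: dvV; first exact: dF.
by rewrite -mg_gt0; apply: lt_le_trans (H y Uy); rewrite mulr_gt0.
Qed.
End SymbolClass.

Section ThirdDifference.
Variable R : realType.
Local Notation C := R[i].
Variables (I : Type) (rho : I -> R) (P : I -> Prop).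
Hypothesis rho1 : forall i, 1 <= rho i.

Definition seg07 (i : I) (y : C) := P i /\ exists2 t : R, y = t%:C & 0 <= t <= 7.

(* The coefficients of - (1 - X) (1 - X^2) (1 - X^4); up to X^7 - 1, those are
   the values of the character on the classes 0, ..., 6. *)
Definition wt (j : nat) : R := nth 0 [:: -1; 1; 1; -1; 1; -1; -1; 1] j.

Definition tdiff (f : C -> C) : C := \sum_(j < 8) (wt j)%:C * f j%:R.

Lemma tdiffE f : tdiff f = (f 4 - f 5 - f 6 + f 7) - (f 0 - f 1 - f 2 + f 3).
Proof.
rewrite /tdiff !big_ord_recl big_ord0 /wt /= !rmorphN !rmorph1 /=.
rewrite /bump /= !addn0 !add1n.
ring.
Qed.

Lemma diff_bound (f f' : C -> C) (a h : R) K :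
  0 <= h -> (forall t : R, a <= t <= a + h -> dv (@reD R) f t%:C (f' t%:C) /\ mg (f' t%:C) <= K) ->
  mg (f (a + h)%:C - f a%:C) <= K * h.
Proof.
move=> h0 H; rewrite rmorphD /=.
apply: le_trans (@dv_mvt R (@reD R) f f' a%:C h%:C K _ _) _.
- by move=> t; rewrite /reD -rmorphM.
- move=> t /andP[t0 t1]; rewrite -rmorphM -rmorphD; apply: H.
  by rewrite lerDl mulr_ge0//= lerD2l ler_piMl.
- by rewrite mgR ger0_norm.
Qed.

Lemma dv_shift D (f : C -> C) z c d : dv D f (z + c) d -> dv D (fun x => f (x + c)) z d.
Proof.
move=> H e /H; apply: near0W => h _; by rewrite [z + c + h]addrAC.
Qed.

(** The weights compose differences of steps 1, 2 and 4. Three mean value inequalities bound the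
    result by the third derivative times 1 * 2 * 4 = 8, a gain of three powers of [rho]. *)
Lemma sym_tdiff d F : sym rho seg07 (@reD R) 1 3 d F ->
  exists K, forall i, P i -> mg (tdiff (F i)) <= K * rho i ^ (d - 3).
Proof.
move=> [_ [F1 [d1 [_ [F2 [d2 [_ [F3 [d3 [[K HK] _]]]]]]]]]].
exists (8 * K) => i Pi.
set M := K * rho i ^ (d - 3).
have hU (t : R) : 0 <= t <= 7 -> seg07 i t%:C by move=> h; split => //; exists t.
have b3 (t : R) : 0 <= t <= 7 -> mg (F3 i t%:C) <= M.
  by move=> /hU /HK; rewrite (_ : d - 1 - 1 - 1 = d - 3)//; ring.
have b2 (t h : R) : 0 <= t -> 0 <= h -> t + h <= 7 -> mg (F2 i (t + h)%:C - F2 i t%:C) <= M * h.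
  move=> t0 h0 th; apply: diff_bound => // u /andP[u1 u2].
  have hu : 0 <= u <= 7 by rewrite (le_trans t0 u1) (le_trans u2 th).
  by split; [exact/d3/hU|exact: b3].
have one : (1 : C) = (1 : R)%:C by rewrite rmorph1.
have natC n : n%:R = (n%:R : R)%:C :> C by rewrite rmorph_nat.
have b1 (t : R) : 0 <= t -> t + 3 <= 7 ->
    mg ((F1 i (t + 2)%:C - F1 i (t + 3)%:C) - (F1 i t%:C - F1 i (t + 1)%:C)) <= 2 * M.
  move=> t0 t3.
  have := @diff_bound (fun x => F1 i x - F1 i (x + 1)) (fun x => F2 i x - F2 i (x + 1)) t 2 M ltac:(lra) _.
  rewrite one -!rmorphD (_ : t + 2 + 1 = t + 3); last by ring.
  rewrite mulrC; apply => u /andP[u1 u2].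
  have hu : 0 <= u <= 7 by apply/andP; split; lra.
  have hu1 : 0 <= u + 1 <= 7 by apply/andP; split; lra.
  split; last first.
    rewrite mgBC -rmorphD; have := b2 u 1 ltac:(lra) ltac:(lra) ltac:(lra); lra.
  apply: dvB; first exact/d2/hU.
  by apply: dv_shift; rewrite -rmorphD; exact/d2/hU.
have := @diff_bound (fun x => F i x - F i (x + 1) - F i (x + 2) + F i (x + 3))
  (fun x => F1 i x - F1 i (x + 1) - F1 i (x + 2) + F1 i (x + 3)) 0 4 (2 * M) ltac:(lra) _.
rewrite (_ : 2 * M * 4 = 8 * K * rho i ^ (d - 3)); last by rewrite /M; ring.
rewrite tdiffE !add0r (_ : (4 : R)%:C = 4); last by rewrite rmorph_nat.
have [e5 e6 e7] : [/\ 4 + 1 = 5 :> C, 4 + 2 = 6 :> C & 4 + 3 = 7 :> C] by split; ring.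
rewrite !rmorph0 e5 e6 e7.
apply => t /andP[t0 t4].
have ht s : 0 <= s -> s <= 3 -> 0 <= t + s <= 7 by move=> *; apply/andP; split; lra.
split; last first.
  have := b1 t ltac:(lra) ltac:(lra); rewrite one (natC 2%N) (natC 3%N) -!rmorphD mgBC.
  apply: le_trans; rewrite le_eqVlt; apply/orP; left; apply/eqP; congr mg; ring.
have sh (s : nat) : (s <= 3)%N -> dv (@reD R) (fun x => F i (x + s%:R)) t%:C (F1 i (t%:C + s%:R)).
  move=> s3; apply: dv_shift; rewrite natC -rmorphD; apply/d1/hU/ht => //.
  by rewrite ler_nat.
apply: dvD (sh 3%N _) => //; apply: dvB (sh 2%N _) => //; apply: dvB (sh 1%N _) => //.
apply/d1/hU; apply/andP; split; lra.
Qed.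
End ThirdDifference.

Section SeriesDerivative.
Variable R : realType.
Local Notation C := R[i].
Local Notation pt := (int * int)%type.

Definition wgt (v : pt) : R := (mx v).+1%:R.

Lemma wgt_ge1 v : 1 <= wgt v. Proof. by rewrite /wgt ler1n. Qed.

Lemma sym0_dec U F n : sym0 wgt U (- n%:Z) F -> exists K, forall y, (forall v, U v y) -> dec n (fun v => F v y) K.
Proof.
move=> [K HK]; exists K => y Uy v; have := HK v y (Uy v).
by rewrite -exprnN /wgt.
Qed.

(** Termwise differentiation: the second derivatives are summable uniformly on [V], so the Taylor
    remainders add up to O(|h|^2). *)
Lemma lsum_dv (D : C -> Prop) (V : C -> Prop) (y0 : C) (F F' : pt -> C -> C) :
  (forall (t : R) h, D h -> D (t%:C * h)) ->
  (exists2 r, 0 < r & forall h, mg h < r -> V (y0 + h)) ->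
  (forall v y, V y -> dv D (F v) y (F' v y)) ->
  sym0 wgt (fun=> V) (-3) F -> sym wgt (fun=> V) D 0 1 (-3) F' ->
  dv D (fun y => lsum (F^~ y)) y0 (lsum (F'^~ y0)).
Proof.
move=> hD [r r0 rV] dF sF [s1 [F2 [d2 [s2 _]]]] e e0.
have [K0 h0] := @sym0_dec (fun=> V) F 3 sF.
have [K1 h1] := @sym0_dec (fun=> V) F' 3 s1.
rewrite subr0 in s2; have [K2 h2] := @sym0_dec (fun=> V) F2 3 s2.
have Vy : V y0 by have := rV 0; rewrite addr0 mg0; apply.
have K20 : 0 <= K2 by exact: dec_ge0 (h2 _ (fun=> Vy)).
have q : 0 < e / (9 * K2 + 1) by rewrite divr_gt0//; lra.
exists (Num.min r (e / (9 * K2 + 1))); first by rewrite lt_min r0.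
move=> h Dh; rewrite lt_min => /andP[hr he].
have Vh := rV h hr.
have S1 := dec_haslsum (h0 _ (fun=> Vh)); have S2 := dec_haslsum (h0 _ (fun=> Vy)).
have S3 := haslsumZ h (dec_haslsum (h1 _ (fun=> Vy))).
have S4 := haslsumB (haslsumB S1 S2) S3.
rewrite -(lsumE S4).
have dd : dec 3 (fun v => F v (y0 + h) - F v y0 - h * F' v y0) (K2 * mg h ^+ 2).
  move=> v; rewrite mulrAC; apply: (@dv_taylor R D (F v) (F' v) (F2 v)) => [t|t /andP[t0 t1]].
    exact: hD.
  have Vt : V (y0 + t%:C * h).
    by apply: rV; rewrite mgM mgR ger0_norm//; apply: le_lt_trans hr; rewrite ler_piMl ?mg_ge0.
  by split; [exact: dF|exact: d2|exact: h2].
apply: (le_trans (lsum_bound dd)).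
rewrite expr2 !mulrA ler_wpM2r ?mg_ge0//.
have : mg h * (9 * K2 + 1) <= e by rewrite -ler_pdivlMr ?ltW//; lra.
have := mg_ge0 h; lra.
Qed.
End SeriesDerivative.

(** * Elliptic functions of the lattice T_t M *)

Section Lattice.
Variable R : realType.
Local Notation C := R[i].
Local Notation pt := (int * int)%type.
Local Notation Re := (@complex.Re R).
Local Notation Im := (@complex.Im R).
Implicit Types (t x z : C) (v : pt).

Definition s7 : R := Num.sqrt 7.
(* A basis of the lattice M = sqrt (-7) O. *)
Definition om : C := (- (7 / 2)) +i* (s7 / 2).
Definition omb : C := (- (7 / 2)) -i* (s7 / 2).

Lemma s7_sq : s7 ^+ 2 = 7. Proof. by rewrite sqr_sqrtr. Qed.
Lemma s7_gt0 : 0 < s7. Proof. by rewrite sqrtr_gt0. Qed.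

Lemma conj_om : conjc om = omb. Proof. by []. Qed.
Lemma conj_omb : conjc omb = om. Proof. by rewrite -conj_om conjcK. Qed.

Lemma om_sum : om + omb = - 7.
Proof.
rewrite (_ : -7 = (-7 : R)%:C); last by rewrite rmorphN rmorph_nat.
by apply/eqP; rewrite eq_complex /=; apply/andP; split; apply/eqP; field.
Qed.

Lemma om_prod : om * omb = 14.
Proof.
rewrite (_ : 14 = (14 : R)%:C); last by rewrite rmorph_nat.
apply/eqP; rewrite eq_complex /=; apply/andP; split; apply/eqP; last by field.
have := s7_sq; set s := s7 => h.
by rewrite (_ : _ - _ = 49 / 4 + s ^+ 2 / 4); [rewrite h; field|field].
Qed.

Lemma om_neq : om != omb.
Proof.
rewrite eq_complex /= eqxx /=; have := s7_gt0; lra.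
Qed.

Definition pp v : C := v.1%:~R * om + v.2%:~R * omb.

Lemma intC (n : int) : n%:~R = (n%:~R : R)%:C :> C. Proof. by rewrite rmorph_int. Qed.

Lemma pp0 : pp (0, 0) = 0. Proof. by rewrite /pp /= !mul0r addr0. Qed.
Lemma ppD v v' : pp (v.1 + v'.1, v.2 + v'.2) = pp v + pp v'.
Proof. by rewrite /pp /= !rmorphD /=; ring. Qed.
Lemma ppN v : pp (- v.1, - v.2) = - pp v.
Proof. by rewrite /pp /= !rmorphN /=; ring. Qed.

Lemma ppE v : pp v = (- (7 / 2) * (v.1%:~R + v.2%:~R)) +i* (s7 / 2 * (v.1%:~R - v.2%:~R)).
Proof.
by rewrite /pp !intC; apply/eqP; rewrite eq_complex /=; apply/andP; split; apply/eqP; ring.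
Qed.

Lemma mx_ge v : `|v.1%:~R| <= (mx v)%:R :> R /\ `|v.2%:~R| <= (mx v)%:R :> R.
Proof.
by split; rewrite -intr_norm -natr_absz ler_nat /mx leq_max leqnn ?orbT.
Qed.

Lemma mx_cases v : (mx v)%:R = `|v.1%:~R| :> R \/ (mx v)%:R = `|v.2%:~R| :> R.
Proof.
rewrite /mx; case: (leqP `|v.1|%N `|v.2|%N) => _; [right|left]; by rewrite -intr_norm -natr_absz.
Qed.

Lemma mx_pp v : (mx v)%:R <= mg (pp v) :> R.
Proof.
rewrite /mg -[leLHS]ger0_norm// -sqrtr_sqr; apply: ler_wsqrtr.
rewrite ppE /=; set a : R := v.1%:~R; set b : R := v.2%:~R.
rewrite (_ : (s7 / 2 * (a - b)) ^+ 2 = s7 ^+ 2 / 4 * (a - b) ^+ 2); last by field.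
rewrite s7_sq.
have a2 := sqr_ge0 a; have b2 := sqr_ge0 b; have ab2 := sqr_ge0 (a + b).
have -> : (- (7 / 2) * (a + b)) ^+ 2 + 7 / 4 * (a - b) ^+ 2 =
  7 / 2 * (a ^+ 2 + b ^+ 2) + 42 / 4 * (a + b) ^+ 2 by field.
by case: (mx_cases v) => ->; rewrite real_normK ?num_real// -/a -/b; lra.
Qed.

Lemma mg_om : mg om <= 4 /\ mg omb <= 4.
Proof.
have h : mg om <= 4.
  rewrite /mg /= sqrrN !expr_div_n s7_sq (_ : 7 ^+ 2 / 2 ^+ 2 + 7 / 2 ^+ 2 = 14); last by field.
  by rewrite -[leRHS]ger0_norm// -sqrtr_sqr; apply: ler_wsqrtr; lra.
by split=> //; rewrite -conj_om mg_conj.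
Qed.

Lemma pp_mx v : mg (pp v) <= 8 * (mx v)%:R.
Proof.
have [h1 h2] := mg_om; have [a1 a2] := mx_ge v.
apply: (le_trans (mgD _ _)); rewrite !mgM !intC !mgR.
have b1 : `|v.1%:~R| * mg om <= (mx v)%:R * 4 by apply: ler_pM; rewrite ?mg_ge0.
have b2 : `|v.2%:~R| * mg omb <= (mx v)%:R * 4 by apply: ler_pM; rewrite ?mg_ge0.
lra.
Qed.

Lemma pp_inj : injective pp.
Proof.
move=> v v' E.
have : (mx (v.1 - v'.1, v.2 - v'.2))%:R <= (0 : R).
  have := mx_pp (v.1 - v'.1, v.2 - v'.2).
  have -> : pp (v.1 - v'.1, v.2 - v'.2) = pp v - pp v'.
    by rewrite (ppD v (- v'.1, - v'.2)) ppN.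
  by rewrite E subrr mg0.
by rewrite lern0 /mx /=; case: v v' {E} => a b [a' b'] /=; move=> h; congr pair; lia.
Qed.

(* For |t| <= 1/2, T_t is a real-linear isomorphism; the elliptic functions
   below are those of the lattice T_t M. *)
Definition T t x : C := conjc x - t * x.
Definition w t v : C := T t (pp v).

Lemma TD t x y : T t (x + y) = T t x + T t y. Proof. by rewrite /T rmorphD /=; ring. Qed.
Lemma TN t x : T t (- x) = - T t x. Proof. by rewrite /T rmorphN /=; ring. Qed.
Lemma TB t x y : T t (x - y) = T t x - T t y. Proof. by rewrite TD TN. Qed.
Lemma T0 t : T t 0 = 0. Proof. by rewrite /T rmorph0 mulr0 subrr. Qed.

Lemma T_ge t x : mg t <= 1 / 2 -> mg x / 2 <= mg (T t x).
Proof.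
move=> ht; rewrite /T; have := mgBr (conjc x) (t * x); rewrite mg_conj mgM.
have := mg_ge0 x; have : mg t * mg x <= 1 / 2 * mg x by rewrite ler_wpM2r ?mg_ge0.
lra.
Qed.

Lemma T_le t x : mg t <= 1 / 2 -> mg (T t x) <= 2 * mg x.
Proof.
move=> ht; rewrite /T; apply: (le_trans (mgB _ _)); rewrite mg_conj mgM.
have := mg_ge0 x; have : mg t * mg x <= 1 / 2 * mg x by rewrite ler_wpM2r ?mg_ge0.
lra.
Qed.

(** The inverse of T_t, from z = conj x - t x and the conjugate equation. *)
Definition Ti t z : C := (conjc z + conjc t * z) / (1 - t * conjc t).

Lemma TiK t z : mg t <= 1 / 2 -> T t (Ti t z) = z.
Proof.
move=> ht.
have nz : 1 - t * conjc t != 0.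
  rewrite -mg_gt0; have := mgBr 1 (t * conjc t); rewrite mg1 mgM mg_conj.
  have : mg t * mg t <= 1 / 2 * (1 / 2) by apply: ler_pM; rewrite ?mg_ge0.
  lra.
have E : conjc (1 - t * conjc t) = 1 - t * conjc t by rewrite rmorphB rmorphM rmorph1 /= conjcK mulrC.
have E4 : conjc (Ti t z) = (z + t * conjc z) / (1 - t * conjc t).
  rewrite /Ti [LHS]rmorphM; congr (_ * _); last by rewrite [LHS]conjc_inv E.
  by rewrite rmorphD rmorphM /= !conjcK.
by rewrite /T E4 /Ti; field.
Qed.

Lemma T_eq0 t x : mg t <= 1 / 2 -> (T t x == 0) = (x == 0).
Proof.
move=> ht; rewrite -!mg_eq0; apply/eqP/eqP => [E|/eqP].
  by apply/eqP; rewrite eq_le mg_ge0 andbT; have := T_ge x ht; rewrite E; lra.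
by rewrite mg_eq0 => /eqP ->; rewrite T0 mg0.
Qed.

Lemma T_inj t x y : mg t <= 1 / 2 -> T t x = T t y -> x = y.
Proof. by move=> ht E; apply/eqP; rewrite -subr_eq0 -(T_eq0 _ ht) TB E subrr. Qed.

Lemma wD t v v' : w t (v.1 + v'.1, v.2 + v'.2) = w t v + w t v'.
Proof. by rewrite /w ppD TD. Qed.
Lemma wN t v : w t (- v.1, - v.2) = - w t v.
Proof. by rewrite /w ppN TN. Qed.
Lemma w0 t : w t (0, 0) = 0. Proof. by rewrite /w pp0 T0. Qed.

Lemma w_ge t v : mg t <= 1 / 2 -> (mx v)%:R / 2 <= mg (w t v).
Proof. by move=> ht; have := T_ge (pp v) ht; have := mx_pp v; rewrite /w; lra. Qed.

Lemma w_le t v : mg t <= 1 / 2 -> mg (w t v) <= 16 * (mx v)%:R.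
Proof. by move=> ht; have := T_le (pp v) ht; have := pp_mx v; rewrite /w; lra. Qed.

Lemma mx_eq0 v : mx v = 0%N -> v = (0, 0).
Proof. by case: v => a b; rewrite /mx /= => h; congr pair; lia. Qed.

Lemma wgtE v : wgt R v = (mx v)%:R + 1. Proof. by rewrite /wgt natr1. Qed.

Lemma w_ge' t v : mg t <= 1 / 2 -> v != (0, 0) -> wgt R v / 4 <= mg (w t v).
Proof.
move=> ht v0; have := w_ge v ht; rewrite wgtE.
have : 1 <= (mx v)%:R :> R.
  by rewrite ler1n lt0n; apply: contraNneq v0 => /mx_eq0 ->.
lra.
Qed.

Lemma w_neq0 t v : mg t <= 1 / 2 -> v != (0, 0) -> w t v != 0.
Proof.
move=> ht v0; rewrite -mg_gt0; apply: lt_le_trans (w_ge' ht v0).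
by rewrite wgtE; have : 0 <= (mx v)%:R :> R by []; lra.
Qed.

Definition inM x := exists v, x = pp v.
Definition inL t z := exists v, z = w t v.

(** For large v the size of [pp v] dominates x; for the finitely many others the distance is
    positive. *)
Lemma dist_M x : ~ inM x -> exists2 c : R, 0 < c & forall v, c * wgt R v <= mg (x - pp v).
Proof.
move=> xM.
pose N := (Num.truncn (2 * mg x + 1)).+1.
have [r r0 rP] := finite_sep [seq pp v | v <- box N] x.
have N0 : 0 < (N.+1)%:R :> R by rewrite ltr0n.
exists (Num.min (1 / 4) (r / N.+1%:R)); first by rewrite lt_min divr_gt0// divr_gt0.
move=> v; have wp : 0 <= wgt R v by have := wgt_ge1 R v; lra.
have [vN|vN] := leqP (mx v) N.
  apply: (@le_trans _ _ (r / N.+1%:R * wgt R v)).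
    by rewrite ler_wpM2r// ge_min lexx orbT.
  rewrite mulrAC ler_pdivrMr//.
  apply: (@le_trans _ _ (r * N.+1%:R)); first by rewrite ler_pM2l// ler_nat ltnS.
  rewrite ler_pM2r// mgBC; apply: rP; first by apply: map_f; rewrite mem_box.
  by apply/eqP => E; apply: xM; exists v.
apply: (@le_trans _ _ (1 / 4 * wgt R v)).
  by rewrite ler_wpM2r// ge_min lexx.
have h1 : 2 * mg x + 1 < (mx v)%:R.
  by apply: (lt_trans (truncnS_gt _)); rewrite ltr_nat.
have := mgBr (pp v) x; rewrite mgBC; have := mx_pp v; have := mg_ge0 x; rewrite wgtE; lra.
Qed.

Lemma inL_T t x : mg t <= 1 / 2 -> inL t (T t x) <-> inM x.
Proof.
by move=> ht; split => -[v E]; exists v; [exact: T_inj E|rewrite /w -E].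
Qed.

Lemma dist_L t z : mg t <= 1 / 2 -> ~ inL t z -> exists2 c : R, 0 < c & forall v, c * wgt R v <= mg (z - w t v).
Proof.
move=> ht; rewrite -(TiK z ht) inL_T// => /dist_M[c c0 cP].
exists (c / 2); first by lra.
by move=> v; rewrite -TB; have := T_ge (Ti t z - pp v) ht; have := cP v; lra.
Qed.

Lemma inL_shift t z v : inL t (z + w t v) <-> inL t z.
Proof.
split=> -[v' E].
  exists (v'.1 - v.1, v'.2 - v.2); rewrite (wD t v' (- v.1, - v.2)) wN -E addrK //.
by exists (v'.1 + v.1, v'.2 + v.2); rewrite wD E.
Qed.

Lemma inL_opp t z : inL t (- z) <-> inL t z.
Proof.
split=> -[v E]; exists (- v.1, - v.2); rewrite wN -E ?opprK //.
Qed.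

Lemma inL_locfin t : mg t <= 1 / 2 -> locfin (inL t).
Proof.
move=> ht r; exists [seq w t v | v <- box (Num.truncn (2 * r)).+1] => z [v ->] wr.
apply: map_f; rewrite mem_box.
have h : (mx v)%:R <= 2 * r by have := w_ge v ht; lra.
by rewrite -(ler_nat R); apply: le_trans h _; exact/ltW/truncnS_gt.
Qed.
End Lattice.

Section TermAlgebra.
Variable R : realType.
Local Notation C := R[i].
Implicit Types z w p i : C.

(* Since 0^-1 = 0, the same formulas give the right term at the lattice point 0. *)
Definition t_zeta (z w : C) := (z - w)^-1 + w^-1 + z * w^-1 ^+ 2.
Definition t_wp (z w : C) := (z - w)^-1 ^+ 2 - w^-1 ^+ 2.
Definition t_zt (z w p : C) := p * (- (z - w)^-1 ^+ 2 + w^-1 ^+ 2 + 2 * z * w^-1 ^+ 3).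
Definition t_ztz (z w p : C) := p * (2 * (z - w)^-1 ^+ 3 + 2 * w^-1 ^+ 3).

(** These identities make the decay visible, as products of inverses of order -3 or better in w. In
    the first two, i marks the index (0, 0), whose pole is kept apart. *)
Lemma alg_zeta z w i : z - w != 0 -> (i = 1 /\ w = 0) \/ (i = 0 /\ w != 0) ->
  i * (z - w)^-1 + z ^+ 2 * (w^-1 ^+ 2 * (z - w)^-1) = t_zeta z w.
Proof.
rewrite /t_zeta => h [[-> E]|[-> hw]]; last by field; rewrite h hw.
move: h; rewrite E invr0 subr0 => h; by field.
Qed.

Lemma alg_wp z w i : z - w != 0 -> (i = 1 /\ w = 0) \/ (i = 0 /\ w != 0) ->
  i * (z - w)^-1 ^+ 2 + (2 * (z * ((z - w)^-1 ^+ 2 * w^-1)) - z ^+ 2 * ((z - w)^-1 ^+ 2 * w^-1 ^+ 2)) = t_wp z w.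
Proof.
rewrite /t_wp => h [[-> E]|[-> hw]]; last by field; rewrite h hw.
move: h; rewrite E invr0 subr0 => h; by field.
Qed.

Lemma alg_zt z w p : z - w != 0 -> p = 0 \/ w != 0 ->
  p * (w^-1 ^+ 2 * (z - w)^-1 ^+ 2 * ((-3) * z ^+ 2 + 2 * (z ^+ 3 * w^-1))) = t_zt z w p.
Proof. by rewrite /t_zt => h [->|hw]; [rewrite !mul0r|field; rewrite h hw]. Qed.

Lemma alg_ztz z w p : z - w != 0 -> p = 0 \/ w != 0 ->
  2 * (p * ((z - w)^-1 ^+ 3 * (z ^+ 3 * w^-1 ^+ 3 - 3 * (z ^+ 2 * w^-1 ^+ 2) + 3 * (z * w^-1)))) = t_ztz z w p.
Proof. by rewrite /t_ztz => h [->|hw]; [rewrite !mul0r mulr0|field; rewrite h hw]. Qed.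
End TermAlgebra.

Section TermSymbols.
Variable R : realType.
Local Notation C := R[i].
Local Notation pt := (int * int)%type.
Variables (V : C -> Prop) (D : C -> Prop).
Local Notation symt k d F := (sym (@wgt R) (fun=> V) D 0 k d F).
Implicit Types F G Z W P : pt -> C -> C.

Let w1 : forall v, 1 <= wgt R v := wgt_ge1 R.
Let d0 : (0 : int) <= 0 := lexx 0.

(** A local form of [sym_ext]: the algebraic identities for the terms hold only off the poles, which
    is an open condition. *)
Lemma sym_near k d F G : (forall v y, V y -> F v y = G v y /\ near0 D (fun h => F v (y + h) = G v (y + h))) ->
  symt k d F -> symt k d G.
Proof.
case: k => [|k] E [s0 s1]; split => //; try by have [K HK] := s0; exists K => v y Vy; have [<- _] := E v y Vy; exact: HK.
have [F' [dF sF]] := s1; exists F'; split => // v y Vy.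
by have [E1 E2] := E v y Vy; apply: dv_near E1 E2 (dF v y Vy).
Qed.

Lemma dv_neq0 F v y d : dv D (F v) y d -> F v y != 0 -> near0 D (fun h => F v (y + h) != 0).
Proof.
rewrite -mg_gt0 => dF Fy; have := dv_cont dF Fy; apply: near0W => h _ hh.
by apply: contraTneq hh => ->; rewrite sub0r mgN ltxx.
Qed.

(* [Z], [W] and [P] stand for the argument, the lattice point and its
   coordinate; the lattice point of index [(0, 0)] vanishes identically. *)
Variables (Z W P : pt -> C -> C).
Hypothesis P0 : forall y, P (0, 0) y = 0.
Hypothesis W0 : forall y, W (0, 0) y = 0.
Hypothesis Wn0 : forall v y, V y -> v != (0, 0) -> W v y != 0.
Hypothesis An0 : forall v y, V y -> Z v y - W v y != 0.
Let IA : pt -> C -> C := fun v y => (Z v y - W v y)^-1.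
Let IW : pt -> C -> C := fun v y => (W v y)^-1.
Let i0 : pt -> C -> C := fun v _ => (v == (0, 0))%:R.

Section Ex.
Variables (k : nat).
Hypothesis sZ : symt k.+1 0 Z.
Hypothesis sW : symt k.+1 1 W.
Hypothesis sP : symt k.+1 1 P.
Hypothesis sIA : symt k.+1 (-1) IA.
Hypothesis sIW : symt k.+1 (-1) IW.

Lemma sym_i0 d : symt k.+1 d i0.
Proof.
apply: (@sym_cst _ _ _ _ _ _ _ _ (fun v => (v == (0, 0))%:R) 1) => v.
have [->|_] := eqVneq v (0, 0).
  by rewrite mg1 mul1r /wgt /mx /= maxnn exp1rz.
by rewrite mg0 mul1r exprz_ge0 // ltW// (lt_le_trans ltr01 (w1 v)).
Qed.

Lemma near_neq v y : V y -> near0 D (fun h => Z v (y + h) - W v (y + h) != 0 /\ (v != (0, 0) -> W v (y + h) != 0)).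
Proof.
move=> Vy.
have [_ [Z' [dZ _]]] := sZ; have [_ [W' [dW _]]] := sW.
have h1 := dv_neq0 (F := fun v y => Z v y - W v y) (dvB (dZ v y Vy) (dW v y Vy)) (An0 v Vy).
have [E|vn] := eqVneq v (0, 0).
  by apply: near0W h1 => h _ hh; split.
have h2 := dv_neq0 (dW v y Vy) (Wn0 Vy vn).
by apply: near0W (near0_and h1 h2) => h _ [].
Qed.

Lemma sym_via d F G : (forall v y, Z v y - W v y != 0 -> (v != (0, 0) -> W v y != 0) -> F v y = G v y) ->
  symt k.+1 d F -> symt k.+1 d G.
Proof.
move=> E; apply: sym_near => v y Vy; split.
  by apply: E; [exact: An0|move=> ?; exact: Wn0].
by apply: near0W (near_neq v Vy) => h _ []; exact: E.
Qed.

Lemma sym_zeta : symt k.+1 (-3) (fun v y => t_zeta (Z v y) (W v y)).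
Proof.
have h : symt k.+1 (-3) (fun v y => i0 v y * IA v y + Z v y ^+ 2 * (IW v y ^+ 2 * IA v y)).
  apply: symD => //; first exact: (symM w1 (sym_i0 (-2)) sIA).
  exact: (symM w1 (symX w1 2 sZ) (symM w1 (symX w1 2 sIW) sIA)).
apply: sym_via h => v y h1 h2; rewrite /i0 /IA /IW.
by apply: alg_zeta => //; have [->|vn] := eqVneq v (0, 0); [left; rewrite W0|right; split=> //; exact: h2].
Qed.

Lemma sym_wp : symt k.+1 (-3) (fun v y => t_wp (Z v y) (W v y)).
Proof.
have h : symt k.+1 (-3) (fun v y => i0 v y * IA v y ^+ 2 +
   (2 * (Z v y * (IA v y ^+ 2 * IW v y)) - Z v y ^+ 2 * (IA v y ^+ 2 * IW v y ^+ 2))).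
  apply: symD => //; first exact: (symM w1 (sym_i0 (-1)) (symX w1 2 sIA)).
  apply: symB => //.
    exact: (sym_scal w1 2 (symM w1 sZ (symM w1 (symX w1 2 sIA) sIW))).
  apply: (@sym_weak _ _ _ _ _ _ w1 k.+1 (-4)) => //.
  exact: (symM w1 (symX w1 2 sZ) (symM w1 (symX w1 2 sIA) (symX w1 2 sIW))).
apply: sym_via h => v y h1 h2; rewrite /i0 /IA /IW.
by apply: alg_wp => //; have [->|vn] := eqVneq v (0, 0); [left; rewrite W0|right; split=> //; exact: h2].
Qed.

Lemma sym_zt : symt k.+1 (-3) (fun v y => t_zt (Z v y) (W v y) (P v y)).
Proof.
have h : symt k.+1 (-3) (fun v y => P v y * (IW v y ^+ 2 * IA v y ^+ 2 *
   ((-3) * Z v y ^+ 2 + 2 * (Z v y ^+ 3 * IW v y)))).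
  apply: (symM w1 (d := 1) (e := -4)) => //.
  apply: (symM w1 (d := -4) (e := 0)).
    exact: (symM w1 (symX w1 2 sIW) (symX w1 2 sIA)).
  apply: symD => //; first exact: (sym_scal w1 (-3) (symX w1 2 sZ)).
  apply: (@sym_weak _ _ _ _ _ _ w1 k.+1 (-1)) => //.
  exact: (sym_scal w1 2 (symM w1 (symX w1 3 sZ) sIW)).
apply: sym_via h => v y h1 h2; rewrite /i0 /IA /IW.
by apply: alg_zt => //; have [->|vn] := eqVneq v (0, 0); [left; rewrite P0|right; exact: h2].
Qed.

Lemma sym_ztz : symt k.+1 (-3) (fun v y => t_ztz (Z v y) (W v y) (P v y)).
Proof.
have h : symt k.+1 (-3) (fun v y => 2 * (P v y * (IA v y ^+ 3 *
   (Z v y ^+ 3 * IW v y ^+ 3 - 3 * (Z v y ^+ 2 * IW v y ^+ 2) + 3 * (Z v y * IW v y))))).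
  apply: sym_scal => //; apply: (symM w1 (d := 1) (e := -4)) => //.
  apply: (symM w1 (d := -3) (e := -1)); first exact: (symX w1 3 sIA).
  apply: symD => //; last exact: (sym_scal w1 3 (symM w1 sZ sIW)).
  apply: symB => //.
    apply: (@sym_weak _ _ _ _ _ _ w1 k.+1 (-3)) => //.
    exact: (symM w1 (symX w1 3 sZ) (symX w1 3 sIW)).
  apply: (@sym_weak _ _ _ _ _ _ w1 k.+1 (-2)) => //.
  exact: (sym_scal w1 3 (symM w1 (symX w1 2 sZ) (symX w1 2 sIW))).
apply: sym_via h => v y h1 h2; rewrite /i0 /IA /IW.
by apply: alg_ztz => //; have [->|vn] := eqVneq v (0, 0); [left; rewrite P0|right; exact: h2].
Qed.

Lemma sym_IA3 : symt k.+1 (-3) (fun v y => (Z v y - W v y)^-1 ^+ 3).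
Proof. exact: (symX w1 3 sIA). Qed.

Lemma sym_IA4 : symt k.+1 (-3) (fun v y => (Z v y - W v y)^-1 ^+ 4).
Proof. apply: (@sym_weak _ _ _ _ _ _ w1 k.+1 (-4)) => //; exact: (symX w1 4 sIA). Qed.
End Ex.
End TermSymbols.

Section SumDerivative.
Variable R : realType.
Local Notation C := R[i].
Local Notation pt := (int * int)%type.

Lemma lsum_dvc (D : C -> Prop) (V : C -> Prop) (y0 : C) (F G : pt -> C -> C) c :
  (forall (t : R) h, D h -> D (t%:C * h)) ->
  (exists2 r, 0 < r & forall h, mg h < r -> V (y0 + h)) ->
  (forall v y, V y -> dv D (F v) y (c * G v y)) ->
  sym0 (@wgt R) (fun=> V) (-3) F -> sym (@wgt R) (fun=> V) D 0 1 (-3) G ->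
  dv D (fun y => lsum (F^~ y)) y0 (c * lsum (G^~ y0)).
Proof.
move=> hD hV dF sF sG.
have sG' := @sym_scal _ _ _ _ _ _ (@wgt_ge1 R) _ _ c _ sG.
have h := lsum_dv hD hV dF sF sG'.
apply: (dv_eq h); apply: lsumE; apply: haslsumZ.
have [K HK] := sym0_dec (sym_sym0 sG); apply: (@dec_haslsum _ _ K); apply: HK => v.
by have [r r0 /(_ 0)] := hV; rewrite mg0 addr0; exact.
Qed.
End SumDerivative.

Section EllipticFunctions.
Variable R : realType.
Local Notation C := R[i].
Local Notation pt := (int * int)%type.
Implicit Types (t x z : C) (v : pt).

(* [zt] and [ztz] are the derivatives in t of zeta and - wp at fixed z. *)
Definition zeta t z : C := lsum (fun v => t_zeta z (w t v)).
Definition wp t z : C := lsum (fun v => t_wp z (w t v)).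
Definition wp1 t z : C := -2 * lsum (fun v => (z - w t v)^-1 ^+ 3).
Definition wp2 t z : C := 6 * lsum (fun v => (z - w t v)^-1 ^+ 4).
Definition zt t z : C := lsum (fun v => t_zt z (w t v) (pp R v)).
Definition ztz t z : C := lsum (fun v => t_ztz z (w t v) (pp R v)).

Let w1 : forall v, 1 <= wgt R v := wgt_ge1 R.
Let dr0 : (0 : int) <= 0 := lexx 0.

Section FixedT.
Variables (t z0 : C).
Hypothesis ht : mg t <= 1 / 2.
Hypothesis hz : ~ inL t z0.

(** Half of the constant of [dist_L] keeps a whole disc around z0 away from all lattice points, with
    a margin proportional to the weight. *)
Lemma symbols_z : exists r : R, [/\ 0 < r,
  (forall v z, mg (z - z0) < r -> z - w t v != 0) &
  forall k, let V z := mg (z - z0) < r in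
   [/\ sym (@wgt R) (fun=> V) (@allD R) 0 k 0 (fun _ z => z),
       sym (@wgt R) (fun=> V) (@allD R) 0 k 1 (fun v _ => w t v),
       sym (@wgt R) (fun=> V) (@allD R) 0 k 1 (fun v _ => pp R v),
       sym (@wgt R) (fun=> V) (@allD R) 0 k (-1) (fun v z => (z - w t v)^-1) &
       sym (@wgt R) (fun=> V) (@allD R) 0 k (-1) (fun v _ => (w t v)^-1)]].
Proof.
have [c c0 cP] := dist_L ht hz.
pose r := Num.min 1 (c / 2).
have r0 : 0 < r by rewrite /r lt_min; apply/andP; split; lra.
have low v z : mg (z - z0) < r -> c / 2 * wgt R v <= mg (z - w t v).
  move=> zr; have hc := cP v; have := w1 v.
  have zc : mg (z - z0) < c / 2 by move: zr; rewrite lt_min => /andP[].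
  have := mgBr (z0 - w t v) (z0 - z); rewrite (_ : z0 - w t v - (z0 - z) = z - w t v); last by ring.
  rewrite (mgBC z0 z) => h1 h2.
  have : c / 2 * 1 <= c / 2 * wgt R v by rewrite ler_wpM2l//; lra.
  lra.
have zb z : mg (z - z0) < r -> mg z <= mg z0 + 1.
  rewrite lt_min => /andP[z1 _]; have := mgD (z - z0) z0; rewrite subrK; lra.
have wle v : mg (w t v) <= 16 * wgt R v ^ 1.
  by rewrite expr1z wgtE; have := w_le v ht; have : 0 <= (mx v)%:R :> R by []; lra.
exists r; split => // [v z /(low v) h|k V].
  by rewrite -mg_gt0; apply: lt_le_trans h; rewrite mulr_gt0 ?(lt_le_trans ltr01 (w1 v))// divr_gt0.
split.
- apply: sym_ext (@sym_lin _ _ _ _ (@allD R) 0 w1 dr0 k 0 (fun=> 0) (fun=> 1) 1 (mg z0 + 1) _ _ _).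
  + by move=> v y; rewrite add0r mul1r.
  + by move=> v; rewrite mg0 expr0z; lra.
  + by move=> v; rewrite mg1 subr0 expr0z; lra.
  + by move=> v y; exact: zb.
- exact: (@sym_cst _ _ _ _ _ _ _ _ _ 16).
- apply: (@sym_cst _ _ _ _ _ _ _ _ _ 8) => v; rewrite expr1z wgtE; have := pp_mx R v; lra.
- apply: (@sym_inv _ _ _ _ _ 0 w1 k 1 (fun v z => z - w t v) (c / 2)); first by lra.
    by move=> v; right => z Vz; rewrite expr1z; exact: low.
  apply: sym_ext (@sym_lin _ _ _ _ (@allD R) 0 w1 dr0 k 1 (fun v => - w t v) (fun=> 1) 16 (mg z0 + 1) _ _ _).
  + by move=> v y; rewrite mul1r addrC.
  + by move=> v; rewrite mgN.
  + by move=> v; rewrite mg1 subr0 expr1z; have := w1 v; lra.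
  + by move=> v y; exact: zb.
- apply: (@sym_cst _ _ _ _ _ _ _ _ _ 4) => v.
  have [->|vn] := eqVneq v (0, 0).
    by rewrite w0 invr0 mg0 mulr_ge0// exprz_ge0// ltW// (lt_le_trans ltr01).
  have h := w_ge' ht vn; have p := lt_le_trans ltr01 (w1 v).
  rewrite mgV exprN1 -[4]invrK -invfM lef_pV2 ?posrE; [lra|apply: lt_le_trans h|]; lra.
Qed.

Local Notation inV r := (fun z => mg (z - z0) < r).

Lemma dv_zA v z : z - w t v != 0 -> dv (@allD R) (fun z => (z - w t v)^-1) z (- (z - w t v)^-1 ^+ 2).
Proof. by rewrite subr_eq0 => /dv_invB h; apply: (dv_eq h); rewrite mulN1r exprVn. Qed.

Let hD (s : R) (h : C) : @allD R h -> @allD R (s%:C * h). Proof. by []. Qed.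
Let hV r : 0 < r -> exists2 r', 0 < r' & forall h, mg h < r' -> mg (z0 + h - z0) < r.
Proof. by move=> r0; exists r => // h; rewrite addrAC subrr add0r. Qed.

Lemma dv_zeta : dv (@allD R) (zeta t) z0 (- wp t z0).
Proof.
have [r [r0 nz sy]] := symbols_z.
have [a1 a2 a3 a4 a5] := sy 1%N.
have An (v : pt) y (h : mg (y - z0) < r) := nz v y h.
have Wn (v : pt) y (h : mg (y - z0) < r) (hv : v != (0, 0)) := w_neq0 ht hv.
have sz := @sym_zeta R (inV r) (@allD R) (fun _ z => z) (fun v _ => w t v) (fun=> w0 t) Wn An 0 a1 a2 a4 a5.
have sp := @sym_wp R (inV r) (@allD R) (fun _ z => z) (fun v _ => w t v) (fun=> w0 t) Wn An 0 a1 a2 a4 a5.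
rewrite -mulN1r; apply: (lsum_dvc hD (hV r0)) (sym_sym0 sz) sp => v y Vy.
have h1 := dv_zA (nz v y Vy).
apply: (dv_eq (dvD (dvD h1 (dv_cst _ _ _)) (dvM (dv_id _ _) (dv_cst _ _ _)))).
by rewrite /t_wp; ring.
Qed.

Lemma dv_wp : dv (@allD R) (wp t) z0 (wp1 t z0).
Proof.
have [r [r0 nz sy]] := symbols_z.
have [a1 a2 a3 a4 a5] := sy 1%N.
have An (v : pt) y (h : mg (y - z0) < r) := nz v y h.
have Wn (v : pt) y (h : mg (y - z0) < r) (hv : v != (0, 0)) := w_neq0 ht hv.
have sp := @sym_wp R (inV r) (@allD R) (fun _ z => z) (fun v _ => w t v) (fun=> w0 t) Wn An 0 a1 a2 a4 a5.
have s3 := @sym_IA3 R (inV r) (@allD R) (fun _ z => z) (fun v _ => w t v) 0 a4.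
apply: (lsum_dvc hD (hV r0)) (sym_sym0 sp) s3 => v y Vy.
have h1 := dvX 1 (dv_zA (nz v y Vy)).
apply: (dv_eq (dvB h1 (dv_cst _ _ _))).
by rewrite /=; ring.
Qed.

Lemma dv_wp1 : dv (@allD R) (wp1 t) z0 (wp2 t z0).
Proof.
have [r [r0 nz sy]] := symbols_z.
have [a1 a2 a3 a4 a5] := sy 1%N.
have s3 := @sym_IA3 R (inV r) (@allD R) (fun _ z => z) (fun v _ => w t v) 0 a4.
have s4 := @sym_IA4 R (inV r) (@allD R) (fun _ z => z) (fun v _ => w t v) 0 a4.
have h : dv (@allD R) (fun z => lsum (fun v => (z - w t v)^-1 ^+ 3)) z0 ((-3) * lsum (fun v => (z0 - w t v)^-1 ^+ 4)).
  apply: (lsum_dvc hD (hV r0)) (sym_sym0 s3) s4 => v y Vy.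
  by apply: (dv_eq (dvX 2 (dv_zA (nz v y Vy)))); rewrite /=; ring.
by apply: (dv_eq (dvZ (-2) h)); rewrite /wp2; ring.
Qed.

Lemma dv_zt : dv (@allD R) (zt t) z0 (ztz t z0).
Proof.
have [r [r0 nz sy]] := symbols_z.
have [a1 a2 a3 a4 a5] := sy 1%N.
have An (v : pt) y (h : mg (y - z0) < r) := nz v y h.
have Wn (v : pt) y (h : mg (y - z0) < r) (hv : v != (0, 0)) := w_neq0 ht hv.
have sz := @sym_zt R (inV r) (@allD R) (fun _ z => z) (fun v _ => w t v) (fun v _ => pp R v) (fun=> pp0 R) Wn An 0 a1 a2 a3 a4 a5.
have sp := @sym_ztz R (inV r) (@allD R) (fun _ z => z) (fun v _ => w t v) (fun v _ => pp R v) (fun=> pp0 R) Wn An 0 a1 a2 a3 a4 a5.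
rewrite -[ztz _ _]mul1r; apply: (lsum_dvc hD (hV r0)) (sym_sym0 sz) sp => v y Vy.
have h1 := dvX 1 (dv_zA (nz v y Vy)).
have h2 := dvM (dvM (dv_cst _ 2 y) (dv_id _ y)) (dv_cst (@allD R) ((w t v)^-1 ^+ 3) y).
apply: (dv_eq (dvM (dv_cst _ (pp R v) y) (dvD (dvD (dvN h1) (dv_cst _ ((w t v)^-1 ^+ 2) y)) h2))).
by rewrite /t_ztz /=; ring.
Qed.
End FixedT.

Section FixedX.
Variables (t0 x : C).
Hypothesis ht0 : mg t0 < 1 / 2.
Hypothesis hx : ~ inM x.
Local Notation V := (fun t : C => mg t <= 1 / 2).

Let hD (s : R) (h : C) : @allD R h -> @allD R (s%:C * h). Proof. by []. Qed.
Let hV : exists2 r', 0 < r' & forall h, mg h < r' -> mg (t0 + h) <= 1 / 2.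
Proof.
exists (1 / 2 - mg t0); first by rewrite subr_gt0.
by move=> h hh; apply: (le_trans (mgD _ _)); lra.
Qed.

Lemma nz_t v t : mg t <= 1 / 2 -> T t x - w t v != 0.
Proof.
move=> ht; rewrite -TB T_eq0// subr_eq0; apply/eqP => E; by apply: hx; exists v.
Qed.

Lemma symbols_t k :
   [/\ sym (@wgt R) (fun=> V) (@allD R) 0 k 0 (fun _ t => T t x),
       sym (@wgt R) (fun=> V) (@allD R) 0 k 1 (fun v t => w t v),
       sym (@wgt R) (fun=> V) (@allD R) 0 k 1 (fun v _ => pp R v),
       sym (@wgt R) (fun=> V) (@allD R) 0 k (-1) (fun v t => (T t x - w t v)^-1) &
       sym (@wgt R) (fun=> V) (@allD R) 0 k (-1) (fun v t => (w t v)^-1)].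
Proof.
have [c c0 cP] := dist_M hx.
have pb v : mg (pp R v) <= 8 * wgt R v ^ 1 by rewrite expr1z wgtE; have := pp_mx R v; lra.
have sZ : sym (@wgt R) (fun=> V) (@allD R) 0 k 0 (fun _ t => T t x).
  apply: sym_ext (@sym_lin _ _ _ _ (@allD R) 0 w1 dr0 k 0 (fun=> conjc x) (fun=> - x) (mg x) (1 / 2) _ _ _).
  + by move=> v y; rewrite /T mulNr mulrC.
  + by move=> v; rewrite mg_conj expr0z mulr1.
  + by move=> v; rewrite mgN subr0 expr0z mulr1.
  + by [].
have sW : sym (@wgt R) (fun=> V) (@allD R) 0 k 1 (fun v t => w t v).
  apply: sym_ext (@sym_lin _ _ _ _ (@allD R) 0 w1 dr0 k 1 (fun v => conjc (pp R v)) (fun v => - pp R v) 8 (1 / 2) _ _ _).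
  + by move=> v y; rewrite /w /T mulNr mulrC.
  + by move=> v; rewrite mg_conj.
  + by move=> v; rewrite mgN subr0.
  + by [].
split=> //.
- exact: (@sym_cst _ _ _ _ _ _ _ _ _ 8).
- apply: (@sym_inv _ _ _ _ _ 0 w1 k 1 (fun v t => T t x - w t v) (c / 2)); first by lra.
    move=> v; right => t ht; rewrite expr1z -TB; have := T_ge (x - pp R v) ht; have := cP v; lra.
  by apply: (symB _ (sym_weak _ _ sZ)).
- apply: (@sym_inv _ _ _ _ _ 0 w1 k 1 (fun v t => w t v) (1 / 4)) ; [by lra|move=> v|exact: sW].
  have [->|vn] := eqVneq v (0, 0); [by left => t; rewrite w0|right => t ht].
  by rewrite expr1z; have := w_ge' ht vn; lra.
Qed.

Lemma dv_Tt y t : dv (@allD R) (fun t => T t y) t (- y).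
Proof.
apply: (@dv_ext R (@allD R) (fun s => conjc y + - y * s)) (dv_lin _ _ _ _) => s.
by rewrite /T mulNr mulrC.
Qed.

Lemma dv_tA v t : mg t <= 1 / 2 -> dv (@allD R) (fun t => (T t x - w t v)^-1) t
  ((x - pp R v) * (T t x - w t v)^-1 ^+ 2).
Proof.
move=> ht; have h := dvV (dvB (dv_Tt x t) (dv_Tt (pp R v) t)) (nz_t v ht).
by apply: (dv_eq h); rewrite exprVn /w; congr (_ * _); ring.
Qed.

Lemma dv_tW v t : mg t <= 1 / 2 -> dv (@allD R) (fun t => (w t v)^-1) t
  (pp R v * (w t v)^-1 ^+ 2).
Proof.
move=> ht; have [->|vn] := eqVneq v (0, 0).
  by rewrite w0 pp0 mul0r; apply: dv_ext (dv_cst _ 0 t) => y; rewrite w0 invr0.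
by apply: (dv_eq (dvV (dv_Tt (pp R v) t) (w_neq0 ht vn))); rewrite opprK exprVn.
Qed.

(** The point T_t x moves with t at speed - x, so the chain rule adds (- x) * (- wp) to [zt]. *)
Lemma dvt_zeta : dv (@allD R) (fun t => zeta t (T t x)) t0 (zt t0 (T t0 x) + x * wp t0 (T t0 x)).
Proof.
have [a1 a2 a3 a4 a5] := symbols_t 1%N.
have Wn (v : pt) (y : C) (ht : mg y <= 1 / 2) (hv : v != (0, 0)) := w_neq0 ht hv.
have sz := @sym_zeta R V (@allD R) (fun _ t => T t x) (fun v t => w t v) (fun y : C => w0 y) Wn nz_t 0 a1 a2 a4 a5.
have sp := @sym_wp R V (@allD R) (fun _ t => T t x) (fun v t => w t v) (fun y : C => w0 y) Wn nz_t 0 a1 a2 a4 a5.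
have sq := @sym_zt R V (@allD R) (fun _ t => T t x) (fun v t => w t v) (fun v _ => pp R v) (fun=> pp0 R) Wn nz_t 0 a1 a2 a3 a4 a5.
have h := lsum_dv hD hV _ (sym_sym0 sz) (symD sq (sym_scal w1 x sp)).
apply: (dv_eq (h _)); last first.
  have ht := ltW ht0.
  apply: lsumE; apply: haslsumD; last apply: haslsumZ.
    by have [K HK] := sym0_dec (sym_sym0 sq); exact: (dec_haslsum (HK _ (fun=> ht))).
  by have [K HK] := sym0_dec (sym_sym0 sp); exact: (dec_haslsum (HK _ (fun=> ht))).
move=> v t ht.
have dA := dv_tA v ht; have dW := dv_tW v ht.
apply: (dv_eq (dvD (dvD dA dW) (dvM (dv_Tt x t) (dvX 1 dW)))).
by rewrite /t_zt /t_wp; ring.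
Qed.

Lemma dvt_wp : dv (@allD R) (fun t => wp t (T t x)) t0 (- ztz t0 (T t0 x) - x * wp1 t0 (T t0 x)).
Proof.
have [a1 a2 a3 a4 a5] := symbols_t 1%N.
have Wn (v : pt) (y : C) (ht : mg y <= 1 / 2) (hv : v != (0, 0)) := w_neq0 ht hv.
have sp := @sym_wp R V (@allD R) (fun _ t => T t x) (fun v t => w t v) (fun y : C => w0 y) Wn nz_t 0 a1 a2 a4 a5.
have sq := @sym_ztz R V (@allD R) (fun _ t => T t x) (fun v t => w t v) (fun v _ => pp R v) (fun=> pp0 R) Wn nz_t 0 a1 a2 a3 a4 a5.
have s3 := @sym_IA3 R V (@allD R) (fun _ t => T t x) (fun v t => w t v) 0 a4.
have h := lsum_dv hD hV _ (sym_sym0 sp) (symB w1 (sym_scal w1 (2 * x) s3) sq).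
apply: (dv_eq (h _)); last first.
  have ht := ltW ht0.
  rewrite (_ : - _ - _ = 2 * x * lsum (fun v => (T t0 x - w t0 v)^-1 ^+ 3) - ztz t0 (T t0 x)); last by rewrite /wp1; ring.
  apply: lsumE; apply: haslsumB; first apply: haslsumZ.
    by have [K HK] := sym0_dec (sym_sym0 s3); exact: (dec_haslsum (HK _ (fun=> ht))).
  by have [K HK] := sym0_dec (sym_sym0 sq); exact: (dec_haslsum (HK _ (fun=> ht))).
move=> v t ht.
have dA := dv_tA v ht; have dW := dv_tW v ht.
apply: (dv_eq (dvB (dvX 1 dA) (dvX 1 dW))).
by rewrite /t_ztz; ring.
Qed.
End FixedX.
End EllipticFunctions.

Section EllipticBasics.
Variable R : realType.
Local Notation C := R[i].
Local Notation pt := (int * int)%type.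
Implicit Types (t x z : C) (v : pt).
Let w1 : forall v, 1 <= wgt R v := wgt_ge1 R.
Let dr0 : (0 : int) <= 0 := lexx 0.

Lemma haslsum_delta (c : C) : haslsum (fun v => (v == (0, 0))%:R * c) c.
Proof.
exists 0 => N; rewrite mul0r (bigD1_seq (0, 0)) ?mem_box ?box_uniq//=.
rewrite mul1r big1 ?addr0 ?subrr ?mg0// => v /negbTE ->; by rewrite mul0r.
Qed.

Lemma dec_weak (F : pt -> C) K : dec 3 F K -> dec 2 F K.
Proof.
move=> h v; apply: le_trans (h v) _; apply: ler_wpM2l; first exact: dec_ge0 h.
by rewrite lef_pV2 ?posrE ?exprn_gt0 ?ltr0n// ler_weXn2l ?ler1n.
Qed.

Section FixedT.
Variable t : C.
Hypothesis ht : mg t <= 1 / 2.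

Lemma dec_terms z : ~ inL t z -> exists K : R,
  [/\ dec 3 (fun v => t_zeta z (w t v)) K, dec 3 (fun v => t_wp z (w t v)) K,
      dec 3 (fun v => (z - w t v)^-1 ^+ 3) K &
      dec 3 (fun v => t_zt z (w t v) (pp R v)) K].
Proof.
move=> hz; have [r [r0 nz sy]] := symbols_z ht hz.
have [a1 a2 a3 a4 a5] := sy 1%N.
have An v y (h : mg (y - z) < r) := nz v y h.
have Wn v y (h : mg (y - z) < r) (hv : v != (0, 0)) := w_neq0 ht hv.
have Vz (_ : pt) : mg (z - z) < r by rewrite subrr mg0.
have [K1 h1] := sym0_dec (sym_sym0 (@sym_zeta R (fun y => mg (y - z) < r) (@allD R) (fun _ z => z) (fun v _ => w t v) (fun=> w0 t) Wn An 0 a1 a2 a4 a5)).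
have [K2 h2] := sym0_dec (sym_sym0 (@sym_wp R (fun y => mg (y - z) < r) (@allD R) (fun _ z => z) (fun v _ => w t v) (fun=> w0 t) Wn An 0 a1 a2 a4 a5)).
have [K3 h3] := sym0_dec (sym_sym0 (@sym_IA3 R (fun y => mg (y - z) < r) (@allD R) (fun _ z => z) (fun v _ => w t v) 0 a4)).
have [K4 h4] := sym0_dec (sym_sym0 (@sym_zt R (fun y => mg (y - z) < r) (@allD R) (fun _ z => z) (fun v _ => w t v) (fun v _ => pp R v) (fun=> pp0 R) Wn An 0 a1 a2 a3 a4 a5)).
exists (Num.max (Num.max K1 K2) (Num.max K3 K4)).
split=> v; [have h := h1 _ Vz v|have h := h2 _ Vz v|have h := h3 _ Vz v|have h := h4 _ Vz v];
  apply: (le_trans h); rewrite ler_wpM2r ?invr_ge0 ?exprn_ge0//;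
  rewrite !le_max lexx ?orbT//.
Qed.

Lemma dec_w2 : exists K : R, dec 2 (fun v => (w t v)^-1 ^+ 2) K.
Proof.
exists 16 => v; have [->|vn] := eqVneq v (0, 0).
  by rewrite w0 invr0 expr0n mg0 divr_ge0// exprn_ge0.
rewrite mgX mgV exprVn -[16]invrK -invfM lef_pV2 ?posrE; last first.
- by rewrite mulr_gt0// exprn_gt0// ltr0n.
- by rewrite exprn_gt0// mg_gt0 w_neq0.
have := w_ge' ht vn; rewrite /wgt; set a := (_.+1)%:R => h.
have a1 : 1 <= a by rewrite /a ler1n.
have -> : 16^-1 * a ^+ 2 = (a / 4) ^+ 2 by field.
by rewrite ler_sqr ?nnegrE ?mg_ge0//; lra.
Qed.

Let neg v : pt := (- v.1, - v.2).
Lemma negv_inv : involutive neg. Proof. by case=> a b; rewrite /neg /= !opprK. Qed.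
Lemma mx_neg v : mx (neg v) = mx v. Proof. by rewrite /mx /= !abszN. Qed.

Lemma lsum_odd (F : pt -> C) (G : pt -> C) K s : dec 3 F K -> (forall v, G v = s * F (neg v)) ->
  lsum G = s * lsum F.
Proof.
move=> h E; apply: lsumE; apply: (haslsum_eq (F := fun v => s * F (neg v))) => [v|]; first by rewrite E.
apply: haslsumZ; exact: (haslsum_perm negv_inv mx_neg (dec_haslsum h)).
Qed.

Lemma zetaN z : ~ inL t z -> zeta t (- z) = - zeta t z.
Proof.
move=> /dec_terms[K [h _ _ _]]; rewrite -[RHS]mulN1r; apply: (lsum_odd (s := -1) h) => v.
by rewrite /t_zeta wN (_ : - z - w t v = - (z - - w t v)) ?invrN; ring.
Qed.

Lemma wpN z : ~ inL t z -> wp t (- z) = wp t z.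
Proof.
move=> /dec_terms[K [_ h _ _]]; rewrite -[RHS]mul1r; apply: (lsum_odd (s := 1) h) => v.
by rewrite /t_wp wN -opprD !invrN opprK; ring.
Qed.

Lemma wp1N z : ~ inL t z -> wp1 t (- z) = - wp1 t z.
Proof.
move=> /dec_terms[K [_ _ h _]]; rewrite /wp1 (lsum_odd (s := -1) h); first by ring.
by move=> v; rewrite wN -opprD !invrN opprK; ring.
Qed.

Lemma ztN z : ~ inL t z -> zt t (- z) = - zt t z.
Proof.
move=> /dec_terms[K [_ _ _ h]]; rewrite -[RHS]mulN1r; apply: (lsum_odd (s := -1) h) => v.
by rewrite /t_zt wN /neg ppN -opprD !invrN opprK; ring.
Qed.

Section Shift.
Variables (sh : pt -> pt) (q : C).
Hypothesis step : forall (G : pt -> C) K, dec 2 G K -> haslsum (fun v => G (sh v) - G v) 0.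
Hypothesis wsh : forall v, w t (sh v) = w t v - q.
Hypothesis inLq : forall z, inL t (z + q) <-> inL t z.

(** Subtracting telescoping sums from zeta (z + q) - zeta z removes z from the terms: the increment
    is the same for every z. *)
Lemma zeta_shift_sum z : ~ inL t z ->
  haslsum (fun v => (w t v)^-1 - (w t (sh v))^-1 + q * (w t v)^-1 ^+ 2) (zeta t (z + q) - zeta t z).
Proof.
move=> hz; have hzq : ~ inL t (z + q) by rewrite inLq.
have [K [h _ _ _]] := dec_terms hz; have [K' [h' _ _ _]] := dec_terms hzq.
have [L hL] := dec_w2.
have s1 := haslsumB (dec_haslsum h') (dec_haslsum h).
have s2 := haslsumB s1 (step (dec_weak h)).
have s3 := haslsumD s2 (haslsumZ z (step hL)).
rewrite mulr0 addr0 subr0 in s3.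
apply: haslsum_eq s3 => v; rewrite /t_zeta wsh (_ : z - (w t v - q) = z + q - w t v); ring.
Qed.

Lemma zeta_shift_gen z1 z2 : ~ inL t z1 -> ~ inL t z2 ->
  zeta t (z1 + q) - zeta t z1 = zeta t (z2 + q) - zeta t z2.
Proof. by move=> h1 h2; exact: haslsum_uniq (zeta_shift_sum h1) (zeta_shift_sum h2). Qed.

Lemma wp_shift_gen z : ~ inL t z -> wp t (z + q) = wp t z.
Proof.
move=> hz; have [K [_ h _ _]] := dec_terms hz; have [L hL] := dec_w2.
apply: lsumE; have s := haslsumD (haslsumD (step (dec_weak h)) (step hL)) (dec_haslsum h).
rewrite !add0r in s; apply: haslsum_eq s => v.
by rewrite /t_wp wsh (_ : z - (w t v - q) = z + q - w t v); ring.
Qed.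

Lemma wp1_shift_gen z : ~ inL t z -> wp1 t (z + q) = wp1 t z.
Proof.
move=> hz; have [K [_ _ h _]] := dec_terms hz.
rewrite /wp1; congr (_ * _); apply: lsumE.
have s := haslsumD (step (dec_weak h)) (dec_haslsum h).
rewrite !add0r in s; apply: haslsum_eq s => v.
by rewrite wsh (_ : z - (w t v - q) = z + q - w t v); ring.
Qed.
End Shift.

Definition q1 : C := w t (1, 0).
Definition q2 : C := w t (0, 1).
Let sh1 v : pt := (v.1 - 1, v.2).
Let sh2 v : pt := (v.1, v.2 - 1).

Lemma wsh1 v : w t (sh1 v) = w t v - q1.
Proof. by rewrite -wN -wD /=; congr (w t (_, _)); rewrite oppr0 addr0. Qed.
Lemma wsh2 v : w t (sh2 v) = w t v - q2.
Proof. by rewrite -wN -wD /=; congr (w t (_, _)); rewrite oppr0 addr0. Qed.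

Lemma zeta_shift z1 z2 : ~ inL t z1 -> ~ inL t z2 ->
  zeta t (z1 + q1) - zeta t z1 = zeta t (z2 + q1) - zeta t z2 /\
  zeta t (z1 + q2) - zeta t z1 = zeta t (z2 + q2) - zeta t z2.
Proof.
move=> h1 h2; split.
  exact: (zeta_shift_gen (@haslsum_step1 R) wsh1 (fun z => inL_shift t z _)).
exact: (zeta_shift_gen (@haslsum_step2 R) wsh2 (fun z => inL_shift t z _)).
Qed.

Lemma wp_shift z : ~ inL t z -> wp t (z + q1) = wp t z /\ wp t (z + q2) = wp t z.
Proof.
move=> h; split; first exact: (wp_shift_gen (@haslsum_step1 R) wsh1).
exact: (wp_shift_gen (@haslsum_step2 R) wsh2).
Qed.

Lemma wp1_shift z : ~ inL t z -> wp1 t (z + q1) = wp1 t z /\ wp1 t (z + q2) = wp1 t z.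
Proof.
move=> h; split; first exact: (wp1_shift_gen (@haslsum_step1 R) wsh1).
exact: (wp1_shift_gen (@haslsum_step2 R) wsh2).
Qed.

Lemma T_int (n : int) x : T t (n%:~R * x) = n%:~R * T t x.
Proof. by rewrite /T rmorphM rmorph_int /=; ring. Qed.

Lemma q1E : q1 = T t (om R). Proof. by rewrite /q1 /w /pp /= mul0r addr0 mul1r. Qed.
Lemma q2E : q2 = T t (omb R). Proof. by rewrite /q2 /w /pp /= mul0r add0r mul1r. Qed.

Lemma wE v : w t v = v.1%:~R * q1 + v.2%:~R * q2.
Proof. by rewrite q1E q2E /w /pp TD !T_int. Qed.

(** Laurent behaviour at 0, with errors weaker than the true ones but small enough for the
    cancellation of poles below. *)
Lemma near_zero : exists K : R, forall z, z != 0 -> mg z <= 1 / 4 ->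
  [/\ mg (zeta t z - z^-1) <= K * mg z ^+ 2, mg (wp t z - z^-1 ^+ 2) <= K * mg z,
      mg (wp1 t z + 2 * z^-1 ^+ 3) <= K & mg (zt t z) <= K].
Proof.
pose V (z : C) : Prop := mg z <= 1 / 4.
(* At the index (0, 0) this vanishes, and its inverse 0 removes the singular term. *)
pose F v z := (v != (0, 0))%:R * (z - w t v).
have p v : 0 < wgt R v := lt_le_trans ltr01 (w1 v).
have low v z : v != (0, 0) -> V z -> 1 / 8 * wgt R v <= mg (z - w t v).
  move=> vn Vz; have h : wgt R v / 4 <= mg (w t v) := w_ge' ht vn.
  have h2 : 2 <= wgt R v by rewrite wgtE -[2]/(1 + 1) lerD2r ler1n lt0n; apply: contraNneq vn => /mx_eq0 ->.
  have := mgBr (w t v) z; rewrite mgBC => h3.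
  have : mg z <= 1 / 4 := Vz.
  lra.
have sF k : sym (@wgt R) (fun=> V) (@allD R) 0 k 1 F.
  apply: sym_ext (@sym_lin _ _ _ _ (@allD R) 0 w1 dr0 k 1 (fun v => - ((v != (0, 0))%:R * w t v)) (fun v => (v != (0, 0))%:R) 16 (1 / 4) _ _ _).
  + by move=> v y; rewrite /F; ring.
  + move=> v; rewrite mgN mgM mgn expr1z wgtE; have := w_le v ht; have := mg_ge0 (w t v).
    by case: (v != _) => /=; rewrite ?mul1r ?mul0r; have : 0 <= (mx v)%:R :> R by []; lra.
  + by move=> v; rewrite mgn subr0 expr1z; have := w1 v; case: (v != _) => /=; lra.
  + by [].
have sA k : sym (@wgt R) (fun=> V) (@allD R) 0 k (-1) (fun v z => (F v z)^-1).
  apply: (@sym_inv _ _ _ _ _ 0 w1 k 1 F (1 / 8)); [by lra|move=> v|exact: sF].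
  rewrite /F; have [E|vn] := eqVneq v (0, 0); first by left => y; rewrite mul0r.
  by right => y Vy; rewrite expr1z [(~~ false)%:R * _]mul1r; exact: low.
have sI k : sym (@wgt R) (fun=> V) (@allD R) 0 k (-1) (fun v z => (w t v)^-1).
  apply: (@sym_cst _ _ _ _ _ _ _ _ _ 4) => v.
  have [->|vn] := eqVneq v (0, 0).
    by rewrite w0 invr0 mg0 mulr_ge0// exprz_ge0// ltW.
  have h := w_ge' ht vn.
  rewrite mgV exprN1 -[4]invrK -invfM lef_pV2 ?posrE; [lra| |].
    by apply: lt_le_trans h; have := p v; lra.
  by have := p v; lra.
have sZ k : sym (@wgt R) (fun=> V) (@allD R) 0 k 0 (fun _ z => z).
  apply: sym_ext (@sym_lin _ _ _ _ (@allD R) 0 w1 dr0 k 0 (fun=> 0) (fun=> 1) 1 (1 / 4) _ _ _).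
  + by move=> v y; rewrite add0r mul1r.
  + by move=> v; rewrite mg0 expr0z; lra.
  + by move=> v; rewrite mg1 subr0 expr0z; lra.
  + by [].
have sP k : sym (@wgt R) (fun=> V) (@allD R) 0 k 1 (fun v _ => pp R v).
  apply: (@sym_cst _ _ _ _ _ _ _ _ _ 8) => v; rewrite expr1z wgtE; have := pp_mx R v; lra.
have s1 : sym (@wgt R) (fun=> V) (@allD R) 0 0 (-3) (fun v z => (w t v)^-1 ^+ 2 * (F v z)^-1).
  exact: (symM w1 (symX w1 2 (sI 0%N)) (sA 0%N)).
have s2 : sym (@wgt R) (fun=> V) (@allD R) 0 0 (-3) (fun v z => 2 * ((F v z)^-1 ^+ 2 * (w t v)^-1) - z * ((F v z)^-1 ^+ 2 * (w t v)^-1 ^+ 2)).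
  apply: symB => //.
    exact: (sym_scal w1 2 (symM w1 (symX w1 2 (sA 0%N)) (sI 0%N))).
  apply: (@sym_weak _ _ _ _ _ _ w1 0 (-4)) => //.
  exact: (symM w1 (sZ 0%N) (symM w1 (symX w1 2 (sA 0%N)) (symX w1 2 (sI 0%N)))).
have s3 : sym (@wgt R) (fun=> V) (@allD R) 0 0 (-3) (fun v z => (F v z)^-1 ^+ 3).
  exact: (symX w1 3 (sA 0%N)).
have s4 : sym (@wgt R) (fun=> V) (@allD R) 0 0 (-3) (fun v z => pp R v * ((w t v)^-1 ^+ 2 * (F v z)^-1 ^+ 2 *
   ((-3) * z ^+ 2 + 2 * (z ^+ 3 * (w t v)^-1)))).
  apply: (symM w1 (d := 1) (e := -4)); first exact: sP.
  apply: (symM w1 (d := -4) (e := 0)).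
    exact: (symM w1 (symX w1 2 (sI 0%N)) (symX w1 2 (sA 0%N))).
  apply: symD => //; first exact: (sym_scal w1 (-3) (symX w1 2 (sZ 0%N))).
  apply: (@sym_weak _ _ _ _ _ _ w1 0 (-1)) => //.
  exact: (sym_scal w1 2 (symM w1 (symX w1 3 (sZ 0%N)) (sI 0%N))).
have [K1 h1] := sym0_dec (sym_sym0 s1). have [K2 h2] := sym0_dec (sym_sym0 s2).
have [K3 h3] := sym0_dec (sym_sym0 s3). have [K4 h4] := sym0_dec (sym_sym0 s4).
have V0 : V 0 by rewrite /V mg0; lra.
have k1 : 0 <= K1 by exact: dec_ge0 (h1 0 (fun=> V0)).
have k2 : 0 <= K2 by exact: dec_ge0 (h2 0 (fun=> V0)).
have k3 : 0 <= K3 by exact: dec_ge0 (h3 0 (fun=> V0)).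
have k4 : 0 <= K4 by exact: dec_ge0 (h4 0 (fun=> V0)).
exists (9 * (K1 + K2 + 2 * K3 + K4)) => z zn Vz.
have d1 := h1 z (fun=> Vz). have d2 := h2 z (fun=> Vz).
have d3 := h3 z (fun=> Vz). have d4 := h4 z (fun=> Vz).
have nz v : v != (0, 0) -> z - w t v != 0.
  by move=> vn; rewrite -mg_gt0; apply: lt_le_trans (low v z vn Vz); have := p v; lra.
have Fv v : v != (0, 0) -> F v z = z - w t v by move=> h; rewrite /F h mul1r.
have F00 : F (0, 0) z = 0 by rewrite /F eqxx mul0r.
have Ez : zeta t z = z^-1 + z ^+ 2 * lsum (fun v => (w t v)^-1 ^+ 2 * (F v z)^-1).
  apply: lsumE; apply: haslsum_eq (haslsumD (haslsum_delta z^-1) (haslsumZ (z ^+ 2) (dec_haslsum d1))) => v.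
  have [->|vn] := eqVneq v (0, 0).
    by rewrite mul1r F00 /t_zeta w0 subr0 invr0; ring.
  by rewrite mul0r Fv//= /t_zeta; field; rewrite nz// w_neq0.
have Ep : wp t z = z^-1 ^+ 2 + z * lsum (fun v => 2 * ((F v z)^-1 ^+ 2 * (w t v)^-1) - z * ((F v z)^-1 ^+ 2 * (w t v)^-1 ^+ 2)).
  apply: lsumE; apply: haslsum_eq (haslsumD (haslsum_delta (z^-1 ^+ 2)) (haslsumZ z (dec_haslsum d2))) => v.
  have [->|vn] := eqVneq v (0, 0).
    by rewrite mul1r F00 /t_wp w0 subr0 invr0; ring.
  by rewrite mul0r Fv//= /t_wp; field; rewrite nz// w_neq0.
have E3 : lsum (fun v => (z - w t v)^-1 ^+ 3) = z^-1 ^+ 3 + lsum (fun v => (F v z)^-1 ^+ 3).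
  apply: lsumE; apply: haslsum_eq (haslsumD (haslsum_delta (z^-1 ^+ 3)) (dec_haslsum d3)) => v.
  have [->|vn] := eqVneq v (0, 0).
    by rewrite mul1r F00 w0 invr0 subr0; ring.
  by rewrite Fv//= mul0r add0r.
have E4 : zt t z = lsum (fun v => pp R v * ((w t v)^-1 ^+ 2 * (F v z)^-1 ^+ 2 *
   ((-3) * z ^+ 2 + 2 * (z ^+ 3 * (w t v)^-1)))).
  apply: lsumE; apply: haslsum_eq (dec_haslsum d4) => v.
  have [->|vn] := eqVneq v (0, 0).
    by rewrite F00 /t_zt pp0 !mul0r.
  by rewrite Fv//= /t_zt; field; rewrite nz// w_neq0.
have b1 := lsum_bound d1. have b2 := lsum_bound d2.
have b3 := lsum_bound d3. have b4 := lsum_bound d4.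
have z0 := mg_ge0 z.
clear -k1 k2 k3 k4 b1 b2 b3 b4 z0 Ez Ep E3 E4.
split.
- rewrite Ez addrAC subrr add0r mgM mgX mulrC ler_wpM2r ?exprn_ge0//; lra.
- rewrite Ep addrAC subrr add0r mgM mulrC ler_wpM2r//; lra.
- rewrite /wp1 E3 (_ : _ + _ = (-2) * lsum (fun v => (F v z)^-1 ^+ 3)); last by ring.
  by rewrite mgM mgN mgn; lra.
- rewrite E4; lra.
Qed.
End FixedT.
End EllipticBasics.

(** * Quasi-periodic functions and the Frobenius-Stickelberger relation *)

Section Liouville.
Variable R : realType.
Local Notation C := R[i].
Local Notation pt := (int * int)%type.
Local Notation Re := (@complex.Re R).
Local Notation Im := (@complex.Im R).
Implicit Types (t x z : C) (v : pt).

Lemma locfin_near_punct (S : C -> Prop) z : locfin S -> near0 (@allD R) (fun h => h != 0 -> ~ S (z + h)).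
Proof.
move=> /(_ (mg z + 1))[l hl]; have [r r0 hr] := finite_sep l z.
exists (Num.min r 1); first by rewrite lt_min r0 ltr01.
move=> h _; rewrite lt_min => /andP[hr1 h1] hn Sh.
have /hr : z + h \in l by apply: hl => //; apply: (le_trans (mgD _ _)); rewrite lerD2l ltW.
rewrite addrAC subrr add0r leNgt hr1 => /(_ _)/notF; apply.
by rewrite -subr_eq0 addrAC subrr add0r.
Qed.

Lemma locfin_or (S S' : C -> Prop) : locfin S -> locfin S' -> locfin (fun z => S z \/ S' z).
Proof.
move=> h h' r; have [l hl] := h r; have [l' hl'] := h' r.
by exists (l ++ l') => z [/hl|/hl'] H /H; rewrite mem_cat => ->; rewrite ?orbT.
Qed.

Lemma locfin_shift (S : C -> Prop) c : locfin S -> locfin (fun z => S (z + c)).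
Proof.
move=> /[swap] r /(_ (r + mg c))[l hl]; exists [seq z - c | z <- l] => z Sz zr.
apply/mapP; exists (z + c); last by rewrite addrK.
by apply: hl => //; apply: (le_trans (mgD _ _)); rewrite lerD2r.
Qed.

Lemma coords x : exists2 ab : R * R, x = ab.1%:C * om R + ab.2%:C * omb R & ab.1 + ab.2 = - (2 / 7) * Re x.
Proof.
have s0 : s7 R != 0 by rewrite gt_eqF// s7_gt0.
exists ((- (2 / 7) * Re x + 2 / s7 R * Im x) / 2, (- (2 / 7) * Re x - 2 / s7 R * Im x) / 2); last by rewrite /=; field.
by apply/eqP; rewrite eq_complex /=; apply/andP; split; apply/eqP; field.
Qed.

Section FixedT.
Variable t : C.
Hypothesis ht : mg t <= 1 / 2.

(** Rounding down the real coordinates leaves a vector of modulus at most 4 + 4, at most doubled by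
    T_t. *)
Lemma reduce_mod z : exists v, mg (z - w t v) <= 16 /\ (mx v)%:R <= 2 * mg z + 8.
Proof.
have [[a b] /= E _] := coords (Ti t z).
pose v : pt := (Num.floor a, Num.floor b).
have unit (c : R) : mg (c%:C - (Num.floor c)%:~R) <= 1.
  rewrite (intC R (Num.floor c)) -rmorphB mgR; have /andP[h1 h2] := floor_itv c.
  by rewrite ger0_norm ?subr_ge0// lerBlDr ltW// addrC -intrD1.
have [g1 g2] := mg_om R.
have px : mg (Ti t z - pp R v) <= 8.
  have -> : Ti t z - pp R v = (a%:C - (Num.floor a)%:~R) * om R + (b%:C - (Num.floor b)%:~R) * omb R.
    by rewrite E /pp /=; ring.
  apply: (le_trans (mgD _ _)); rewrite !mgM.
  have h1 : mg (a%:C - (Num.floor a)%:~R) * mg (om R) <= 1 * 4 by apply: ler_pM; rewrite ?mg_ge0.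
  have h2 : mg (b%:C - (Num.floor b)%:~R) * mg (omb R) <= 1 * 4 by apply: ler_pM; rewrite ?mg_ge0.
  lra.
exists v; split.
  rewrite -{1}(TiK z ht) /w -TB; have := T_le (Ti t z - pp R v) ht; lra.
have h1 := mx_pp R v; have h2 := mgBr (pp R v) (Ti t z); rewrite mgBC in h2.
have h3 := T_ge (Ti t z) ht; rewrite TiK// in h3; lra.
Qed.

Section Periods.
Variables (S : C -> Prop) (H : C -> C) (c1 c2 : C).
Hypothesis Sw : forall z v, S (z + w t v) <-> S z.
Hypothesis H1 : forall z, ~ S z -> H (z + q1 t) = H z + c1.
Hypothesis H2 : forall z, ~ S z -> H (z + q2 t) = H z + c2.

Lemma period_int (q c : C) : (forall z (n : int), S (z + n%:~R * q) <-> S z) ->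
  (forall z, ~ S z -> H (z + q) = H z + c) -> forall (n : int) z, ~ S z -> H (z + n%:~R * q) = H z + n%:~R * c.
Proof.
move=> Sn Hq.
have nat_case (n : nat) z : ~ S z -> H (z + n%:~R * q) = H z + n%:~R * c.
  move=> hz; elim: n => [|n IH]; first by rewrite !mul0r !addr0.
  rewrite (_ : n.+1%:~R = n%:~R + 1 :> C); last by rewrite -!pmulrn mulrSr.
  rewrite !mulrDl !mul1r !addrA Hq ?IH//.
  by rewrite (Sn z n).
move=> [n|n] z hz; first exact: nat_case.
have hz' : ~ S (z + (Negz n)%:~R * q) by rewrite Sn.
have := nat_case n.+1 _ hz'; rewrite NegzE !rmorphN /= -addrA -mulrDl addNr mul0r addr0 => ->.
by rewrite !mulNr addrK.
Qed.

Lemma period_w v z : ~ S z -> H (z + w t v) = H z + (v.1%:~R * c1 + v.2%:~R * c2).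
Proof.
move=> hz; rewrite wE !addrA.
have S1 x (n : int) : S (x + n%:~R * q1 t) <-> S x.
  by have := Sw x (n, 0); rewrite wE /= mul0r addr0.
have S2 x (n : int) : S (x + n%:~R * q2 t) <-> S x.
  by have := Sw x (0, n); rewrite wE /= mul0r add0r.
rewrite (period_int S2 H2); last by rewrite S1.
by rewrite (period_int S1 H1).
Qed.

Hypothesis Sfin : locfin S.
Hypothesis Hd : forall z, ~ S z -> exists d, dv (@allD R) H z d.
Hypothesis Hb : forall z, S z -> exists K r, 0 < r /\ forall h, mg h < r -> ~ S (z + h) -> mg (H (z + h)) <= K.

(** Reduction modulo the lattice gives linear growth, so [liouville_linear] applies, and the
    increments determine the slope. The elliptic identities below reduce to this: it remains to
    bound a function near its singularities. *)
Lemma elliptic_affine : exists a b, [/\ forall z, ~ S z -> H z = b + a * z, a * q1 t = c1 & a * q2 t = c2].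
Proof.
have [z1 hz1] : exists z, ~ S z.
  have [r r0 hr] := locfin_near_punct 0 Sfin.
  have [h [_ h1 h2]] := @thick_all R r r0; exists (0 + h); exact: hr.
pose H' z := if `[< S z >] then 0 else H z.
have [K HK] : exists K, forall z, insq 0 16 z -> mg (H' z) <= K.
  apply: locbounded_sq => // z _.
  have [/asboolP Sz|/asboolP Sz] := boolP `[< S z >].
    have [K [r [r0 hK]]] := Hb Sz; exists (Num.max 0 K), r; split => // h hr.
    rewrite /H'; case: asboolP => hS; first by rewrite mg0 le_max lexx.
    by rewrite le_max hK ?orbT.
  have [d /dv_locbounded[K [r [r0 hK]]]] := Hd Sz.
  exists (Num.max 0 K), r; split => // h hr.
  rewrite /H'; case: asboolP => hS; first by rewrite mg0 le_max lexx.
  by rewrite le_max hK ?orbT.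
have lin z : ~ S z -> mg (H z) <= (K + 8 * (mg c1 + mg c2)) + (2 * (mg c1 + mg c2)) * mg z.
  move=> hz; have [v [v1 v2]] := reduce_mod z.
  have hz' : ~ S (z - w t v) by rewrite -(Sw _ v) subrK.
  have := period_w v hz'; rewrite subrK => ->.
  have b1 : mg (H (z - w t v)) <= K.
    have := HK (z - w t v); rewrite /H'; case: asboolP => // _; apply.
    by apply: insq_mg; rewrite subr0.
  have [m1 m2] := mx_ge R v; rewrite -!mgR -!intC in m1 m2.
  have b2 : mg (v.1%:~R * c1 + v.2%:~R * c2) <= (2 * mg z + 8) * (mg c1 + mg c2).
    apply: (le_trans (mgD _ _)); rewrite !mgM mulrDr.
    by apply: lerD; rewrite ler_wpM2r ?mg_ge0//; [apply: le_trans m1 _|apply: le_trans m2 _].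
  apply: (le_trans (mgD _ _)); lra.
have [a Ha] := liouville_linear Sfin Hd lin hz1.
have E z : ~ S z -> H z = (H z1 - a * z1) + a * z by move=> /Ha ->; ring.
exists a, (H z1 - a * z1); split => //.
  have hq : ~ S (z1 + q1 t) by rewrite Sw.
  have := H1 hz1; rewrite (E _ hq) (E _ hz1) => /eqP; rewrite -subr_eq0 => /eqP h.
  by apply/eqP; rewrite -subr_eq0 -h; apply/eqP; ring.
have hq : ~ S (z1 + q2 t) by rewrite Sw.
have := H2 hz1; rewrite (E _ hq) (E _ hz1) => /eqP; rewrite -subr_eq0 => /eqP h.
  by apply/eqP; rewrite -subr_eq0 -h; apply/eqP; ring.
Qed.
End Periods.

Lemma q1_neq0 : q1 t != 0. Proof. exact: w_neq0. Qed.

Section FrobeniusStickelberger.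
Variable y : C.
Hypothesis hy : ~ inL t y.
Let S x := inL t x \/ inL t (x + y).
Let G x := zeta t x + zeta t y - zeta t (x + y).
Let Phi x := G x ^+ 2 - (wp t x + wp t y + wp t (x + y)).

Let Sw z v : S (z + w t v) <-> S z.
Proof. by rewrite /S addrAC !inL_shift. Qed.

Let Sfin : locfin S.
Proof. by apply: locfin_or; [exact: inL_locfin|apply: locfin_shift; exact: inL_locfin]. Qed.

Let notS x : ~ S x -> ~ inL t x /\ ~ inL t (x + y).
Proof. by rewrite /S => h; split=> ?; apply: h; [left|right]. Qed.

Let dvG x : ~ S x -> dv (@allD R) G x (- wp t x + wp t (x + y)).
Proof.
move=> /notS[h1 h2].
apply: (dv_eq (dvB (dvD (dv_zeta ht h1) (dv_cst _ _ _)) (dv_shift (dv_zeta ht h2)))); ring.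
Qed.

Let dvWp x : ~ S x -> dv (@allD R) (fun x => wp t x + wp t y + wp t (x + y)) x (wp1 t x + wp1 t (x + y)).
Proof.
move=> /notS[h1 h2].
apply: (dv_eq (dvD (dvD (dv_wp ht h1) (dv_cst _ _ _)) (dv_shift (dv_wp ht h2)))); ring.
Qed.

Let Phi_per x : ~ S x -> Phi (x + q1 t) = Phi x /\ Phi (x + q2 t) = Phi x.
Proof.
move=> /notS[h1 h2]; have [e1 e2] := zeta_shift ht h1 h2.
have [a1 a2] := wp_shift ht h1; have [b1 b2] := wp_shift ht h2.
rewrite /Phi /G !(addrAC x _ y) a1 a2 b1 b2.
split; congr (_ ^+ 2 - _).
  by rewrite -(subrK (zeta t x) (zeta t (x + q1 t))) e1; ring.
by rewrite -(subrK (zeta t x) (zeta t (x + q2 t))) e2; ring.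
Qed.

(** The singularities lie over 0 and - y; this symmetry exchanges them, so that one expansion, at 0,
    suffices. *)
Let Phi_sym x : ~ S x -> Phi (- x - y) = Phi x.
Proof.
move=> /notS[h1 h2]; rewrite /Phi /G subrK -opprD !(zetaN ht, wpN ht)//.
by congr (_ - _); ring.
Qed.

(** A and B are the errors of zeta and wp at 0, E is the first-order remainder of zeta at y and F
    the increment of wp at y. The poles of G^2 and wp cancel, and what is left tends to 0; this also
    fixes the constant in [FS]. *)
Let Phi_lim (e : R) : 0 < e -> near0 (@allD R) (fun h => h != 0 -> mg (Phi h) <= e).
Proof.
move=> e0; have [K hK] := near_zero ht.
have K0 : 0 <= K.
  have q : (1 / 4)%:C != 0 :> C by rewrite -mg_gt0 mgR ger0_norm; lra.
  have [||_ _ h _] := hK (1 / 4)%:C => //; first by rewrite mgR ger0_norm; lra.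
  exact: le_trans (mg_ge0 _) h.
pose M := mg (wp t y) + 1.
have M0 : 1 <= M by rewrite /M lerDr mg_ge0.
pose r := Num.min 1 (e / (100 * (K + M + 1) ^+ 2)).
have D0 : 0 < 100 * (K + M + 1) ^+ 2 by rewrite mulr_gt0// exprn_gt0//; lra.
have e8 : 0 < e / 8 by lra.
have e81 : 0 < Num.min 1 (e / 8) by rewrite lt_min e8 ltr01.
have n1 := dv_zeta ht hy e81; have n2 := dv_cont (dv_wp ht hy) e8.
have n3 : near0 (@allD R) (fun h => mg h < 1 / 4) by apply: near0_lt; lra.
have n4 : near0 (@allD R) (fun h => mg h < e / (100 * (K + M + 1) ^+ 2)) by apply: near0_lt; rewrite divr_gt0.
apply: near0W (near0_and (near0_and n1 n2) (near0_and n3 n4)) => h _ [[]].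
set E := _ - _ - _ => hE; set F := _ - _ => hF [h4 h5] hn.
have [A1 A2 _ _] := hK h hn (ltW h4).
move: A1 A2; set A := _ - _ => hA; set B := _ - _ => hB.
have -> : Phi h = 2 * ((A - E) * h^-1) + (A + h * wp t y - E) ^+ 2 - B - F.
  by rewrite /Phi /G /A /E /B /F (addrC h y); field.
have h0 := mg_ge0 h; have hp : 0 < mg h by rewrite mg_gt0.
have hE1 : mg E <= mg h.
  by apply: le_trans hE _; rewrite ler_piMl// ge_min lexx.
have hE2 : mg E <= e / 8 * mg h.
  by apply: le_trans hE _; rewrite ler_wpM2r// ge_min lexx orbT.
have hA1 : mg A <= K * mg h.
  apply: (le_trans hA); rewrite expr2 mulrA ler_piMr ?mulr_ge0//; lra.
have b1 : mg (2 * ((A - E) * h^-1)) <= 2 * (K * mg h + e / 8).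
  rewrite !mgM mgn mgV ler_wpM2l// ler_pdivrMr// mulrDl.
  by apply: (le_trans (mgB _ _)); apply: lerD => //; rewrite -mulrA -expr2.
have b2 : mg (A + h * wp t y - E) <= (K + M + 1) * mg h.
  apply: (le_trans (mgB _ _)); rewrite mulrDl mul1r; apply: lerD => //.
  apply: (le_trans (mgD _ _)); rewrite mulrDl; apply: lerD => //.
  by rewrite mgM mulrC ler_wpM2r// /M lerDl.
have b3 : mg ((A + h * wp t y - E) ^+ 2) <= (K + M + 1) ^+ 2 * mg h.
  rewrite mgX; apply: (@le_trans _ _ (((K + M + 1) * mg h) ^+ 2)).
    by rewrite ler_sqr ?nnegrE ?mg_ge0// mulr_ge0//; lra.
  by rewrite exprMn ler_wpM2l ?sqr_ge0// expr2 ler_piMl//; lra.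
have b4 : (K + M + 1) ^+ 2 * mg h <= e / 100.
  have : (100 * (K + M + 1) ^+ 2) * mg h <= e by rewrite mulrC -ler_pdivlMr//; exact: ltW.
  lra.
have b5 : K * mg h <= (K + M + 1) ^+ 2 * mg h.
  rewrite ler_wpM2r//; have -> : (K + M + 1) ^+ 2 = K * 1 + (K * (K + M) + (K + M + 1) * (M + 1)) by ring.
  have : 0 <= K * (K + M) by rewrite mulr_ge0//; lra.
  have : 0 <= (K + M + 1) * (M + 1) by rewrite mulr_ge0//; lra.
  lra.
apply: (le_trans (mgB _ _)); have := mgB (2 * ((A - E) * h^-1) + (A + h * wp t y - E) ^+ 2) B.
have := mgD (2 * ((A - E) * h^-1)) ((A + h * wp t y - E) ^+ 2).
clearbody A B E F M; lra.
Qed.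

Let Phi_bd z : S z -> exists K r, 0 < r /\ forall h, mg h < r -> ~ S (z + h) -> mg (Phi (z + h)) <= K.
Proof.
have [r r0 hr] := Phi_lim ltr01.
have per x v : ~ S x -> Phi (x + w t v) = Phi x.
  move=> hx; rewrite (@period_w S Phi 0 0 Sw _ _ v) ?mulr0 ?addr0// => u /Phi_per[e1 e2].
    by rewrite e1 addr0.
  by rewrite e2 addr0.
have S0 : S 0 by left; exists (0, 0); rewrite w0.
have Sn x : S x -> S (- x - y).
  by rewrite /S subrK -opprD !inL_opp => -[]; [right|left].
move=> [[v ->]|[v Ev]]; exists 1, r; split => // h hr1.
  rewrite addrC Sw => hh; rewrite per//; apply: hr => //.
  by apply: contra_notN hh => /eqP ->.
have -> : z = w t v - y by rewrite -Ev addrK.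
have -> : w t v - y + h = (h - y) + w t v by ring.
rewrite Sw => hh; rewrite per// -[h]opprK.
have hh' : ~ S (- h) by move=> /Sn; rewrite opprK.
rewrite Phi_sym//; apply: hr => //; first by rewrite mgN.
by apply: contra_notN hh' => /eqP ->.
Qed.

Lemma FS x : ~ inL t x -> ~ inL t (x + y) ->
  (zeta t x + zeta t y - zeta t (x + y)) ^+ 2 = wp t x + wp t y + wp t (x + y).
Proof.
move=> hx hxy; have nS : ~ S x by case.
have [|||a [b [E a1 _]]] := @elliptic_affine S Phi 0 0 Sw _ _ Sfin _ Phi_bd.
- by move=> z /Phi_per[-> _]; rewrite addr0.
- by move=> z /Phi_per[_ ->]; rewrite addr0.
- by move=> z hz; eexists; exact: (dvB (dvX 1 (dvG hz)) (dvWp hz)).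
have a0 : a = 0 by move/eqP: a1; rewrite mulf_eq0 (negbTE q1_neq0) orbF => /eqP.
have b0 : b = 0.
  apply/eqP; rewrite -mg_eq0 -[_ == _]negbK; apply/negP => bn.
  have bp : 0 < mg b / 2 by rewrite divr_gt0// lt_def bn mg_ge0.
  have [r r0 hr] := near0_and (Phi_lim bp) (locfin_near_punct 0 Sfin).
  have [h [_ hr1 hn]] := @thick_all R r r0.
  have [/(_ hn) p1 /(_ hn)] := hr h I hr1; rewrite add0r => /E E2.
  by move: p1; rewrite E2 a0 mul0r addr0; lra.
by have := E x nS; rewrite a0 b0 mul0r addr0 => /eqP; rewrite subr_eq0 => /eqP.
Qed.

Let near_notS x : ~ S x -> near0 (@allD R) (fun h => ~ S (x + h)).
Proof. exact: locfin_near. Qed.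

(** The x-derivative of [FS], and [FS2] is the next one; they supply wp' and wp'' at the torsion
    points. *)
Lemma FS1 x : ~ inL t x -> ~ inL t (x + y) ->
  2 * (zeta t x + zeta t y - zeta t (x + y)) * (wp t (x + y) - wp t x) = wp1 t x + wp1 t (x + y).
Proof.
move=> hx hxy; have nS : ~ S x by case.
have d1 := dvX 1 (dvG nS).
have d2 : dv (@allD R) (fun x => G x ^+ 2) x (wp1 t x + wp1 t (x + y)).
  apply: dv_near (dvWp nS); first by rewrite /G FS.
  by apply: near0W (near_notS nS) => h _ /notS[? ?]; rewrite /G FS.
by rewrite -(dv_uniq (@thick_all R) d1 d2) /G; ring.
Qed.

Lemma FS2 x : ~ inL t x -> ~ inL t (x + y) ->
  2 * (wp t (x + y) - wp t x) ^+ 2 + 2 * (zeta t x + zeta t y - zeta t (x + y)) * (wp1 t (x + y) - wp1 t x)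
  = wp2 t x + wp2 t (x + y).
Proof.
move=> hx hxy; have nS : ~ S x by case.
have d1 := dvD (dv_wp1 ht hx) (dv_shift (dv_wp1 ht hxy)).
have d0 := dvM (dvZ 2 (dvG nS)) (dvB (dv_shift (dv_wp ht hxy)) (dv_wp ht hx)).
have d2 : dv (@allD R) (fun x => wp1 t x + wp1 t (x + y)) x
    (2 * (- wp t x + wp t (x + y)) * (wp t (x + y) - wp t x) +
     2 * G x * (wp1 t (x + y) - wp1 t x)).
  apply: dv_near d0; first by rewrite -FS1.
  by apply: near0W (near_notS nS) => h _ /notS[? ?]; rewrite -FS1.
by rewrite (dv_uniq (@thick_all R) d1 d2) /G; ring.
Qed.
End FrobeniusStickelberger.
End FixedT.
End Liouville.

(** * Quasi-periods and derivatives in t *)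

Section QuasiPeriods.
Variable R : realType.
Local Notation C := R[i].
Local Notation pt := (int * int)%type.
Implicit Types (t x z : C) (v : pt).

Lemma inMD x v : inM (x + pp R v) <-> inM x.
Proof.
split=> -[v' E]; last by exists (v'.1 + v.1, v'.2 + v.2); rewrite ppD E.
by exists (v'.1 - v.1, v'.2 - v.2); rewrite (ppD R v' (- v.1, - v.2)) ppN -E addrK.
Qed.

Lemma inMN x : inM (- x) <-> inM x.
Proof. by split=> -[v E]; exists (- v.1, - v.2); rewrite ppN -E ?opprK. Qed.

Lemma inM_double x : inM x -> inM (2 * x).
Proof. by move=> [v ->]; exists (v.1 + v.1, v.2 + v.2); rewrite ppD; ring. Qed.

Lemma omE : om R = pp R (1, 0). Proof. by rewrite /pp /= mul0r addr0 mul1r. Qed.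
Lemma ombE : omb R = pp R (0, 1). Proof. by rewrite /pp /= mul0r add0r mul1r. Qed.

Lemma half_notinM v : odd `|v.1|%N || odd `|v.2|%N -> ~ inM (pp R v / 2).
Proof.
move=> ov [v' E].
have : pp R v = pp R (v'.1 + v'.1, v'.2 + v'.2).
  rewrite ppD -E; by field.
by move/pp_inj => E'; move: ov; rewrite E' /=; lia.
Qed.

Definition et1 t : C := 2 * zeta t (T t (om R / 2)).
Definition et2 t : C := 2 * zeta t (T t (omb R / 2)).
Definition dq : C := omb R ^+ 2 - om R ^+ 2.
(* zeta (z + T_t p) = zeta z + ee t * T_t p + ff t * p for p in M. *)
Definition ee t : C := (et1 t * omb R - et2 t * om R) / dq.
Definition ff t : C := (q1 t * et2 t - q2 t * et1 t) / dq.
Definition zd t x : C := zt t (T t x) + x * wp t (T t x).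
Definition et1' t : C := 2 * zd t (om R / 2).
Definition et2' t : C := 2 * zd t (omb R / 2).
Definition ee' t : C := (et1' t * omb R - et2' t * om R) / dq.
Definition ff' t : C := ((- om R * et2 t + q1 t * et2' t) - (- omb R * et1 t + q2 t * et1' t)) / dq.

Lemma dq_neq0 : dq != 0.
Proof.
have -> : dq = (omb R - om R) * (om R + omb R) by rewrite /dq; ring.
by rewrite om_sum mulf_neq0// subr_eq0 eq_sym om_neq.
Qed.

Lemma q1T t : q1 t = omb R - t * om R. Proof. by rewrite q1E /T conj_om. Qed.
Lemma q2T t : q2 t = om R - t * omb R. Proof. by rewrite q2E /T conj_omb. Qed.
(** The determinant of the periods against the basis of M does not depend on t, so Cramer's rule
    gives [ee] and [ff] with a constant denominator. *)
Lemma qdet t : q1 t * omb R - q2 t * om R = dq.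
Proof. by rewrite q1T q2T /dq; ring. Qed.

Lemma et1_lin t : ee t * q1 t + ff t * om R = et1 t.
Proof.
have n := dq_neq0; apply: (mulIf n); rewrite mulrDl /ee /ff.
rewrite (mulrAC _ (q1 t)) (mulrAC _ (om R)) !divfK// -(qdet t); ring.
Qed.

Lemma et2_lin t : ee t * q2 t + ff t * omb R = et2 t.
Proof.
have n := dq_neq0; apply: (mulIf n); rewrite mulrDl /ee /ff.
rewrite (mulrAC _ (q2 t)) (mulrAC _ (omb R)) !divfK// -(qdet t); ring.
Qed.

Lemma om2_notinM : ~ inM (om R / 2). Proof. by rewrite omE; apply: half_notinM. Qed.
Lemma omb2_notinM : ~ inM (omb R / 2). Proof. by rewrite ombE; apply: half_notinM. Qed.

Section FixedT.
Variable t : C.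
Hypothesis ht' : mg t < 1 / 2.
Let ht : mg t <= 1 / 2 := ltW ht'.

Lemma notinL x : ~ inM x -> ~ inL t (T t x). Proof. by rewrite inL_T. Qed.

(** Oddness of zeta evaluates the constant increment at minus half the period. *)
Lemma half_eta x z q : ~ inM (x / 2) -> q = T t x -> ~ inL t z ->
  (forall z1 z2, ~ inL t z1 -> ~ inL t z2 -> zeta t (z1 + q) - zeta t z1 = zeta t (z2 + q) - zeta t z2) ->
  zeta t (z + q) = zeta t z + 2 * zeta t (T t (x / 2)).
Proof.
move=> hx E hz H.
have h1 : ~ inL t (T t (x / 2)) by exact: notinL.
have h2 : ~ inL t (- T t (x / 2)) by rewrite inL_opp.
have := H _ _ hz h2; rewrite (zetaN ht h1) E.
have -> : - T t (x / 2) + T t x = T t (x / 2) by rewrite -TN -TD; congr (T t _); field.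
by move=> h; rewrite -[LHS](subrK (zeta t z)) h; ring.
Qed.

Lemma zeta_q1 z : ~ inL t z -> zeta t (z + q1 t) = zeta t z + et1 t.
Proof.
move=> hz; apply: half_eta => //; [exact: om2_notinM|exact: q1E|].
by move=> z1 z2 h1 h2; have [] := zeta_shift ht h1 h2.
Qed.

Lemma zeta_q2 z : ~ inL t z -> zeta t (z + q2 t) = zeta t z + et2 t.
Proof.
move=> hz; apply: half_eta => //; [exact: omb2_notinM|exact: q2E|].
by move=> z1 z2 h1 h2; have [] := zeta_shift ht h1 h2.
Qed.

Lemma zeta_w z v : ~ inL t z -> zeta t (z + w t v) = zeta t z + (ee t * w t v + ff t * pp R v).
Proof.
move=> hz.
rewrite (period_w (fun z v => inL_shift t z v) zeta_q1 zeta_q2 v hz).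
by rewrite -et1_lin -et2_lin wE /pp; ring.
Qed.

Lemma wp_w z v : ~ inL t z -> wp t (z + w t v) = wp t z.
Proof.
move=> hz; rewrite (@period_w _ t (inL t) (wp t) 0 0 (fun z v => inL_shift t z v) _ _ v _ hz) ?mulr0 ?addr0//.
  by move=> u hu; rewrite addr0; have [] := wp_shift ht hu.
by move=> u hu; rewrite addr0; have [] := wp_shift ht hu.
Qed.

Lemma wp1_w z v : ~ inL t z -> wp1 t (z + w t v) = wp1 t z.
Proof.
move=> hz; rewrite (@period_w _ t (inL t) (wp1 t) 0 0 (fun z v => inL_shift t z v) _ _ v _ hz) ?mulr0 ?addr0//.
  by move=> u hu; rewrite addr0; have [] := wp1_shift ht hu.
by move=> u hu; rewrite addr0; have [] := wp1_shift ht hu.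
Qed.

Lemma inL_near z : ~ inL t z -> near0 (@allD R) (fun h => ~ inL t (z + h)).
Proof. by move=> hz; apply: locfin_near hz; exact: inL_locfin. Qed.

Lemma wp2_w z v : ~ inL t z -> wp2 t (z + w t v) = wp2 t z.
Proof.
move=> hz.
have hz' : ~ inL t (z + w t v) by rewrite inL_shift.
have d1 := dv_shift (dv_wp1 ht hz').
have d2 := dv_wp1 ht hz.
apply: (dv_uniq (@thick_all R) _ d2); apply: dv_near d1; first by rewrite wp1_w.
by apply: near0W (inL_near hz) => h _ hh; rewrite wp1_w.
Qed.

Lemma dv_ee : dv (@allD R) ee t (ee' t).
Proof.
have d1 := dvZ 2 (dvt_zeta ht' om2_notinM).
have d2 := dvZ 2 (dvt_zeta ht' omb2_notinM).
apply: (dv_eq (dvM (dvB (dvM d1 (dv_cst _ (omb R) t)) (dvM d2 (dv_cst _ (om R) t))) (dv_cst _ dq^-1 t))).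
by rewrite /ee' /et1' /et2' /zd; ring.
Qed.

Lemma dv_ff : dv (@allD R) ff t (ff' t).
Proof.
have d1 := dvZ 2 (dvt_zeta ht' om2_notinM).
have d2 := dvZ 2 (dvt_zeta ht' omb2_notinM).
have c1 : dv (@allD R) (@q1 R) t (- om R).
  by apply: dv_ext (dv_Tt (om R) t) => s; rewrite q1E.
have c2 : dv (@allD R) (@q2 R) t (- omb R).
  by apply: dv_ext (dv_Tt (omb R) t) => s; rewrite q2E.
apply: (dv_eq (dvM (dvB (dvM c1 d2) (dvM c2 d1)) (dv_cst _ dq^-1 t))).
by rewrite /ff' /et1' /et2' /et1 /et2 /zd; ring.
Qed.
End FixedT.

Lemma near_disc t : mg t < 1 / 2 -> near0 (@allD R) (fun h => mg (t + h) < 1 / 2).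
Proof.
move=> ht; apply: near0W (near0_lt (@allD R) (_ : 0 < 1 / 2 - mg t)); last by rewrite subr_gt0.
by move=> h _ hh; apply: (le_lt_trans (mgD _ _)); lra.
Qed.

Section FixedT2.
Variable t : C.
Hypothesis ht' : mg t < 1 / 2.
Let ht : mg t <= 1 / 2 := ltW ht'.

(** The t-derivative of [zeta_w] at the moving point T_t x. *)
Lemma zt_w z v : ~ inL t z -> zt t (z + w t v) = zt t z +
  (ee' t * w t v - ee t * pp R v + ff' t * pp R v - pp R v * wp t z).
Proof.
set x := Ti t z; set p := pp R v; rewrite -(TiK z ht) -/x => hz.
have hx : ~ inM x by rewrite -(inL_T x ht).
have hxp : ~ inM (x + p) by rewrite inMD.
have d1 := dvt_zeta ht' hxp.
have d2 := dvD (dvt_zeta ht' hx) (dvD (dvM (dv_ee ht') (dv_Tt p t)) (dvM (dv_ff ht') (dv_cst _ p t))).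
have d3 : dv (@allD R) (fun t => zeta t (T t (x + p))) t (zt t (T t x) + x * wp t (T t x) +
       (ee' t * T t p + ee t * - p + (ff' t * p + ff t * 0))).
  apply: dv_near d2; first by rewrite TD [RHS]zeta_w//; exact: notinL.
  apply: near0W (near_disc ht') => h _ hh; rewrite TD [RHS]zeta_w//; exact: notinL.
have := dv_uniq (@thick_all R) d1 d3.
rewrite TD wp_w// -/(w t v) => E.
by rewrite -[LHS](addrK ((x + p) * wp t (T t x))) E; ring.
Qed.

(* The t-derivative of Z satisfies 2 ff dZ = - (wp' + 2 Z (wp + ee)) because this
   function has constant increments along the lattice and no poles. *)
Definition JJ z : C := 2 * ff t * (zt t z - ee' t * z) + wp1 t z + 2 * (zeta t z - ee t * z) * (wp t z + ee t).

Lemma JJ_w z v : ~ inL t z -> JJ (z + w t v) = JJ z + 2 * ff t * ff' t * pp R v.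
Proof. by move=> hz; rewrite /JJ zt_w// zeta_w// wp_w// wp1_w//; ring. Qed.

Lemma JJ_dv z : ~ inL t z -> dv (@allD R) JJ z
  (2 * ff t * (ztz t z - ee' t) + wp2 t z - 2 * (wp t z + ee t) ^+ 2 + 2 * (zeta t z - ee t * z) * wp1 t z).
Proof.
move=> hz.
have l c := dvM (dv_cst (@allD R) c z) (dv_id (@allD R) z).
have d1 := dvZ (2 * ff t) (dvB (dv_zt ht hz) (l (ee' t))).
have d2 := dvM (dvZ 2 (dvB (dv_zeta ht hz) (l (ee t)))) (dvD (dv_wp ht hz) (dv_cst _ (ee t) z)).
by apply: (dv_eq (dvD (dvD d1 (dv_wp1 ht hz)) d2)); ring.
Qed.

Lemma near_zero_nneg : exists K : R, 0 <= K /\ forall z, z != 0 -> mg z <= 1 / 4 ->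
  [/\ mg (zeta t z - z^-1) <= K * mg z ^+ 2, mg (wp t z - z^-1 ^+ 2) <= K * mg z,
      mg (wp1 t z + 2 * z^-1 ^+ 3) <= K & mg (zt t z) <= K].
Proof.
have [K hK] := near_zero ht; exists K; split=> //.
have q : (1 / 4)%:C != 0 :> C by rewrite -mg_gt0 mgR ger0_norm; lra.
have [||_ _ h _] := hK (1 / 4)%:C => //; first by rewrite mgR ger0_norm; lra.
exact: le_trans (mg_ge0 _) h.
Qed.

(** The triple poles of wp' and of 2 zeta wp cancel. *)
Lemma JJ_near0 : exists K : R, forall h, h != 0 -> mg h <= 1 / 4 -> mg (JJ h) <= K.
Proof.
have [K [K0 hK]] := near_zero_nneg.
exists (2 * mg (ff t) * (K + mg (ee' t)) + (K + (2 * K + 2 * K + 2 * (K * K))) + 2 * mg (ee t) * (K + K + mg (ee t))).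
move=> h hn h4; have [A1 B1 C1 D1] := hK h hn h4.
move: A1 B1 C1; set A := _ - _ => hA; set B := _ - _ => hB; set E := _ + _ => hE.
have h0 : 0 < mg h by rewrite mg_gt0.
have -> : JJ h = 2 * ff t * (zt t h - ee' t * h) +
  (E + (2 * (B / h) + 2 * (A / h ^+ 2) + 2 * (A * B))) + 2 * ee t * (A - h * B - ee t * h).
  by rewrite /JJ /A /B /E; field.
have bA : mg A <= K.
  by apply: le_trans hA _; rewrite ler_piMr// exprn_ile1//; lra.
have bB : mg B <= K by apply: le_trans hB _; rewrite ler_piMr//; lra.
move: (ee t) (ee' t) (ff t) => e e' f.
have bh (c : C) : mg (c * h) <= mg c by rewrite mgM ler_piMr ?mg_ge0//; lra.
apply: (le_trans (mgD _ _)); apply: lerD.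
  apply: (le_trans (mgD _ _)); apply: lerD.
    rewrite !mgM mgn ler_wpM2l ?mulr_ge0 ?mg_ge0//.
    by apply: (le_trans (mgB _ _)); apply: lerD.
  apply: (le_trans (mgD _ _)); apply: lerD => //.
  apply: (le_trans (mgD _ _)); apply: lerD.
    apply: (le_trans (mgD _ _)); apply: lerD; rewrite !mgM mgn mgV ler_wpM2l//.
      by rewrite ler_pdivrMr.
    by rewrite mgX ler_pdivrMr ?exprn_gt0.
  by rewrite !mgM mgn ler_wpM2l//; apply: ler_pM; rewrite ?mg_ge0.
rewrite !mgM mgn ler_wpM2l ?mulr_ge0 ?mg_ge0//.
apply: (le_trans (mgB _ _)); apply: lerD => //.
apply: (le_trans (mgB _ _)); apply: lerD => //.
by rewrite mulrC; apply: le_trans (bh _) _.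
Qed.

Lemma bounded_translates (H : C -> C) (c1 c2 : C) K :
  (forall z, ~ inL t z -> H (z + q1 t) = H z + c1) ->
  (forall z, ~ inL t z -> H (z + q2 t) = H z + c2) ->
  (forall h, h != 0 -> mg h <= 1 / 4 -> mg (H h) <= K) ->
  forall z, inL t z -> exists K r, 0 < r /\ forall h, mg h < r -> ~ inL t (z + h) -> mg (H (z + h)) <= K.
Proof.
move=> h1 h2 hK z [v ->]; exists (K + mg (v.1%:~R * c1 + v.2%:~R * c2)), (1 / 4); split; first by lra.
move=> h h4; rewrite addrC inL_shift => hh.
rewrite (period_w (fun z v => inL_shift t z v) h1 h2 v hh).
apply: (le_trans (mgD _ _)); rewrite lerD2r; apply: hK; last exact: ltW.
by apply: contra_notN hh => /eqP ->; exists (0, 0); rewrite w0.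
Qed.

(** With c = 2 ff ff', [elliptic_affine] gives a slope a such that a * q1 = c * om and a * q2 = c *
    omb; [qdet] forces a = 0, hence c = 0. The remaining constant vanishes because [JJ] is odd. *)
Lemma JJ_eq0 : ff t * ff' t = 0 /\ forall z, ~ inL t z -> JJ z = 0.
Proof.
have p1 z : ~ inL t z -> JJ (z + q1 t) = JJ z + 2 * ff t * ff' t * om R.
  by move=> hz; rewrite omE -JJ_w// /q1.
have p2 z : ~ inL t z -> JJ (z + q2 t) = JJ z + 2 * ff t * ff' t * omb R.
  by move=> hz; rewrite ombE -JJ_w// /q2.
have [K hK] := JJ_near0.
have [z hz|a [b [E a1 a2]]] := elliptic_affine ht (fun z v => inL_shift t z v) p1 p2 (inL_locfin ht) _ (bounded_translates p1 p2 hK).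
  by eexists; exact: JJ_dv.
have a0 : a = 0.
  apply/eqP; have : a * dq = 0 by rewrite -(qdet t) mulrBr !mulrA a1 a2; ring.
  by move/eqP; rewrite mulf_eq0 (negbTE dq_neq0) orbF.
have f0 : ff t * ff' t = 0.
  move: a1; rewrite a0 mul0r => /esym/eqP; rewrite mulf_eq0.
  have /negbTE -> : om R != 0 by rewrite -mg_gt0 omE; apply: lt_le_trans (mx_pp R (1, 0)).
  by rewrite orbF -mulrA mulf_eq0 (eqr_nat _ 2 0) /= => /eqP.
split=> // z hz.
have hzN : ~ inL t (- z) by rewrite inL_opp.
have od : JJ (- z) = - JJ z.
  by rewrite /JJ (ztN ht)// (zetaN ht)// (wpN ht)// (wp1N ht)//; ring.
have := od; rewrite !E// a0 !mul0r !addr0 => bb.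
have : 2 * b = 0 by rewrite [2 * b](_ : _ = b - - b); [rewrite -bb subrr|ring].
by move/eqP; rewrite mulf_eq0 (eqr_nat _ 2 0) => /eqP.
Qed.

Lemma JJ'_eq0 z : ~ inL t z -> 2 * ff t * (ztz t z - ee' t) + wp2 t z - 2 * (wp t z + ee t) ^+ 2 + 2 * (zeta t z - ee t * z) * wp1 t z = 0.
Proof.
move=> hz; have [_ J0] := JJ_eq0; have d := JJ_dv hz.
apply: (dv_uniq (@thick_all R) d); apply: dv_near (dv_cst _ 0 z); first by rewrite J0.
by apply: near0W (inL_near ht' hz) => h _ hh; rewrite J0.
Qed.

Lemma halves_notinM x0 : ~ inM x0 -> forall n, ~ inM (x0 / 2 ^+ n).
Proof.
move=> hx; elim=> [|n IH]; first by rewrite expr0 divr1.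
by move/inM_double => h; apply: IH; move: h; congr inM; rewrite exprS; field.
Qed.

Lemma halving (Q : C -> Prop) x0 : ~ inM x0 -> (forall x, ~ inM x -> ~ inM (2 * x) -> Q (2 * x) -> Q x) ->
  Q x0 -> forall n, Q (x0 / 2 ^+ n).
Proof.
move=> hx h h0; elim=> [|n IH]; first by rewrite expr0 divr1.
have E : 2 * (x0 / 2 ^+ n.+1) = x0 / 2 ^+ n by rewrite exprS; field.
by apply: h; rewrite ?E//; exact: halves_notinM.
Qed.

(** The points T_t (x0 / 2^n) tend to the double pole at 0. Combined with [halving], this refutes
    identities that would make wp vanish at all of them. *)
Lemma wp_pole x0 : ~ inM x0 -> exists n, wp t (T t (x0 / 2 ^+ n)) != 0.
Proof.
move=> hx; have hn := halves_notinM hx.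
have [K [K0 hK]] := near_zero_nneg.
pose n := Num.truncn ((16 + 4 * K) * mg x0); exists n.
have n0 : (16 + 4 * K) * mg x0 < n.+1%:R by exact: truncnS_gt.
set z := T t _.
have nX : n.+1%:R <= 2 ^+ n :> R by rewrite -natrX ler_nat ltn_expl.
have X0 : 0 < 2 ^+ n :> R by rewrite exprn_gt0.
have zz : mg z * (16 + 4 * K) < 4.
  have h1 : mg z <= 2 * (mg x0 / 2 ^+ n).
    by have := T_le (x0 / 2 ^+ n) ht; rewrite mgM mgV mgX mgn.
  have h2 : mg x0 / 2 ^+ n * (16 + 4 * K) <= 1.
    by rewrite mulrAC ler_pdivrMr// mul1r mulrC; lra.
  apply: (@le_lt_trans _ _ (2 * (mg x0 / 2 ^+ n) * (16 + 4 * K))).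
    by rewrite ler_wpM2r//; lra.
  by rewrite -mulrA; lra.
have zn : z != 0.
  by apply: contra_notN (notinL ht' (hn n)) => /eqP; rewrite -/z => ->; exists (0, 0); rewrite w0.
have zp : 0 < mg z by rewrite mg_gt0.
have z4 : mg z <= 1 / 4.
  have : 0 <= mg z * (4 * K) by rewrite mulr_ge0//; lra.
  lra.
have [_ hB _ _] := hK z zn z4.
apply/eqP => E; move: hB; rewrite E sub0r mgN mgX mgV => hB.
have h1 : (mg z)^-1 ^+ 2 * mg z ^+ 2 <= K * mg z * mg z ^+ 2 by rewrite ler_wpM2r ?sqr_ge0.
move: h1; rewrite exprVn mulVf ?expf_neq0 ?gt_eqF// => h1.
have h2 : K * mg z <= 1.
  have : mg z * (16 + 4 * K) = 16 * mg z + 4 * (K * mg z) by ring.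
  lra.
have h3 : mg z ^+ 2 <= 1 / 4 * (1 / 4) by rewrite expr2; apply: ler_pM; lra.
have : K * mg z * mg z ^+ 2 <= 1 * (1 / 4 * (1 / 4)).
  by apply: ler_pM => //; rewrite ?mulr_ge0 ?sqr_ge0//; lra.
lra.
Qed.
End FixedT2.
End QuasiPeriods.

Lemma eq_by_sub (V : zmodType) (x y x' y' : V) : x' = y' -> x - y = x' - y' -> x = y.
Proof. by move=> -> /eqP; rewrite subrr subr_eq0 => /eqP. Qed.

(** * The constant [ff] and the M-periodic function Z *)

Section Division.
Variable R : realType.
Local Notation C := R[i].
Local Notation pt := (int * int)%type.
Implicit Types (t x z : C) (v : pt).

Lemma inM_int (k : int) : inM (k%:~R : C) -> (7 %| k)%Z.
Proof.
move=> [v]; rewrite ppE intC => /eqP; rewrite eq_complex /= => /andP[/eqP h1 /eqP h2].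
have s0 := s7_gt0 R.
have uv : v.1 = v.2.
  apply/eqP; rewrite -(eqr_int R) -subr_eq0; apply/eqP.
  move/esym/eqP: h2; rewrite mulf_eq0 mulf_eq0 (gt_eqF s0) invr_eq0 (eqr_nat _ 2 0) /= => /eqP //.
apply/dvdzP; exists (- v.1); apply/eqP; rewrite -(eqr_int R) h1 -uv rmorphM rmorphN /=.
by apply/eqP; field.
Qed.

Lemma n_notinM (n : nat) : ~~ (7 %| n)%N -> ~ inM (n%:R : C).
Proof. by move=> h /(@inM_int n%:Z); rewrite dvdzE /= (negbTE h). Qed.

Lemma seven : (7 : C) = pp R (-1, -1).
Proof. by rewrite /pp /= !rmorphN /= !mulN1r -opprD om_sum opprK. Qed.

Section FixedT.
Variable t : C.
Hypothesis ht' : mg t < 1 / 2.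
Let ht : mg t <= 1 / 2 := ltW ht'.
Let inS := fun z v => inL_shift t z v.

(* If f vanished, zeta z - e z would be elliptic and wp would be its square;
   halving a 2-torsion point repeatedly then contradicts the pole of wp. *)
Lemma ff_neq0 : ff t != 0.
Proof.
apply/eqP => f0.
pose Y z := zeta t z - ee t * z.
have Yw z v : ~ inL t z -> Y (z + w t v) = Y z.
  by move=> hz; rewrite /Y zeta_w// f0; ring.
have YN z : ~ inL t z -> Y (- z) = - Y z by move=> hz; rewrite /Y (zetaN ht hz); ring.
pose Q z := Y z ^+ 2 - wp t z.
have Q1 z : ~ inL t z -> Q (z + q1 t) = Q z + 0.
  by move=> hz; rewrite /Q /q1 Yw// wp_w// addr0.
have Q2 z : ~ inL t z -> Q (z + q2 t) = Q z + 0.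
  by move=> hz; rewrite /Q /q2 Yw// wp_w// addr0.
have [K [K0 hK]] := near_zero_nneg ht'.
have Qb h : h != 0 -> mg h <= 1 / 4 -> mg (Q h) <= 2 * (K + mg (ee t)) + (K + mg (ee t)) ^+ 2 + K.
  move=> hn h4; have [A1 B1 _ _] := hK h hn h4; move: A1 B1.
  set A := _ - _ => hA; set B := _ - _ => hB.
  have h0 : 0 < mg h by rewrite mg_gt0.
  have -> : Q h = 2 * ((A - ee t * h) / h) + (A - ee t * h) ^+ 2 - B.
    by rewrite /Q /Y /A /B; field.
  move: (ee t) => e.
  have b1 : mg (A - e * h) <= (K + mg e) * mg h.
    apply: (le_trans (mgB _ _)); rewrite mulrDl mgM lerD2r; apply: (le_trans hA).
    by rewrite expr2 mulrA ler_piMr ?mulr_ge0//; lra.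
  have p : 0 <= K + mg e by have := mg_ge0 e; lra.
  apply: (le_trans (mgB _ _)); apply: lerD; last by apply: (le_trans hB); rewrite ler_piMr//; lra.
  apply: (le_trans (mgD _ _)); apply: lerD.
    by rewrite mgM mgn mgM mgV ler_wpM2l// ler_pdivrMr.
  rewrite mgX ler_sqr ?nnegrE ?mg_ge0//; apply: (le_trans b1); rewrite ler_piMr//; lra.
have dQ z : ~ inL t z -> exists d, dv (@allD R) Q z d.
  move=> hz; eexists; apply: (dvB (dvX 1 (dvB (dv_zeta ht hz) _)) (dv_wp ht hz)).
  exact: (dvM (dv_cst _ _ _) (dv_id _ _)).
have [k kE] : exists k, forall z, ~ inL t z -> Y z ^+ 2 - wp t z = k.
  have [a [b [E a1 _]]] := elliptic_affine ht inS Q1 Q2 (inL_locfin ht) dQ (bounded_translates Q1 Q2 Qb).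
  exists b => z hz; rewrite -/(Q z) (E z hz).
  by move/eqP: a1; rewrite mulf_eq0 (negbTE (q1_neq0 ht)) orbF => /eqP ->; rewrite mul0r addr0.
have FSY x y : ~ inL t x -> ~ inL t y -> ~ inL t (x + y) ->
    (Y x + Y y - Y (x + y)) ^+ 2 = wp t x + wp t y + wp t (x + y).
  move=> hx hy hxy; rewrite -(FS ht hy hx hxy) /Y; congr (_ ^+ 2); ring.
have tor v : odd `|v.1|%N || odd `|v.2|%N -> ~ inL t (T t (pp R v / 2)) /\ Y (T t (pp R v / 2)) = 0.
  move=> ov; have hz := notinL ht' (half_notinM ov); split=> //.
  have hzN : ~ inL t (- T t (pp R v / 2)) by rewrite inL_opp.
  have := Yw _ v hzN; rewrite YN//.
  have -> : - T t (pp R v / 2) + w t v = T t (pp R v / 2).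
    by rewrite /w -TN -TD; congr (T t _); field.
  set y := Y _ => E; have : 2 * y = 0 by rewrite (_ : 2 * y = y - - y); [rewrite {1}E subrr|ring].
  by move/eqP; rewrite mulf_eq0 (eqr_nat _ 2 0) => /eqP.
(* At the three half-periods Y is 0 and wp is - k, so the relation between them reads 3 k = 0. *)
have k0 : k = 0.
  have [l1 y1] := tor (1, 0) isT; have [l2 y2] := tor (0, 1) isT; have [l3 y3] := tor (1, 1) isT.
  have E3 : T t (pp R (1, 0) / 2) + T t (pp R (0, 1) / 2) = T t (pp R (1, 1) / 2).
    by rewrite -TD -mulrDl -ppD.
  have := FSY _ _ l1 l2; rewrite E3 y1 y2 y3 => /(_ l3).
  have g1 := kE _ l1; have g2 := kE _ l2; have g3 := kE _ l3.
  move: g1 g2 g3; rewrite y1 y2 y3 => g1 g2 g3 g4.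
  have : 3 * k = 0.
    have -> : 3 * k = k + k + k by ring.
    rewrite -{1}g1 -{1}g2 -g3; move: g4; rewrite (_ : (0 + 0 - 0) ^+ 2 = 0 :> C); last by ring.
    move=> g4; apply: (eq_by_sub g4); ring.
  by move/eqP; rewrite mulf_eq0 (eqr_nat _ 3 0) => /eqP.
have wpE z : ~ inL t z -> wp t z = Y z ^+ 2.
  by move=> hz; apply/esym/eqP; rewrite -subr_eq0 kE// k0.
have [n /negP] := wp_pole ht' (@om2_notinM R); apply.
rewrite (wpE _ (notinL ht' (@halves_notinM R _ (@om2_notinM R) n))).
rewrite (@halving R (fun x => Y (T t x) = 0) _ (@om2_notinM R)) ?expr0n//; last by have [_] := tor (1, 0) isT; rewrite -omE.
move=> x hx h2 Y0.
have lx := notinL ht' hx; have l2 := notinL ht' h2.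
have E2 : T t x + T t x = T t (2 * x) by rewrite -TD mulrDl mul1r.
(* Since Y and wp vanish at 2 x, the relation reads 4 Y^2 = 2 Y^2. *)
have := FSY _ _ lx lx; rewrite E2 => /(_ l2); rewrite (wpE _ lx) (wpE _ l2) Y0 => E.
have : 2 * Y (T t x) ^+ 2 = 0.
  apply: (addrI (2 * Y (T t x) ^+ 2)); rewrite addr0.
  by transitivity ((Y (T t x) + Y (T t x) - 0) ^+ 2); [ring|rewrite E; ring].
by move/eqP; rewrite mulf_eq0 (eqr_nat _ 2 0) expf_eq0 /= => /eqP.
Qed.

Lemma ff'_eq0 : ff' t = 0.
Proof. by have [/eqP + _] := JJ_eq0 ht'; rewrite mulf_eq0 (negbTE ff_neq0) => /eqP. Qed.

(* The M-periodic, non-holomorphic correction of zeta. *)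
Definition ZZ t x : C := zeta t (T t x) - ee t * T t x - ff t * x.
Definition P0 t x : C := wp t (T t x).
Definition P1 t x : C := wp1 t (T t x).
Definition P2 t x : C := wp2 t (T t x).

Lemma ZZ_pp x v : ~ inM x -> [/\ ZZ t (x + pp R v) = ZZ t x, P0 t (x + pp R v) = P0 t x,
  P1 t (x + pp R v) = P1 t x & P2 t (x + pp R v) = P2 t x].
Proof.
move=> hx; have hz := notinL ht' hx.
rewrite /ZZ /P0 /P1 /P2 TD -/(w t v) zeta_w// wp_w// wp1_w// wp2_w//; split=> //; ring.
Qed.

Lemma wp2N z : ~ inL t z -> wp2 t (- z) = wp2 t z.
Proof.
move=> hz; have hzN : ~ inL t (- z) by rewrite inL_opp.
have d1 := dv_wp1 ht hzN.
have d2 := dv_comp (dvN (dv_id (@allD R) z)) d1.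
have d3 : dv (@allD R) (wp1 t) z (wp2 t (- z)).
  have d3 := dvN d2; rewrite mulrN1 opprK in d3.
  apply: dv_near d3 => //=; first by rewrite (wp1N ht)// opprK.
  by apply: near0W (inL_near ht' hz) => h _ hh; rewrite (wp1N ht)// opprK.
exact: (dv_uniq (@thick_all R) d3 (dv_wp1 ht hz)).
Qed.

Lemma ZZN x : ~ inM x -> [/\ ZZ t (- x) = - ZZ t x, P0 t (- x) = P0 t x,
  P1 t (- x) = - P1 t x & P2 t (- x) = P2 t x].
Proof.
move=> hx; have hz := notinL ht' hx.
rewrite /ZZ /P0 /P1 /P2 TN zetaN// wpN// wp1N// wp2N//; split=> //; ring.
Qed.

Lemma FSZ x y : ~ inM x -> ~ inM y -> ~ inM (x + y) -> let G := ZZ t x + ZZ t y - ZZ t (x + y) in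
  [/\ G ^+ 2 = P0 t x + P0 t y + P0 t (x + y),
      2 * G * (P0 t (x + y) - P0 t x) = P1 t x + P1 t (x + y) &
      2 * (P0 t (x + y) - P0 t x) ^+ 2 + 2 * G * (P1 t (x + y) - P1 t x) = P2 t x + P2 t (x + y)].
Proof.
move=> /(notinL ht') hx /(notinL ht') hy /(notinL ht'); rewrite TD => hxy G.
have -> : G = zeta t (T t x) + zeta t (T t y) - zeta t (T t x + T t y).
  by rewrite /G /ZZ TD; ring.
rewrite /P0 /P1 /P2 TD.
by split; [exact: FS|exact: FS1|exact: FS2].
Qed.

Lemma dv_ZZ x : ~ inM x -> exists2 d, dv (@allD R) ((ZZ)^~ x) t d &
  2 * ff t * d = - (P1 t x + 2 * ZZ t x * (P0 t x + ee t)).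
Proof.
move=> hx; have hz := notinL ht' hx; eexists.
  apply: (dvB (dvB (dvt_zeta ht' hx) (dvM (dv_ee ht') (dv_Tt x t))) (dvM (dv_ff ht') (dv_cst _ x t))).
have [ff0 J0] := JJ_eq0 ht'; have J := J0 _ hz.
have E : JJ t (T t x) - 2 * x * (ff t * ff' t) = 0 by rewrite J ff0; ring.
by apply: (eq_by_sub E); rewrite /JJ /ZZ /P0 /P1; ring.
Qed.

Lemma dv_P0 x : ~ inM x -> exists2 d, dv (@allD R) ((P0)^~ x) t d &
  2 * ff t * (d + ee' t) = P2 t x - 2 * (P0 t x + ee t) ^+ 2 + 2 * ZZ t x * P1 t x.
Proof.
move=> hx; have hz := notinL ht' hx; eexists; first exact: (dvt_wp ht' hx).
have J := JJ'_eq0 ht' hz.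
rewrite -[LHS]addr0 -{1}J /ZZ /P0 /P1 /P2; ring.
Qed.
End FixedT.

Lemma ff_const t : mg t < 1 / 2 -> ff t = ff 0.
Proof.
move=> ht; apply/eqP; rewrite -subr_eq0 -mg_eq0 eq_le mg_ge0 andbT.
have := @dv_mvt R (@allD R) (@ff R) (fun=> 0) 0 t 0 (fun=> I) _.
rewrite add0r mul0r; apply => s /andP[s0 s1]; rewrite mg0 add0r; split=> //.
have h : mg (s%:C * t) < 1 / 2.
  by rewrite mgM mgR ger0_norm//; apply: le_lt_trans ht; rewrite ler_piMl ?mg_ge0.
by apply: (dv_eq (dv_ff h)); exact: ff'_eq0.
Qed.

(** * Seven-torsion values and their differential system *)

Section SevenTorsion.
Variable t : C.
Hypothesis ht : mg t < 1 / 2.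
Local Notation a := (ZZ t 1). Local Notation b := (ZZ t 2). Local Notation c := (ZZ t 4).

Let h1 : ~ inM (1 : C). Proof. exact: (@n_notinM 1). Qed.
Let h2 : ~ inM (2 : C). Proof. exact: (@n_notinM 2). Qed.
Let h4 : ~ inM (4 : C). Proof. exact: (@n_notinM 4). Qed.

(** Since 7 lies in M, doubling permutes 1, 2, 4 cyclically by 8 = 1 + 7, and 1 + 2 = - 4 + 7 gives
    the fourth relation. *)
Lemma torsion_rels :
  [/\ [/\ (2 * a - b) ^+ 2 = 2 * P0 t 1 + P0 t 2,
      (2 * b - c) ^+ 2 = 2 * P0 t 2 + P0 t 4,
      (2 * c - a) ^+ 2 = 2 * P0 t 4 + P0 t 1 &
      (a + b + c) ^+ 2 = P0 t 1 + P0 t 2 + P0 t 4],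
   [/\ 2 * (2 * a - b) * (P0 t 2 - P0 t 1) = P1 t 1 + P1 t 2,
      2 * (2 * b - c) * (P0 t 4 - P0 t 2) = P1 t 2 + P1 t 4 &
      2 * (2 * c - a) * (P0 t 1 - P0 t 4) = P1 t 4 + P1 t 1] &
   [/\ 2 * (P0 t 2 - P0 t 1) ^+ 2 + 2 * (2 * a - b) * (P1 t 2 - P1 t 1) = P2 t 1 + P2 t 2,
      2 * (P0 t 4 - P0 t 2) ^+ 2 + 2 * (2 * b - c) * (P1 t 4 - P1 t 2) = P2 t 2 + P2 t 4 &
      2 * (P0 t 1 - P0 t 4) ^+ 2 + 2 * (2 * c - a) * (P1 t 1 - P1 t 4) = P2 t 4 + P2 t 1]].
Proof.
have e2 : 1 + 1 = 2 :> C by ring.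
have e4 : 2 + 2 = 4 :> C by ring.
have e8 : 4 + 4 = 1 + pp R (-1, -1) :> C by rewrite -seven; ring.
have e3 : 1 + 2 = - 4 + pp R (-1, -1) :> C by rewrite -seven; ring.
have hN4 : ~ inM (- 4 : C) by rewrite inMN.
have h8 : ~ inM (4 + 4 : C) by rewrite e8 inMD.
have h3 : ~ inM (1 + 2 : C) by rewrite e3 inMD.
have := FSZ ht h1 h1; rewrite /= e2 => /(_ h2)[A1 A2 A3].
have := FSZ ht h2 h2; rewrite /= e4 => /(_ h4)[B1 B2 B3].
have := FSZ ht h4 h4 h8; rewrite /= e8; have [-> -> -> ->] := ZZ_pp ht (-1, -1) h1 => -[C1 C2 C3].
have := FSZ ht h1 h2 h3; rewrite /= e3; have [-> -> _ _] := ZZ_pp ht (-1, -1) hN4.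
have [-> -> _ _] := ZZN ht h4; rewrite opprK => -[D1 _ _].
have dbl (x : C) : x + x = 2 * x by ring.
rewrite !(dbl a) ?(dbl (P0 t 1)) in A1 A2 A3; rewrite !(dbl b) ?(dbl (P0 t 2)) in B1 B2 B3.
rewrite !(dbl c) ?(dbl (P0 t 4)) in C1 C2 C3.
by split; split.
Qed.

(** The three doubling relations add up to three times the fourth relation. *)
Lemma conic : a ^+ 2 + b ^+ 2 + c ^+ 2 = 5 * (a * b + b * c + c * a).
Proof.
have [[A B D E] _ _] := torsion_rels.
have : (2 * a - b) ^+ 2 + (2 * b - c) ^+ 2 + (2 * c - a) ^+ 2 = 3 * (a + b + c) ^+ 2.
  by rewrite A B D E; ring.
have n2 : (2 : C) != 0 by rewrite (eqr_nat _ 2 0).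
by move=> h; apply: (mulfI n2); apply: (eq_by_sub h); ring.
Qed.
End SevenTorsion.
End Division.

(** * Multiplication by sqrt (-7) and the relation between t and - t *)

Section Fricke.
Variable R : realType.
Local Notation C := R[i].
Local Notation pt := (int * int)%type.
Implicit Types (t x z : C) (v : pt).

Definition sq7 : C := om R - omb R.

Lemma sq7_sq : sq7 ^+ 2 = - 7.
Proof.
have -> : sq7 ^+ 2 = (om R + omb R) ^+ 2 - 4 * (om R * omb R) by rewrite /sq7; ring.
by rewrite om_sum om_prod; ring.
Qed.

Lemma sq7_neq0 : sq7 != 0. Proof. by rewrite subr_eq0 om_neq. Qed.

(** The number sqrt (-7) changes sign under conjugation, which replaces t by - t. *)
Lemma T_sq7 t x : T (- t) (sq7 * x) = - sq7 * T t x.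
Proof.
have hs : conjc sq7 = - sq7.
  by apply/eqP; rewrite eq_complex /=; apply/andP; split; apply/eqP; field.
have E : conjc (sq7 * x) = - sq7 * conjc x by rewrite [LHS]rmorphM -hs.
by rewrite /T E; ring.
Qed.

Lemma sq7_pp v (n : int) : sq7 * (pp R v + n%:~R) = pp R (- 3 * v.1 - 4 * v.2 + n, 4 * v.1 + 3 * v.2 - n).
Proof.
have h1 : om R ^+ 2 = - 7 * om R - 14 by rewrite -om_sum -om_prod; ring.
have h2 : omb R ^+ 2 = - 7 * omb R - 14 by rewrite -om_sum -om_prod; ring.
rewrite /pp /sq7 /=.
move: h1 h2 (om_prod R) (om_sum R); move: (om R) (omb R) => a b h1 h2 h3 h4.
have -> : (a - b) * (v.1%:~R * a + v.2%:~R * b + n%:~R) =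
  v.1%:~R * a ^+ 2 + (v.2%:~R - v.1%:~R) * (a * b) - v.2%:~R * b ^+ 2 + n%:~R * (a - b) by ring.
rewrite h1 h2 h3.
have -> : b = - 7 - a by rewrite -h4; ring.
ring.
Qed.

Section FixedT.
Variable t : C.
Hypothesis ht' : mg t < 1 / 2.
Let ht : mg t <= 1 / 2 := ltW ht'.
Let htN' : mg (- t) < 1 / 2. Proof. by rewrite mgN. Qed.
Let htN : mg (- t) <= 1 / 2 := ltW htN'.

(** This lattice contains T_t M with index 7, with representatives T_t 0, ..., T_t 6. *)
Let S z := inL (- t) (sq7 * z).

Let Sn z (n : int) : S z -> inL t (z + T t n%:~R) -> S z. Proof. by []. Qed.

Lemma S_T v (n : int) : exists v', sq7 * T t (pp R v + n%:~R) = w (- t) v'.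
Proof.
exists (- (- 3 * v.1 - 4 * v.2 + n), - (4 * v.1 + 3 * v.2 - n)).
by rewrite (wN (- t) (- 3 * v.1 - 4 * v.2 + n, 4 * v.1 + 3 * v.2 - n)) /w -sq7_pp T_sq7 mulNr opprK.
Qed.

Let SD z v (n : int) : S (z + T t (pp R v + n%:~R)) <-> S z.
Proof. by rewrite /S mulrDr; have [v' ->] := S_T v n; exact: inL_shift. Qed.

Let Sw z v : S (z + w t v) <-> S z.
Proof. by have := SD z v 0; rewrite addr0. Qed.

Let S0 : S 0. Proof. by exists (0, 0); rewrite mulr0 w0. Qed.

Let notS z (n : int) : ~ S z -> ~ inL t (z + T t n%:~R).
Proof.
move=> hz [v E]; apply: hz; have -> : z = 0 + T t (pp R v + (- n)%:~R).
  by rewrite add0r TD -/(w t v) -E rmorphN TN addrK.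
exact/SD.
Qed.

Let S_inv z : S z -> exists v (n : int), z = T t (pp R v) + n%:~R * T t 1.
Proof.
move=> [v E]; exists (- (v.1 + v.2), 0), (- (4 * v.1 + 3 * v.2)).
apply: (mulfI sq7_neq0); rewrite E -T_int -TD mulr1.
rewrite -[RHS]opprK -mulNr -T_sq7 sq7_pp -TN -ppN /w; congr (T _ (pp R _)).
by case: v {E} => a b /=; congr pair; lia.
Qed.

Let Sfin : locfin S.
Proof.
move=> r; have [l hl] := inL_locfin htN (mg sq7 * r).
exists [seq sq7^-1 * z | z <- l] => z Sz zr; apply/mapP; exists (sq7 * z).
  by apply: hl => //; rewrite mgM ler_wpM2l// mg_ge0.
by rewrite mulKf// sq7_neq0.
Qed.

Let g z := zeta t (z + T t 1) + zeta t (z + T t 2) + zeta t (z + T t 3) +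
  zeta t (z + T t 4) + zeta t (z + T t 5) + zeta t (z + T t 6).
(** Both parts have simple poles with residue 1 at the points of S, so the difference has none. *)
Let F z := sq7 * zeta (- t) (sq7 * z) - (zeta t z + g z).

Let nS z (n : nat) : ~ S z -> ~ inL t (z + T t n%:R).
Proof. exact: (@notS z n%:Z). Qed.
Let nS0 z : ~ S z -> ~ inL t z.
Proof. by move=> /(@nS z 0%N); rewrite T0 addr0. Qed.

Let dvg z : (forall n : nat, (0 < n < 7)%N -> ~ inL t (z + T t n%:R)) ->
  dv (@allD R) g z (- (wp t (z + T t 1) + wp t (z + T t 2) + wp t (z + T t 3) +
  wp t (z + T t 4) + wp t (z + T t 5) + wp t (z + T t 6))).
Proof.
move=> h; have d (n : nat) (hn : (0 < n < 7)%N) := dv_shift (dv_zeta ht (h n hn)).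
apply: (dv_eq (dvD (dvD (dvD (dvD (dvD (d 1%N isT) (d 2%N isT)) (d 3%N isT)) (d 4%N isT)) (d 5%N isT)) (d 6%N isT))).
by rewrite !opprD.
Qed.

Let dvF z : ~ S z -> exists d, dv (@allD R) F z d.
Proof.
move=> hz; eexists; apply: dvB.
  apply: (dvZ sq7 (dv_comp _ (dv_zeta htN hz))).
  exact: (dvM (dv_cst _ sq7 z) (dv_id _ z)).
apply: dvD (dv_zeta ht (nS0 hz)) (dvg _) => n _; exact: nS.
Qed.

(** Because sq7^2 = - 7 and [ff] is constant in t, the contributions of [ff] cancel. *)
Let F_w z v : ~ S z -> F (z + w t v) = F z - 7 * ((ee t + ee (- t)) * w t v).
Proof.
move=> hz; have hz0 := nS0 hz; have h (n : nat) := @nS z n hz.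
rewrite /F /g !(addrAC z (w t v)) !zeta_w//.
have -> : sq7 * (z + w t v) = sq7 * z + w (- t) (3 * v.1 + 4 * v.2, - (4 * v.1 + 3 * v.2)).
  rewrite mulrDr; congr (_ + _); rewrite /w.
  have := sq7_pp v 0; rewrite addr0 => E.
  rewrite -[LHS]opprK -mulNr -T_sq7 E -TN -ppN; congr (T _ (pp R _)).
  by case: v {E} => a b /=; congr pair; lia.
rewrite zeta_w// (ff_const htN') (ff_const ht').
have Ew : w (- t) (3 * v.1 + 4 * v.2, - (4 * v.1 + 3 * v.2)) = sq7 * w t v.
  rewrite -[RHS]opprK -mulNr -T_sq7 /w -TN; congr (T _ _).
  have := sq7_pp v 0; rewrite addr0 => ->; rewrite -ppN; congr pp.
  by case: v => a b /=; congr pair; lia.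
have Ep : pp R (3 * v.1 + 4 * v.2, - (4 * v.1 + 3 * v.2)) = - sq7 * pp R v.
  have := sq7_pp v 0; rewrite addr0 => E; rewrite [RHS]mulNr E -ppN; congr pp.
  by case: v {E Ew} => a b /=; congr pair; lia.
rewrite Ew Ep; apply: (eq_by_sub (x' := sq7 ^+ 2 * (ee (- t) * w t v - ff 0 * pp R v)) (y' := - 7 * (ee (- t) * w t v - ff 0 * pp R v))).
  by rewrite sq7_sq.
- move: (zeta (- t) (sq7 * z)) (zeta t z) (zeta t (z + T t 1)) (zeta t (z + T t 2)) (zeta t (z + T t 3)) (zeta t (z + T t 4)) (zeta t (z + T t 5)) (zeta t (z + T t 6)).
  move: sq7 (w t v) (pp R v) (ff 0) (ee t) (ee (- t)) => q wv p f e e' y0 y1 y2 y3 y4 y5 y6 y7.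
  ring.
all: first [exact: (h 1%N)|exact: (h 2%N)|exact: (h 3%N)|exact: (h 4%N)|exact: (h 5%N)|exact: (h 6%N)].
Qed.

Let F_T1 : exists c, forall z, ~ S z -> F (z + T t 1) = F z + c.
Proof.
exists (sq7 * (ee (- t) * w (- t) (-1, 1) + ff (- t) * pp R (-1, 1)) - (ee t * w t (-1, -1) + ff t * pp R (-1, -1))) => z hz.
have hz0 := nS0 hz; have h (n : nat) := @nS z n hz.
have e (n : nat) : z + T t 1 + T t n%:R = z + T t n.+1%:R by rewrite -addrA -TD nat1r.
have e7 : T t 7 = w t (-1, -1) by rewrite /w -seven.
rewrite /F /g (e 1%N) (e 2%N) (e 3%N) (e 4%N) (e 5%N) (e 6%N).
rewrite e7 zeta_w//.
have -> : sq7 * (z + T t 1) = sq7 * z + w (- t) (-1, 1).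
  rewrite mulrDr; congr (_ + _); rewrite -[LHS]opprK -mulNr -T_sq7 /w -TN; congr (T _ _).
  by have := sq7_pp (0, 0) 1; rewrite pp0 add0r /= => ->; rewrite -ppN; congr pp.
rewrite zeta_w//.
move: (zeta (- t) (sq7 * z)) (zeta t z) (zeta t (z + T t 1)) (zeta t (z + T t 2)) (zeta t (z + T t 3)) (zeta t (z + T t 4)) (zeta t (z + T t 5)) (zeta t (z + T t 6)).
move: (w (- t) (-1, 1)) (w t (-1, -1)) (pp R (-1, 1)) (pp R (-1, -1)) (ee t) (ee (- t)) (ff t) (ff (- t)).
move=> a1 a2 a3 a4 a5 a6 a7 a8 y0 y1 y2 y3 y4 y5 y6 y7; ring.
Qed.

Let F_near0 : exists K : R, 0 <= K /\ near0 (@allD R) (fun h => h != 0 -> mg (F h + g h) <= K * mg h ^+ 2).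
Proof.
have [K1 [K10 h1]] := near_zero_nneg ht'; have [K2 [K20 h2]] := near_zero_nneg htN'.
have s0 : 0 < mg sq7 by rewrite mg_gt0 sq7_neq0.
exists (mg sq7 * (K2 * mg sq7 ^+ 2) + K1); split.
  by rewrite addr_ge0// mulr_ge0 ?mg_ge0// mulr_ge0// exprn_ge0// mg_ge0.
have q0 : 0 < 1 / 4 :> R by lra.
have q1 : 0 < 1 / 4 / mg sq7 by rewrite divr_gt0.
apply: near0W (near0_and (near0_lt (@allD R) q0) (near0_lt (@allD R) q1)) => h _ [ha hb] hn.
have [A1 _ _ _] := h1 h hn (ltW ha).
have sn : sq7 * h != 0 by rewrite mulf_neq0 ?sq7_neq0.
have sh : mg (sq7 * h) <= 1 / 4 by rewrite mgM mulrC -ler_pdivlMr// ltW.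
have [A2 _ _ _] := h2 _ sn sh.
have -> : F h + g h = sq7 * (zeta (- t) (sq7 * h) - (sq7 * h)^-1) - (zeta t h - h^-1).
  by rewrite /F; field; rewrite sq7_neq0 hn.
apply: (le_trans (mgB _ _)); rewrite [leRHS]mulrDl; apply: lerD => //.
by rewrite mgM -mulrA ler_wpM2l ?mg_ge0// -mulrA -exprMn -mgM.
Qed.

(** Every point of S is moved to 0 by periods and multiples of T_t 1, under which F has constant
    increments. *)
Let F_bd z : S z -> exists K r, 0 < r /\ forall h, mg h < r -> ~ S (z + h) -> mg (F (z + h)) <= K.
Proof.
move=> /S_inv[v [n ->]].
have [c hc] := F_T1.
have [K [K0 [r r0 hr]]] := F_near0.
have hn (k : nat) : (0 < k < 7)%N -> ~ inL t (0 + T t k%:R).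
  move=> hk; rewrite add0r; apply: (notinL ht'); apply: n_notinM.
  by apply/negP => /dvdn_leq; lia.
have [M [s [s0 hM]]] := dv_locbounded (dvg hn).
exists (K + M + mg (n%:~R * c - 7 * ((ee t + ee (- t)) * w t v))), (Num.min 1 (Num.min r s)).
split; first by rewrite !lt_min r0 s0 ltr01.
move=> h; rewrite !lt_min => /and3P[m1 m2 m3].
have S1 z' (k : int) : S (z' + k%:~R * T t 1) <-> S z'.
  by have := SD z' (0, 0) k; rewrite pp0 add0r -T_int mulr1.
have -> : T t (pp R v) + n%:~R * T t 1 + h = (h + n%:~R * T t 1) + w t v by rewrite /w; ring.
rewrite Sw S1 => hS.
have hS' : ~ S (h + n%:~R * T t 1) by rewrite S1.
rewrite F_w//.
rewrite (period_int S1 hc n hS).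
have hh : h != 0 by apply: contra_notN hS => /eqP ->.
have b1 := hr h I m2 hh.
have b2 := hM h m3; rewrite add0r in b2.
have b3 : K * mg h ^+ 2 <= K.
  by rewrite ler_piMr// exprn_ile1 ?mg_ge0//; exact: ltW.
have -> : F h + n%:~R * c - 7 * ((ee t + ee (- t)) * w t v) =
  (F h + g h) - g h + (n%:~R * c - 7 * ((ee t + ee (- t)) * w t v)) by ring.
apply: (le_trans (mgD _ _)); rewrite lerD2r; apply: (le_trans (mgB _ _)).
by apply: lerD => //; exact: le_trans b1 b3.
Qed.

Lemma dv_quad (H : C -> C) d K : 0 <= K -> dv (@allD R) H 0 d ->
  near0 (@allD R) (fun h => h != 0 -> mg (H h) <= K * mg h ^+ 2) -> d = 0.
Proof.
move=> K0 dH hH.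
have H0 : H 0 = 0.
  apply/eqP; rewrite -mg_eq0 -[_ == _]negbK; apply/negP => bn.
  have bp : 0 < mg (H 0) / 2 by rewrite divr_gt0// lt_def bn mg_ge0.
  have k1 : 0 < mg (H 0) / 2 / (K + 1) by rewrite divr_gt0//; lra.
  have [r r0 hr] := near0_and (near0_and (dv_cont dH bp) hH) (near0_and (near0_lt (@allD R) k1) (near0_lt (@allD R) ltr01)).
  have [h [_ hr1 hn]] := @thick_all R r r0.
  have [[a1 /(_ hn) a2] [a3 a4]] := hr h I hr1; rewrite add0r in a1.
  have a5 : mg h * (K + 1) < mg (H 0) / 2 by rewrite -ltr_pdivlMr//; lra.
  have a6 : K * mg h ^+ 2 <= K * mg h.
    by rewrite ler_wpM2l// expr2 ler_piMl ?mg_ge0// ltW.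
  have a7 := mg_ge0 h; have := mgBr (H 0) (H 0 - H h); rewrite subKr mgBC.
  lra.
apply: (dv_uniq (@thick_all R) dH) => e e0.
have k1 : 0 < e / (K + 1) by rewrite divr_gt0//; lra.
apply: near0W (near0_and hH (near0_lt (@allD R) k1)) => h _ [a1 a2].
rewrite add0r H0 mulr0 !subr0.
have [->|hn] := eqVneq h 0; first by rewrite H0 mg0 mulr0.
apply: (le_trans (a1 hn)); rewrite expr2 mulrA ler_wpM2r ?mg_ge0//.
have : mg h * (K + 1) <= e by rewrite -ler_pdivlMr ?ltW//; lra.
by have := mg_ge0 h; lra.
Qed.

(** By its increments F is affine with slope - 7 (ee t + ee (- t)). By [F_near0], F + g vanishes to
    second order at 0, so the slope is the sum of wp over the nonzero classes 1, ..., 6, that is 2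
    (P0 1 + P0 2 + P0 4), which is twice the square of the sum of the torsion values. *)
Lemma fricke : ee t + ee (- t) = - (2 / 7) * (ZZ t 1 + ZZ t 2 + ZZ t 4) ^+ 2.
Proof.
have F1 z : ~ S z -> F (z + q1 t) = F z + - (7 * ((ee t + ee (- t)) * q1 t)).
  by move=> hz; rewrite F_w.
have F2 z : ~ S z -> F (z + q2 t) = F z + - (7 * ((ee t + ee (- t)) * q2 t)).
  by move=> hz; rewrite F_w.
have [a [b [E a1 _]]] := elliptic_affine ht Sw F1 F2 Sfin dvF F_bd.
have aE : a = - (7 * (ee t + ee (- t))).
  by apply: (mulIf (q1_neq0 ht)); rewrite a1; ring.
have hn (k : nat) : (0 < k < 7)%N -> ~ inM (k%:R : C).
  by move=> hk; apply: n_notinM; apply/negP => /dvdn_leq; lia.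
have hL (k : nat) : (0 < k < 7)%N -> ~ inL t (0 + T t k%:R).
  by move=> hk; rewrite add0r; apply: (notinL ht'); exact: hn.
have dl : dv (@allD R) (fun h => b + a * h + g h) 0 (a - (wp t (T t 1) + wp t (T t 2) + wp t (T t 3) +
   wp t (T t 4) + wp t (T t 5) + wp t (T t 6))).
  have := dvD (dv_lin (@allD R) b a 0) (dvg hL).
  by rewrite (add0r (T t 1)) (add0r (T t 2)) (add0r (T t 3)) (add0r (T t 4)) (add0r (T t 5)) (add0r (T t 6)).
have [K [K0 hK]] := F_near0.
have := dv_quad K0 dl; move=> /(_ _)/eqP; rewrite subr_eq0 => H.
have /eqP : a == wp t (T t 1) + wp t (T t 2) + wp t (T t 3) + wp t (T t 4) + wp t (T t 5) + wp t (T t 6).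
  apply: H; apply: near0W (near0_and hK (locfin_near_punct 0 Sfin)) => h _ [k1 k2] hh.
  by rewrite -E ?k1//; have := k2 hh; rewrite add0r.
have sy (n m : nat) : (0 < n < 7)%N -> (n + m = 7)%N -> wp t (T t m%:R) = P0 t n%:R.
  move=> hn7 nm; have h := hn n hn7; have hN : ~ inM (- n%:R : C) by rewrite inMN.
  have [_ <- _ _] := ZZN ht' h; have [_ <- _ _] := ZZ_pp ht' (-1, -1) hN.
  rewrite /P0 -seven; congr (wp t (T t _)).
  by apply/eqP; rewrite eq_sym addrC subr_eq -natrD addnC nm.
rewrite (sy 4 3)// (sy 2 5)// (sy 1 6)// -/(P0 t 1) -/(P0 t 2) -/(P0 t 4).
have [[_ _ _ ->] _ _] := torsion_rels ht'; rewrite aE => H2.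
have E7 : 7 != 0 :> C by rewrite (eqr_nat _ 7 0).
by apply: (mulfI E7); apply: (eq_by_sub (esym H2)); field.
Qed.
End FixedT.
End Fricke.

(** * Values at t = 0 *)

Section BasePoint.
Variable R : realType.
Local Notation C := R[i].
Local Notation pt := (int * int)%type.
Implicit Types (t x z : C) (v : pt).

Definition ww t : C := ZZ t 1 + ZZ t 2 + ZZ t 4.

Let m0 : mg (0 : C) < 1 / 2. Proof. by rewrite mg0; lra. Qed.

Lemma cjD x y : conjc (x + y) = conjc x + conjc y. Proof. exact: rmorphD. Qed.
Lemma cjB x y : conjc (x - y) = conjc x - conjc y. Proof. exact: rmorphB. Qed.
Lemma cjM x y : conjc (x * y) = conjc x * conjc y. Proof. exact: rmorphM. Qed.
Lemma cjX x n : conjc (x ^+ n) = conjc x ^+ n. Proof. exact: rmorphXn. Qed.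
Lemma cjn n : conjc (n%:R : C) = n%:R. Proof. exact: rmorph_nat. Qed.
Lemma cjV x : conjc x^-1 = (conjc x)^-1. Proof. exact: conjc_inv. Qed.
Lemma cji (n : int) : conjc (n%:~R : C) = n%:~R. Proof. exact: rmorph_int. Qed.

Lemma haslsum_conj (F : pt -> C) l : haslsum F l -> haslsum (fun v => conjc (F v)) (conjc l).
Proof.
move=> [K hK]; exists K => N; rewrite -[X in mg X]conjcK mg_conj.
apply: le_trans (hK N); rewrite le_eqVlt; apply/orP; left; apply/eqP; congr mg.
by rewrite rmorphB /= conjcK rmorph_sum; congr (_ - _); apply: eq_bigr => v _; exact: conjcK.
Qed.

Let swap v : pt := (v.2, v.1).

Lemma conj_zeta z : ~ inL 0 z -> zeta 0 (conjc z) = conjc (zeta 0 z).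
Proof.
move=> hz; have [K [h _ _ _]] := dec_terms (ltW m0) hz.
have sw : involutive swap by case.
have ms v : mx (swap v) = mx v by rewrite /mx maxnC.
apply: lsumE; apply: haslsum_eq (haslsum_conj (haslsum_perm sw ms (dec_haslsum h))) => v.
have E : conjc (w (0 : C) (swap v)) = w 0 v.
  rewrite /w /T mul0r subr0 [0 * pp R v]mul0r subr0 conjcK.
  by rewrite /pp cjD !cjM !cji conj_om conj_omb addrC.
by rewrite /t_zeta !cjD (cjM z) cjX !cjV cjB E.
Qed.

(** Conjugation preserves M, swapping its two coordinates, and T_0 is conjugation itself; so zeta,
    [ee] and [ff] are real at t = 0. *)
Lemma conj_ZZ (n : nat) : ~ inM (n%:R : C) -> conjc (ZZ 0 n%:R) = ZZ 0 n%:R :> C.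
Proof.
move=> hn.
have T0x x : T 0 x = conjc x by rewrite /T mul0r subr0.
have ch x : conjc (x / 2) = conjc x / 2 by rewrite cjM cjV cjn.
have e1 : et1 0 = 2 * zeta 0 (omb R / 2) by rewrite /et1 T0x ch conj_om.
have e2 : et2 0 = 2 * zeta 0 (om R / 2) by rewrite /et2 T0x ch conj_omb.
have cx : conjc (et2 0) = et1 0 :> C.
  rewrite e1 e2 cjM cjn -conj_zeta ?ch ?conj_om//.
  by have := notinL m0 (@omb2_notinM R); rewrite T0x ch conj_omb.
have cy : conjc (et1 0) = et2 0 :> C by rewrite -cx conjcK.
have cd : conjc (dq R) = - dq R by rewrite /dq cjB !cjX conj_om conj_omb opprB.
have ce : conjc (ee 0) = ee 0 :> C.
  rewrite /ee cjM cjB (cjM (et1 0)) (cjM (et2 0)) cjV cd cx cy conj_om conj_omb.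
  by rewrite invrN mulrN -mulNr opprB.
have cf : conjc (ff 0) = ff 0 :> C.
  rewrite /ff !q1T !q2T !mul0r !subr0 cjM cjB (cjM (omb R)) (cjM (om R)) cjV cd cx cy conj_om conj_omb.
  by rewrite invrN mulrN -mulNr opprB.
rewrite /ZZ T0x cjn !cjB (cjM (ee 0)) (cjM (ff 0)) ce cf cjn -conj_zeta ?cjn//.
by have := notinL m0 hn; rewrite T0x cjn.
Qed.

(* With vanishing invariants P'' = 6 P^2 propagates the zero from x to x / 2. *)
Lemma halve_triple x : ~ inM x -> ~ inM (2 * x) -> ~ inM (3 * x) ->
  [/\ P0 0 (2 * x) = 0, P1 0 (2 * x) = 0 & P2 0 (2 * x) = 0] ->
  [/\ P0 0 x = 0, P1 0 x = 0 & P2 0 x = 0] :> Prop.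
Proof.
move=> hx h2 h3 [a0 a1 a2].
have n2 : (2 : C) != 0 by rewrite (eqr_nat _ 2 0).
have n4 : (4 : C) != 0 by rewrite (eqr_nat _ 4 0).
have e2 : x + x = 2 * x by ring.
have := FSZ m0 hx hx; rewrite /= e2 => /(_ h2); set g := _ - _; rewrite a0 a1 a2 => -[A1 A2 A3].
have e3 : x + 2 * x = 3 * x by ring.
have e3' : 2 * x + x = 3 * x by ring.
have := FSZ m0 hx h2; rewrite /= e3 => /(_ h3)[B1 B2 B3].
have := FSZ m0 h2 hx; rewrite /= e3' (addrC (ZZ 0 (2 * x))) => /(_ h3)[C1 C2 C3].
move: B1 B2 B3 C1 C2 C3; set k := _ - _; rewrite a0 a1 a2 => B1 B2 B3 C1 C2 C3.
move: (P0 0 (3 * x)) (P1 0 (3 * x)) (P2 0 (3 * x)) B1 B2 B3 C1 C2 C3 => s s1 s2 B1 B2 B3 C1 C2 C3.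
move: (P0 0 x) (P1 0 x) (P2 0 x) A1 A2 A3 B1 B2 B3 C1 C2 C3 => p p1 p2 A1 A2 A3 B1 B2 B3 C1 C2 C3.
have E1 : p1 = - 2 * (k * p).
  have : 2 * k * (s - p) - 2 * k * (s - 0) = (p1 + s1) - (0 + s1) by rewrite B2 C2.
  by move=> h; apply: (eq_by_sub (esym h)); ring.
have E2 : p2 = 6 * p ^+ 2.
  have h1 : (2 * (s - p) ^+ 2 + 2 * k * (s1 - p1)) - (2 * (s - 0) ^+ 2 + 2 * k * (s1 - 0)) = (p2 + s2) - (0 + s2).
    by rewrite B3 C3.
  have h2' : p2 = - 4 * s * p + 2 * p ^+ 2 - 2 * k * p1 by apply: (eq_by_sub (esym h1)); ring.
  rewrite h2' E1; have -> : - 4 * s * p + 2 * p ^+ 2 - 2 * k * (-2 * (k * p)) = - 4 * s * p + 2 * p ^+ 2 + 4 * k ^+ 2 * p by ring.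
  by rewrite B1; ring.
have E3 : p1 = - 2 * (g * p) by apply: (eq_by_sub (esym A2)); ring.
have p00 : p = 0.
  have : 4 * (p * p) = 0.
    have : 2 * p ^+ 2 + 4 * g ^+ 2 * p = 6 * p ^+ 2.
      by rewrite -E2; transitivity (2 * (0 - p) ^+ 2 + 2 * g * (0 - p1)); [rewrite E3; ring|rewrite A3 addr0].
    by rewrite A1 => h; apply: (eq_by_sub h); ring.
  by move/eqP; rewrite !mulf_eq0 (negbTE n4) /= orbb => /eqP.
by rewrite E2 E3 p00; split=> //; ring.
Qed.

(** If w = 0, then by [conic] the squares of three real numbers add up to 0. All torsion values of Z
    then vanish, with those of wp, wp' and wp'' that the relations determine, and [halve_triple]
    carries the zero to 1 / 2^n for every n, against [wp_pole]. *)
Lemma ww0_neq0 : ww 0 != 0.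
Proof.
apply/eqP => W0.
have n2 : (2 : C) != 0 by rewrite (eqr_nat _ 2 0).
have r1 := conj_ZZ (@n_notinM R 1 isT). have r2 := conj_ZZ (@n_notinM R 2 isT).
have r4 := conj_ZZ (@n_notinM R 4 isT).
have cn := conic m0; have [[A1 A2 A3 _] [B1 B2 B3] [C1 C2 C3]] := torsion_rels m0.
move: W0 r1 r2 r4 cn A1 A2 A3 B1 B2 B3 C1 C2 C3; rewrite /ww.
move E1 : (ZZ 0 1) => a; move E2 : (ZZ 0 2) => b; move E4 : (ZZ 0 4) => c.
move=> W0 r1 r2 r4 cn A1 A2 A3 B1 B2 B3 C1 C2 C3.
have ss : a ^+ 2 + b ^+ 2 + c ^+ 2 = 0.
  have h : (a + b + c) ^+ 2 = 0 by rewrite W0 expr0n.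
  have n7 : (7 : C) != 0 by rewrite (eqr_nat _ 7 0).
  apply: (mulfI n7).
  have h' : 2 * (a ^+ 2 + b ^+ 2 + c ^+ 2 - 5 * (a * b + b * c + c * a)) + 5 * (a + b + c) ^+ 2 = 0.
    by rewrite cn h; ring.
  by apply: (eq_by_sub h'); ring.
have re x : conjc x = x -> x ^+ 2 = ((complex.Re x) ^+ 2)%:C.
  case: x => u v [] /= hv; have -> : v = 0 by lra.
  by rewrite -[u +i* 0]/(u%:C) rmorphXn.
have z3 (u v y : R) : u ^+ 2 + v ^+ 2 + y ^+ 2 = 0 -> [/\ u = 0, v = 0 & y = 0].
  move=> h; have := sqr_ge0 u; have := sqr_ge0 v; have := sqr_ge0 y => h1 h2 h3.
  by split; apply/eqP; rewrite -sqrf_eq0 eq_le sqr_ge0 andbT; lra.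
have zz : [/\ a = 0, b = 0 & c = 0].
  have [u v y] : [/\ complex.Re a = 0, complex.Re b = 0 & complex.Re c = 0].
    by apply: z3; apply: complexI; rewrite !rmorphD /= -!re.
  by split; apply/eqP; rewrite -sqrf_eq0 re// ?u ?v ?y expr0n.
have [a0 b0 c0] := zz; rewrite {}a0 {}b0 {}c0 in A1 A2 A3 B1 B2 B3 C1 C2 C3.
have n9 : (9 : C) != 0 by rewrite (eqr_nat _ 9 0).
have p1 : P0 0 1 = 0 :> C.
  apply: (mulfI n9); have h : 4 * (2 * P0 0 1 + P0 0 2) - 2 * (2 * P0 0 2 + P0 0 4) + (2 * P0 0 4 + P0 0 1) = 0 :> C.
    by rewrite -A1 -A2 -A3; ring.
  by apply: (eq_by_sub h); ring.
have p2 : P0 0 2 = 0 :> C by move: A1; rewrite p1 => h; apply: (eq_by_sub (esym h)); ring.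
have p4 : P0 0 4 = 0 :> C by move: A2; rewrite p2 => h; apply: (eq_by_sub (esym h)); ring.
have q1 : P1 0 1 = 0 :> C.
  apply: (mulfI n2); have h : (P1 0 1 + P1 0 2) - (P1 0 2 + P1 0 4) + (P1 0 4 + P1 0 1) = 0 :> C.
    by rewrite -B1 -B2 -B3; ring.
  by apply: (eq_by_sub h); ring.
have q2 : P1 0 2 = 0 :> C by move: B1; rewrite q1 => h; apply: (eq_by_sub (esym h)); ring.
have q4 : P1 0 4 = 0 :> C by move: B2; rewrite q2 => h; apply: (eq_by_sub (esym h)); ring.
have s1 : P2 0 1 = 0 :> C.
  apply: (mulfI n2); have h : (P2 0 1 + P2 0 2) - (P2 0 2 + P2 0 4) + (P2 0 4 + P2 0 1) = 0 :> C.
    by rewrite -C1 -C2 -C3 p1 p2 p4; ring.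
  by apply: (eq_by_sub h); ring.
have h1 : ~ inM (1 : C) := @n_notinM R 1 isT.
have h3 : ~ inM (3 : C) := @n_notinM R 3 isT.
have [n /negP] := wp_pole m0 h1; apply; apply/eqP.
(* The condition on 3 x is carried along as [halve_triple] requires it. *)
pose Q x := ~ inM (3 * x) /\ [/\ P0 0 x = 0, P1 0 x = 0 & P2 0 x = 0].
have : Q (1 / 2 ^+ n).
  apply: halving h1 _ _ n => //; last by split=> //; rewrite mulr1.
  move=> x hx h2 [h6 hQ].
  have h3x : ~ inM (3 * x) by move/inM_double; rewrite mulrCA.
  by split=> //; exact: halve_triple.
by case=> _ [].
Qed.

Lemma ee0 : ee 0 = - (1 / 7) * ww 0 ^+ 2.
Proof.
have n2 : (2 : C) != 0 by rewrite (eqr_nat _ 2 0).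
have := fricke m0; rewrite oppr0 -/(ww 0) => h.
by apply: (mulfI n2); apply: (eq_by_sub h); field.
Qed.

(** The left side of [fricke] is even in t, so w^2 has derivative 0 at 0. *)
Lemma dv_ww0 d : dv (@allD R) ww 0 d -> d = 0.
Proof.
move=> dw.
have d1 : dv (@allD R) (fun t => ee t + ee (- t)) 0 0.
  have dN : dv (@allD R) (@ee R) (- 0) (ee' 0) by rewrite oppr0; exact: dv_ee.
  by apply: (dv_eq (dvD (dv_ee m0) (dv_comp (dvN (dv_id _ 0)) dN))); ring.
have d2 : dv (@allD R) (fun t => ee t + ee (- t)) 0 (- (2 / 7) * (2 * ww 0 * d)).
  apply: dv_near (dvZ (- (2 / 7)) (dvX 1 dw)); first by rewrite (fricke m0).
  by apply: near0W (near_disc m0) => h _ hh; rewrite (fricke hh).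
have := dv_uniq (@thick_all R) d1 d2.
have n0 : - (2 / 7) * (2 * ww 0) != 0 :> C.
  by rewrite mulf_neq0 ?oppr_eq0 ?mulf_neq0 ?invr_eq0 ?(eqr_nat _ 2 0) ?(eqr_nat _ 7 0) ?ww0_neq0.
by move=> h; apply: (mulfI n0); apply: (eq_by_sub (esym h)); ring.
Qed.
End BasePoint.

(** * Polynomial identities between the torsion values and their derivatives *)

Section TorsionAlgebra.
Variable F : numFieldType.
Implicit Types a b c e : F.

(* At the torsion values a, b, c of Z, with w = a + b + c, the functions eta and
   V - 1 are N3 / w^3 and X3 / w^3; [odes] gives their relation
   eta^2 = V (28 - 27 V). *)
Definition N3 a b c := (7 / 16) * (- 5 * (a + b + c) ^+ 3 - 189 * (a * b * c) + 7 * ((a - b) * (b - c) * (c - a))).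
Definition X3 a b c := - (11 / 4) * (a + b + c) ^+ 3 - (343 / 4) * (a * b * c) - N3 a b c.
Definition dE a b c da db dc := da * b * c + a * db * c + a * b * dc.
Definition dN3 a b c da db dc := (7 / 16) * (- 15 * (a + b + c) ^+ 2 * (da + db + dc) - 189 * dE a b c da db dc +
  7 * ((da - db) * (b - c) * (c - a) + (a - b) * (db - dc) * (c - a) + (a - b) * (b - c) * (dc - da))).
Definition dX3 a b c da db dc := - (33 / 4) * (a + b + c) ^+ 2 * (da + db + dc) - (343 / 4) * dE a b c da db dc - dN3 a b c da db dc.

Section Relations.
Variables (a b c e da db dc de dp k p1 p2 p4 q1 q2 q4 r1 r2 r4 : F).
Local Notation w := (a + b + c).
Hypothesis cn : a ^+ 2 + b ^+ 2 + c ^+ 2 = 5 * (a * b + b * c + c * a).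
Hypothesis A1 : (2 * a - b) ^+ 2 = 2 * p1 + p2.
Hypothesis A2 : (2 * b - c) ^+ 2 = 2 * p2 + p4.
Hypothesis A3 : (2 * c - a) ^+ 2 = 2 * p4 + p1.
Hypothesis B1 : 2 * (2 * a - b) * (p2 - p1) = q1 + q2.
Hypothesis B2 : 2 * (2 * b - c) * (p4 - p2) = q2 + q4.
Hypothesis B3 : 2 * (2 * c - a) * (p1 - p4) = q4 + q1.
Hypothesis C1 : 2 * (p2 - p1) ^+ 2 + 2 * (2 * a - b) * (q2 - q1) = r1 + r2.
Hypothesis C2 : 2 * (p4 - p2) ^+ 2 + 2 * (2 * b - c) * (q4 - q2) = r2 + r4.
Hypothesis C3 : 2 * (p1 - p4) ^+ 2 + 2 * (2 * c - a) * (q1 - q4) = r4 + r1.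
Hypothesis Da : k * da = q1 + 2 * a * (p1 + e).
Hypothesis Db : k * db = q2 + 2 * b * (p2 + e).
Hypothesis Dc : k * dc = q4 + 2 * c * (p4 + e).
Hypothesis Dp : dp = (2 * (2 * c - a) * (2 * dc - da) - 4 * (2 * b - c) * (2 * db - dc) + 8 * (2 * a - b) * (2 * da - db)) / 9.
Hypothesis De : k * (dp + de) = - (r1 - 2 * (p1 + e) ^+ 2 + 2 * a * q1).

(** The doubling relations solved for wp at 1: the combination with weights 1, -2, 4 isolates 9 p1.
    Cyclic permutation gives the other two values. *)
Definition f1 a b c := ((2 * c - a) ^+ 2 - 2 * (2 * b - c) ^+ 2 + 4 * (2 * a - b) ^+ 2) / 9.

Let p1E : p1 = f1 a b c. Proof. by rewrite /f1 A1 A2 A3; field. Qed.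
Let p2E : p2 = f1 b c a. Proof. by rewrite /f1 A1 A2 A3; field. Qed.
Let p4E : p4 = f1 c a b. Proof. by rewrite /f1 A1 A2 A3; field. Qed.

Definition f2 a b c := (2 * a - b) * (f1 b c a - f1 a b c) - (2 * b - c) * (f1 c a b - f1 b c a) + (2 * c - a) * (f1 a b c - f1 c a b).
Let n2 : (2 : F) != 0. Proof. by rewrite pnatr_eq0. Qed.
Let q1E : q1 = f2 a b c.
Proof.
rewrite /f2 -p1E -p2E -p4E; apply: (mulfI n2).
have h : (q1 + q2) - (q2 + q4) + (q4 + q1) = 2 * q1 by ring.
by rewrite -h -B1 -B2 -B3; ring.
Qed.
Let q2E : q2 = f2 b c a.
Proof.
rewrite /f2 -p1E -p2E -p4E; apply: (mulfI n2).
have h : (q2 + q4) - (q4 + q1) + (q1 + q2) = 2 * q2 by ring.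
by rewrite -h -B1 -B2 -B3; ring.
Qed.
Let q4E : q4 = f2 c a b.
Proof.
rewrite /f2 -p1E -p2E -p4E; apply: (mulfI n2).
have h : (q4 + q1) - (q1 + q2) + (q2 + q4) = 2 * q4 by ring.
by rewrite -h -B1 -B2 -B3; ring.
Qed.

Definition g2 a b c := (f1 b c a - f1 a b c) ^+ 2 + (2 * a - b) * (f2 b c a - f2 a b c).
Let r1E : r1 = g2 a b c - g2 b c a + g2 c a b.
Proof.
apply: (mulfI n2); rewrite /g2 -p1E -p2E -p4E -q1E -q2E -q4E.
have h : (r1 + r2) - (r2 + r4) + (r4 + r1) = 2 * r1 by ring.
by rewrite -h -C1 -C2 -C3; ring.
Qed.

(** The identities below hold only modulo [cn]; the explicit Q is the cofactor of the conic, after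
    which [field] decides. *)
Let eqQ x y Q : x - y = (a ^+ 2 + b ^+ 2 + c ^+ 2) * Q - 5 * (a * b + b * c + c * a) * Q -> x = y.
Proof. by apply: eq_by_sub; rewrite cn. Qed.

Lemma ode_conic : N3 a b c ^+ 2 = (w ^+ 3 + X3 a b c) * (w ^+ 3 - 27 * X3 a b c).
Proof.
by apply: (@eqQ _ _ ((49 / 64) * (-3 * a ^+ 4 - 33 * a ^+ 3 * b - 33 * a ^+ 3 * c + 136 * a ^+ 2 * b ^+ 2 - 631 * a ^+ 2 * b * c + 136 * a ^+ 2 * c ^+ 2 - 33 * a * b ^+ 3 - 631 * a * b ^+ 2 * c - 631 * a * b * c ^+ 2 - 33 * a * c ^+ 3 - 3 * b ^+ 4 - 33 * b ^+ 3 * c + 136 * b ^+ 2 * c ^+ 2 - 33 * b * c ^+ 3 - 3 * c ^+ 4))); rewrite /X3 /N3; field.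
Qed.

Lemma ode_w : k * (da + db + dc) = (8 / 21) * N3 a b c + 2 * (e + w ^+ 2 / 7) * w.
Proof.
rewrite !mulrDr Da Db Dc q1E q2E q4E p1E p2E p4E.
by apply: (@eqQ _ _ ((-169 * a - 169 * b - 169 * c) / 126)); rewrite /N3 /f2 /f1; field.
Qed.

Let lin (G : F -> F -> F -> F -> F -> F -> F) : (forall x y z, k * G a b c x y z = G a b c (k * x) (k * y) (k * z)) ->
  k * G a b c da db dc = G a b c (f2 a b c + 2 * a * (f1 a b c + e)) (f2 b c a + 2 * b * (f1 b c a + e)) (f2 c a b + 2 * c * (f1 c a b + e)).
Proof. by move=> ->; rewrite Da Db Dc q1E q2E q4E p1E p2E p4E. Qed.

Lemma ode_X : w * (k * dX3 a b c da db dc) = 3 * X3 a b c * (k * (da + db + dc)) - (8 / 7) * X3 a b c * N3 a b c.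
Proof.
rewrite lin; last by move=> *; rewrite /dX3 /dN3 /dE; field.
rewrite !mulrDr Da Db Dc q1E q2E q4E p1E p2E p4E.
by apply: (@eqQ _ _ ((-453 * a ^+ 4 - 629 * a ^+ 3 * b - 1301 * a ^+ 3 * c - 1024 * a ^+ 2 * b ^+ 2 - 4477 * a ^+ 2 * b * c - 1024 * a ^+ 2 * c ^+ 2 - 1301 * a * b ^+ 3 - 4477 * a * b ^+ 2 * c - 4477 * a * b * c ^+ 2 - 629 * a * c ^+ 3 - 453 * b ^+ 4 - 629 * b ^+ 3 * c - 1024 * b ^+ 2 * c ^+ 2 - 1301 * b * c ^+ 3 - 453 * c ^+ 4) / 96)); rewrite /dX3 /dN3 /dE /X3 /N3 /f2 /f1; field.
Qed.

Lemma ode_N : w * (k * dN3 a b c da db dc) = 3 * N3 a b c * (k * (da + db + dc)) + (8 / 7) * X3 a b c * (13 * w ^+ 3 + 27 * X3 a b c).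
Proof.
rewrite lin; last by move=> *; rewrite /dX3 /dN3 /dE; field.
rewrite !mulrDr Da Db Dc q1E q2E q4E p1E p2E p4E.
by apply: (@eqQ _ _ ((453 * a ^+ 4 - 2311 * a ^+ 3 * b + 4241 * a ^+ 3 * c - 15440 * a ^+ 2 * b ^+ 2 + 20941 * a ^+ 2 * b * c - 15440 * a ^+ 2 * c ^+ 2 + 4241 * a * b ^+ 3 + 20941 * a * b ^+ 2 * c + 20941 * a * b * c ^+ 2 - 2311 * a * c ^+ 3 + 453 * b ^+ 4 - 2311 * b ^+ 3 * c - 15440 * b ^+ 2 * c ^+ 2 + 4241 * b * c ^+ 3 + 453 * c ^+ 4) / 96)); rewrite /dX3 /dN3 /dE /X3 /N3 /f2 /f1; field.
Qed.

Lemma ode_e : k * de + (2 / 7) * w * (k * (da + db + dc)) = 2 * (e + w ^+ 2 / 7) ^+ 2 - (32 / 441) * (w ^+ 4 - 5 * w * X3 a b c).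
Proof.
have -> : k * de = - (r1 - 2 * (p1 + e) ^+ 2 + 2 * a * q1) - (2 * (2 * c - a) * (2 * (k * dc) - k * da) - 4 * (2 * b - c) * (2 * (k * db) - k * dc) + 8 * (2 * a - b) * (2 * (k * da) - k * db)) / 9.
  by rewrite -De Dp; field.
rewrite r1E !mulrDr Da Db Dc q1E q2E q4E p1E p2E p4E.
by apply: (@eqQ _ _ ((754 * a ^+ 2 - 4568 * a * b + 2488 * a * c + 2518 * b ^+ 2 - 4568 * b * c - 4538 * c ^+ 2) / 3969)); rewrite /X3 /N3 /g2 /f2 /f1; field.
Qed.
End Relations.
End TorsionAlgebra.

(** * The differential ring of V, eta and beta, and its values modulo 8 *)

Section DifferentialRing.
Variable R : realType.
Local Notation C := R[i].
Implicit Types (t : C).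

Definition U t := mg t < 1 / 2 /\ ww t != 0.
(* [nn], [VV], [bb] are eta, V and beta; up to the factor [lam * w^2],
   the derivation in t is [dx] below. *)
Definition nn t : C := N3 (ZZ t 1) (ZZ t 2) (ZZ t 4) / ww t ^+ 3.
Definition VV t : C := X3 (ZZ t 1) (ZZ t 2) (ZZ t 4) / ww t ^+ 3 + 1.
Definition bb t : C := nn t + (21 / 4) * (ee t / ww t ^+ 2 + 1 / 7).
Definition lam : C := - 4 / (21 * ff 0).

(** The hypothesis has the shape of [ode_X] and [ode_N]: division by w^3 absorbs the term in dw. *)
Lemma quot_deriv (w k n dn dw m : C) : w != 0 -> k != 0 ->
  w * (k * dn) = 3 * n * (k * dw) + m -> dn / w ^+ 3 + n * (- (3 * w ^+ 2 * dw) / (w ^+ 3) ^+ 2) = m / (k * w ^+ 4).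
Proof.
move=> w0 k0 h; have -> : dn = (3 * n * (k * dw) + m) / (w * k) by rewrite -h; field; rewrite w0 k0.
by field; rewrite w0 k0.
Qed.

Lemma eps_deriv (w k n x e dw de dn : C) : w != 0 -> k != 0 ->
  k * dw = (8 / 21) * n + 2 * (e + w ^+ 2 / 7) * w ->
  k * de + (2 / 7) * w * (k * dw) = 2 * (e + w ^+ 2 / 7) ^+ 2 - (32 / 441) * (w ^+ 4 - 5 * w * x) ->
  n ^+ 2 = (w ^+ 3 + x) * (w ^+ 3 - 27 * x) ->
  dn = (8 / 7) * x * (13 * w ^+ 3 + 27 * x) / (k * w ^+ 4) ->
  let b := n / w ^+ 3 + (21 / 4) * (e / w ^+ 2 + 1 / 7) in
  dn + (21 / 4) * (de / w ^+ 2 + e * (- (2 * w * dw) / (w ^+ 2) ^+ 2)) =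
  8 / (21 * k) * w ^+ 2 * (- b ^+ 2 + 18 * (x / w ^+ 3) * (1 + 3 * (x / w ^+ 3))).
Proof.
move=> w0 k0 h1 h2 h3 -> b.
have dwE : dw = ((8 / 21) * n + 2 * (e + w ^+ 2 / 7) * w) / k by rewrite -h1 mulrC mulKf.
have deE : de = (2 * (e + w ^+ 2 / 7) ^+ 2 - (32 / 441) * (w ^+ 4 - 5 * w * x) - (2 / 7) * w * ((8 / 21) * n + 2 * (e + w ^+ 2 / 7) * w)) / k.
  by rewrite -h1 -h2 addrK mulrC mulKf.
apply: (eq_by_sub (x' := 8 / (21 * k) * w ^+ 2 * (n ^+ 2 / w ^+ 6)) (y' := 8 / (21 * k) * w ^+ 2 * ((w ^+ 3 + x) * (w ^+ 3 - 27 * x) / w ^+ 6))).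
  by rewrite h3.
by rewrite /b dwE deE; field; rewrite w0 k0.
Qed.

Section Composites.
Variables (A B Cc : C -> C) (t da db dc : C).
Hypothesis dA : dv (@allD R) A t da.
Hypothesis dB : dv (@allD R) B t db.
Hypothesis dC : dv (@allD R) Cc t dc.

Lemma dv_f1 : dv (@allD R) (fun s => f1 (A s) (B s) (Cc s)) t
  ((2 * (2 * Cc t - A t) * (2 * dc - da) - 4 * (2 * B t - Cc t) * (2 * db - dc) + 8 * (2 * A t - B t) * (2 * da - db)) / 9).
Proof.
have d1 := dvX 1 (dvB (dvZ 2 dC) dA); have d2 := dvX 1 (dvB (dvZ 2 dB) dC).
have d3 := dvX 1 (dvB (dvZ 2 dA) dB).
have d := dvM (dvD (dvB d1 (dvZ 2 d2)) (dvZ 4 d3)) (dv_cst (@allD R) 9^-1 t).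
by apply: (dv_eq d); ring.
Qed.

Lemma dv_N3 : dv (@allD R) (fun s => N3 (A s) (B s) (Cc s)) t (dN3 (A t) (B t) (Cc t) da db dc).
Proof.
have d := dvZ (7 / 16) (dvD (dvB (dvZ (-5) (dvX 2 (dvD (dvD dA dB) dC))) (dvZ 189 (dvM (dvM dA dB) dC)))
  (dvZ 7 (dvM (dvM (dvB dA dB) (dvB dB dC)) (dvB dC dA)))).
by apply: (dv_eq d); rewrite /dN3 /dE; ring.
Qed.

Lemma dv_X3 : dv (@allD R) (fun s => X3 (A s) (B s) (Cc s)) t (dX3 (A t) (B t) (Cc t) da db dc).
Proof.
have d := dvB (dvB (dvZ (- (11 / 4)) (dvX 2 (dvD (dvD dA dB) dC))) (dvZ (343 / 4) (dvM (dvM dA dB) dC))) dv_N3.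
by apply: (dv_eq d); rewrite /dX3 /dE; field.
Qed.
End Composites.

Lemma ff0_neq0 : ff 0 != 0 :> C. Proof. by apply: ff_neq0; rewrite mg0; lra. Qed.

Lemma U0 : U 0. Proof. by split; [rewrite mg0; lra|exact: ww0_neq0]. Qed.

Lemma odes t : U t ->
  [/\ dv (@allD R) (@ww R) t (lam * ww t ^+ 2 * (ww t * bb t)),
      dv (@allD R) VV t (lam * ww t ^+ 2 * (- 3 * (VV t - 1) * nn t)),
      dv (@allD R) nn t (lam * ww t ^+ 2 * (3 * (VV t - 1) * (27 * VV t - 14))),
      dv (@allD R) bb t (lam * ww t ^+ 2 * (- bb t ^+ 2 + 18 * (VV t - 1) * (3 * VV t - 2))) &
      nn t ^+ 2 = VV t * (28 - 27 * VV t)].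
Proof.
move=> [ht w0].
have [da dA hA] := dv_ZZ ht (@n_notinM R 1 isT).
have [db dB hB] := dv_ZZ ht (@n_notinM R 2 isT).
have [dc dC hC] := dv_ZZ ht (@n_notinM R 4 isT).
have [dp dP hP] := dv_P0 ht (@n_notinM R 1 isT).
have [[A1 A2 A3 A4] [B1 B2 B3] [C1 C2 C3]] := torsion_rels ht.
have cn := conic ht.
(* With this factor k, [dv_ZZ] expresses k times each t-derivative polynomially, and [lam] is 8 /
   (21 k). *)
have k0 : - 2 * ff t != 0 :> C by rewrite mulf_neq0 ?oppr_eq0 ?(eqr_nat _ 2 0) ?ff_neq0.
have lamE : lam = 8 / (21 * (- 2 * ff t)).
  by rewrite /lam -(ff_const ht); field; exact: ff_neq0.
move: k0 lamE hA hB hC hP; set k := - 2 * ff t => k0 lamE hA hB hC hP.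
(* The doubling relations make [P0 t 1] a polynomial in the torsion values, so its derivative is
   computed a second way; comparison with [dv_P0] yields the derivative of [ee]. *)
have dpE : dp = (2 * (2 * ZZ t 4 - ZZ t 1) * (2 * dc - da) - 4 * (2 * ZZ t 2 - ZZ t 4) * (2 * db - dc) + 8 * (2 * ZZ t 1 - ZZ t 2) * (2 * da - db)) / 9.
  apply: (dv_uniq (@thick_all R) dP).
  have fE s : mg s < 1 / 2 -> f1 (ZZ s 1) (ZZ s 2) (ZZ s 4) = P0 s 1.
    by move=> hs; have [[E1 E2 E3 _] _ _] := torsion_rels hs; rewrite /f1 E1 E2 E3; field.
  apply: dv_near (dv_f1 dA dB dC); first by rewrite fE.
  by apply: near0W (near_disc ht) => h _ hh; rewrite fE.
have Da : k * da = P1 t 1 + 2 * ZZ t 1 * (P0 t 1 + ee t) by rewrite /k !mulNr hA opprK.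
have Db : k * db = P1 t 2 + 2 * ZZ t 2 * (P0 t 2 + ee t) by rewrite /k !mulNr hB opprK.
have Dc : k * dc = P1 t 4 + 2 * ZZ t 4 * (P0 t 4 + ee t) by rewrite /k !mulNr hC opprK.
have De : k * (dp + ee' t) = - (P2 t 1 - 2 * (P0 t 1 + ee t) ^+ 2 + 2 * ZZ t 1 * P1 t 1) by rewrite /k !mulNr hP.
have o0 := ode_conic cn.
have o1 := ode_w cn A1 A2 A3 B1 B2 B3 Da Db Dc.
have o2 := ode_X cn A1 A2 A3 B1 B2 B3 Da Db Dc.
have o3 := ode_N cn A1 A2 A3 B1 B2 B3 Da Db Dc.
have o4 := ode_e cn A1 A2 A3 B1 B2 B3 C1 C2 C3 Da Db Dc dpE De.
have dW : dv (@allD R) (@ww R) t (da + db + dc) := dvD (dvD dA dB) dC.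
have dN := dv_N3 dA dB dC; have dX := dv_X3 dA dB dC.
rewrite -/(ww t) in o0 o1 o2 o3 o4.
move: o0 o1 o2 o3 o4 dN dX; rewrite /VV /bb /nn.
set w := ww t in w0 *; set n := N3 _ _ _; set x := X3 _ _ _; set dn := dN3 _ _ _ _ _ _; set dx := dX3 _ _ _ _ _ _.
set dw := da + db + dc => o0 o1 o2 o3 o4 dN dX.
have w3 : w ^+ 3 != 0 by rewrite expf_neq0.
have w2 : w ^+ 2 != 0 by rewrite expf_neq0.
have iW3 := dvV (dvX 2 dW) w3.
have iW2 := dvV (dvX 1 dW) w2.
have dN' := dvM dN iW3; have dX' := dvM dX iW3.
have E3 := quot_deriv w0 k0 o3.
have o2' : w * (k * dx) = 3 * x * (k * dw) + - (8 / 7 * x * n) by rewrite o2.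
have E2 := quot_deriv w0 k0 o2'.
rewrite lamE; split.
(* [ode_w] says that k times the derivative of w is (8 / 21) w^3 beta; this is the origin of [bb]
   and [lam]. *)
- apply: (dv_eq dW); apply: (mulfI k0); rewrite o1; field; rewrite w0 k0 //.
- have d := dvD dX' (dv_cst (@allD R) 1 t); rewrite addr0 in d.
  by apply: (dv_eq d); rewrite E2; field; rewrite w0 k0.
- by apply: (dv_eq dN'); rewrite E3; field; rewrite w0 k0.
- have d := dvD dN' (dvZ (21 / 4) (dvD (dvM (dv_ee ht) iW2) (dv_cst (@allD R) (1 / 7) t))).
  apply: (dv_eq d); rewrite addr0 E3.
  have := eps_deriv w0 k0 o1 o4 o0 (erefl _).
  rewrite /= => E; rewrite [LHS]E; field; rewrite w0 k0 //.
- rewrite expr_div_n o0; field; exact: w0.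
Qed.

Lemma near_U t : U t -> near0 (@allD R) (fun h => U (t + h)).
Proof.
move=> Ut; have [dw _ _ _ _] := odes Ut; have [ht w0] := Ut.
by apply: near0W (near0_and (near_disc ht) (dv_neq0 (F := fun _ : int * int => @ww R) (v := (0, 0)) dw w0)) => h _ [].
Qed.

Lemma lamw_neq0 t : U t -> lam * ww t ^+ 2 != 0.
Proof.
move=> [_ w0]; rewrite mulf_neq0 ?expf_neq0// /lam mulf_neq0 ?oppr_eq0 ?(eqr_nat _ 4 0)//.
by rewrite invr_eq0 mulf_neq0 ?(eqr_nat _ 21 0) ?ff0_neq0.
Qed.

(* Syntax of the integral polynomials in V, eta, beta, on which [dx] is the
   derivation induced by [odes]. *)
Inductive ex := Ci of int | Xv | Xe | Xb | Xadd of ex & ex | Xmul of ex & ex.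

Fixpoint ev (t : C) (x : ex) : C := match x with
  | Ci n => n%:~R | Xv => VV t | Xe => nn t | Xb => bb t
  | Xadd x y => ev t x + ev t y | Xmul x y => ev t x * ev t y end.

Local Notation "x +! y" := (Xadd x y) (at level 50, left associativity).
Local Notation "x *! y" := (Xmul x y) (at level 40, left associativity).

Definition V1 := Xv +! Ci (-1).
Definition dXb := Ci (-1) *! Xb *! Xb +! Ci 18 *! V1 *! (Ci 3 *! Xv +! Ci (-2)).

Fixpoint dx (x : ex) : ex := match x with
  | Ci _ => Ci 0
  | Xv => Ci (-3) *! V1 *! Xe
  | Xe => Ci 3 *! V1 *! (Ci 27 *! Xv +! Ci (-14))
  | Xb => dXb
  | Xadd x y => Xadd (dx x) (dx y)
  | Xmul x y => Xadd (Xmul (dx x) y) (Xmul x (dx y)) end.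

Lemma dv_ev t x : U t -> dv (@allD R) (ev^~ x) t (lam * ww t ^+ 2 * ev t (dx x)).
Proof.
move=> Ut; have [_ dV dN dB _] := odes Ut.
elim: x => [n||||x IHx y IHy|x IHx y IHy] /=.
- by rewrite mulr0; exact: dv_cst.
- by apply: (dv_eq dV); ring.
- by apply: (dv_eq dN); ring.
- by apply: (dv_eq dB); ring.
- by apply: (dv_eq (dvD IHx IHy)); ring.
- by apply: (dv_eq (dvM IHx IHy)); ring.
Qed.

Definition exeq x y := forall t, U t -> ev t x = ev t y.

(** [J] is closed under equality of functions on U, which includes eta^2 = V (28 - 27 V); such
    equalities may be differentiated because U is open. *)
Lemma dx_exeq x y : exeq x y -> exeq (dx x) (dx y).
Proof.
move=> E t Ut; apply: (mulfI (lamw_neq0 Ut)).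
apply: (dv_uniq (@thick_all R) (dv_ev x Ut)).
apply: dv_near (dv_ev y Ut); first by rewrite E.
by apply: near0W (near_U Ut) => h _ hh; rewrite E.
Qed.

(* A differential ideal modulo which the successive derivatives of w alternate
   between 4 + 2 V and 2 eta. *)
Inductive J : ex -> Prop :=
| J1 : J (Ci 8)
| J2 : J (Ci 4 *! Xv)
| J3 : J (Ci 4 *! Xe)
| J4 : J (Ci 2 *! Xb)
| J5 : J (Xb *! Xb)
| J6 : J (Xe *! Xb)
| J7 : J (Xv *! Xb)
| J8 : J (Xv *! Xv)
| J9 : J (Ci 2 *! Xv *! Xe)
| Ja x y of J x & J y : J (Xadd x y)
| Jm x y of J y : J (Xmul x y)
| Je x y of exeq x y & J x : J y.

Ltac evring := move=> t Ut /=; ring.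

(** The derivative of each generator is an explicit combination of generators. Only the one of 2 V
    eta uses the relation between eta and V. *)
Lemma J_dx x : J x -> J (dx x).
Proof.
elim=> {x} [|||||||||x y _ hx _ hy|x y hy IH|x y E hx IH].
- by apply: (Je (x := Ci 0 *! Ci 8)); [evring|apply: Jm; exact: J1].
- apply: (Je (x := Ci 3 *! (Ci 4 *! Xe) +! Ci (-6) *! (Ci 2 *! Xv *! Xe))); first by evring.
  by apply: Ja; apply: Jm; [exact: J3|exact: J9].
- apply: (Je (x := Ci 324 *! (Xv *! Xv) +! Ci (-123) *! (Ci 4 *! Xv) +! Ci 21 *! Ci 8)); first by evring.
  by apply: Ja; [apply: Ja|]; apply: Jm; [exact: J8|exact: J2|exact: J1].
- apply: (Je (x := Ci (-2) *! (Xb *! Xb) +! Ci 108 *! (Xv *! Xv) +! Ci (-45) *! (Ci 4 *! Xv) +! Ci 9 *! Ci 8)); first by evring.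
  by apply: Ja; [apply: Ja; [apply: Ja|]|]; apply: Jm; [exact: J5|exact: J8|exact: J2|exact: J1].
- by apply: (Je (x := dXb *! (Ci 2 *! Xb))); [evring|apply: Jm; exact: J4].
- apply: (Je (x := (Ci 81 *! Xv +! Ci (-123)) *! (Xv *! Xb) +! Ci 21 *! (Ci 2 *! Xb) +! Ci (-1) *! Xb *! (Xe *! Xb)
    +! Ci 54 *! Xe *! (Xv *! Xv) +! Ci (-45) *! (Ci 2 *! Xv *! Xe) +! Ci 9 *! (Ci 4 *! Xe))); first by evring.
  by apply: Ja; [apply: Ja; [apply: Ja; [apply: Ja; [apply: Ja|]|]|]|]; apply: Jm;
    [exact: J7|exact: J4|exact: J6|exact: J8|exact: J9|exact: J3].
- apply: (Je (x := Ci (-3) *! V1 *! (Xe *! Xb) +! Ci (-1) *! Xb *! (Xv *! Xb) +! (Ci 54 *! Xv +! Ci (-90)) *! (Xv *! Xv) +! Ci 9 *! (Ci 4 *! Xv))); first by evring.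
  by apply: Ja; [apply: Ja; [apply: Ja|]|]; apply: Jm; [exact: J6|exact: J7|exact: J8|exact: J2].
- by apply: (Je (x := Ci (-3) *! V1 *! (Ci 2 *! Xv *! Xe))); [evring|apply: Jm; exact: J9].
- apply: (Je (x := (Ci 324 *! Xv +! Ci (-576)) *! (Xv *! Xv) +! Ci 63 *! (Ci 4 *! Xv))).
    move=> t Ut /=; have [_ _ _ _ h] := odes Ut.
    apply: (eq_by_sub (x' := 6 * (VV t - 1) * nn t ^+ 2) (y' := 6 * (VV t - 1) * (VV t * (28 - 27 * VV t)))); first by rewrite h.
    ring.
  by apply: Ja; apply: Jm; [exact: J8|exact: J2].
- exact: Ja.
- by apply: Ja; apply: Jm.
- exact: Je (dx_exeq E) IH.
Qed.

(** The normalised n-th derivative of w, see [w_chain]; the term with 2 m + 1 comes from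
    differentiating w^(2 m + 1). *)
Fixpoint gx n : ex := if n is m.+1 then dx (gx m) +! Ci (2 * m%:Z + 1) *! Xb *! gx m else Ci 1.

Lemma gx_step m x y : J (y +! Ci (-1) *! gx m) -> J (dx y +! Ci (2 * m%:Z + 1) *! Xb *! y +! Ci (-1) *! x) ->
  J (x +! Ci (-1) *! gx m.+1).
Proof.
move=> h1 h2.
apply: (Je (x := dx (y +! Ci (-1) *! gx m) +! Ci (2 * m%:Z + 1) *! Xb *! (y +! Ci (-1) *! gx m) +! Ci (-1) *! (dx y +! Ci (2 * m%:Z + 1) *! Xb *! y +! Ci (-1) *! x))).
  by evring.
by apply: Ja; [apply: Ja; [exact: J_dx|exact: Jm]|exact: Jm].
Qed.

Local Notation A4 := (Ci 4 +! Ci 2 *! Xv).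
Local Notation B2 := (Ci 2 *! Xe).

Lemma step_even m : J (A4 +! Ci (-1) *! gx m) -> J (B2 +! Ci (-1) *! gx m.+1).
Proof.
move=> h; apply: gx_step h _.
apply: (Je (x := Ci (-3) *! (Ci 2 *! Xv *! Xe) +! Ci 1 *! (Ci 4 *! Xe) +! Ci (2 * m%:Z + 1) *! (Ci 2 +! Xv) *! (Ci 2 *! Xb))).
  by evring.
by apply: Ja; [apply: Ja|]; apply: Jm; [exact: J9|exact: J3|exact: J4].
Qed.

Lemma step_odd m : J (B2 +! Ci (-1) *! gx m) -> J (A4 +! Ci (-1) *! gx m.+1).
Proof.
move=> h; apply: gx_step h _.
apply: (Je (x := Ci 162 *! (Xv *! Xv) +! Ci (-62) *! (Ci 4 *! Xv) +! Ci 10 *! Ci 8 +! Ci (2 * m%:Z + 1) *! Xe *! (Ci 2 *! Xb))).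
  by evring.
by apply: Ja; [apply: Ja; [apply: Ja|]|]; apply: Jm; [exact: J8|exact: J2|exact: J1|exact: J4].
Qed.

(** The alternation starts at 2, where gx 2 = 2 beta^2 + 54 V^2 - 90 V + 36 is congruent to 4 + 2 V;
    gx 0 is 1 and is treated separately. *)
Lemma gx_even r : J (A4 +! Ci (-1) *! gx r.*2.+2).
Proof.
elim: r => [|r IH]; last by rewrite doubleS; exact/step_odd/step_even.
apply: (Je (x := Ci (-4) *! Ci 8 +! Ci 23 *! (Ci 4 *! Xv) +! Ci (-54) *! (Xv *! Xv) +! Ci (-2) *! (Xb *! Xb))).
  move=> t Ut /=; rewrite (_ : 2 * 1%N%:Z + 1 = 3)// (_ : 2 * 0%N%:Z + 1 = 1)//.
  ring.
by apply: Ja; [apply: Ja; [apply: Ja|]|]; apply: Jm; [exact: J1|exact: J2|exact: J8|exact: J5].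
Qed.

Lemma base_point : [/\ nn 0 = 0, bb 0 = 0 & VV 0 = 0 \/ VV 0 = 28 / 27] :> Prop.
Proof.
have [dw _ _ _ cn] := odes U0.
have b0 : bb 0 = 0.
  have /eqP := dv_ww0 dw; rewrite mulf_eq0 (negbTE (lamw_neq0 U0)) mulf_eq0 (negbTE (ww0_neq0 R)) /=.
  by move/eqP.
have n0 : nn 0 = 0.
  by rewrite -[RHS]b0 /bb ee0; field; exact: ww0_neq0.
split=> //; move: cn; rewrite n0 expr0n /= => /esym/eqP; rewrite mulf_eq0 => /orP[/eqP|]; first by left.
rewrite subr_eq0 => /eqP h; right; rewrite h mulrC mulKf//; exact: (eqr_nat _ 27 0).
Qed.

(** Membership of c in k Z[1/3]. *)
Definition int27 (c : C) (k : int) := exists N : nat, exists m : int, 27 ^+ N * c = (k * m)%:~R.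

Lemma int27D c d k : int27 c k -> int27 d k -> int27 (c + d) k.
Proof.
move=> [N [m h]] [N' [m' h']]; exists (N + N')%N, (27 ^+ N' * m + 27 ^+ N * m').
rewrite exprD mulrDr [27 ^+ N * _ * c]mulrAC h -[27 ^+ N * 27 ^+ N' * d]mulrA h'.
by rewrite !(rmorphD, rmorphM, rmorphXn) /=; ring.
Qed.

Lemma int27M c d k : int27 c 1 -> int27 d k -> int27 (c * d) k.
Proof.
move=> [N [m h]] [N' [m' h']]; exists (N + N')%N, (m * m').
by rewrite exprD mulrACA h h' -rmorphM; congr _%:~R; ring.
Qed.

Lemma int27i n k : int27 (k * n)%:~R k.
Proof. by exists 0%N, n; rewrite expr0 mul1r. Qed.

Lemma ev_int27 x : int27 (ev 0 x) 1.
Proof.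
have [n0 b0 v0] := base_point.
elim: x => [n||||x IHx y IHy|x IHx y IHy] /=.
- by rewrite -[n]mul1r; exact: int27i.
- case: v0 => ->; first exact: (int27i 0 1).
  by exists 1%N, 28; rewrite expr1 mul1r; field.
- by rewrite n0; exact: (int27i 0 1).
- by rewrite b0; exact: (int27i 0 1).
- exact: int27D.
- exact: int27M.
Qed.

Lemma J_int27 x : J x -> int27 (ev 0 x) 8.
Proof.
have [n0 b0 v0] := base_point.
have z : int27 0 8 := int27i 0 8.
elim=> {x} [|||||||||x y _ hx _ hy|x y hy IH|x y E hx IH] /=; rewrite ?n0 ?b0 ?mulr0//.
- exact: (int27i 1 8).
- case: v0 => ->; rewrite ?mulr0//.
  by exists 1%N, 14; rewrite expr1; field.
- case: v0 => ->; rewrite ?mulr0//.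
  by exists 2%N, 98; field.
- exact: int27D.
- by apply: int27M => //; exact: ev_int27.
- by rewrite -(E 0 U0).
Qed.

(** At t = 0 the value 4 + 2 V is 4 or 164 / 27; if it lay in 8 Z[1/3], an odd power of 3 or 1 would
    be even. *)
Lemma gx_neq0 r : ev 0 (gx r.*2) != 0.
Proof.
case: r => [|r]; first exact: oner_neq0.
rewrite doubleS; apply/eqP => g0; have := J_int27 (gx_even r).
have -> : ev 0 (A4 +! Ci (-1) *! gx r.*2.+2) = 4 + 2 * VV 0.
  by rewrite -[LHS]/(4%:~R + 2%:~R * VV 0 + (-1)%:~R * ev 0 (gx r.*2.+2)) g0 mulr0 addr0.
have [_ _ v0] := base_point.
move=> [N [m]]; set q := 27 ^+ N => h.
have oq : odd `|(27 ^+ N : int)|%N by rewrite abszX oddX orbT.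
have qE : q = (27 ^+ N : int)%:~R by rewrite rmorphXn.
move: (27 ^+ N : int) oq qE => p op qE; move: h; rewrite qE.
case: v0 => -> h.
  have : (p * 4)%:~R = (8 * m)%:~R :> C by rewrite -h rmorphM /= mulr0 addr0.
  move/eqP; rewrite eqr_int => /eqP h'; have pE : p = 2 * m by lia.
  by move: op; rewrite pE abszM oddM.
have : (p * 41 * 4)%:~R = (27 * (8 * m))%:~R :> C.
  by rewrite [RHS]rmorphM /= -h !rmorphM /=; field.
move/eqP; rewrite eqr_int => /eqP h'; have pE : p = 2 * (27 * m - 20 * p) by lia.
by move: op; rewrite pE abszM oddM.
Qed.

Lemma w_chain n t : U t -> dv (@allD R) (fun t => ww t ^+ n.*2.+1 * ev t (gx n)) t
  (lam * (ww t ^+ n.*2.+3 * ev t (gx n.+1))).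
Proof.
move=> Ut; have [dw _ _ _ _] := odes Ut.
apply: (dv_eq (dvM (dvX n.*2 dw) (dv_ev (gx n) Ut))) => /=.
rewrite !exprS -(natr1 n.*2) -mul2n natrM !(rmorphD, rmorphM) /= rmorph1; ring.
Qed.

Theorem deriv_ww_neq0 (W : nat -> C -> C) :
  (forall t, mg t < 1 / 2 -> W 0%N t = 2 * ww t) ->
  (forall n t, mg t < 1 / 2 -> dv (@allD R) (W n) t (W n.+1 t)) ->
  forall r, W r.*2 0 != 0.
Proof.
move=> hW dW.
have E n : forall t, U t -> W n t = 2 * lam ^+ n * (ww t ^+ n.*2.+1 * ev t (gx n)).
  elim: n => [|n IH] t Ut; first by rewrite hW ?expr0 ?expr1 ?mulr1//; case: Ut.
  have [ht _] := Ut.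
  apply: (dv_uniq (@thick_all R) (dW n t ht)).
  have d := dvZ (2 * lam ^+ n) (w_chain n Ut).
  apply: dv_near (dv_eq d _); first by rewrite IH.
    by apply: near0W (near_U Ut) => h _ hh; rewrite IH.
  by rewrite [lam ^+ n.+1]exprS (doubleS n); ring.
move=> r; rewrite E; last exact: U0.
have l0 : lam != 0 by move: (lamw_neq0 U0); rewrite mulf_eq0 negb_or => /andP[].
by rewrite !mulf_neq0 ?(eqr_nat _ 2 0) ?expf_neq0 ?ww0_neq0 ?gx_neq0.
Qed.
End DifferentialRing.

(** * The Hecke series *)

Section DerivativeSeries.
Variable R : realType.
Local Notation C := R[i].
Local Notation pt := (int * int)%type.
Implicit Types (t x z : C) (v : pt).

Lemma natC n : n%:R = (n%:R : R)%:C :> C. Proof. by rewrite rmorph_nat. Qed.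

Let sh v : pt := (v.1 - 1, v.2 - 1).

(** The shift by (-1, -1) is translation by 7, split into two coordinate steps. The shifted G has
    constant 4 K since [mx v + 1] changes at most by a factor 2. *)
Lemma haslsum_step7 (G : pt -> C) K : dec 2 G K -> haslsum (fun v => G (sh v) - G v) 0.
Proof.
move=> hG; pose G2 v := G (v.1, v.2 - 1).
have h2 : dec 2 G2 (4 * K).
  move=> v; apply: (le_trans (hG _)); have K0 := dec_ge0 hG.
  rewrite (mulrC 4) -mulrA ler_wpM2l//.
  have -> : 4 / (mx v).+1%:R ^+ 2 = ((mx v).+1%:R / 2) ^- 2 :> R by field.
  rewrite lef_pV2 ?posrE ?exprn_gt0 ?divr_gt0 ?ltr0n//.
  rewrite ler_sqr ?nnegrE ?divr_ge0//.
  have : ((mx v).+1 <= 2 * (mx (v.1, (v.2 - 1)%R)).+1)%N by rewrite /mx /=; lia.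
  by rewrite -(ler_nat R) natrM; lra.
have s := haslsumD (haslsum_step1 h2) (haslsum_step2 hG); rewrite addr0 in s.
by apply: haslsum_eq s => v; rewrite /G2 /sh /=; ring.
Qed.

Lemma pp_sh v : pp R (sh v) = pp R v + 7.
Proof. by rewrite seven -ppD. Qed.

Lemma tdiff_eq (f g : C -> C) : (forall n : nat, (n < 8)%N -> f n%:R = g n%:R) -> tdiff f = tdiff g.
Proof. by move=> h; apply: eq_bigr => j _; rewrite h. Qed.

Lemma tdiffD (f g : C -> C) : tdiff (fun x => f x + g x) = tdiff f + tdiff g.
Proof. by rewrite !tdiffE; ring. Qed.

Lemma tdiff_lin (a b : C) : tdiff (fun x => a + b * x) = 0.
Proof. by rewrite tdiffE; ring. Qed.

(** Up to a!, the a-th t-derivative of 1 / T_t x, grouped over the points p, ..., p + 7 with the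
    weights of the character. *)
Definition tmW a t v : C := tdiff (fun x => (pp R v + x) ^+ a * (T t (pp R v + x))^-1 ^+ a.+1).
Definition Wa a t : C := a`!%:R * lsum (tmW a t).

Section FixedT.
Variable t : C.
Hypothesis ht' : mg t < 1 / 2.
Let ht : mg t <= 1 / 2 := ltW ht'.

(** The point T_t 7 is a lattice point, where zeta has a pole; with 0^-1 = 0 for the singular term,
    the sum is the quasi-period. *)
Lemma zeta7_sum : haslsum (fun v => t_zeta (T t 7) (- w t v)) (ee t * T t 7 + ff t * 7).
Proof.
have e7 : T t 7 = w t (-1, -1) by rewrite /w -seven.
have wsh v : w t (sh v) = w t v - (- w t (-1, -1)) by rewrite opprK -wD.
have inq z : inL t (z + - w t (-1, -1)) <-> inL t z.
  by rewrite -wN; exact: inL_shift.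
have h1 : ~ inL t (T t 1) by apply: (notinL ht'); exact: (@n_notinM R 1).
have h1' : ~ inL t (T t 1 - w t (-1, -1)) by rewrite inq.
have s := zeta_shift_sum ht haslsum_step7 wsh inq h1.
have E := zeta_w ht' (-1, -1) h1'; rewrite subrK in E.
rewrite E -seven -e7 in s.
have := haslsumN s; rewrite [X in haslsum _ X](_ : _ = ee t * T t 7 + ff t * 7); last by ring.
apply: haslsum_eq => v.
by rewrite /t_zeta wsh opprK -e7 (addrC (T t 7)) opprK invrN; ring.
Qed.

(** [tdiff] kills affine functions: the convergence corrections of zeta may be added to 1 / T_t x,
    and the affine difference between zeta and Z drops out. Oddness and periodicity of Z then pair n
    with 7 - n, whence the factor 2. *)
Lemma W0_ww : Wa 0 t = 2 * ww t.
Proof.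
have neg v : involutive (fun v : pt => (- v.1, - v.2)) /\ mx (- v.1, - v.2) = mx v.
  by split; [case=> a b; rewrite /= !opprK|rewrite /mx /= !abszN].
have hz n : (0 < n < 7)%N -> haslsum (fun v => t_zeta (T t n%:R) (- w t v)) (zeta t (T t n%:R)).
  move=> hn; have hL : ~ inL t (T t n%:R).
    by apply: (notinL ht'); apply: n_notinM; apply/negP => /dvdn_leq; lia.
  have [K [h _ _ _]] := dec_terms ht hL.
  have := haslsum_perm (proj1 (neg (0, 0))) (fun v => proj2 (neg v)) (dec_haslsum h).
  by apply: haslsum_eq => v; rewrite wN.
have h0 : haslsum (fun v => t_zeta (T t 0) (- w t v)) 0.
  exists 0 => N; rewrite big1 ?subrr ?mg0 ?mul0r// => v _.
  by rewrite /t_zeta T0 !mul0r addr0 sub0r opprK invrN addrN.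
have s := haslsumB (haslsumD (haslsumB (haslsumB (hz 4%N isT) (hz 5%N isT)) (hz 6%N isT)) zeta7_sum)
  (haslsumD (haslsumB (haslsumB h0 (hz 1%N isT)) (hz 2%N isT)) (hz 3%N isT)).
rewrite /Wa mul1r.
have -> : lsum (tmW 0 t) = zeta t (T t 4) - zeta t (T t 5) - zeta t (T t 6) + (ee t * T t 7 + ff t * 7)
   - (0 - zeta t (T t 1) - zeta t (T t 2) + zeta t (T t 3)).
  apply: lsumE; apply: haslsum_eq s => v.
  rewrite -[LHS](tdiffE (fun x => t_zeta (T t x) (- w t v))) /tmW.
  transitivity (tdiff (fun x => (T t (pp R v + x))^-1 + ((- w t v)^-1 + (T t 1 * (- w t v)^-1 ^+ 2) * x))).
    apply: tdiff_eq => n _; rewrite /t_zeta opprK TD -/(w t v) [T t n%:R + _]addrC -addrA; congr (_ + (_ + _)).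
    have -> : T t n%:R = T t 1 * n%:R.
      by rewrite -[n%:R]mulr1 (T_int t n%:Z 1) mulr1 mulrC.
    by rewrite mulrAC.
  rewrite tdiffD tdiff_lin addr0; apply: tdiff_eq => n _; by rewrite expr0 mul1r expr1.
have e n (hn : (0 < n < 7)%N) : zeta t (T t n%:R) = ZZ t n%:R + ee t * T t n%:R + ff t * n%:R.
  by rewrite /ZZ; ring.
rewrite (e 1%N isT) (e 2%N isT) (e 3%N isT) (e 4%N isT) (e 5%N isT) (e 6%N isT).
have sy (n m : nat) : (0 < n < 7)%N -> (n + m = 7)%N -> ZZ t m%:R = - ZZ t n%:R.
  move=> hn7 nm; have h : ~ inM (n%:R : C).
    by apply: n_notinM; apply/negP => /dvdn_leq; lia.
  have hN : ~ inM (- n%:R : C) by rewrite inMN.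
  have [<- _ _ _] := ZZN ht' h; have [<- _ _ _] := ZZ_pp ht' (-1, -1) hN.
  by rewrite -seven; congr (ZZ t _); apply/eqP; rewrite eq_sym addrC subr_eq -natrD addnC nm.
rewrite (sy 4 3)%N// (sy 2 5)%N// (sy 1 6)%N//.
have Tn (n : nat) : T t n%:R = n%:R * T t 1 by rewrite -[n%:R in LHS]mulr1 (T_int t n%:Z 1).
by rewrite (Tn 2) (Tn 3) (Tn 4) (Tn 5) (Tn 6) (Tn 7) /ww; ring.
Qed.
End FixedT.

Lemma dv_tmW a v t : mg t <= 1 / 2 -> dv (@allD R) (tmW a ^~ v) t (a.+1%:R * tmW a.+1 t v).
Proof.
move=> ht; rewrite /tmW /tdiff mulr_sumr.
apply: dv_eq (dv_sum (index_enum 'I_8) (F := fun j t => (wt R j)%:C * ((pp R v + j%:R) ^+ a * (T t (pp R v + j%:R))^-1 ^+ a.+1))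
   (d := fun j => a.+1%:R * ((wt R j)%:C * ((pp R v + j%:R) ^+ a.+1 * (T t (pp R v + j%:R))^-1 ^+ a.+2))) _) _ => //.
move=> j; set x := pp R v + j%:R; rewrite mulrCA; apply: dvZ.
have [->|xn] := eqVneq x 0.
  rewrite [0 ^+ a.+1]expr0n mul0r mulr0; apply: dv_ext (dv_cst _ 0 t) => s.
  by rewrite T0 invr0 [0 ^+ a.+1]expr0n mulr0.
have Tn : T t x != 0 by rewrite T_eq0.
have d := dvM (dv_cst (@allD R) (x ^+ a) t) (dvX a (dvV (dv_Tt x t) Tn)).
by apply: (dv_eq d); rewrite !exprVn mul0r add0r opprK !exprS; field; rewrite Tn expf_neq0.
Qed.

Lemma lat_ge1 v (j : nat) : pp R v + j%:R != 0 -> 1 <= mg (pp R v + j%:R).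
Proof.
move=> h; have E : pp R v + j%:R = (- (7 / 2) * (v.1%:~R + v.2%:~R) + j%:R) +i* (s7 R / 2 * (v.1%:~R - v.2%:~R)).
  by rewrite ppE natC; apply/eqP; rewrite eq_complex /=; apply/andP; split; apply/eqP; ring.
have hi (n : int) : n != 0 -> 1 <= `|n%:~R : R|.
  by rewrite -intr_norm -[1]/(1%:~R) ler_int => n0; lia.
have [E12|N12] := eqVneq v.1 v.2.
  have E' : pp R v + j%:R = ((- 7 * v.1 + j%:Z)%:~R : R)%:C.
    rewrite E E12 subrr mulr0; congr (_ +i* _).
    by rewrite rmorphD rmorphM rmorphN /=; field.
  rewrite E' mgR; apply: hi; apply: contraNneq h => h; by rewrite E' h.
apply: le_trans (Im_mg _); rewrite E /= normrM -rmorphB /= ger0_norm; last by rewrite divr_ge0// ltW// s7_gt0.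
have s2 : 2 <= s7 R.
  rewrite -[2]ger0_norm// -sqrtr_sqr; apply: ler_wsqrtr; lra.
have := hi (v.1 - v.2); rewrite subr_eq0 => /(_ N12) h1.
have : 1 * 1 <= s7 R / 2 * `|(v.1 - v.2)%:~R| by apply: ler_pM => //; lra.
by rewrite mulr1.
Qed.

(** Far from 0 the segment from p to p + 7 has distance to 0 comparable to the weight. The threshold
    20 is a convenient choice; smaller indices are estimated trivially. *)
Lemma seg_low v (y : R) : (20 <= mx v)%N -> 0 <= y <= 7 -> wgt R v / 4 <= mg (pp R v + y%:C).
Proof.
rewrite -(ler_nat R) => m20 /andP[y0 y7]; rewrite wgtE.
have := mgBl (pp R v) y%:C; rewrite mgR ger0_norm//; have := mx_pp R v; lra.
Qed.

Lemma tdiff_bound (f : C -> C) B : (forall n : nat, (n < 8)%N -> mg (f n%:R) <= B) -> mg (tdiff f) <= 8 * B.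
Proof.
move=> h; rewrite tdiffE; have b n (hn : (n < 8)%N) := h n hn.
have := b 0%N isT; have := b 1%N isT; have := b 2%N isT; have := b 3%N isT.
have := b 4%N isT; have := b 5%N isT; have := b 6%N isT; have := b 7%N isT.
move: (f 0) (f 1) (f 2) (f 3) (f 4) (f 5) (f 6) (f 7) => f0 f1 f2 f3 f4 f5 f6 f7 b7 b6 b5 b4 b3 b2 b1 b0.
have := mgB (f4 - f5 - f6 + f7) (f0 - f1 - f2 + f3); have := mgD (f4 - f5 - f6) f7; have := mgB (f4 - f5) f6; have := mgB f4 f5.
have := mgD (f0 - f1 - f2) f3; have := mgB (f0 - f1) f2; have := mgB f0 f1; lra.
Qed.

Section Symbols.
Variables (J : Type) (ok : pt * J -> Prop).
Hypothesis ok20 : forall i, ok i -> (20 <= mx i.1)%N.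
Let II := {i : pt * J | ok i}.
Let rh (i : II) : R := wgt R (sval i).1.
Let rh1 i : 1 <= rh i := wgt_ge1 R (sval i).1.
Let U := @seg07 R II (fun=> True).
Let p (i : II) : C := pp R (sval i).1.

Lemma sym_affine k (a b : II -> C) (c K : R) : 0 < c ->
  (forall i, mg (a i) <= K * rh i) -> (forall i, mg (b i) <= K) ->
  (forall i y, U i y -> c * rh i <= mg (a i + b i * y)) ->
  sym rh U (@reD R) 1 k 1 (fun i y => a i + b i * y) /\
  sym rh U (@reD R) 1 k (-1) (fun i y => (a i + b i * y)^-1).
Proof.
move=> c0 ha hb low.
have s : sym rh U (@reD R) 1 k 1 (fun i y => a i + b i * y).
  apply: (@sym_lin _ _ _ _ (@reD R) 1 rh1 _ k 1 a b K 7) => //.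
  + by move=> i; rewrite subrr expr0z mulr1.
  + by move=> i y [_ [s -> /andP[s0 s7]]]; rewrite mgR ger0_norm.
split=> //; apply: (@sym_inv _ _ _ _ _ 1 rh1 k 1 (fun i y => a i + b i * y) c) => //.
by move=> i; right => y Uy; rewrite expr1z; exact: low.
Qed.

Lemma sym_X k : sym rh U (@reD R) 1 k 1 (fun i y => p i + 1 * y) /\
  sym rh U (@reD R) 1 k (-1) (fun i y => (p i + 1 * y)^-1).
Proof.
apply: (@sym_affine k p (fun=> 1) (1 / 4) 8); first by lra.
- by move=> i; rewrite /rh wgtE; have := pp_mx R (sval i).1; rewrite /p; lra.
- by move=> i; rewrite mg1; lra.
- move=> [i oki] y [_ [s -> hs]]; rewrite [1 * s%:C]mul1r.
  by have := seg_low (ok20 oki) hs; rewrite /rh /p /=; lra.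
Qed.

Lemma sym_Xc k : sym rh U (@reD R) 1 k 1 (fun i y => conjc (p i) + 1 * y) /\
  sym rh U (@reD R) 1 k (-1) (fun i y => (conjc (p i) + 1 * y)^-1).
Proof.
apply: (@sym_affine k (fun i => conjc (p i)) (fun=> 1) (1 / 4) 8); first by lra.
- by move=> i; rewrite mg_conj /rh wgtE; have := pp_mx R (sval i).1; rewrite /p; lra.
- by move=> i; rewrite mg1; lra.
- move=> [i oki] y [_ [s -> hs]]; rewrite [1 * s%:C]mul1r -(conjc_real s) -cjD mg_conj.
  by have := seg_low (ok20 oki) hs; rewrite /rh /p /=; lra.
Qed.
End Symbols.

Lemma T_real t v (s : R) : w t v + (1 - t) * s%:C = T t (pp R v + s%:C).
Proof. by rewrite TD /w; congr (_ + _); rewrite /T conjc_real; ring. Qed.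

(** Along the segment the term is a symbol of degree a - (a + 1) = -1, so its third difference even
    has order -4. *)
Lemma tmW_bound a : exists K, forall v t, mg t <= 1 / 2 -> mg (tmW a t v) <= K * wgt R v ^ (- 3).
Proof.
pose ok (i : pt * C) : Prop := (20 <= mx i.1)%N /\ mg i.2 <= 1 / 2.
have ok20 i : ok i -> (20 <= mx i.1)%N by case.
pose II := {i : pt * C | ok i}.
pose rh (i : II) : R := wgt R (sval i).1.
have rh1 i : 1 <= rh i := wgt_ge1 R (sval i).1.
pose U := @seg07 R II (fun=> True).
have [sX _] := sym_X ok20 3.
have [_ sY] : sym rh U (@reD R) 1 3 1 (fun i y => w (sval i).2 (sval i).1 + (1 - (sval i).2) * y) /\
    sym rh U (@reD R) 1 3 (-1) (fun i y => (w (sval i).2 (sval i).1 + (1 - (sval i).2) * y)^-1).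
  apply: (@sym_affine _ ok 3 (fun i => w (sval i).2 (sval i).1) (fun i => 1 - (sval i).2) (1 / 8) 16); first by lra.
  - by move=> [i [i20 it]]; rewrite /= wgtE; have := w_le i.1 it; lra.
  - by move=> [i [i20 it]]; have := mgB 1 i.2; rewrite mg1 /=; lra.
  - move=> [i [i20 it]] y [_ [s -> hs]]; rewrite /= T_real.
    by have := T_ge (pp R i.1 + s%:C) it; have := seg_low i20 hs; lra.
have sF : sym rh U (@reD R) 1 3 (-1) (fun i y => (pp R (sval i).1 + 1 * y) ^+ a * (w (sval i).2 (sval i).1 + (1 - (sval i).2) * y)^-1 ^+ a.+1).
  have := symM rh1 (symX rh1 a sX) (symX rh1 a.+1 sY).
  by rewrite (_ : 1 * a%:Z + -1 * a.+1%:Z = -1)//; lia.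
have [K HK] := sym_tdiff sF.
exists (`|K| + 8 * 2 ^+ a.+1 * 20 ^+ 3) => v t ht.
have v1 := wgt_ge1 R v.
have v3 : 0 < wgt R v ^ (-3) by rewrite exprz_gt0//; lra.
rewrite mulrDl; have [m20|m20] := leqP 20 (mx v).
  have /= := HK (exist _ (v, t) (conj m20 ht)) I.
  have -> : tdiff (fun y => (pp R v + 1 * y) ^+ a * (w t v + (1 - t) * y)^-1 ^+ a.+1) = tmW a t v.
    by apply: tdiff_eq => n _; rewrite natC T_real mul1r.
  move=> h; apply: (le_trans h); apply: (@le_trans _ _ (`|K| * wgt R v ^ (-3))); last first.
    by rewrite lerDl !mulr_ge0 ?exprn_ge0 ?(ltW v3).
  have r := @rho_le R _ rh rh1 (-1 - 3) (-3) (exist _ (v, t) (conj m20 ht)) isT.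
  apply: (@le_trans _ _ (`|K| * rh (exist _ (v, t) (conj m20 ht)) ^ (-1 - 3))).
    by rewrite ler_wpM2r ?ler_norm// exprz_ge0// (le_trans ler01).
  by rewrite ler_wpM2l.
apply: (@le_trans _ _ (8 * 2 ^+ a.+1 * 20 ^+ 3 * wgt R v ^ (-3))); last first.
  by rewrite lerDr mulr_ge0 ?normr_ge0 ?ltW.
have b : mg (tmW a t v) <= 8 * 2 ^+ a.+1.
  apply: tdiff_bound => n _.
  have [->|xn] := eqVneq (pp R v + n%:R) 0.
    by rewrite T0 invr0 [0 ^+ a.+1]expr0n mulr0 mg0 exprn_ge0.
  have x1 := lat_ge1 xn; have h := T_ge (pp R v + n%:R) ht.
  move: (T t _) x1 h => z; move: (mg (pp R v + n%:R)) (mgX (pp R v + n%:R) a) => x xa x1 h.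
  have z0 : 0 < mg z by lra.
  rewrite mgM xa mgX mgV exprVn ler_pdivrMr ?exprn_gt0// -exprMn exprS.
  apply: (@le_trans _ _ (x * x ^+ a)).
    by rewrite ler_peMl// exprn_ge0; lra.
  by rewrite -!exprS lerXn2r ?nnegrE; lra.
apply: (le_trans b); rewrite -mulrA ler_peMr ?mulr_ge0 ?exprn_ge0//.
have h : wgt R v <= 20 by rewrite /wgt ler_nat.
rewrite -exprnN -expr_div_n exprn_ege1// ler_pdivlMr; lra.
Qed.

Lemma dv_Wa a t : mg t < 1 / 2 -> dv (@allD R) (Wa a) t (Wa a.+1 t).
Proof.
move=> ht'; have ht := ltW ht'.
have s0 b : sym0 (@wgt R) (fun _ s => mg s <= 1 / 2) (-3) (fun v s => tmW b s v).
  by have [K HK] := tmW_bound b; exists K => v s hs; exact: HK.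
have s1 b : sym (@wgt R) (fun _ s => mg s <= 1 / 2) (@allD R) 0 1 (-3) (fun v s => tmW b s v).
  split; first exact: s0.
  exists (fun v s => b.+1%:R * tmW b.+1 s v); split; first by move=> v s hs; exact: dv_tmW.
  split=> //; have [K HK] := tmW_bound b.+1; exists (b.+1%:R * K) => v s hs.
  by rewrite mgM mgn -mulrA ler_wpM2l// HK.
have h := @lsum_dvc R (@allD R) (fun s => mg s <= 1 / 2) t (fun v s => tmW a s v) (fun v s => tmW a.+1 s v) a.+1%:R (fun _ _ _ => I) _ _ (s0 a) (s1 a.+1).
have d := h _ _; apply: (dv_eq (dvZ a`!%:R (d _ _))).
- exists (1 / 2 - mg t); first by rewrite subr_gt0.
  by move=> u hu; apply: (le_trans (mgD _ _)); lra.
- by move=> v s hs; exact: dv_tmW.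
- by rewrite /Wa factS natrM; ring.
Qed.
End DerivativeSeries.

(** * The complex exponential *)

Section ComplexExponential.
Variable R : realType.
Local Notation C := R[i].
Local Notation Re := (@complex.Re R).
Local Notation Im := (@complex.Im R).
Local Notation pt := (int * int)%type.
Implicit Types (s x z : C) (v : pt).

Definition rdv (f : R -> R) (x d : R) := forall e : R, 0 < e ->
  exists2 r : R, 0 < r & forall u, `|u| < r -> `|f (x + u) - f x - u * d| <= e * `|u|.

Lemma is_derive_rdv (f : R -> R) (x d : R) : is_derive x 1 f d -> rdv f x d.
Proof.
move=> [/cvg_ex[/= l hl] dE] e e0.
have El : l = d by rewrite -dE; apply/esym/cvg_lim.
move/cvgrPdist_le: hl => /(_ e e0); rewrite near_withinE near_nbhs => /nbhs_ballP[r /= r0 rP].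
exists r => // u ur.
have [->|un] := eqVneq u 0; first by rewrite addr0 subrr mul0r subrr !normr0 mulr0.
have := rP u; rewrite -ball_normE /= sub0r normrN => /(_ ur un) H.
have -> : f (x + u) - f x - u * d = - (u * (l - u^-1 *: (f (u *: 1 + x) - f x))).
  by rewrite El /GRing.scale /= mulr1 (addrC u); field.
by rewrite normrN normrM mulrC ler_wpM2r.
Qed.

Lemma dv_real (f : R -> R) (x d : R) : rdv f x d -> dv (@reD R) (fun y => (f (Re y))%:C) x%:C d%:C.
Proof.
move=> hf e /hf[r r0 hr]; exists r => // h hI hm.
have hE : h = (Re h)%:C by apply/eqP; rewrite eq_complex /= hI !eqxx.
have -> : Re (x%:C + h) = x + Re h by rewrite hE.
have hm' : mg h = `|Re h| by rewrite {1}hE mgR.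
by rewrite hm' {2}hE -rmorphM -!rmorphB mgR; apply: hr; rewrite -hm'.
Qed.

Definition Exp z : C := (expR (Re z))%:C * (cos (Im z) +i* sin (Im z)).

Lemma ExpD z s : Exp (z + s) = Exp z * Exp s.
Proof.
case: z s => a b [a' b']; rewrite /Exp /= expRD cosD sinD.
by apply/eqP; rewrite eq_complex /=; apply/andP; split; apply/eqP; ring.
Qed.

Lemma Exp0 : Exp 0 = 1.
Proof. by rewrite /Exp /= expR0 cos0 sin0 mulr1. Qed.

Lemma mg_cis (a : R) : mg (cos a +i* sin a) = 1.
Proof. by rewrite /mg /= cos2Dsin2 sqrtr1. Qed.

Lemma mg_Exp z : mg (Exp z) = expR (Re z).
Proof. by rewrite /Exp mgM mg_cis mulr1 mgR ger0_norm// expR_ge0. Qed.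

Lemma ExpN z : Exp (- z) = (Exp z)^-1.
Proof.
have n0 : Exp z != 0 by rewrite -mg_gt0 mg_Exp expR_gt0.
by apply: (mulfI n0); rewrite -ExpD subrr Exp0 divff.
Qed.

Lemma Exp_nat n z : Exp (n%:R * z) = Exp z ^+ n.
Proof.
elim: n => [|n IH]; first by rewrite mul0r Exp0 expr0.
by rewrite -natr1 mulrDl mul1r ExpD IH exprSr.
Qed.

Lemma Exp_ln (x : R) : 0 < x -> Exp (ln x)%:C = x%:C.
Proof. by move=> x0; rewrite /Exp /= cos0 sin0 lnK// -[1 +i* 0]/(1%:C) rmorph1 mulr1. Qed.

Lemma cpowE (x : R) s : 0 < x -> cpow x s = Exp (s * (ln x)%:C).
Proof.
move=> x0; have h : Re (s * (ln x)%:C) = Re s * ln x /\ Im (s * (ln x)%:C) = Im s * ln x.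
  by case: s => a b /=; split; ring.
by rewrite /cpow /Exp h.1 h.2 /powR gt_eqF.
Qed.

(** The addition law reduces this to 0, where the real derivatives of exp, cos and sin are
    combined. *)
Lemma dv_Exp z : dv (@allD R) Exp z (Exp z).
Proof.
suff d0 : dv (@allD R) Exp 0 1.
  move=> e e0; have k0 : 0 < e / (mg (Exp z) + 1) by rewrite divr_gt0//; have := mg_ge0 (Exp z); lra.
  have := d0 _ k0; apply: near0W => h _; rewrite add0r Exp0 mulr1 => hh.
  rewrite ExpD (_ : _ - _ - _ = Exp z * (Exp h - 1 - h)); last by ring.
  rewrite mgM; apply: (@le_trans _ _ (mg (Exp z) * (e / (mg (Exp z) + 1) * mg h))).
    by rewrite ler_wpM2l// mg_ge0.
  rewrite mulrA ler_wpM2r ?mg_ge0// mulrA ler_pdivrMr; last by have := mg_ge0 (Exp z); lra.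
  by rewrite mulrC ler_pM2l//; lra.
move=> e e0; pose k := Num.min 1 (e / 10).
have k0 : 0 < k by rewrite lt_min ltr01 divr_gt0.
have k1 : k <= 1 by rewrite ge_min lexx.
have ke : k <= e / 10 by rewrite ge_min lexx orbT.
clearbody k.
have [r1 r10 h1] := is_derive_rdv (is_derive_expR (0 : R)) k0.
have [r2 r20 h2] := is_derive_rdv (is_derive_sin (0 : R)) k0.
have [r3 r30 h3] := is_derive_rdv (is_derive_cos (0 : R)) k0.
exists (Num.min (Num.min r1 r2) (Num.min r3 k)); first by rewrite !lt_min r10 r20 r30 k0.
move=> h _; rewrite !lt_min => /andP[/andP[m1 m2] /andP[m3 m4]].
rewrite add0r Exp0 mulr1.
set u := Re h; set w := Im h.
have hu : `|u| <= mg h := Re_mg h. have hw : `|w| <= mg h := Im_mg h.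
have A := h1 u (le_lt_trans hu m1); have B := h2 w (le_lt_trans hw m2); have D := h3 w (le_lt_trans hw m3).
rewrite !add0r expR0 mulr1 in A; rewrite !add0r sin0 cos0 subr0 mulr1 in B.
rewrite !add0r cos0 sin0 oppr0 mulr0 subr0 in D.
have E : Exp h - 1 - h = (expR u - 1 - u)%:C * (cos w +i* sin w) + (1 + u)%:C * ((cos w - 1) +i* (sin w - w)) + (u * w)%:C * 'i.
  by rewrite /Exp -/u -/w (_ : h = u +i* w); [apply/eqP; rewrite eq_complex /=; apply/andP; split; apply/eqP; ring|rewrite /u /w; case: (h)].
have u1 : `|u| <= 1 by lra.
have kk (y : R) : y <= mg h -> k * y <= k * mg h by move=> ?; rewrite ler_wpM2l// ltW.
rewrite E; apply: (le_trans (mgD _ _)); have q1 := mgD ((expR u - 1 - u)%:C * (cos w +i* sin w)) ((1 + u)%:C * ((cos w - 1) +i* (sin w - w))).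
have q2 : mg ((expR u - 1 - u)%:C * (cos w +i* sin w)) <= k * mg h.
  by rewrite mgM mg_cis mulr1 mgR; apply: (le_trans A); exact: kk.
have q3 : mg ((1 + u)%:C * ((cos w - 1) +i* (sin w - w))) <= 2 * (2 * (k * mg h)).
  rewrite mgM; apply: ler_pM; rewrite ?mg_ge0//.
    by rewrite mgR; apply: (le_trans (ler_normD _ _)); rewrite normr1; lra.
  apply: (le_trans (mg_ReIm _)) => /=; have := kk _ hw; lra.
have q4 : mg ((u * w)%:C * 'i) <= k * mg h.
  by rewrite mgM mg_i mulr1 mgR normrM; apply: ler_pM => //; lra.
have : k * mg h <= e / 10 * mg h by rewrite ler_wpM2r ?mg_ge0.
have := mulr_ge0 (ltW e0) (mg_ge0 h); lra.
Qed.
End ComplexExponential.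

(** * The grouped Hecke terms for Re s >= 0 *)

Section HeckeTerms.
Variable R : realType.
Local Notation C := R[i].
Local Notation Re := (@complex.Re R).
Local Notation Im := (@complex.Im R).
Local Notation pt := (int * int)%type.
Implicit Types (s x z : C) (v : pt).
Variable k : nat.
Hypothesis k0 : (0 < k)%N.

(* x^k / (x * conj x)^(s + k/2), with value 0 at 0 when k > 0. *)
Definition phi s x : C := x ^+ k * Exp (- (s + k%:R / 2) * (ln (mg x ^+ 2))%:C).
Definition tphi s v : C := tdiff (fun x => phi s (pp R v + x)).

Lemma phi0 s : phi s 0 = 0.
Proof. by rewrite /phi expr0n gtn_eqF// mul0r. Qed.

Lemma mg_phi s x : x != 0 -> mg (phi s x) = expR (- (2 * Re s) * ln (mg x)).
Proof.
rewrite -mg_gt0 => x0; rewrite /phi mgM mgX mg_Exp.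
have -> : Re (- (s + k%:R / 2) * (ln (mg x ^+ 2))%:C) = - (Re s + k%:R / 2) * (2 * ln (mg x)).
  have kE : k%:R / 2 = (k%:R / 2 : R)%:C :> C by rewrite rmorphM fmorphV !rmorph_nat.
  by rewrite lnXn// kE; case: s => a b /=; rewrite -mulr_natl; ring.
rewrite -[X in X ^+ k]lnK ?posrE// -expRM_natl -expRD//; congr expR; field.
by [].
Qed.

Lemma phi_le1 s x : 0 <= Re s -> 1 <= mg x -> mg (phi s x) <= 1.
Proof.
move=> s0 x1; rewrite mg_phi; last by rewrite -mg_gt0; lra.
rewrite -[leRHS]expR0 ler_expR mulNr oppr_le0; apply: mulr_ge0; [lra|exact: ln_ge0].
Qed.

Lemma phi_dec s x : 2 <= Re s -> 1 <= mg x -> mg (phi s x) <= (mg x ^+ 3)^-1.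
Proof.
move=> s0 x1; have x0 : 0 < mg x by lra.
rewrite mg_phi; last by rewrite -mg_gt0.
rewrite -[X in (X ^+ 3)^-1]lnK ?posrE// -expRM_natl -expRN ler_expR mulNr lerN2.
by apply: ler_wpM2r; [exact: ln_ge0|lra].
Qed.

Lemma dv_phi_s s x : exists d, dv (@allD R) (phi^~ x) s d.
Proof.
eexists; apply: dvZ; apply: dv_comp (dv_Exp _).
exact: dvM (dvN (dvD (dv_id _ _) (dv_cst _ _ _))) (dv_cst _ _ _).
Qed.

(** Since [phi] involves conj x, only real increments are allowed; along them its logarithmic
    derivative is a symbol of degree -1. *)
Lemma dv_phi_tau s (p : C) (y : R) : p + y%:C != 0 ->
  let X := p + 1 * y%:C in let Xc := conjc p + 1 * y%:C in
  dv (@reD R) (fun y => phi s (p + 1 * y)) y%:C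
    (phi s X * (k%:R * X^-1 - (s + k%:R / 2) * (X^-1 + Xc^-1))).
Proof.
move=> n0 X Xc.
pose nf (y : C) : C := (p + 1 * y) * (conjc p + 1 * y).
have nR (a : R) : nf a%:C = (mg (p + a%:C) ^+ 2)%:C.
  by rewrite /nf !mul1r -{2}(conjc_real a) -cjD -normCK -mgE rmorphXn.
have X0 : X != 0 by rewrite /X mul1r.
have XcE : Xc = conjc X by rewrite /Xc /X !mul1r cjD conjc_real.
have Xc0 : Xc != 0 by rewrite XcE conjc_eq0.
have N0 : 0 < mg (p + y%:C) ^+ 2 by rewrite exprn_gt0// mg_gt0.
have dn : dv (@reD R) nf y%:C (1 * Xc + X * 1) := dvM (dv_lin (@reD R) p 1 _) (dv_lin (@reD R) (conjc p) 1 _).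
have dl := dv_real (is_derive_rdv (is_derive1_ln N0)); rewrite -nR in dl.
have dnl : dv (@reD R) (fun y => (ln (Re (nf y)))%:C) y%:C ((mg (p + y%:C) ^+ 2)^-1%:C * (1 * Xc + X * 1)).
  apply: dv_compD dn dl => h; rewrite /reD => hI.
  have hE : h = (Re h)%:C by apply/eqP; rewrite eq_complex /= hI !eqxx.
  by rewrite hE -rmorphD !nR -rmorphB.
have dE := dv_comp (dvM (dv_cst (@reD R) (- (s + k%:R / 2)) y%:C) dnl) (dv_Exp _).
have dX : dv (@reD R) (fun y => (p + 1 * y) ^+ k) y%:C (k%:R * X ^+ k.-1 * 1).
  by have := dvX k.-1 (dv_lin (@reD R) p 1 y%:C); rewrite prednK.
have d := dvM dX dE.
have NE : (mg (p + y%:C) ^+ 2)^-1%:C = (X * Xc)^-1 by rewrite (_ : X * Xc = nf y%:C)// nR fmorphV.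
have ER : Re (nf y%:C) = mg X ^+ 2 by rewrite nR /X mul1r.
rewrite ER NE in d.
have Xk : X ^+ k = X * X ^+ k.-1 by rewrite -exprS prednK.
apply: dv_near (dv_eq d _).
- by rewrite /phi ER -/X.
- exists 1 => // h hI _; have hE : h = (Re h)%:C by apply/eqP; rewrite eq_complex /= hI !eqxx.
  by rewrite /phi hE -rmorphD nR mul1r.
- by rewrite /phi -/X Xk; field; rewrite X0 Xc0.
Qed.

(** For Re s >= 0, [phi] is bounded by 1 and its derivative is [phi] times M, of degree -1; by
    induction it is a symbol of degree 0 to every order. The third difference has order -3, just
    what summation over Z^2 needs. *)
Lemma tphi_bound (B : R) : exists K, forall v s, 0 <= Re s -> mg s <= B -> mg (tphi s v) <= K * wgt R v ^ (- 3).
Proof.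
pose ok (i : pt * C) : Prop := (20 <= mx i.1)%N /\ (0 <= Re i.2 /\ mg i.2 <= B).
have ok20 i : ok i -> (20 <= mx i.1)%N by case.
pose II := {i : pt * C | ok i}.
pose rh (i : II) : R := wgt R (sval i).1.
have rh1 i : 1 <= rh i := wgt_ge1 R (sval i).1.
pose U := @seg07 R II (fun=> True).
pose p (i : II) : C := pp R (sval i).1.
pose sg (i : II) : C := (sval i).2 + k%:R / 2.
pose M (i : II) (y : C) : C := k%:R * (p i + 1 * y)^-1 - sg i * ((p i + 1 * y)^-1 + (conjc (p i) + 1 * y)^-1).
have nz (i : II) (y : R) : 0 <= y <= 7 -> 1 <= mg (p i + y%:C) /\ p i + y%:C != 0.
  case: i => i [i20 it] hy; have := seg_low i20 hy; rewrite /p /= wgtE => h.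
  have : 20 <= (mx i.1)%:R :> R by rewrite (ler_nat R 20).
  by move=> h'; split; [lra|rewrite -mg_gt0; lra].
have sM q : sym rh U (@reD R) 1 q (-1) M.
  have [_ s1] := sym_X R ok20 q; have [_ s2] := sym_Xc R ok20 q.
  apply: (symB rh1); first exact: (sym_scal rh1 k%:R s1).
  rewrite -[-1]add0r; apply: (symM rh1); last exact: symD s1 s2.
  apply: (@sym_cst _ _ _ _ _ _ _ _ _ (B + mg (k%:R / 2))) => -[i [i20 [i1 i2]]].
  by rewrite expr0z mulr1 /sg /=; apply: (le_trans (mgD _ _)); rewrite lerD2r.
have sF q : sym rh U (@reD R) 1 q 0 (fun i y => phi (sval i).2 (p i + 1 * y)).
  have b0 : sym0 rh U 0 (fun i y => phi (sval i).2 (p i + 1 * y)).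
    exists 1 => i y [_ [a -> ha]]; rewrite expr0z mul1r; have [h1 _] := nz i a ha.
    by rewrite mul1r; apply: phi_le1 => //; case: (i) => j [? []].
  elim: q => [|q IH]; split=> //.
  exists (fun i y => phi (sval i).2 (p i + 1 * y) * M i y); split.
    by move=> i y [_ [a -> ha]]; apply: dv_phi_tau; have [] := nz i a ha.
  by rewrite sub0r -[-1]add0r; apply: (symM rh1).
have [K HK] := sym_tdiff (sF 3%N).
exists (`|K| + 8 * 20 ^+ 3) => v s s0 sB.
have v1 := wgt_ge1 R v.
have v3 : 0 < wgt R v ^ (-3) by rewrite exprz_gt0//; lra.
rewrite mulrDl; have [m20|m20] := leqP 20 (mx v).
  have /= := HK (exist _ (v, s) (conj m20 (conj s0 sB))) I.
  have -> : tdiff (fun y => phi s (p (exist ok (v, s) (conj m20 (conj s0 sB))) + 1 * y)) = tphi s v.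
    by apply: tdiff_eq => n _; rewrite mul1r.
  rewrite sub0r => h; apply: (le_trans h); apply: (@le_trans _ _ (`|K| * wgt R v ^ (-3))).
    by rewrite ler_wpM2r ?ler_norm ?(ltW v3).
  by rewrite lerDl !mulr_ge0 ?exprn_ge0 ?(ltW v3).
apply: (@le_trans _ _ (8 * 20 ^+ 3 * wgt R v ^ (-3))); last first.
  by rewrite lerDr mulr_ge0 ?normr_ge0 ?ltW.
have b : mg (tphi s v) <= 8 * 1.
  apply: tdiff_bound => n _.
  have [->|xn] := eqVneq (pp R v + n%:R) 0; first by rewrite phi0 mg0.
  by apply: phi_le1 => //; exact: lat_ge1.
apply: (le_trans b); rewrite mulr1 -mulrA ler_peMr//.
have h : wgt R v <= 20 by rewrite /wgt ler_nat.
rewrite -exprnN -expr_div_n exprn_ege1// ler_pdivlMr; lra.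
Qed.

Lemma dv_tphi v s : exists d, dv (@allD R) (tphi^~ v) s d.
Proof.
have h (j : 'I_8) : {d | dv (@allD R) (phi^~ (pp R v + (j : nat)%:R)) s d} := cid (dv_phi_s s _).
exists (\sum_(j < 8) (wt R j)%:C * sval (h j)).
apply: (dv_sum (index_enum 'I_8) (F := fun (j : 'I_8) s => (wt R j)%:C * phi s (pp R v + (j : nat)%:R)) (d := fun j => (wt R j)%:C * sval (h j))) => j.
by apply: dvZ; exact: (svalP (h j)).
Qed.
End HeckeTerms.

(** * Propagation of zeros from Re s > 2 to s = 1/2 *)

Section IdentityTheorem.
Variable R : realType.
Local Notation C := R[i].
Local Notation Re := (@complex.Re R).
Local Notation Im := (@complex.Im R).
Implicit Types (s z : C).

Variables (HN : nat -> C -> C) (H : C -> C).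
Hypothesis dHN : forall N s, exists d, dv (@allD R) (HN N) s d.
Hypothesis HNH : forall B : R, exists K : R, forall s N, 0 <= Re s -> mg s <= B ->
  mg (HN N s - H s) <= K / N.+1%:R.

(* The maximum principle for [HN * Exp (m psi)], with
   psi = (z - z0) + (z - z0)^2 / (2 rho): on the square of radius rho = Re z0
   around z0, psi has negative real part on the part of the boundary outside
   the half-plane where H vanishes. *)
Lemma vanish_step (x1 : R) : 0 < x1 -> (forall s, x1 < Re s -> H s = 0) ->
  forall s, 3 / 4 * x1 < Re s -> H s = 0.
Proof.
move=> x10 Hx z0 hz0; have [/Hx//|hx1] := ltP x1 (Re z0).
set rho := Re z0 in hz0 hx1.
have rho0 : 0 < rho by lra.
have [K HK] := HNH (mg z0 + 2 * rho).
(* The radius is Re z0, so the square stays in the half-plane of convergence. *)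
have in_half z : insq z0 rho z -> 0 <= Re z /\ mg z <= mg z0 + 2 * rho.
  move=> hz; split.
    by move: hz => [+ _]; rewrite raddfB /= ler_norml => /andP[h _]; move: h; rewrite -/rho; lra.
  by have := insq_mg2 hz; have := mgD (z - z0) z0; rewrite subrK; lra.
have z0in : insq z0 rho z0 by apply: insq_mg; rewrite subrr mg0 ltW.
have K0 : 0 <= K.
  have [h1 h2] := in_half z0 z0in.
  by have := HK z0 0%N h1 h2; rewrite divr1 => /(le_trans _); apply; exact: mg_ge0.
have [M0 HM0] := dv_bounded_sq rho0 (fun z (_ : insq z0 rho z) => dHN 0 z).
pose M := `|M0| + 2 * K.
have HM N z : insq z0 rho z -> mg (HN N z) <= M.
  move=> hz; have [h1 h2] := in_half z hz.
  have a := HK z 0%N h1 h2; have b := HK z N h1 h2; rewrite divr1 in a.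
  have c := HM0 z hz.
  have Kn : K / N.+1%:R <= K by rewrite ler_pdivrMr ?ltr0n// ler_peMr// ler1n.
  have := mgD (HN N z - H z) (H z - HN 0%N z + HN 0%N z); have := mgD (H z - HN 0%N z) (HN 0%N z).
  rewrite mgBC addrA subrK (_ : HN N z - H z + (H z - HN 0%N z) = HN N z - HN 0%N z); last by ring.
  rewrite subrK; have := ler_norm M0; rewrite /M; move: (K / _) b Kn => Kn *; lra.
pose psi z : C := (z - z0) + (z - z0) ^+ 2 / (2 * rho)%:C.
have dpsi z : exists d, dv (@allD R) psi z d.
  have d1 := dvB (dv_id (@allD R) z) (dv_cst (@allD R) z0 z).
  by eexists; exact: dvD d1 (dvM (dvX 1 d1) (dv_cst _ _ _)).
have Repsi z : Re (psi z) = Re (z - z0) + (Re (z - z0) ^+ 2 - Im (z - z0) ^+ 2) / (2 * rho).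
  rewrite /psi; case: (z - z0) => a b; rewrite -fmorphV expr2 /=; ring.
have up z : insq z0 rho z -> Re (psi z) <= 2 * rho.
  move=> [h1 h2]; rewrite Repsi; move: (Re (z - z0)) (Im (z - z0)) h1 h2 => u v h1 h2.
  have a : u ^+ 2 - v ^+ 2 <= rho ^+ 2.
    have : u ^+ 2 <= rho ^+ 2 by rewrite -[u ^+ 2]real_normK ?num_real// ler_sqr ?nnegrE ?(ltW rho0).
    have := sqr_ge0 v; lra.
  have : (u ^+ 2 - v ^+ 2) / (2 * rho) <= rho.
    rewrite ler_pdivrMr; last by lra.
    by rewrite (_ : rho * (2 * rho) = 2 * rho ^+ 2); [have := sqr_ge0 rho; lra|ring].
  have := ler_norm u; lra.
(* With u = Re (z - z0), Re psi is at most u + u^2 / rho - rho / 2, and u is at most rho / 3 since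
   rho > (3 / 4) x1. The maximum, at u = rho / 3, is rho / 3 + rho / 9 - rho / 2 = - rho / 18. *)
have down z : bdsq z0 rho z -> Re z <= x1 -> Re (psi z) <= - (rho / 18).
  move=> [[h1 h2] h3] hx; rewrite Repsi.
  have hu : Re (z - z0) <= rho / 3 by rewrite raddfB /= -/rho; lra.
  have h4 : rho ^+ 2 <= Re (z - z0) ^+ 2 + Im (z - z0) ^+ 2.
    move: h3; rewrite -(ler_sqr (x := rho)) ?nnegrE ?mg_ge0 ?(ltW rho0)// /mg sqr_sqrtr//.
    by rewrite addr_ge0 ?sqr_ge0.
  move: (Re (z - z0)) (Im (z - z0)) h1 h2 hu h4 => u v h1 h2 hu h4.
  have h5 : - rho <= u by move: h1; rewrite ler_norml => /andP[].
  rewrite -[u]mulr1 -{1}(divff (x := 2 * rho)) ?gt_eqF//; last by lra.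
  have -> : u * (2 * rho / (2 * rho)) + ((u * 1) ^+ 2 - v ^+ 2) / (2 * rho) = (2 * (u * rho) + u ^+ 2 - v ^+ 2) / (2 * rho).
    by field; lra.
  rewrite ler_pdivrMr; last by lra.
  have : (u + rho) * (u - rho / 3) <= 0 by rewrite mulr_ge0_le0//; lra.
  nra.
(* N tends to infinity with m fixed; m grows afterwards. *)
have key m : mg (H z0) <= M * expR (- (m%:R * (rho / 18))).
  have e N : mg (H z0) <= M * expR (- (m%:R * (rho / 18))) + K * (1 + expR (m%:R * (2 * rho))) / N.+1%:R.
    pose F z := HN N z * Exp (m%:R * psi z).
    have Ep : Exp (m%:R * psi z0) = 1.
      by rewrite /psi subrr expr0n mul0r addr0 mulr0 Exp0.
    have ReM z : Re (m%:R * psi z) = m%:R * Re (psi z).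
      by rewrite natC; case: (psi z) => a b /=; ring.
    have n0 : 0 < N.+1%:R :> R by rewrite ltr0n.
    have p1 : 0 <= K * expR (m%:R * (2 * rho)) / N.+1%:R by rewrite divr_ge0 ?mulr_ge0 ?expR_ge0.
    have p2 : 0 <= M * expR (- (m%:R * (rho / 18))).
      by rewrite mulr_ge0 ?expR_ge0// /M addr_ge0 ?normr_ge0// mulr_ge0.
    have : mg (F z0) <= M * expR (- (m%:R * (rho / 18))) + K * expR (m%:R * (2 * rho)) / N.+1%:R.
      apply: (max_modulus rho0) => [z _|z hz].
        have [d1 D1] := dHN N z; have [d2 D2] := dpsi z.
        by eexists; exact: dvM D1 (dv_comp (dvZ m%:R D2) (dv_Exp _)).
      have [hin _] := hz; have [q1 q2] := in_half z hin.
      rewrite /F mgM mg_Exp ReM; have [hx|hx] := ltP x1 (Re z).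
        rewrite ler_wpDl//; have := HK z N q1 q2; rewrite (Hx _ hx) subr0 mulrAC => h.
        by apply: ler_pM; rewrite ?mg_ge0 ?expR_ge0// ler_expR ler_wpM2l// up.
      rewrite ler_wpDr//; apply: ler_pM; rewrite ?mg_ge0 ?expR_ge0 ?HM//.
      by rewrite ler_expR -mulrN ler_wpM2l// down.
    rewrite /F Ep mulr1 => h.
    have [q1 q2] := in_half z0 z0in.
    have := HK z0 N q1 q2; rewrite mgBC => h'.
    have := mgD (H z0 - HN N z0) (HN N z0); rewrite subrK => h''.
    have -> : K * (1 + expR (m%:R * (2 * rho))) / N.+1%:R = K / N.+1%:R + K * expR (m%:R * (2 * rho)) / N.+1%:R by rewrite mulrDr mulrDl mulr1.
    by apply: (le_trans h''); rewrite addrCA; exact: lerD.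
  rewrite leNgt; apply/negP => lt.
  pose g := mg (H z0) - M * expR (- (m%:R * (rho / 18))).
  have g0 : 0 < g by rewrite subr_gt0.
  have : g = 0.
    apply: (@rate_eq0 R g (K * (1 + expR (m%:R * (2 * rho))))) => [|N]; first exact: ltW.
    by rewrite /g lerBlDl.
  by move=> gE; rewrite gE ltxx in g0.
apply/eqP; rewrite -mg_eq0 -[_ == _]negbK; apply/negP => hn.
have h0 : 0 < mg (H z0) by rewrite lt_def hn mg_ge0.
have M00 : 0 <= M by rewrite /M addr_ge0 ?normr_ge0// mulr_ge0.
pose m := Num.truncn (M / mg (H z0) / (rho / 18)).
have hm : M / mg (H z0) / (rho / 18) < m.+1%:R by exact: truncnS_gt.
have r18 : 0 < rho / 18 by lra.
have hM : M < mg (H z0) * (m.+1%:R * (rho / 18)).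
  by move: hm; rewrite ltr_pdivrMr// ltr_pdivrMr// mulrC.
have := key m.+1; rewrite expRN ler_pdivlMr ?expR_gt0// => h.
have := expR_ge1Dx (m.+1%:R * (rho / 18)) => h1.
have : mg (H z0) * (1 + m.+1%:R * (rho / 18)) <= mg (H z0) * expR (m.+1%:R * (rho / 18)) by rewrite ler_wpM2l// ltW.
rewrite mulrDr mulr1; lra.
Qed.

(** Five steps of ratio 3 / 4, rounded up: 2, 1.5, 1.13, 0.85, 0.64, 0.48. *)
Lemma identity_half : (forall s, 2 < Re s -> H s = 0) -> H (1 / 2) = 0.
Proof.
move=> h2.
have st x y : 0 < x -> 3 / 4 * x <= y -> (forall s, x < Re s -> H s = 0) -> (forall s, y < Re s -> H s = 0).
  by move=> x0 xy /(vanish_step x0) h s ys; apply: h; lra.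
apply: (st (64 / 100) (48 / 100)); [lra|lra| |]; last first.
  have -> : 1 / 2 = (1 / 2 : R)%:C :> C by rewrite !mul1r fmorphV rmorph_nat.
  by rewrite /=; lra.
apply: (st (85 / 100)); [lra|lra|]; apply: (st (113 / 100)); [lra|lra|].
by apply: (st (3 / 2)); [lra|lra|]; apply: (st 2); [lra|lra|].
Qed.
End IdentityTheorem.

(** * The quadratic character modulo sqrt (-7) *)

Section HeckeCoefficients.

(** Modulo sqrt (-7) the generator eta is 4, so a + b eta is a + 4 b, and the cubic form is the cube
    of this residue modulo 7. *)
Lemma cube_residue (a b v : int) : let j := a + 4 * b + 7 * v in
  exists q : int, a ^+ 3 - 2 * a ^+ 2 * b - a * b ^+ 2 + b ^+ 3 = j ^+ 3 + 7 * q.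
Proof.
move=> j; exists (- (v * ((a + 4 * b) ^+ 2 + (a + 4 * b) * j + j ^+ 2)) - 2 * (a + 4 * b) ^+ 2 * b + 9 * (a + 4 * b) * b ^+ 2 - 13 * b ^+ 3).
rewrite /j; ring.
Qed.

(** The Legendre symbol modulo 7, which takes the same value at j and at j^3. *)
Definition eps7 (j : nat) : int := nth 0 [:: 0; 1; 1; -1; 1; -1; -1] j.

Lemma legendre7_0 (q : int) : legendre 7 (7 * q) = 0.
Proof. by rewrite /legendre dvdz_mulr. Qed.

Lemma legendre7_1 (q : int) : legendre 7 (1 + 7 * q) = 1.
Proof.
rewrite /legendre ifF; last by apply/negP => /dvdzP[k]; lia.
rewrite ifT//; apply/existsP; exists 1.
rewrite rmorphD rmorphM /= (_ : 7%:~R = 0 :> 'F_7); last exact/val_inj.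
by rewrite mul0r addr0 expr1n.
Qed.

Lemma legendre7_6 (q : int) : legendre 7 (-1 + 7 * q) = -1.
Proof.
rewrite /legendre ifF; last by apply/negP => /dvdzP[k]; lia.
rewrite ifF//; apply/negbTE; rewrite negb_exists; apply/forallP => x.
rewrite rmorphD rmorphM /= (_ : 7%:~R = 0 :> 'F_7); last exact/val_inj.
rewrite mul0r (_ : (-1)%:~R + 0 = 6%:R :> 'F_7); last exact/val_inj.
by case: x => [[|[|[|[|[|[|[|]]]]]]]].
Qed.

Lemma legendre7 (j : nat) (q : int) : (j < 7)%N -> legendre 7 (j%:Z ^+ 3 + 7 * q) = eps7 j.
Proof.
case: j => [|[|[|[|[|[|[|]]]]]]] // _.
- by rewrite (_ : _ + _ = 7 * q) ?legendre7_0//; ring.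
- by rewrite (_ : _ + _ = 1 + 7 * q) ?legendre7_1//; ring.
- by rewrite (_ : _ + _ = 1 + 7 * (q + 1)) ?legendre7_1//; lia.
- by rewrite (_ : _ + _ = -1 + 7 * (q + 4)) ?legendre7_6//; lia.
- by rewrite (_ : _ + _ = 1 + 7 * (q + 9)) ?legendre7_1//; lia.
- by rewrite (_ : _ + _ = -1 + 7 * (q + 18)) ?legendre7_6//; lia.
- by rewrite (_ : _ + _ = -1 + 7 * (q + 31)) ?legendre7_6//; lia.
Qed.

Lemma hecke_eps_coord (u v : int) (j : nat) : (j < 7)%N -> hecke_eps (j%:Z - 4 * u - 3 * v) (u - v) = eps7 j.
Proof.
move=> j7; rewrite /hecke_eps; have [q ->] := cube_residue (j%:Z - 4 * u - 3 * v) (u - v) v.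
by rewrite (_ : _ + _ + _ = j%:Z); [exact: legendre7|ring].
Qed.

Lemma eps7_le1 j : (`|eps7 j| <= 1)%N.
Proof. by case: j => [|[|[|[|[|[|[|j]]]]]]] //; rewrite /eps7 nth_default. Qed.
End HeckeCoefficients.

(** * From the Hecke series to the derivatives of w *)

Section HeckeSeries.
Variable R : realType.
Local Notation C := R[i].
Local Notation Re := (@complex.Re R).
Local Notation pt := (int * int)%type.
Implicit Types (s x z : C) (v : pt).

Definition xab (w : pt) : C := w.1%:~R + w.2%:~R * Defs.eta R.

(* The pair (a, b) with a + b eta = p + j, where p in M has coordinates v. *)
Definition ab v (j : nat) : pt := (j%:Z - 4 * v.1 - 3 * v.2, v.1 - v.2).

Lemma etaE : Defs.eta R = om R + 4.
Proof.
rewrite /Defs.eta (natC R 2) (natC R 4) -fmorphV.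
by apply/eqP; rewrite eq_complex /=; apply/andP; split; apply/eqP; rewrite /s7; field.
Qed.

Lemma xab_ab v j : xab (ab v j) = pp R v + j%:R.
Proof.
have ob : omb R = - 7 - om R by rewrite -om_sum; ring.
by rewrite /xab /ab /pp ob etaE /= !(rmorphB, rmorphM) /=; ring.
Qed.

Lemma ab_inj v v' (i j : nat) : (i < 7)%N -> (j < 7)%N -> ab v i = ab v' j -> v = v' /\ i = j.
Proof.
case: v v' => a b [a' b'] hi hj [] /= h1 h2.
have h : i = j by lia.
split=> //; congr pair; lia.
Qed.

Lemma norm_xab w : (eta_norm w.1 w.2)%:~R = mg (xab w) ^+ 2 :> R.
Proof.
have -> : xab w = (w.1%:~R + w.2%:~R / 2) +i* (w.2%:~R * s7 R / 2).
  rewrite /xab etaE !intC natC.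
  by apply/eqP; rewrite eq_complex /=; apply/andP; split; apply/eqP; field.
rewrite /mg sqr_sqrtr ?addr_ge0 ?sqr_ge0//= /eta_norm !(rmorphD, rmorphM, rmorphXn) /=.
have := s7_sq R; move: (s7 R) (w.1%:~R : R) (w.2%:~R : R) => q a b h.
rewrite (_ : (b * q / 2) ^+ 2 = b ^+ 2 * q ^+ 2 / 4); last by field.
by rewrite h; field.
Qed.

Lemma xab_ge w : w != (0, 0) -> 1 <= mg (xab w) /\ wgt R w / 3 <= mg (xab w).
Proof.
move=> wn; have m1 : (1 <= mx w)%N by rewrite lt0n; apply: contraNneq wn => /mx_eq0 ->.
have N2 := norm_xab w; have g0 := mg_ge0 (xab w).
have h1 : (1 <= eta_norm w.1 w.2).
  have : 7 * w.1 ^+ 2 + (w.1 + 4 * w.2) ^+ 2 = 8 * eta_norm w.1 w.2 by rewrite /eta_norm; ring.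
  have : 7 * w.2 ^+ 2 + (2 * w.1 + w.2) ^+ 2 = 4 * eta_norm w.1 w.2 by rewrite /eta_norm; ring.
  have := sqr_ge0 (w.1 + 4 * w.2); have := sqr_ge0 (2 * w.1 + w.2).
  have [E|n1] := eqVneq w.1 0; last first.
    have : 0 < w.1 ^+ 2 by rewrite lt_def sqrf_eq0 n1 sqr_ge0.
    lia.
  have [E2|n2] := eqVneq w.2 0; last first.
    have : 0 < w.2 ^+ 2 by rewrite lt_def sqrf_eq0 n2 sqr_ge0.
    lia.
  by move: wn; rewrite (surjective_pairing w) E E2 eqxx.
split.
  rewrite -(ler_sqr (x := 1)) ?nnegrE// -N2 expr1n -[1]/(1%:~R) ler_int //.
have p0 : 0 <= wgt R w / 3 by rewrite divr_ge0// (le_trans ler01 (wgt_ge1 R w)).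
rewrite -ler_sqr ?nnegrE//.
rewrite -N2 wgtE.
have e : (eta_norm w.1 w.2)%:~R = w.1%:~R ^+ 2 + w.1%:~R * w.2%:~R + 2 * w.2%:~R ^+ 2 :> R.
  by rewrite /eta_norm !(rmorphD, rmorphM, rmorphXn).
have m1' : 1 <= (mx w)%:R :> R by rewrite ler1n.
have sq : (mx w)%:R ^+ 2 = w.1%:~R ^+ 2 :> R \/ (mx w)%:R ^+ 2 = w.2%:~R ^+ 2 :> R.
  by case: (mx_cases R w) => ->; rewrite real_normK ?num_real//; [left|right].
rewrite e; move: (w.1%:~R : R) (w.2%:~R : R) sq => a b sq.
have a2 := sqr_ge0 (a + 4 * b); have b2 := sqr_ge0 (2 * a + b).
have m2 : (mx w)%:R ^+ 2 * (7 / 8) <= a ^+ 2 + a * b + 2 * b ^+ 2 by case: sq => ->; nra.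
apply: le_trans m2; move: m1'; set m := (mx w)%:R => m1'; nra.
Qed.

Variable n : nat.
Hypothesis n1 : (1 <= n)%N.
Local Notation k := (4 * n - 3)%N.

Lemma k_gt0 : (0 < k)%N. Proof. by lia. Qed.

(** The shift 2 n - 3/2 in the exponent of the norm is half of k = 4 n - 3. *)
Lemma hecke_term_phi s w : w != (0, 0) -> hecke_term n s w.1 w.2 = (hecke_eps w.1 w.2)%:~R * phi k s (xab w).
Proof.
move=> wn; have [x1 _] := xab_ge wn.
rewrite /hecke_term /phi -/(xab w) -mulrA; congr (_ * (_ * _)).
rewrite norm_xab cpowE; last by rewrite exprn_gt0//; lra.
rewrite -ExpN; congr Exp; rewrite -mulNr; congr (- _ * _); rewrite -addrA; congr (_ + _).
rewrite natrB; last by lia.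
by rewrite !natrM; field.
Qed.

Section Convergent.
Variable s : C.
Hypothesis s2 : 2 <= Re s.

(** The index (0, 0) is restored with value 0, so that sums run over all of Z^2. *)
Definition Fs (w : pt) : C := if w == (0, 0) then 0 else hecke_term n s w.1 w.2.

Lemma eps_le1 a b : mg ((hecke_eps a b)%:~R : C) <= 1.
Proof.
pose v := - ((a + 4 * b) %/ 7)%Z; pose j := `|((a + 4 * b) %% 7)%Z|%N.
have h : ((a + 4 * b) %% 7)%Z = j by rewrite /j gez0_abs// modz_ge0.
have j7 : (j < 7)%N by rewrite -ltz_nat -h ltz_pmod.
have E := divz_eq (a + 4 * b) 7.
have -> : hecke_eps a b = eps7 j.
  rewrite -(hecke_eps_coord (b + v) v j7); congr hecke_eps; rewrite -?h /v; lia.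
rewrite intC mgR -intr_norm -[1]/(1%:~R) ler_int; have := eps7_le1 j; lia.
Qed.

Lemma dec_Fs : dec 3 Fs 27.
Proof.
move=> w; rewrite /Fs; case: eqP => [_|/eqP wn]; first by rewrite mg0 divr_ge0// exprn_ge0.
have [x1 x2] := xab_ge wn; rewrite hecke_term_phi// mgM.
have w1 := wgt_ge1 R w.
apply: (@le_trans _ _ (1 * (mg (xab w) ^+ 3)^-1)).
  by apply: ler_pM; rewrite ?mg_ge0 ?eps_le1// phi_dec.
rewrite mul1r -/(wgt R w) (_ : 27 / wgt R w ^+ 3 = ((wgt R w / 3) ^+ 3)^-1); last by field; rewrite gt_eqF//; lra.
have p : 0 < wgt R w / 3 by lra.
have q : 0 < mg (xab w) by lra.
rewrite lef_pV2 ?posrE ?exprn_gt0//.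
by rewrite lerXn2r ?nnegrE ?(ltW p) ?(ltW q).
Qed.

(** The seven classes over a box of size N form a set containing the box of size N / 2, to which
    [lsum_exhaust] applies. *)
Lemma haslsum_residues : haslsum (fun v => \sum_(j <- iota 0 7) Fs (ab v j)) (lsum Fs).
Proof.
exists (16 * 27) => N.
pose S := [seq ab v j | v <- box N, j <- iota 0 7].
have uS : uniq S.
  apply: allpairs_uniq; [exact: box_uniq|exact: iota_uniq|].
  move=> p p' hp hp'; case/allpairsP: hp => -[v i] [_ hi ->]; case/allpairsP: hp' => -[v' j] [_ hj ->] E.
  rewrite mem_iota /= in hi; rewrite mem_iota /= in hj.
  by have [-> ->] := ab_inj hi hj E.
have sub : {subset box N./2 <= S}.
  move=> [a b]; rewrite mem_box /mx /= => h.
  apply/allpairsP; pose v := - ((a + 4 * b) %/ 7)%Z.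
  have E := divz_eq (a + 4 * b) 7.
  have r0 : 0 <= ((a + 4 * b) %% 7)%Z by rewrite modz_ge0.
  have r7 : ((a + 4 * b) %% 7)%Z < 7 by rewrite ltz_pmod.
  exists ((b + v, v), `|((a + 4 * b) %% 7)%Z|%N) => /=; split.
  - by rewrite mem_box /mx /= /v; lia.
  - by rewrite (mem_iota 0 7); lia.
  - by rewrite /ab /= gez0_abs// /v; congr pair; lia.
have := lsum_exhaust dec_Fs uS sub.
rewrite big_allpairs_dep /= => /le_trans; apply.
rewrite -mulrA -mulrA; have -> : 8 * (27 / (N./2).+1%:R) = 16 * (27 * (2 * (N./2).+1%:R)^-1) :> R.
  by field.
rewrite ler_pM2l// ler_pM2l// lef_pV2 ?posrE ?mulr_gt0 ?ltr0n// -natrM ler_nat.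
by have := odd_double_half N; lia.
Qed.

(** The weights of [tdiff] differ from the character by -1 at 0 and 1 at 7; the difference phi (p +
    7) - phi (p) telescopes to 0. *)
Lemma lsum_Fs : lsum Fs = lsum (tphi k s).
Proof.
have k0 := k_gt0.
have dG : dec 3 (fun v => phi k s (pp R v)) 8.
  move=> v; have [->|vn] := eqVneq v (0, 0).
    by rewrite pp0 phi0// mg0 divr_ge0// exprn_ge0.
  have m1 : (1 <= mx v)%N by rewrite lt0n; apply: contraNneq vn => /mx_eq0 ->.
  have h := mx_pp R v; have m1' : 1 <= (mx v)%:R :> R by rewrite ler1n.
  have w1 := wgt_ge1 R v.
  apply: (@le_trans _ _ (mg (pp R v) ^+ 3)^-1); first by apply: phi_dec => //; exact: le_trans h.
  rewrite -/(wgt R v) (_ : 8 / wgt R v ^+ 3 = ((wgt R v / 2) ^+ 3)^-1); last by field; rewrite gt_eqF//; lra.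
  have p : 0 < wgt R v / 2 by lra.
  have q : 0 < mg (pp R v) by lra.
  rewrite lef_pV2 ?posrE ?exprn_gt0// lerXn2r ?nnegrE ?(ltW p) ?(ltW q)//.
  by rewrite wgtE; lra.
have sm := haslsumD haslsum_residues (haslsum_step7 (dec_weak dG)); rewrite addr0 in sm.
have [K HK] := tphi_bound k0 (mg s).
have dK : dec 3 (tphi k s) K.
  move=> v; have s0 : 0 <= Re s by apply: le_trans s2.
  by have := HK v s s0 (lexx _); rewrite -exprnN.
apply: haslsum_uniq sm _; apply: haslsum_eq (dec_haslsum dK) => v.
have Fj (j : nat) : (j < 7)%N -> Fs (ab v j) = (eps7 j)%:~R * phi k s (pp R v + j%:R).
  move=> j7; rewrite /Fs; case: eqP => [E|/eqP abn].
    by rewrite -xab_ab E /xab /= mul0r addr0 phi0// mulr0.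
  by rewrite hecke_term_phi// xab_ab hecke_eps_coord.
rewrite pp_sh /tphi tdiffE !big_cons big_nil !Fj// /eps7 /= addr0 !rmorphN /= rmorph1 rmorph0.
ring.
Qed.

(** Any finite index set containing a large box is close to the limit by [lsum_exhaust], which is
    convergence of the unconditional sum. *)
Lemma hecke_series_lsum : hecke_series n s = 2^-1 * lsum (tphi k s).
Proof.
rewrite /hecke_series -lsum_Fs; congr (_ * _).
pose I0 := {v : pt | v != (0, 0)}.
apply: (@cvg_lim C^o (@norm_hausdorff _ C^o) _ _ (@summability.totally_filter I0)).
have PF := @summability.totally_filter I0; have FF : Filter (@summability.totally I0) by exact: filter_filter.
apply/cvgrPdist_lt => e; rewrite ltcE /= => /andP[/eqP eI eR].
pose N := Num.truncn (8 * 27 / Re e).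
have hN : 8 * 27 / N.+1%:R < Re e.
  by rewrite ltr_pdivrMr ?ltr0n// [ltRHS]mulrC -ltr_pdivrMr//; exact: truncnS_gt.
pose A0 := finmap.seq_fset tt (pmap (insub : pt -> option I0) (box N)).
exists A0 => // B /= AB.
have -> : summability.partial_sum (fun v : I0 => hecke_term n s (val v).1 (val v).2 : C^o) B
   = \sum_(v <- (0, 0) :: map val (finmap.enum_fset B)) Fs v.
  rewrite big_cons big_map {1}/Fs eqxx add0r /summability.partial_sum.
  rewrite -(finmap.big_seq_fsetE _ _ xpredT (fun v : I0 => hecke_term n s (val v).1 (val v).2)) /=.
  by apply: eq_bigr => v _; rewrite /Fs (negbTE (valP v)).
rewrite distrC -mgE ltcE /= eI eqxx /=; apply: le_lt_trans hN.
apply: lsum_exhaust dec_Fs _ _.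
  rewrite /= map_inj_uniq ?finmap.fset_uniq ?andbT; last exact: val_inj.
  by apply/mapP => -[[v vn] _ /= E]; move: vn; rewrite -E eqxx.
move=> w wN; rewrite inE; have [//|/= wn] := eqVneq w (0, 0).
apply/mapP; exists (Sub w wn : I0); last by rewrite SubK.
apply: (finmap.fsubsetP AB); rewrite finmap.seq_fsetE mem_pmap; apply/mapP.
by exists w => //; rewrite insubT.
Qed.
End Convergent.

Variable L : C -> C.
Hypothesis L_hecke : is_hecke_L n L.

(** [identity_half] for L minus the grouped series, approximated by L minus its box sums; for Re s >
    2 the two sides agree by [hecke_series_lsum]. *)
Lemma hecke_L_central : L (1 / 2) = 2^-1 * lsum (tphi k (1 / 2)).
Proof.
have k0 := k_gt0.
pose HN N s := L s - 2^-1 * \sum_(v <- box N) tphi k s v.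
pose H s := L s - 2^-1 * lsum (tphi k s).
suff : H (1 / 2) = 0 by move/eqP; rewrite subr_eq0 => /eqP.
case: L_hecke => Le Ls; apply: (@identity_half _ HN).
- move=> N s; have [d1 h1] := derivable_dv (Le s).
  have h v : {d | dv (@allD R) ((tphi k)^~ v) s d} := cid (dv_tphi k v s).
  eexists; apply: dvB h1 (dvZ _ (dv_sum (d := fun v => sval (h v)) (box N) _)).
  by move=> v; exact: svalP (h v).
- move=> B; have [K HK] := tphi_bound k0 B; exists (8 * K) => s N s0 sB.
  have dK : dec 3 (tphi k s) K by move=> v; have := HK v s s0 sB; rewrite -exprnN.
  have -> : HN N s - H s = - (2^-1 * (\sum_(v <- box N) tphi k s v - lsum (tphi k s))).
    by rewrite /HN /H; ring.
  rewrite mgN mgM; have := lsum_box N dK; apply: le_trans.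
  rewrite ler_piMl ?mg_ge0// (_ : 2^-1 = (2^-1 : R)%:C); last by rewrite fmorphV rmorph_nat.
  by rewrite mgR ger0_norm; lra.
- move=> s s2; rewrite /H Ls; last by lra.
  by rewrite hecke_series_lsum ?subrr// ltW.
Qed.

(** With r = 2 (n - 1) one has k = 2 r + 1 and 1/2 + k / 2 = r + 1, so each term is x^(2 r + 1) / (x
    conj x)^(r + 1) = x^r / (conj x)^(r + 1). *)
Lemma tphi_central v : tphi k (1 / 2) v = tmW (n.-1).*2 (0 : C) v.
Proof.
apply: tdiff_eq => j _; set x := pp R v + j%:R.
rewrite /T mul0r subr0; have [->|x0] := eqVneq x 0.
  rewrite phi0 ?k_gt0// (_ : conjc 0 = 0) ?invr0 ?expr0n ?mulr0//; apply/eqP; by rewrite eq_complex /= oppr0 !eqxx.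
have m0 : 0 < mg x by rewrite mg_gt0.
have xx : ((mg x ^+ 2)%:C : C) = x * conjc x by rewrite -normCK -mgE rmorphXn.
have cx0 : conjc x != 0 by rewrite -mg_gt0 mg_conj.
have m20 : 0 < mg x ^+ 2 by rewrite exprn_gt0.
set r := (n.-1).*2; have ke : k = (r + r.+1)%N by rewrite /r; lia.
rewrite /phi (_ : 1 / 2 + k%:R / 2 = r.+1%:R); last first.
  by rewrite ke natrD -natr1; field.
rewrite mulNr ExpN Exp_nat Exp_ln// xx exprMn invfM mulrA ke exprD exprVn.
by rewrite mulfK// expf_neq0.
Qed.

Lemma hecke_L_neq0 : L (1 / 2) != 0.
Proof.
rewrite hecke_L_central (_ : tphi k (1 / 2) = tmW (n.-1).*2 (0 : C)); last first.
  by apply/funext => v; exact: tphi_central.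
have := @deriv_ww_neq0 R (@Wa R) (@W0_ww R) (@dv_Wa R) n.-1.
by rewrite /Wa !mulf_eq0 !negb_or => /andP[_ ->]; rewrite invr_neq0// pnatr_eq0.
Qed.

End HeckeSeries.

Local Close Scope complex_scope.

Theorem theorem4p1 (R : realType) (L : nat -> R[i] -> R[i])
    (L_hecke : forall n : nat, (1 <= n)%N -> is_hecke_L n (L n))
    (RH : forall n : nat, (1 <= n)%N -> zeros_on_critical_line (L n))
    (eps : R) (eps_gt0 : 0 < eps) :
  exists N0 : nat, forall N : nat, (N0 <= N)%N ->
    (1 / 4 - eps) * N%:R <=
      (\sum_(1 <= n < N.+1 | L n (1 / 2)%R != 0%R) 1)%N%:R.
Proof.
(* Every n from 1 to N is counted, and 1/4 - eps is at most 1. *)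
exists 0%N => N _.
have -> : (\sum_(1 <= n < N.+1 | L n (1 / 2)%R != 0%R) 1)%N = N.
  rewrite big_nat_cond (eq_bigl (fun n => (1 <= n < N.+1)%N && true)); last first.
    move=> n; case: (boolP (1 <= n < N.+1)%N) => //= /andP[n1 _].
    by rewrite (hecke_L_neq0 n1 (L_hecke n n1)).
  by rewrite -big_nat_cond big_const_nat iter_addn mul1n addn0 subn1.
by rewrite ler_piMl ?ler0n//; lra.
Qed.
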